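(* Let $[A]\in\mathcal A_G(\mathbb B^5)$ and let $A$ be a connection form corresponding to $[A]$ with curvature form $F_A$, both in $L^2(\mathbb B^5)$. Assume further that $$\lim_{r\to0}\frac1r\int_{\mathbb B\setminus\mathbb B_{1-r}}|A|^2<\infty .$$ Let $\rho(x)=1-|x|$ be the radial coordinate on $\mathbb B^5$ and let $t\in[0,1[$ be fixed. Then there exists a solution $g\in W^{1,2}(\mathbb B^5,G)$ of $$\left\{\begin{array}{ll}\partial_\rho g=-A_\rho\, g&\text{on }\mathbb B_1\setminus\mathbb B_{1-t},\\ g(\omega,0)=id&\text{for }\omega\in\mathbb S^4.\end{array}\right.$$ In particular the form $A^g:=g^{-1}dg+g^{-1}Ag$ is still in $L^2$, has zero component in the direction $\partial/\partial\rho$ on $\mathbb B_1\setminus\mathbb B_{1-t}$, and the formula $$F_{A^g}=g^{-1}F_Ag$$ holds in the sense of distributions, where $F_{A^g}:=dA^g+A^g\wedge A^g$ in the sense of distributions.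
   Context: $G$ is a compact connected simply connected nonabelian Lie group (realized as a group of matrices) with Lie algebra $\mathfrak g$, whose norm is $\mathrm{Ad}$-invariant. $\mathbb B_s$ is the ball of radius $s$ centered at $0$ in $\mathbb R^5$, $\mathbb B=\mathbb B^5=\mathbb B_1$. Points near $\mathbb S^4$ are written in polar coordinates $(\omega,\rho)$ with $\omega=x/|x|\in\mathbb S^4$, $\rho=1-|x|$; $A_\rho$ is the component of $A$ along $\partial/\partial\rho$; the boundary condition at $\rho=0$ is in the sense of traces. For a $\mathfrak g$-valued $1$-form $A$, the curvature is $F_A=dA+A\wedge A$ (components $F_{ij}=\partial_iA_j-\partial_jA_i+[A_i,A_j]$), and $A^g:=g^{-1}dg+g^{-1}Ag$. For a compact Riemannian $4$-manifold $\Sigma$, $\mathfrak A_G(\Sigma)$ is the set of $A\in L^2(\Sigma,\Lambda^1\otimes\mathfrak g)$ such that $\int_\Sigma|dA+A\wedge A|^2<\infty$ and, locally on $\Sigma$, there exists $g\in W^{1,2}$ with values in $G$ such that $A^g\in W^{1,2}$. $\mathfrak a_G(\mathbb B^5)$ is the set of $A\in L^2(\mathbb B^5,\Lambda^1\mathbb R^5\otimes\mathfrak g)$ such that the distribution $F_A=dA+A\wedge A$ belongs to $L^2$ and such that for all $p\in\mathbb B^5$ and a.e. $r>0$ (with $\partial B_r(p)\subset\mathbb B^5$) the restriction $i^*_{\partial B_r(p)}A$ belongs to $\mathfrak A_G(\partial B_r(p))$. Set $A\sim A'$ if $A'=g^{-1}dg+g^{-1}Ag$ for some $g\in W^{1,2}(\mathbb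 B^5,G)$, and $\mathcal A_G(\mathbb B^5):=\mathfrak a_G(\mathbb B^5)/\sim$, with $[A]$ the class of $A$. *)

(* Defs.v *)
From HB Require Import structures.
From mathcomp Require Import all_boot all_order all_algebra.
From mathcomp Require Import all_classical all_reals all_analysis.
Import Order.TTheory GRing.Theory Num.Theory.
Import numFieldNormedType.Exports.

Set Implicit Arguments.
Unset Strict Implicit.
Unset Printing Implicit Defensive.

Local Open Scope classical_set_scope.
Local Open Scope ring_scope.

Section measurable_rV.
Context {R : realType} {n : nat}.

Let coors : 'I_n -> 'rV[R]_n -> R := fun i x => x ord0 i.

Let rV_set0 : g_sigma_preimage coors set0.
Proof. exact: sigma_algebra0. Qed.

Let rV_setC A : g_sigma_preimage coors A -> g_sigma_preimage coors (~` A).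
Proof. exact: sigma_algebraC. Qed.

Let rV_bigcup (F : (set 'rV[R]_n)^nat) :
  (forall i, g_sigma_preimage coors (F i)) ->
  g_sigma_preimage coors (\bigcup_i (F i)).
Proof. exact: sigma_algebra_bigcup. Qed.

(* The sigma-algebra generated by the coordinates (the Borel one), exactly as
   the library does for n.-tuple R. *)
HB.instance Definition _ :=
  @isMeasurable.Build (measure_tuple_display default_measure_display)
  'rV[R]_n (g_sigma_preimage coors) rV_set0 rV_setC rV_bigcup.

Lemma measurable_fun_rV d (T : measurableType d) (f : T -> 'rV[R]_n) :
  (forall i, measurable_fun [set: T] (fun x => f x ord0 i)) ->
  measurable_fun [set: T] f.
Proof.
move=> mf; apply: (@measurability _ _ _ _ setT f
  (\big[setU/set0]_(i < n) preimage_set_system setT (coors i) measurable)) => //.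
move=> _ [B + <-]; rewrite -bigcup_seq => -[i _ [C mC <-]].
by rewrite setTI; exact: (mf i measurableT).
Qed.

Lemma measurable_coord (i : 'I_n) :
  measurable_fun [set: 'rV[R]_n] (fun x => x ord0 i).
Proof.
move=> _ Y mY; rewrite setTI; apply: sub_sigma_algebra.
rewrite -bigcup_seq/=; exists i => /=; first by rewrite mem_index_enum.
by exists Y => //; rewrite setTI.
Qed.

End measurable_rV.

Section lebesgue_rV.
Context {R : realType}.

Definition rV_cons n (p : 'rV[R]_n * measurableTypeR R) : 'rV[R]_n.+1 :=
  \row_i (if unlift ord0 i is Some j then p.1 ord0 j else p.2).

Lemma rV_cons0 n (p : 'rV[R]_n * measurableTypeR R) :
  rV_cons p ord0 ord0 = p.2.
Proof. by rewrite mxE unlift_none. Qed.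

Lemma rV_consS n (p : 'rV[R]_n * measurableTypeR R) (i : 'I_n) :
  rV_cons p ord0 (lift ord0 i) = p.1 ord0 i.
Proof. by rewrite mxE liftK. Qed.

Lemma measurable_rV_cons n : measurable_fun setT (@rV_cons n).
Proof.
apply: measurable_fun_rV => i; case: (unliftP ord0 i) => [j ->|->].
  under eq_fun do rewrite rV_consS.
  exact: measurableT_comp (measurable_coord j) measurable_fst.
by under eq_fun do rewrite rV_cons0; exact: measurable_snd.
Qed.

Section step.
Variables (n : nat) (m : {measure set 'rV[R]_n -> \bar R}).

Definition leb_step : set 'rV[R]_n.+1 -> \bar R :=
  pushforward (m \x @lebesgue_measure R)%E (@rV_cons n).

Let leb_step0 : leb_step set0 = 0%E.
Proof. by rewrite /leb_step /pushforward preimage_set0 measure0. Qed.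

Let leb_step_ge0 A : (0 <= leb_step A)%E.
Proof. by rewrite /leb_step /pushforward measure_ge0. Qed.

Let leb_step_sigma_additive : semi_sigma_additive leb_step.
Proof.
move=> F mF tF mUF; rewrite /leb_step /pushforward preimage_bigcup.
have mc := @measurable_rV_cons n.
apply: measure_semi_sigma_additive.
- by move=> k; rewrite -[X in measurable X]setTI; exact: mc.
- apply/trivIsetP => /= i j _ _ ij; rewrite -preimage_setI.
  by move/trivIsetP : tF => /(_ _ _ _ _ ij) ->//; rewrite preimage_set0.
- by rewrite -preimage_bigcup -[X in measurable X]setTI; exact: mc.
Qed.

HB.instance Definition _ := isMeasure.Build _ _ _ leb_step
  leb_step0 leb_step_ge0 leb_step_sigma_additive.

End step.

Fixpoint lebesgue_rV n : {measure set 'rV[R]_n -> \bar R} :=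
  match n with
  | 0%N => dirac (0 : 'rV[R]_0)
  | n'.+1 => leb_step (lebesgue_rV n')
  end.

Lemma lebesgue_rV_box n (B : 'I_n -> set R) :
  (forall i, measurable (B i)) ->
  lebesgue_rV n [set x | forall i, B i (x ord0 i)] =
  (\prod_(i < n) @lebesgue_measure R (B i))%E.
Proof.
elim: n B => [|n IH] B mB.
  rewrite big_ord0 /= /dirac /= indicE mem_set//.
  by case.
rewrite big_ord_recl /= /leb_step /pushforward.
pose Bn := [set x : 'rV[R]_n | forall i, B (lift ord0 i) (x ord0 i)].
have mBn : measurable Bn.
  rewrite (_ : Bn = \bigcap_(i in [set: 'I_n])
      [set x : 'rV[R]_n | B (lift ord0 i) (x ord0 i)]); last first.
    apply/seteqP; split => x /= Bx i; first by move=> _; exact: Bx.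
    exact: Bx.
  apply: fin_bigcap_measurable => [|i _]; first exact: finite_finset.
  by have := measurable_coord i measurableT (mB (lift ord0 i)); rewrite setTI.
rewrite [X in (_ \x _)%E X](_ : _ = Bn `*` B ord0).
  rewrite product_measure1E//; last exact: mB.
  rewrite muleC; congr (_ * _)%E.
  by apply: (IH (fun i => B (lift ord0 i))) => i; exact: mB.
apply/seteqP; split => -[v s] /=.
  move=> H; split=> /= [i|].
    by have := H (lift ord0 i); rewrite rV_consS.
  by have := H ord0; rewrite rV_cons0.
move=> [Hv Hs] i; case: (unliftP ord0 i) => [j ->|->].
  by rewrite rV_consS; exact: Hv.
by rewrite rV_cons0.
Qed.

End lebesgue_rV.

Section sobolev.
Context {R : realType}.

Definition enorm n (x : 'rV[R]_n) : R := Num.sqrt (\sum_i x ord0 i ^+ 2).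

(* Euclidean ball; the library's [ball] on 'rV[R]_n is that of the sup norm. *)
Definition eball n (p : 'rV[R]_n) (r : R) : set 'rV[R]_n :=
  [set x | enorm (x - p) < r].

Definition partial n (i : 'I_n) (f : 'rV[R]_n -> R) : 'rV[R]_n -> R :=
  fun x => 'D_(delta_mx ord0 i) f x.

Definition smooth n (f : 'rV[R]_n -> R) : Prop :=
  forall s : seq 'I_n, let h := foldr (@partial n) f s in
    continuous h /\ forall i x, derivable h x (delta_mx ord0 i).

Definition test_fun n (U : set 'rV[R]_n) (phi : 'rV[R]_n -> R) : Prop :=
  smooth phi /\
  exists K, [/\ compact K, K `<=` U & forall x, ~ K x -> phi x = 0].

Definition aeon n (U : set 'rV[R]_n) (P : 'rV[R]_n -> Prop) : Prop :=
  {ae lebesgue_rV n, forall x, U x -> P x}.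

Variable N : nat.
Notation mat := 'M[R]_N.+1.
Variable nrm : mat -> R.

Definition L2 n (U : set 'rV[R]_n) (f : 'rV[R]_n -> mat) : Prop :=
  (forall a b, measurable_fun U (fun x => f x a b)) /\
  (\int[lebesgue_rV n]_(x in U) (nrm (f x) ^+ 2)%:E < +oo)%E.

Definition weak_partial n (U : set 'rV[R]_n) (i : 'I_n)
    (f h : 'rV[R]_n -> mat) : Prop :=
  forall phi, test_fun U phi -> forall a b,
    \int[lebesgue_rV n]_(x in U) (f x a b * partial i phi x) =
    - \int[lebesgue_rV n]_(x in U) (h x a b * phi x).

(* The weak gradient Df is a separate argument; f determines it a.e. on U. *)
Definition W12 n (U : set 'rV[R]_n) (f : 'rV[R]_n -> mat)
    (Df : 'I_n -> 'rV[R]_n -> mat) : Prop :=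
  L2 U f /\ forall i, L2 U (Df i) /\ weak_partial U i f (Df i).

Definition W12_in n (G : set mat) (U : set 'rV[R]_n) (g : 'rV[R]_n -> mat)
    (Dg : 'I_n -> 'rV[R]_n -> mat) : Prop :=
  W12 U g Dg /\ aeon U (fun x => G (g x)).

End sobolev.

Section group.
Context {R : realType} {N : nat}.
Notation mat := 'M[R]_N.+1.

(* By Cartan's closed-subgroup theorem these are exactly the compact Lie groups
   of real matrices. *)
Definition compact_matrix_group (G : set mat) : Prop :=
  [/\ compact G, G 1, forall g h, G g -> G h -> G (g * h) &
      forall g, G g -> g \is a GRing.unit /\ G g^-1].

Definition simply_connected (G : set mat) : Prop :=
  connected G /\
  forall gam : R -> mat,
    {within `[0, 1], continuous gam} -> (forall s, s \in `[0, 1] -> G (gam s)) ->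
    gam 0 = gam 1 ->
    exists H : R * R -> mat,
      [/\ {within `[0, 1] `*` `[0, 1], continuous H},
          forall s u, s \in `[0, 1] -> u \in `[0, 1] -> G (H (s, u)),
          forall s, s \in `[0, 1] -> H (0, s) = gam s /\ H (1, s) = gam 0 &
          forall u, u \in `[0, 1] -> H (u, 0) = gam 0 /\ H (u, 1) = gam 0].

Definition nonabelian (G : set mat) : Prop :=
  exists g h, [/\ G g, G h & g * h <> h * g].

Definition lie_algebra (G : set mat) : set mat :=
  [set X | exists gam : R -> mat,
    [/\ forall s, G (gam s), gam 0 = 1 & is_derive (0 : R) (1 : R) gam X]].

(* A norm on the whole matrix space, of which only the restriction to the Lie
   algebra is intrinsic: any norm on the Lie algebra extends. *)
Definition is_norm (nrm : mat -> R) : Prop :=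
  [/\ forall X Y, nrm (X + Y) <= nrm X + nrm Y,
      forall (c : R) X, nrm (c *: X) = `|c| * nrm X &
      forall X, nrm X = 0 -> X = 0].

Definition Ad_invariant (G : set mat) (nrm : mat -> R) : Prop :=
  forall g X, G g -> lie_algebra G X -> nrm (g * X * g^-1) = nrm X.

End group.

Section connections.
Context {R : realType} {N : nat}.
Notation mat := 'M[R]_N.+1.

(* matrix-valued 1- and 2-forms on R^n, given by their components *)
Definition form1 n := 'I_n -> 'rV[R]_n -> mat.
Definition form2 n := 'I_n -> 'I_n -> 'rV[R]_n -> mat.

(* F = dA + A /\ A on U, in the sense of distributions *)
Definition is_curvature n (U : set 'rV[R]_n) (A : form1 n) (F : form2 n) : Prop :=
  forall i j phi, test_fun U phi -> forall a b,
    \int[lebesgue_rV n]_(x in U)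
      (A i x a b * partial j phi x - A j x a b * partial i phi x
       + (A i x * A j x - A j x * A i x) a b * phi x) =
    \int[lebesgue_rV n]_(x in U) (F i j x a b * phi x).

(* A^g = g^-1 dg + g^-1 A g; Dg stands for the weak gradient of g. *)
Definition gauge n (g : 'rV[R]_n -> mat) (Dg A : form1 n) : form1 n :=
  fun i x => (g x)^-1 * Dg i x + (g x)^-1 * A i x * g x.

Definition pullback m n (f : 'rV[R]_m -> 'rV[R]_n) (A : form1 n) : form1 m :=
  fun j y => \sum_i partial j (fun z => f z ord0 i) y *: A i (f y).

(* The sphere of radius r centered at p in R^5, covered by the two stereographic
   charts [stereo p r false] and [stereo p r true], each of which misses one
   pole. They are conformal: the round metric is [conf r y ^+ 2] times the flat
   one, so that the volume element is [conf r y ^+ 4]. *)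
Definition stereo (p : 'rV[R]_5) (r : R) (b : bool) (y : 'rV[R]_4) : 'rV[R]_5 :=
  let s := enorm y ^+ 2 in
  p + r *: (row_mx ((2 / (1 + s)) *: y)
                   (const_mx ((-1) ^+ b * ((s - 1) / (1 + s))) : 'rV[R]_1)
            : 'rV[R]_(4 + 1)).

Definition conf (r : R) (y : 'rV[R]_4) : R := r * (2 / (1 + enorm y ^+ 2)).

Definition sphere_int (p : 'rV[R]_5) (r : R) (f : 'rV[R]_5 -> R) : \bar R :=
  (\int[lebesgue_rV 4]_y (f (stereo p r false y) * conf r y ^+ 4)%:E)%E.

Variables (G : set mat) (nrm : mat -> R).

Definition L2_form1 n (U : set 'rV[R]_n) (A : form1 n) : Prop :=
  forall i, L2 nrm U (A i) /\ aeon U (fun x => lie_algebra G (A i x)).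

(* The set A_G(Sigma) for Sigma a sphere of radius r; a 1-form on Sigma is given
   by its expressions alpha b in the two stereographic charts. With respect to
   the round metric, |alpha|^2 dvol = conf^2 |alpha b|^2 dy, and
   |F|^2 dvol = |F b|^2 dy for the 2-form F. *)
Definition frakA_sphere (r : R) (alpha : bool -> form1 4) : Prop :=
  forall b,
  [/\ L2_form1 setT (fun j y => conf r y *: alpha b j y),
      exists2 F : form2 4, (forall j k, L2 nrm setT (F j k)) &
        is_curvature setT (alpha b) F &
      forall y, exists2 d : R, 0 < d & exists g Dg,
        W12_in nrm G (eball y d) g Dg /\
        forall j, exists D, W12 nrm (eball y d) (gauge g Dg (alpha b) j) D].

Notation B5 := (eball (0 : 'rV[R]_5) 1).

Definition fraka : set (form1 5) :=
  [set A | [/\ L2_form1 B5 A,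
      exists2 F : form2 5, (forall i j, L2 nrm B5 (F i j)) & is_curvature B5 A F &
      forall p, B5 p ->
        {ae @lebesgue_measure R, forall r, 0 < r ->
           [set x | enorm (x - p) = r] `<=` B5 ->
           frakA_sphere r (fun b => pullback (stereo p r b) A)}]].

Definition gauge_equiv (A A' : form1 5) : Prop :=
  exists g Dg, W12_in nrm G B5 g Dg /\
    forall i, aeon B5 (fun x => A' i x = gauge g Dg A i x).

Definition gauge_class (A : form1 5) : set (form1 5) :=
  [set A' | fraka A' /\ gauge_equiv A A'].

Definition calA : set (set (form1 5)) := gauge_class @` fraka.

(* [h] is the trace on S^4 of g in W^{1,2}(B5), with weak gradient Dg: g is a
   W^{1,2} limit of functions smooth up to the boundary, whose restrictions to
   S^4 converge to h in L^2(S^4). *)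
Definition has_trace (g : 'rV[R]_5 -> mat) (Dg : form1 5)
    (h : 'rV[R]_5 -> mat) : Prop :=
  exists u : nat -> 'rV[R]_5 -> mat,
  [/\ forall k a b, smooth (fun x => u k x a b),
      (fun k => \int[lebesgue_rV 5]_(x in B5) (nrm (u k x - g x) ^+ 2)%:E)%E
        @ \oo --> 0%E,
      forall i, (fun k => \int[lebesgue_rV 5]_(x in B5)
        (nrm (\matrix_(a, b) partial i (fun z => u k z a b) x - Dg i x) ^+ 2)%:E)%E
        @ \oo --> 0%E &
      (fun k => sphere_int 0 1 (fun x => nrm (u k x - h x) ^+ 2)) @ \oo --> 0%E].

(* The component of V along d/drho, where rho = 1 - |x|, i.e. V contracted with
   - x / |x|; for V = Dg this is the derivative of g in rho. *)
Definition rho_comp (V : form1 5) : 'rV[R]_5 -> mat :=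
  fun x => - \sum_i (x ord0 i / enorm x) *: V i x.

End connections.

(* Main.v *)
Require Import Defs.
From HB Require Import structures.
From mathcomp Require Import all_boot all_order all_algebra.
From mathcomp Require Import all_classical all_reals all_analysis.
From mathcomp Require Import measurable_realfun ring lra.

(** The gauge g is the parallel transport of A along the rays from the sphere to the origin:
    on each ray it solves the linear equation with value 1 at the sphere, so that in the new
    gauge the component along the ray vanishes. Since A is only square integrable, the
    equation has no pointwise meaning, and g is obtained as a limit; it is constructed on the
    whole ball, so that every t is covered at once.

    For a smooth form supported in the open ball the transports exist, stay in the compact
    group by a Dini type argument ([flow_in_group]), and satisfy dg = g B - A g, where B is
    the form A^g. By Duhamel's formula ([gauge_stable]) two transports differ by at most the
    integral along the ray of the difference of the connections, and B is bounded by the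
    integral along the ray of the curvature ([gauge_derive]); this is where a radial gauge
    is better than a general one, since A itself drops out of the bound for B.

    Integration along rays, T f (x) = int_1^oo f(s x) ds, is controlled without polar
    coordinates: dilating by s multiplies integrals by s^-n. Hence T is bounded on L1, and on
    L2 in dimension at least 4; on functions carried by a shell of width d its square norm is
    at most 2d ([n2_Tr_shell]).

    A is approximated by cutting off at distance d from the sphere and mollifying
    ([approximation]). The curvature of the result is the cut off curvature, plus a part that
    is small in L1, plus A times the gradient of the cutoff. The latter has size |A| / d on a
    shell of width d, where by hypothesis the square integral of A is O(d): its square norm is
    O(1 / d), and the gain d of T makes its contribution to B bounded in L2. So the gauges
    form a Cauchy sequence in L1, by Duhamel's formula, and up to an error that vanishes in L1
    the forms B are bounded in L2. Convex combinations of them converge strongly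
    ([weak_limit]), which gives g with values in G and B square integrable, radially zero and
    with values in the Lie algebra, with dg = g B - A g off the origin; a point is removable
    for weak derivatives ([removable_origin], [radial_gauge]).

    Finally g = 1 outside the ball, so that its trace is 1 ([constant_trace]), and the
    curvature follows from d(dg) = 0 and the Leibniz rule applied to A g and then to
    g^-1 (g B) ([gauge_curvature]). *)

Import Order.TTheory GRing.Theory Num.Theory.
Import numFieldNormedType.Exports.
Set Implicit Arguments.
Unset Strict Implicit.
Unset Printing Implicit Defensive.
Local Open Scope classical_set_scope.
Local Open Scope ring_scope.
Arguments lebesgue_rV : simpl never.

(** * Lebesgue measure and affine maps *)
Section lebesgue_basics.
Context {R : realType}.
Implicit Types n : nat.

Definition rV_box n (B : 'I_n -> set R) : set 'rV[R]_n :=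
  [set x | forall i, B i (x ord0 i)].

Lemma measurable_box n (B : 'I_n -> set R) :
  (forall i, measurable (B i)) -> measurable (rV_box B).
Proof.
move=> mB; rewrite (_ : rV_box B = \bigcap_(i in [set: 'I_n])
    [set x : 'rV[R]_n | B i (x ord0 i)]); last first.
  by apply/seteqP; split => x /= Bx i; [move=> _|]; exact: Bx.
apply: fin_bigcap_measurable => [|i _]; first exact: finite_finset.
by have := measurable_coord i measurableT (mB i); rewrite setTI.
Qed.

Definition cbox n (r : R) : set 'rV[R]_n := rV_box (fun=> `[- r, r]%classic).

Lemma cbox_cover n : \bigcup_k (@cbox n k%:R) = setT.
Proof.
apply/seteqP; split => // x _.
have [K hK] : exists K : nat, forall i, `|x ord0 i| <= K%:R.
  exists (\max_i Num.truncn `|x ord0 i|).+1 => i.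
  rewrite (le_trans (ltW (truncnS_gt _)))// ler_nat ltnS.
  exact: (leq_bigmax i).
by exists K => // i /=; rewrite in_itv/= -ler_norml.
Qed.

Lemma measurable_cbox n r : measurable (@cbox n r).
Proof. exact: measurable_box. Qed.

Lemma cbox_measure n r : (lebesgue_rV n (@cbox n r) < +oo)%E.
Proof.
rewrite lebesgue_rV_box//.
rewrite (eq_bigr (fun=> (if (- r : R) < r then r + r else 0)%:E)).
  by rewrite prodEFin ltry.
by move=> i _; rewrite lebesgue_measure_itv/= lte_fin; case: ifP => //; rewrite -EFinB opprK.
Qed.

Lemma lebesgue_rV_sigma_finite n : sigma_finite setT (lebesgue_rV n : set _ -> \bar R).
Proof.
exists (fun k => @cbox n k%:R); first by rewrite cbox_cover.
by move=> k; split; [exact: measurable_box|exact: cbox_measure].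
Qed.

Lemma rV_measurableE n : @measurable _ 'rV[R]_n =
  <<s [set X | exists2 B : 'I_n -> set R, (forall i, measurable (B i)) & X = rV_box B] >>.
Proof.
apply/seteqP; split.
  apply: smallest_sub; first exact: smallest_sigma_algebra.
  move=> X; rewrite -bigcup_seq => -[i _ [C mC <-]].
  apply: sub_sigma_algebra.
  exists (fun j => if j == i then C else setT).
    by move=> j; case: ifP.
  apply/seteqP; split => x /=.
    by move=> [_ Cx] j; case: eqP => // ->.
  by move=> /(_ i); rewrite eqxx.
apply: smallest_sub; first exact: sigma_algebra_measurable.
by move=> X [B mB ->]; exact: measurable_box.
Qed.

Lemma rV_measure_unique n (m : {measure set 'rV[R]_n -> \bar R}) :
  (forall B : 'I_n -> set R, (forall i, measurable (B i)) ->
     m (rV_box B) = lebesgue_rV n (rV_box B)) ->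
  forall A, measurable A -> m A = lebesgue_rV n A.
Proof.
move=> mE A mA; apply/esym.
apply: (@measure_unique _ R _ [set X | exists2 B : 'I_n -> set R,
  (forall i, measurable (B i)) & X = rV_box B] (fun k => @cbox n k%:R)) => //.
- exact: rV_measurableE.
- move=> _ _ [B mB ->] [C mC ->]; exists (fun i => B i `&` C i).
    by move=> i; exact: measurableI.
  apply/seteqP; split => x /=; first by move=> [Bx Cx] i; split; [exact: Bx|exact: Cx].
  by move=> BC; split => i; have [] := BC i.
- by move=> k; exists (fun=> `[- k%:R, k%:R]%classic).
- exact: cbox_cover.
- by move=> _ [B mB ->]; rewrite mE.
- by move=> k; exact: cbox_measure.
Qed.

Lemma measurable_affine1 (c h : R) :
  measurable_fun setT (fun t : R => c * t + h).
Proof. by apply: measurable_funD => //; exact: measurable_funM. Qed.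

Lemma lebesgue_affine (c h : R) (A : set R) : c != 0 -> measurable A ->
  lebesgue_measure ((fun t : R => c * t + h) @^-1` A) =
  ((`|c|^-1)%:E * lebesgue_measure A)%E.
Proof.
move=> c0 mA.
have c0' : 0 < `|c| by rewrite normr_gt0.
pose phi : R -> measurableTypeR R := fun t => c * t + h.
have mphi : measurable_fun [set: measurableTypeR R] phi by exact: measurable_affine1.
pose m : {measure set (measurableTypeR R) -> \bar R} :=
  mscale (NngNum (ltW c0'))
    (measure_function_pushforward__canonical__measure_function_Measure
      (@lebesgue_measure R) mphi).
have H : lebesgue_measure A = m A.
  apply: (lebesgue_measure_unique (mu := m)) => // _ [[a b]] /= _ <-.
  rewrite /m /mscale /= /pushforward.
  have [cp|cn] : 0 < c \/ c < 0 by move: c0; rewrite neq_lt => /orP[]; [right|left].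
    have -> : phi @^-1` `]a, b] = `](a - h) / c, (b - h) / c]%classic.
      apply/seteqP; split => t /=; rewrite !in_itv /= /phi.
        by rewrite ltr_pdivrMr// ler_pdivlMr// ltrBlDr lerBrDr mulrC.
      by rewrite ltr_pdivrMr// ler_pdivlMr// ltrBlDr lerBrDr mulrC.
    rewrite !lebesgue_measure_itv/= !lte_fin ltr_pM2r ?invr_gt0// ltrD2r.
    case: ifP => ab; last by rewrite mule0.
    rewrite -EFinB -EFinM gtr0_norm//; congr (_%:E).
    by field.
  have -> : phi @^-1` `]a, b] = `[(b - h) / c, (a - h) / c[%classic.
    apply/seteqP; split => t /=; rewrite !in_itv /= /phi.
      by rewrite ltr_ndivlMr// ler_ndivrMr// ltrBlDr lerBrDr mulrC andbC.
    by rewrite ltr_ndivlMr// ler_ndivrMr// ltrBlDr lerBrDr mulrC andbC.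
  rewrite !lebesgue_measure_itv/= !lte_fin ltr_nM2r ?invr_lt0// ltrD2r.
  case: ifP => ab; last by rewrite mule0.
  rewrite -EFinB -EFinM ltr0_norm//; congr (_%:E).
  by field.
by rewrite H /m /mscale/= muleA -EFinM mulVf ?mul1e// gt_eqF.
Qed.

Definition affine n (c : R) (h : 'rV[R]_n) : 'rV[R]_n -> 'rV[R]_n :=
  fun x => c *: x + h.

Lemma measurable_rV_affine n c h : measurable_fun setT (@affine n c h).
Proof.
apply: measurable_fun_rV => i.
under eq_fun do rewrite /affine !mxE.
apply: measurable_funD => //; apply: measurable_funM => //.
exact: measurable_coord.
Qed.

Lemma lebesgue_rV_affine n (c : R) h (A : set 'rV[R]_n) : c != 0 -> measurable A ->
  lebesgue_rV n (affine c h @^-1` A) = ((`|c| ^- n)%:E * lebesgue_rV n A)%E.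
Proof.
move=> c0 mA.
have c0' : 0 < `|c| by rewrite normr_gt0.
have cn0' : 0 < `|c| ^+ n by rewrite exprn_gt0.
have mphi := @measurable_rV_affine n c h.
pose m : {measure set 'rV[R]_n -> \bar R} :=
  mscale (NngNum (ltW cn0'))
    (measure_function_pushforward__canonical__measure_function_Measure
      (lebesgue_rV n) mphi).
have H : m A = lebesgue_rV n A.
  apply: rV_measure_unique => // B mB.
  change ((`|c| ^+ n)%:E * lebesgue_rV n (affine c h @^-1` rV_box B) =
    lebesgue_rV n (rV_box B))%E.
  have -> : affine c h @^-1` rV_box B =
    rV_box (fun i => (fun t => c * t + h ord0 i) @^-1` B i).
    by apply/seteqP; split => x /= Bx i; have := Bx i; rewrite /affine !mxE.
  have mB' i : measurable ((fun t => c * t + h ord0 i) @^-1` B i).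
    by rewrite -[X in measurable X]setTI; exact: measurable_affine1.
  rewrite !lebesgue_rV_box//.
  under eq_bigr do rewrite lebesgue_affine//.
  rewrite big_split/= muleA.
  rewrite (_ : (\prod_(i < n) (`|c|^-1)%:E)%E = (`|c| ^- n)%:E); last first.
    by rewrite prodEFin prodr_const card_ord exprVn.
  by rewrite -EFinM divff ?mul1e// gt_eqF.
by rewrite -H /m /mscale/= muleA -EFinM mulVf ?mul1e// gt_eqF.
Qed.

Local Open Scope ereal_scope.

Lemma ge0_integral_affine n (c : R) h (f : 'rV[R]_n -> \bar R) : c != 0%R ->
  measurable_fun setT f -> (forall x, 0 <= f x) ->
  \int[lebesgue_rV n]_x f (affine c h x) = (`|c| ^- n)%:E * \int[lebesgue_rV n]_x f x.
Proof.
move=> c0 mf f0.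
have c0' : (0 < `|c| ^- n)%R by rewrite invr_gt0 exprn_gt0// normr_gt0.
have mphi := @measurable_rV_affine n c h.
have := @ge0_integral_pushforward _ _ _ _ _ _ mphi (lebesgue_rV n) setT f measurableT mf
  (fun x _ => f0 x).
rewrite preimage_setT /comp => <-.
rewrite -[(`|c| ^- n)%R]/((NngNum (ltW c0'))%:num) -ge0_integral_mscale//.
apply: eq_measure_integral => A mA _.
exact: lebesgue_rV_affine.
Qed.

Lemma integrable_affine n (c : R) h (f : 'rV[R]_n -> \bar R) : c != 0%R ->
  (lebesgue_rV n).-integrable setT f ->
  (lebesgue_rV n).-integrable setT (fun x => f (affine c h x)).
Proof.
move=> c0 /integrableP[mf fi]; apply/integrableP; split.
  by apply: measurableT_comp => //; exact: measurable_rV_affine.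
rewrite (ge0_integral_affine h (f := fun x => `|f x|))//; last exact: measurableT_comp.
by rewrite lte_mul_pinfty// lee_fin invr_ge0.
Qed.

Lemma integral_affine n (c : R) h (f : 'rV[R]_n -> \bar R) : c != 0%R ->
  (lebesgue_rV n).-integrable setT f ->
  \int[lebesgue_rV n]_x f (affine c h x) = (`|c| ^- n)%:E * \int[lebesgue_rV n]_x f x.
Proof.
move=> c0 fi.
have [mf _] := integrableP _ _ _ fi.
rewrite integralE [in RHS]integralE.
rewrite -[fun x => f (affine c h x)]/(f \o affine c h) funepos_comp funeneg_comp.
rewrite /comp.
rewrite !ge0_integral_affine//.
  rewrite [RHS]muleBr//; apply: fin_num_adde_defl.
  by rewrite fin_numN; exact: integrable_neg_fin_num.
- exact: measurable_funeneg.
- exact: measurable_funepos.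
Qed.

End lebesgue_basics.

Section tonelli.
Context {R : realType}.
Local Open Scope ereal_scope.

Lemma tonelli_sigma_finite d1 d2 (T1 : measurableType d1) (T2 : measurableType d2)
  (m1 : {measure set T1 -> \bar R}) (m2 : {measure set T2 -> \bar R})
  (s1 : sigma_finite setT m1) (s2 : sigma_finite setT m2)
  (f : T1 * T2 -> \bar R) : measurable_fun setT f -> (forall x, 0 <= f x) ->
  [/\ measurable_fun setT (fun x => \int[m2]_y f (x, y)),
      measurable_fun setT (fun y => \int[m1]_x f (x, y)) &
  \int[m1]_x \int[m2]_y f (x, y) = \int[m2]_y \int[m1]_x f (x, y)].
Proof.
move=> mf f0.
have x1 : isSigmaFinite d1 T1 R (Measure.sort m1) by constructor.
have y1 : isSFinite d1 T1 R (Measure.sort m1).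
  by constructor; exact: sfinite_measure_sigma_finite.
have x2 : isSigmaFinite d2 T2 R (Measure.sort m2) by constructor.
have y2 : isSFinite d2 T2 R (Measure.sort m2).
  by constructor; exact: sfinite_measure_sigma_finite.
pose M1 : {sigma_finite_measure set T1 -> \bar R} := HB.pack (Measure.sort m1) x1 y1.
pose M2 : {sigma_finite_measure set T2 -> \bar R} := HB.pack (Measure.sort m2) x2 y2.
split.
- exact: (@measurable_fun_fubini_tonelli_F _ _ _ _ _ M2).
- exact: (@measurable_fun_fubini_tonelli_G _ _ _ _ _ M1).
- exact: (@fubini_tonelli _ _ _ _ _ M1 M2).
Qed.

End tonelli.

(** * Mean and mean-square norms *)

Lemma le_of_eq d (T : porderType d) (x y : T) : x = y -> (x <= y)%O.
Proof. by move=> ->. Qed.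

Section mean_norms.
Context d (T : measurableType d) (R : realType) (mu : {measure set T -> \bar R}).
Implicit Types (f g h : T -> R).

Definition n1 f : \bar R := (\int[mu]_x `|f x|%:E)%E.
Definition n2 f : \bar R := (\int[mu]_x (f x ^+ 2)%:E)%E.
Definition mf f := measurable_fun setT f.
Definition L1 f := mu.-integrable setT (EFin \o f).
Definition sqL f := mf f /\ (n2 f < +oo)%E.

Lemma n1_ge0 f : (0 <= n1 f)%E.
Proof. by apply: integral_ge0 => x _; rewrite lee_fin. Qed.

Lemma n2_ge0 f : (0 <= n2 f)%E.
Proof. by apply: integral_ge0 => x _; rewrite lee_fin sqr_ge0. Qed.

Lemma mfD f g : mf f -> mf g -> mf (fun x => f x + g x).
Proof. exact: measurable_funD. Qed.
Lemma mfB f g : mf f -> mf g -> mf (fun x => f x - g x).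
Proof. exact: measurable_funB. Qed.
Lemma mfN f : mf f -> mf (fun x => - f x).
Proof. exact: measurable_funN. Qed.
Lemma mfM f g : mf f -> mf g -> mf (fun x => f x * g x).
Proof. exact: measurable_funM. Qed.
Lemma mf_cst (c : R) : mf (fun=> c).
Proof. exact: measurable_cst. Qed.
Lemma mfZ (c : R) f : mf f -> mf (fun x => c * f x).
Proof. by move=> ?; apply: mfM => //; exact: mf_cst. Qed.
Lemma mf_sum (I : Type) (s : seq I) (P : pred I) (F : I -> T -> R) :
  (forall i, mf (F i)) -> mf (fun x => \sum_(i <- s | P i) F i x).
Proof.
move=> mF; elim: s => [|i s IH].
  by under eq_fun do rewrite big_nil; exact: mf_cst.
under eq_fun do rewrite big_cons.
by case: (P i) => //; apply: mfD.
Qed.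
Lemma mf_norm f : mf f -> mf (fun x => `|f x|).
Proof. by move=> ?; apply: measurableT_comp => //; exact: normr_measurable. Qed.
Lemma mfX f k : mf f -> mf (fun x => f x ^+ k).
Proof. exact: measurable_funX. Qed.
Lemma mfE f : mf f -> measurable_fun setT (fun x => (f x)%:E).
Proof. by move=> ?; exact/measurable_EFinP. Qed.

Lemma le_n1 f g : mf f -> mf g -> (forall x, `|f x| <= `|g x|) -> (n1 f <= n1 g)%E.
Proof.
move=> hf hg fg; apply: ge0_le_integral => //.
- exact/mfE/mf_norm.
- exact/mfE/mf_norm.
- by move=> x _; rewrite lee_fin.
Qed.

Lemma le_n2 f g : mf f -> mf g -> (forall x, `|f x| <= `|g x|) -> (n2 f <= n2 g)%E.
Proof.
move=> hf hg fg; apply: ge0_le_integral => //.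
- by move=> x _; rewrite lee_fin sqr_ge0.
- exact/mfE/mfX.
- exact/mfE/mfX.
- by move=> x _; rewrite lee_fin -(real_normK (num_real (f x)))
   -(real_normK (num_real (g x))) lerXn2r// nnegrE.
Qed.

Lemma ae_le_n1 f g : mf f -> mf g -> {ae mu, forall x, `|f x| <= `|g x|} ->
  (n1 f <= n1 g)%E.
Proof.
move=> hf hg fg; apply: ae_ge0_le_integral => //.
- exact/mfE/mf_norm.
- exact/mfE/mf_norm.
- by apply: filterS fg => x fgx _; rewrite lee_fin.
Qed.

Lemma eq_n1 f g : f =1 g -> n1 f = n1 g.
Proof. by move=> fg; rewrite (_ : f = g)//; exact/funext. Qed.

Lemma eq_n2 f g : f =1 g -> n2 f = n2 g.
Proof. by move=> fg; rewrite (_ : f = g)//; exact/funext. Qed.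

Lemma n1D f g : mf f -> mf g -> (n1 (fun x => f x + g x)%R <= n1 f + n1 g)%E.
Proof.
move=> hf hg; rewrite -ge0_integralD//; last 2 first.
- exact/mfE/mf_norm.
- exact/mfE/mf_norm.
apply: ge0_le_integral => //.
- exact/mfE/mf_norm/mfD.
- by apply: emeasurable_funD; exact/mfE/mf_norm.
- by move=> x _; rewrite -EFinD lee_fin ler_normD.
Qed.

Lemma n1Z (c : R) f : mf f -> n1 (fun x => c * f x) = (`|c|%:E * n1 f)%E.
Proof.
move=> hf; rewrite -ge0_integralZl//.
- by apply: eq_integral => x _; rewrite normrM EFinM.
- exact/mfE/mf_norm.
Qed.

Lemma n1N f : n1 (fun x => - f x) = n1 f.
Proof. by apply: eq_integral => x _; rewrite normrN. Qed.

Lemma n1B f g : mf f -> mf g -> (n1 (fun x => f x - g x)%R <= n1 f + n1 g)%E.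
Proof. by move=> hf hg; rewrite -(n1N g); apply: n1D => //; exact: mfN. Qed.

Lemma n1_sum (I : Type) (s : seq I) (F : I -> T -> R) : (forall i, mf (F i)) ->
  (n1 (fun x => \sum_(i <- s) F i x)%R <= \sum_(i <- s) n1 (F i))%E.
Proof.
move=> mF; elim: s => [|i s IH].
  rewrite big_nil /n1; under eq_integral do rewrite big_nil normr0.
  by rewrite integral0.
rewrite big_cons; apply: (le_trans _ (leeD2l _ IH)).
apply: (le_trans _ (n1D _ _)) => //; last exact: mf_sum.
by apply: le_n1 => [||x]; rewrite ?big_cons//; [exact: (@mf_sum _ (i :: s))|apply: mfD => //; exact: mf_sum].
Qed.

Lemma n2Z (c : R) f : mf f -> n2 (fun x => c * f x) = ((c ^+ 2)%:E * n2 f)%E.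
Proof.
move=> hf; rewrite -ge0_integralZl//.
- by apply: eq_integral => x _; rewrite exprMn EFinM.
- exact/mfE/mfX.
- by move=> x _; rewrite lee_fin sqr_ge0.
- by rewrite lee_fin sqr_ge0.
Qed.

Lemma n2_int (c : R) f : 0 <= c -> mf f -> (c%:E * n2 f = \int[mu]_x (c * f x ^+ 2)%:E)%E.
Proof.
move=> c0 hf; rewrite -ge0_integralZl//.
- exact/mfE/mfX.
- by move=> x _; rewrite lee_fin sqr_ge0.
Qed.

Lemma n2D f g : mf f -> mf g ->
  (n2 (fun x => f x + g x)%R <= 2%:E * n2 f + 2%:E * n2 g)%E.
Proof.
move=> hf hg; rewrite !n2_int// -ge0_integralD//; last 4 first.
- by move=> x _; rewrite lee_fin mulr_ge0// sqr_ge0.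
- exact/mfE/mfZ/mfX.
- by move=> x _; rewrite lee_fin mulr_ge0// sqr_ge0.
- exact/mfE/mfZ/mfX.
apply: ge0_le_integral => //.
- by move=> x _; rewrite lee_fin sqr_ge0.
- exact/mfE/mfX/mfD.
- by apply: emeasurable_funD; exact/mfE/mfZ/mfX.
- by move=> x _; rewrite -EFinD lee_fin; have := sqr_ge0 (f x - g x); nra.
Qed.

(** Integrates 2ab <= e a^2 + b^2 / e; the weight e replaces the square roots of the
    inequality of Cauchy and Schwarz. *)
Lemma n1M_young (e : R) f g : 0 < e -> mf f -> mf g ->
  (n1 (fun x => f x * g x)%R <= e%:E * n2 f + (e^-1)%:E * n2 g)%E.
Proof.
move=> e0 hf hg.
have ei0 : 0 < e^-1 by rewrite invr_gt0.
rewrite !n2_int ?(ltW e0) ?(ltW ei0)// -ge0_integralD//; last 4 first.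
- by move=> x _; rewrite lee_fin mulr_ge0// ?sqr_ge0// ltW.
- exact/mfE/mfZ/mfX.
- by move=> x _; rewrite lee_fin mulr_ge0// ?sqr_ge0// ltW.
- exact/mfE/mfZ/mfX.
apply: ge0_le_integral => //.
- exact/mfE/mf_norm/mfM.
- by apply: emeasurable_funD; exact/mfE/mfZ/mfX.
- move=> x _; rewrite -EFinD lee_fin normrM.
  rewrite -(real_normK (num_real (f x))) -(real_normK (num_real (g x))).
  have eei : e * e^-1 = 1 by rewrite divff// gt_eqF.
  have : 0 <= e^-1 * (e * `|f x| - `|g x| / 2) ^+ 2 by rewrite mulr_ge0// ?sqr_ge0// ltW.
  have : 0 <= e^-1 * `|g x| ^+ 2 by rewrite mulr_ge0// ?sqr_ge0// ltW.
  rewrite (_ : e^-1 * (e * `|f x| - `|g x| / 2) ^+ 2 =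
    (e * e^-1) * (e * `|f x| ^+ 2) - (e * e^-1) * (`|f x| * `|g x|)
     + e^-1 * `|g x| ^+ 2 / 4); last by field; rewrite gt_eqF.
  by rewrite eei; lra.
Qed.

Lemma L1P f : L1 f <-> mf f /\ (n1 f < +oo)%E.
Proof.
split=> [/integrableP[m i]|[m i]]; first by split => //; exact/measurable_EFinP.
by apply/integrableP; split => //; exact/mfE.
Qed.

Lemma le_L1 f g : mf f -> (forall x, `|f x| <= `|g x|) -> L1 g -> L1 f.
Proof.
move=> hf fg /L1P[mg g1]; apply/L1P; split => //.
by apply: le_lt_trans g1; exact: le_n1.
Qed.

Lemma L1_mf f : L1 f -> mf f. Proof. by move/L1P => []. Qed.

Lemma L1D f g : L1 f -> L1 g -> L1 (fun x => f x + g x).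
Proof.
move=> /L1P[mf1 f1] /L1P[mg1 g1]; apply/L1P; split; first exact: mfD.
by apply: (le_lt_trans (n1D _ _)) => //; rewrite lte_add_pinfty.
Qed.

Lemma L1Z (c : R) f : L1 f -> L1 (fun x => c * f x).
Proof.
move=> /L1P[mf1 f1]; apply/L1P; split; first exact: mfZ.
by rewrite n1Z// lte_mul_pinfty.
Qed.

Lemma L1N f : L1 f -> L1 (fun x => - f x).
Proof.
by move=> /L1P[mf1 f1]; apply/L1P; split; [exact: mfN|rewrite n1N].
Qed.

Lemma L1B f g : L1 f -> L1 g -> L1 (fun x => f x - g x).
Proof. by move=> hf hg; apply: L1D => //; exact: L1N. Qed.

Lemma L1_sum (I : Type) (s : seq I) (F : I -> T -> R) :
  (forall i, L1 (F i)) -> L1 (fun x => \sum_(i <- s) F i x).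
Proof.
move=> mF; elim: s => [|i s IH].
  apply/L1P; split.
    by under eq_fun do rewrite big_nil; exact: mf_cst.
  rewrite /n1; under eq_integral do rewrite big_nil normr0.
  by rewrite integral0.
under eq_fun do rewrite big_cons.
exact: L1D.
Qed.

Lemma L1Ml (K : R) f g : mf f -> (forall x, `|f x| <= K) -> L1 g ->
  L1 (fun x => f x * g x).
Proof.
move=> hf fK hg; apply: (@le_L1 _ (fun x => K * g x)).
- by apply: mfM => //; exact: L1_mf.
- move=> x; rewrite !normrM ler_wpM2r//.
  by apply: (le_trans (fK x)); rewrite ler_norm.
- exact: L1Z.
Qed.

Lemma sqLM f g : sqL f -> sqL g -> L1 (fun x => f x * g x).
Proof.
move=> [hf f2] [hg g2]; apply/L1P; split; first exact: mfM.
apply: (le_lt_trans (@n1M_young 1 _ _ ltr01 hf hg)).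
by rewrite invr1 !mul1e lte_add_pinfty.
Qed.

Lemma sqLD f g : sqL f -> sqL g -> sqL (fun x => f x + g x).
Proof.
move=> [hf f2] [hg g2]; split; first exact: mfD.
apply: (le_lt_trans (n2D hf hg)).
by rewrite lte_add_pinfty// lte_mul_pinfty.
Qed.

Lemma sqLZ (c : R) f : sqL f -> sqL (fun x => c * f x).
Proof.
move=> [hf f2]; split; first exact: mfZ.
by rewrite n2Z// lte_mul_pinfty// lee_fin sqr_ge0.
Qed.

Lemma sqLN f : sqL f -> sqL (fun x => - f x).
Proof.
move=> [hf f2]; split; first exact: mfN.
by rewrite /n2; under eq_integral do rewrite sqrrN.
Qed.

Lemma sqLB f g : sqL f -> sqL g -> sqL (fun x => f x - g x).
Proof. by move=> hf hg; apply: sqLD => //; exact: sqLN. Qed.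

Lemma sqL_sum (I : Type) (s : seq I) (F : I -> T -> R) :
  (forall i, sqL (F i)) -> sqL (fun x => \sum_(i <- s) F i x).
Proof.
move=> mF; elim: s => [|i s IH].
  split; first by under eq_fun do rewrite big_nil; exact: mf_cst.
  rewrite /n2; under eq_integral do rewrite big_nil expr0n.
  by rewrite integral0.
under eq_fun do rewrite big_cons.
exact: sqLD.
Qed.

Lemma le_sqL f g : mf f -> (forall x, `|f x| <= `|g x|) -> sqL g -> sqL f.
Proof.
move=> hf fg [mg g1]; split => //.
by apply: le_lt_trans g1; exact: le_n2.
Qed.

Lemma sqLMl (K : R) f g : mf f -> (forall x, `|f x| <= K) -> sqL g ->
  sqL (fun x => f x * g x).
Proof.
move=> hf fK hg; apply: (@le_sqL _ (fun x => K * g x)).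
- by apply: mfM => //; case: hg.
- move=> x; rewrite !normrM ler_wpM2r//.
  by apply: (le_trans (fK x)); rewrite ler_norm.
- exact: sqLZ.
Qed.

Lemma le_norm_Rint f : L1 f -> (`|\int[mu]_x f x|%:E <= n1 f)%E.
Proof.
move=> hf; rewrite EFin_normr_Rintegral//.
by apply: le_abse_integral => //; exact/mfE/L1_mf.
Qed.

Lemma RintD f g : L1 f -> L1 g ->
  \int[mu]_x (f x + g x) = \int[mu]_x f x + \int[mu]_x g x.
Proof. exact: RintegralD. Qed.

Lemma RintB f g : L1 f -> L1 g ->
  \int[mu]_x (f x - g x) = \int[mu]_x f x - \int[mu]_x g x.
Proof. exact: RintegralB. Qed.

Lemma RintZ (c : R) f : L1 f -> \int[mu]_x (c * f x) = c * \int[mu]_x f x.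
Proof. by move=> hf; exact: RintegralZl. Qed.

Lemma RintN f : L1 f -> \int[mu]_x (- f x) = - \int[mu]_x f x.
Proof.
move=> hf; under eq_Rintegral do rewrite -mulN1r.
by rewrite RintZ// mulN1r.
Qed.

Lemma Rint_sum (I : Type) (s : seq I) (F : I -> T -> R) :
  (forall i, L1 (F i)) ->
  \int[mu]_x (\sum_(i <- s) F i x) = \sum_(i <- s) \int[mu]_x F i x.
Proof.
move=> mF; elim: s => [|i s IH].
  rewrite big_nil; under eq_Rintegral do rewrite big_nil.
  by rewrite /Rintegral integral0.
under eq_Rintegral do rewrite big_cons.
by rewrite big_cons RintD// ?IH//; exact: L1_sum.
Qed.

(** Convergence to 0 of norms that may be infinite for small indices. *)
Definition to0 (u : nat -> \bar R) :=
  forall e : R, 0 < e -> exists N, forall k, (N <= k)%N -> (u k <= e%:E)%E.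

Lemma to0_le u v : (forall k, (u k <= v k)%E) -> to0 v -> to0 u.
Proof.
move=> uv hv e e0; have [N hN] := hv e e0; exists N => k Nk.
exact: le_trans (uv k) (hN k Nk).
Qed.

Lemma to0D u v : to0 u -> to0 v -> to0 (fun k => u k + v k)%E.
Proof.
move=> hu hv e e0; have e20 : 0 < e / 2 by rewrite divr_gt0.
have [N hN] := hu _ e20; have [M hM] := hv _ e20; exists (maxn N M) => k.
rewrite geq_max => /andP[Nk Mk].
by rewrite [e]splitr EFinD leeD// ?hN ?hM.
Qed.

Lemma to0Z (c : R) u : 0 <= c -> to0 u -> to0 (fun k => c%:E * u k)%E.
Proof.
rewrite le_eqVlt => /predU1P[<- _ e e0|c0 hu e e0].
  by exists 0%N => k _; rewrite mul0e lee_fin ltW.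
have [N hN] := hu _ (divr_gt0 e0 c0); exists N => k Nk.
apply: (le_trans (lee_wpmul2l _ (hN k Nk))); first by rewrite lee_fin ltW.
by rewrite -EFinM mulrC divfK// gt_eqF.
Qed.

Lemma to0_sum (I : Type) (s : seq I) (F : I -> nat -> \bar R) :
  (forall i, to0 (F i)) -> to0 (fun k => \sum_(i <- s) F i k)%E.
Proof.
move=> mF; elim: s => [|i s IH].
  by move=> e e0; exists 0%N => k _; rewrite big_nil lee_fin ltW.
have := to0D (mF i) IH; apply: to0_le => k.
by rewrite big_cons.
Qed.

Lemma to0_cvg u : (forall k, 0 <= u k)%E -> to0 u -> (u @ \oo --> 0)%E.
Proof.
move=> u0 hu; apply/fine_cvgP; split.
  have [N hN] := hu 1 ltr01; exists N => // k /= Nk.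
  by rewrite ge0_fin_numE// (le_lt_trans (hN k Nk))// ltry.
apply/cvgrPdist_le => e e0; have [N hN] := hu e e0.
exists N => // k /= Nk; rewrite sub0r normrN ger0_norm ?fine_ge0//.
rewrite -lee_fin fineK ?hN// ge0_fin_numE//.
by rewrite (le_lt_trans (hN k Nk))// ltry.
Qed.

Lemma cvg_to0 (u : nat -> \bar R) : (u @ \oo --> 0)%E -> to0 u.
Proof.
move=> /fine_cvgP[[N _ hN] /cvgrPdist_le hu] e e0.
have [M _ hM] := hu e e0; exists (maxn N M) => k.
rewrite geq_max => /andP[Nk Mk]; have := hM k Mk.
rewrite sub0r normrN => /(le_trans (ler_norm _)).
by rewrite -lee_fin fineK// hN.
Qed.

Lemma to0_L2M (C : R) (f g : nat -> T -> R) :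
  (forall k, mf (f k)) -> (forall k, mf (g k)) ->
  (forall k, (n2 (f k) <= C%:E)%E) -> to0 (fun k => n2 (g k)) ->
  to0 (fun k => n1 (fun x => f k x * g k x)).
Proof.
move=> hf hg fC g0 e e0.
have C0 : 0 <= C by rewrite -lee_fin (le_trans (n2_ge0 (f 0%N))).
pose a := (e / 2) / (C + 1).
have C1 : 0 < C + 1 by lra.
have a0 : 0 < a by rewrite divr_gt0// divr_gt0.
have [N hN] := g0 (a * (e / 2)) (mulr_gt0 a0 (divr_gt0 e0 (ltr0Sn _ _))).
exists N => k Nk; apply: (le_trans (n1M_young a0 (hf k) (hg k))).
rewrite [e]splitr EFinD; apply: leeD.
  apply: (le_trans (lee_wpmul2l _ (fC k))); first by rewrite lee_fin ltW.
  rewrite -EFinM lee_fin /a mulrAC ler_pdivrMr//.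
  by rewrite ler_wpM2l//; [rewrite ltW// divr_gt0|lra].
apply: (le_trans (lee_wpmul2l _ (hN k Nk))); first by rewrite lee_fin invr_ge0 ltW.
by rewrite -EFinM lee_fin mulKf// gt_eqF.
Qed.

Lemma n1_small_ae0 f : mf f -> (forall e : R, 0 < e -> (n1 f <= e%:E)%E) ->
  {ae mu, forall x, f x = 0}.
Proof.
move=> hf h; have n0 : n1 f = 0%E.
  by apply/eqP; rewrite eq_le n1_ge0 andbT; apply/lee_addgt0Pr => e /h; rewrite add0e.
have /= := (ae_eq_integral_abs mu measurableT (mfE hf)).1 n0.
by apply: filterS => x /(_ I) [].
Qed.

Lemma dominated_to0 (f : nat -> T -> R) g h : (forall k, mf (f k)) -> mf g -> L1 h ->
  {ae mu, forall x, (fun k => f k x) @ \oo --> g x} -> (forall k x, `|f k x| <= h x) ->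
  to0 (fun k => n1 (fun x => f k x - g x)).
Proof.
move=> mf_ mg Lh fg fh.
have [||||_ H _] := @dominated_convergence _ _ _ mu setT measurableT
   (fun k x => (f k x)%:E) (fun x => (g x)%:E) _ _ _ _ Lh _.
- by move=> k; exact: mfE.
- exact: mfE.
- by apply: filterS fg => x hx _; apply: cvg_EFin => //; exact: nearW.
- by apply: aeW => x k _; rewrite lee_fin; exact: fh.
exact: cvg_to0 H.
Qed.

Lemma fatou_ae (h : nat -> T -> R) (g : T -> R) (C : R) :
  (forall k, mf (h k)) -> mf g -> (forall k x, 0 <= h k x) -> (forall x, 0 <= g x) ->
  {ae mu, forall x, (fun k => h k x) @ \oo --> g x} ->
  (exists N, forall k, (N <= k)%N -> (\int[mu]_x (h k x)%:E <= C%:E)%E) ->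
  (\int[mu]_x (g x)%:E <= C%:E)%E.
Proof.
move=> mh mg h0 g0 hg [N hC].
pose h' k x := (h (k + N)%N x)%:E.
have mh' k : measurable_fun setT (h' k) by exact/mfE.
have H : (\int[mu]_x limn_einf (h' ^~ x) <=
    limn_einf (fun k => \int[mu]_x h' k x))%E.
  by apply: fatou => // k x _; rewrite lee_fin.
have -> : (\int[mu]_x (g x)%:E = \int[mu]_x limn_einf (h' ^~ x))%E.
  apply: ae_eq_integral => //.
  - exact/mfE.
  - apply: (@emeasurable_fun_cvg _ _ _ _ (fun m x => einfs (h' ^~ x) m)).
      by move=> m; exact: measurable_fun_einfs.
    by move=> x _; rewrite limn_einf_lim; exact: is_cvg_einfs.
  - apply: filterS hg => x hx _.
    have /cvg_limn_einf_sup[-> _] // : h' ^~ x @ \oo --> (g x)%:E.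
    apply: cvg_EFin; first by near=> k.
    by rewrite -(@cvg_shiftn N) in hx; exact: hx.
apply: (le_trans H); rewrite limn_einf_lim; apply: lime_le.
  exact: is_cvg_einfs.
near=> k; apply: (@le_trans _ _ (\int[mu]_x h' k x)%E).
  by apply: ereal_inf_lbound; exists k => //=.
by apply: hC; rewrite leq_addl.
Unshelve. all: by end_near. Qed.

Lemma fatou_n1 (h : nat -> T -> R) (g : T -> R) (C : R) :
  (forall k, mf (h k)) -> mf g ->
  {ae mu, forall x, (fun k => h k x) @ \oo --> g x} ->
  (exists N, forall k, (N <= k)%N -> (n1 (h k) <= C%:E)%E) ->
  (n1 g <= C%:E)%E.
Proof.
move=> mh mg hg hC; apply: (@fatou_ae (fun k x => `|h k x|)) => //.
- by move=> k; exact: mf_norm.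
- exact: mf_norm.
- by apply: filterS hg => x; exact: cvg_norm.
Qed.

Lemma fatou_n2 (h : nat -> T -> R) (g : T -> R) (C : R) :
  (forall k, mf (h k)) -> mf g ->
  {ae mu, forall x, (fun k => h k x) @ \oo --> g x} ->
  (exists N, forall k, (N <= k)%N -> (n2 (h k) <= C%:E)%E) ->
  (n2 g <= C%:E)%E.
Proof.
move=> mh mg hg hC; apply: (@fatou_ae (fun k x => h k x ^+ 2)) => //.
- by move=> k; exact: mfX.
- exact: mfX.
- by move=> k x; exact: sqr_ge0.
- by move=> x; exact: sqr_ge0.
- by apply: filterS hg => x hx; rewrite expr2; under eq_fun do rewrite expr2; exact: cvgM.
Qed.

(** The increments are summable in the mean, hence almost everywhere. *)
Lemma fast_cauchy (f : nat -> T -> R) : (forall k, mf (f k)) ->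
  (forall k, (n1 (fun x => f k.+1 x - f k x)%R <= (2 ^- k)%:E)%E) ->
  exists2 g, mf g & {ae mu, forall x, (fun k => f k x) @ \oo --> g x}.
Proof.
move=> hf fk.
pose D k x := `|f k.+1 x - f k x|%:E.
have mD k : measurable_fun setT (D k) by apply/mfE/mf_norm/mfB.
have D0 k x : (0 <= D k x)%E by rewrite lee_fin.
have iD : mu.-integrable setT (fun x => \sum_(0 <= k <oo) D k x)%E.
  apply/integrableP; split; first exact: ge0_emeasurable_sum.
  under eq_integral do rewrite gee0_abs ?nneseries_ge0//.
  rewrite integral_nneseries//.
  apply: (@le_lt_trans _ _ (\sum_(0 <= k <oo) (2 ^- k)%:E)%E).
    by apply: lee_nneseries => k *; [exact: integral_ge0|exact: fk].
  have := @cvg_geometric_eseries_half R 2 0.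
  rewrite (_ : [series _]_n = fun n => (\sum_(0 <= k < n) (2 ^- k)%:E)%E)%E; last first.
    apply/funext => n; rewrite /series/=; apply: eq_bigr => k _; congr (_%:E).
    by rewrite ?addn0 addn1 natrX exprS invfM mulrA divff ?mul1r// pnatr_eq0.
  by move=> /cvg_lim ->//; rewrite ltry.
exists (fun x => fine (limn_esup (fun k => (f k x)%:E))).
  have m1 : measurable_fun setT (fun x => limn_esup (fun k => (f k x)%:E)).
    by apply: measurable_fun_limn_esup => k; exact/mfE.
  exact: (measurableT_comp (@fine_measurable R setT measurableT) m1).
have := integrable_ae measurableT iD; apply: filterS => x /(_ Logic.I) Sx.
have cx : cvgn (fun k => f k x).
  have cd : cvgn (series (fun k => f k.+1 x - f k x)).
    apply: normed_cvg; apply: nondecreasing_is_cvgn.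
      apply/nondecreasing_seqP => k.
      change (\sum_(0 <= i < k) `|f i.+1 x - f i x| <=
              \sum_(0 <= i < k.+1) `|f i.+1 x - f i x|).
      by rewrite big_nat_recr//= lerDl.
    exists (fine (\sum_(0 <= k <oo) D k x)%E) => _ [k _ <-].
    rewrite -lee_fin fineK// /series/= -sumEFin.
    exact: nneseries_lim_ge.
  have -> : (fun k => f k x) = (fun k => f 0%N x + series (fun k => f k.+1 x - f k x) k).
    by apply/funext => k; rewrite /series/= telescope_sumr// addrC subrK.
  by apply: is_cvgD => //; exact: is_cvg_cst.
have cE : (fun k => (f k x)%:E) @ \oo --> (limn (fun k => f k x))%:E.
  by apply: cvg_EFin => //; exact: nearW.
have [_ ->] := cvg_limn_einf_sup cE.
exact: cx.
Qed.

Lemma L1_complete (f : nat -> T -> R) : (forall k, mf (f k)) ->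
  (forall e : R, 0 < e -> exists N, forall k m, (N <= k)%N -> (N <= m)%N ->
     (n1 (fun x => f k x - f m x)%R <= e%:E)%E) ->
  exists g (s : nat -> nat), [/\ mf g, forall k, (k <= s k)%N,
    {ae mu, forall x, (fun k => f (s k) x) @ \oo --> g x} &
    to0 (fun k => n1 (fun x => f k x - g x))].
Proof.
move=> hf fc.
have p2 k : 0 < 2 ^- k :> R by rewrite invr_gt0 exprn_gt0.
have /choice[N hN] : forall k, exists N, forall i m, (N <= i)%N -> (N <= m)%N ->
    (n1 (fun x => f i x - f m x)%R <= (2 ^- k)%:E)%E.
  by move=> k; exact: fc.
pose s := fix s k := if k is k'.+1 then maxn (s k').+1 (N k) else N 0%N.
have sS k : (s k < s k.+1)%N by rewrite /= leq_max leqnn.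
have sN k : (N k <= s k)%N by case: k => [|k] //=; rewrite leq_max leqnn orbT.
have sk k : (k <= s k)%N.
  by elim: k => // k IH; apply: leq_ltn_trans (sS k).
have [|g mg hg] := @fast_cauchy (fun k => f (s k)) (fun k => hf _).
  move=> k; apply: hN; last exact: sN.
  by apply: leq_trans (ltnW (sS k)).
exists g, s; split => //.
move=> e e0; have [M hM] := fc e e0; exists M => k Mk.
apply: (@fatou_n1 (fun j x => f k x - f (s j) x)).
- by move=> j; exact: mfB.
- exact: mfB.
- by apply: filterS hg => x hx; apply: cvgB => //; exact: cvg_cst.
- by exists M => j Mj; apply: hM => //; apply: (leq_trans Mj).
Qed.

End mean_norms.

(** * Strong limits of midpoint combinations *)
Section mazur.
Context (R : realType) (V : lmodType R).

Inductive hull (v : nat -> V) (n : nat) : V -> Prop :=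
| hull_base k : (n <= k)%N -> hull v n (v k)
| hull_mid u w : hull v n u -> hull v n w -> hull v n (2^-1 *: (u + w)).

Lemma hullW v n m u : (n <= m)%N -> hull v m u -> hull v n u.
Proof.
move=> nm; elim=> [k mk|u1 u2 _ h1 _ h2]; last exact: hull_mid.
by apply: hull_base; exact: leq_trans mk.
Qed.

(** By the parallelogram law midpoints of far points of the tail hulls have a smaller q; so
    points of the hulls whose q is nearly minimal are close. *)
Lemma mazur (P : V -> Prop) (q : V -> R) (v : nat -> V) (C : R) :
  (forall u w, P u -> P w -> P (u + w)) -> (forall (c : R) u, P u -> P (c *: u)) ->
  (forall u, 0 <= q u) ->
  (forall u w, P u -> P w -> q (u + w) + q (u - w) = 2 * q u + 2 * q w) ->
  (forall (c : R) u, P u -> q (c *: u) = c ^+ 2 * q u) ->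
  (forall k, P (v k)) -> (forall k, q (v k) <= C) ->
  exists w : nat -> V, (forall n, hull v n (w n)) /\
    forall e, 0 < e -> exists N, forall k m, (N <= k)%N -> (N <= m)%N ->
      q (w k - w m) <= e.
Proof.
move=> PD PZ q0 par qZ Pv qC.
have Ph n u : hull v n u -> P u.
  by elim=> [k _|u1 u2 _ h1 _ h2] //; apply/PZ/PD.
have mid u w : P u -> P w ->
    q (2^-1 *: (u - w)) = (q u + q w) / 2 - q (2^-1 *: (u + w)).
  move=> Pu Pw; have PNw : P (- w) by rewrite -scaleN1r; exact: PZ.
  have := par u w Pu Pw.
  by rewrite !qZ; [lra|exact: PD|exact: PD].
have qh n u : hull v n u -> q u <= C.
  elim=> [k _|u1 u2 h1 c1 h2 c2] //.
  have := mid u1 u2 (Ph _ _ h1) (Ph _ _ h2).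
  by have := q0 (2^-1 *: (u1 - u2)); lra.
pose S n := [set q u | u in hull v n].
have infS n : has_inf (S n).
  split; first by exists (q (v n)), (v n) => //; exact: hull_base.
  by exists 0 => _ [u _ <-].
pose dn n := inf (S n).
have dn_le n u : hull v n u -> dn n <= q u.
  by move=> hu; apply: ge_inf; [exact: (infS n).2|exists u].
have dnC n : dn n <= C by apply: le_trans (qC n); apply: dn_le; exact: hull_base.
pose D := sup (range dn).
have supD : has_sup (range dn).
  by split; [exists (dn 0%N), 0%N|exists C => _ [n _ <-]].
have dnD n : dn n <= D by apply: ub_le_sup; [exact: supD.2|exists n].
have /choice[w hw] : forall n, exists w, hull v n w /\ q w <= D + n.+1%:R^-1.
  move=> n; have e0 : 0 < n.+1%:R^-1 :> R by [].
  have [_ [u hu <-] qu] := inf_adherent e0 (infS n).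
  exists u; split => //; apply: ltW; apply: (lt_le_trans qu).
  by rewrite lerD2r; exact: dnD.
exists w; split; first by move=> n; case: (hw n).
move=> e e0.
have e8 : 0 < e / 8 by rewrite divr_gt0.
have [_ [N1 _ <-] hN1] := sup_adherent e8 supD.
pose N2 := Num.truncn (8 / e).
have hN2 k : (N2 <= k)%N -> k.+1%:R^-1 <= e / 8.
  move=> Nk; rewrite -[e / 8]invrK lef_pV2 ?posrE ?invr_gt0// invf_div.
  by apply: ltW; apply: (lt_le_trans (truncnS_gt _)); rewrite ler_nat.
exists (maxn N1 N2) => k m; rewrite !geq_max => /andP[k1 k2] /andP[m1 m2].
have [hk qk] := hw k; have [hm qm] := hw m.
have hk1 := hullW k1 hk; have hm1 := hullW m1 hm.
have := mid _ _ (Ph _ _ hk) (Ph _ _ hm).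
have := dn_le _ _ (hull_mid hk1 hm1).
have PB : P (w k - w m).
  by apply: PD; [exact: Ph hk|rewrite -scaleN1r; apply: PZ; exact: Ph hm].
rewrite [q (2^-1 *: (w k - w m))]qZ//.
have := hN2 k k2; have := hN2 m m2.
rewrite -/D in hN1; rewrite (_ : 2^-1 ^+ 2 = 4^-1 :> R); last by field.
have arith (a b D' d' x y z t e' : R) : x <= D' + a -> y <= D' + b ->
    D' - e' / 8 < d' -> b <= e' / 8 -> a <= e' / 8 -> d' <= z ->
    4^-1 * t = (x + y) / 2 - z -> t <= e' by lra.
exact: arith qk qm hN1.
Qed.

(** Being within e of the limit is preserved by midpoints. *)
Lemma hull_lim (l : V -> R) (v w : nat -> V) (P : V -> Prop) (L : R) :
  (forall u w, P u -> P w -> P (2^-1 *: (u + w))) -> (forall k, P (v k)) ->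
  (forall u w, P u -> P w -> l (2^-1 *: (u + w)) = (l u + l w) / 2) ->
  (forall n, hull v n (w n)) -> (fun k => l (v k)) @ \oo --> L ->
  (fun k => l (w k)) @ \oo --> L.
Proof.
move=> PM Pv lm hw /cvgrPdist_le hl; apply/cvgrPdist_le => e e0.
have [N _ hN] := hl e e0; exists N => // n /= Nn.
suff : P (w n) /\ `|L - l (w n)| <= e by case.
elim: (hw n) => [k nk|u1 u2 _ [P1 h1] _ [P2 h2]].
  by split=> //; apply: hN; exact: leq_trans nk.
split; first exact: PM.
rewrite lm//; move: h1 h2; rewrite !ler_norml => /andP[? ?] /andP[? ?].
by apply/andP; split; lra.
Qed.

End mazur.

(** * Partial derivatives *)
Section partials.
Context {R : realType}.
Implicit Types n : nat.

Definition ed n (i : 'I_n) : 'rV[R]_n := delta_mx ord0 i.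

Lemma line_entry n (i j : 'I_n) (h : R) (x : 'rV[R]_n) :
  (h *: ed i + x) ord0 j = (if j == i then h else 0) + x ord0 j.
Proof. by rewrite !mxE eqxx/=; case: eqP; rewrite ?mulr1 ?mulr0. Qed.

Lemma is_derive_line n (f : 'rV[R]_n -> R) (x v : 'rV[R]_n) (t d : R) :
  is_derive (t *: v + x) v f d <-> is_derive t (1 : R) (fun h : R => f (h *: v + x)) d.
Proof.
have E : (fun h : R => h^-1 *: ((f \o shift (t *: v + x)) (h *: v) - f (t *: v + x)))
   = (fun h : R => h^-1 *: (((fun h : R => f (h *: v + x)) \o shift t) (h *: 1)
        - f (t *: v + x))).
  apply/funext => h /=; congr (_ *: (f _ - _)).
  by rewrite addrA -scalerDl; congr ((_ + _) *: _ + _); rewrite /GRing.scale/= mulr1.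
split=> -[h1 h2]; split.
- by move: h1; rewrite /derivable E.
- by move: h2; rewrite /derive E.
- by move: h1; rewrite /derivable -E.
- by move: h2; rewrite /derive -E.
Qed.

Lemma is_derive_line0 n (f : 'rV[R]_n -> R) (x v : 'rV[R]_n) (d : R) :
  is_derive x v f d <-> is_derive (0 : R) (1 : R) (fun h : R => f (h *: v + x)) d.
Proof. by rewrite -is_derive_line scale0r add0r. Qed.

Lemma is_derive_partial n (i : 'I_n) (f : 'rV[R]_n -> R) x d :
  is_derive x (ed i) f d -> partial i f x = d.
Proof. by move=> h; rewrite /partial; exact: derive_val. Qed.

Lemma mvt_bound (f df : R -> R) (a b K : R) :
  (forall t, Num.min a b <= t <= Num.max a b -> is_derive t 1 f (df t)) ->
  (forall t, Num.min a b <= t <= Num.max a b -> `|df t| <= K) ->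
  `|f b - f a| <= K * `|b - a|.
Proof.
wlog ab : a b / a <= b.
  move=> W h1 h2; have [ab|/ltW ba] := leP a b; first exact: W.
  by rewrite distrC [X in _ * X]distrC; apply: W => // t; rewrite minC maxC; [exact: h1|exact: h2].
move=> h1 h2; rewrite min_l// max_r// in h1 h2.
have [||c cab ->] := @MVT_segment R f df a b ab.
- by move=> x; rewrite in_itv/= => /andP[xa xb]; apply: h1; rewrite !ltW.
- apply: continuous_in_subspaceT => x; rewrite inE/= in_itv/= => xab.
  have [d _] := h1 x xab.
  by apply: differentiable_continuous; apply/derivable1_diffP.
- by rewrite normrM ler_wpM2r//; apply: h2; rewrite in_itv/= in cab.
Qed.

Definition l1n n (x : 'rV[R]_n) : R := \sum_i `|x ord0 i|.

Lemma l1n_ge0 n (x : 'rV[R]_n) : 0 <= l1n x.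
Proof. by apply: sumr_ge0. Qed.

Lemma le_l1n n (x : 'rV[R]_n) i : `|x ord0 i| <= l1n x.
Proof. by rewrite /l1n (bigD1 i)//= lerDl sumr_ge0. Qed.

Lemma l1nD n (x y : 'rV[R]_n) : l1n (x + y) <= l1n x + l1n y.
Proof.
rewrite /l1n -big_split/=; apply: ler_sum => i _.
by rewrite mxE ler_normD.
Qed.

Lemma l1nZ n (c : R) (x : 'rV[R]_n) : l1n (c *: x) = `|c| * l1n x.
Proof. by rewrite /l1n mulr_sumr; apply: eq_bigr => i _; rewrite mxE normrM. Qed.

Lemma l1nN n (x : 'rV[R]_n) : l1n (- x) = l1n x.
Proof. by apply: eq_bigr => i _; rewrite mxE normrN. Qed.

Lemma l1n_ed n (i : 'I_n) : l1n (ed i) = 1.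
Proof.
rewrite /l1n (bigD1 i)//= big1 ?addr0; first by rewrite mxE !eqxx normr1.
by move=> j ji; rewrite mxE (negbTE ji) andbF normr0.
Qed.

Lemma mx_norm_le n (x : 'rV[R]_n) (r : R) : 0 <= r ->
  (forall i, `|x ord0 i| <= r) -> `|x| <= r.
Proof.
move=> r0 h; rewrite [`|x|]mx_normrE; apply: bigmax_le => // -[i j] _ /=.
by rewrite (ord1 i).
Qed.

Lemma entry_le_mx_norm n (x : 'rV[R]_n) i : `|x ord0 i| <= `|x|.
Proof.
rewrite [`|x|]mx_normrE.
exact: (le_bigmax _ (fun ij : 'I_1 * 'I_n => `|x ij.1 ij.2|) (ord0, i)).
Qed.

Lemma norm_le_l1n n (x : 'rV[R]_n) : `|x| <= l1n x.
Proof. by apply: mx_norm_le; [exact: l1n_ge0|exact: le_l1n]. Qed.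

Lemma l1n_le_norm n (x : 'rV[R]_n) : l1n x <= n%:R * `|x|.
Proof.
rewrite /l1n mulr_natl -[X in _ *+ X]card_ord -sumr_const.
by apply: ler_sum => i _; exact: entry_le_mx_norm.
Qed.

(** Changing one coordinate at a time bounds the oscillation of a function on a
    box by that of its partial derivatives. *)
Lemma box_lipschitz n (f : 'rV[R]_n -> R) (D : 'I_n -> 'rV[R]_n -> R)
  (x : 'rV[R]_n) (r K : R) :
  (forall i y, `|y - x| <= r -> is_derive y (ed i) f (D i y)) ->
  (forall i y, `|y - x| <= r -> `|D i y| <= K) ->
  forall y, `|y - x| <= r -> `|f y - f x| <= K * l1n (y - x).
Proof.
move=> hD hK y yr.
have r0 : 0 <= r by apply: le_trans yr.
pose z (k : nat) : 'rV[R]_n := \row_j (if (j < k)%N then y ord0 j else x ord0 j).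
have z0 : z 0%N = x by apply/rowP => j; rewrite mxE.
have zn : z n = y by apply/rowP => j; rewrite mxE ltn_ord.
rewrite -{1}zn -{1}z0 -(telescope_sumr (f \o z))//= big_mkord.
apply: (le_trans (ler_norm_sum _ _ _)).
rewrite /l1n mulr_sumr; apply: ler_sum => i _.
have zS : z i.+1 = (y ord0 i - x ord0 i) *: ed i + z i.
  apply/rowP => j; rewrite line_entry !mxE.
  have [->|ji] := eqVneq j i; first by rewrite ltnS leqnn ltnn subrK.
  by rewrite add0r ltnS leq_eqVlt (inj_eq val_inj) (negbTE ji).
have box t : Num.min 0 (y ord0 i - x ord0 i) <= t <= Num.max 0 (y ord0 i - x ord0 i) ->
    `|(t *: ed i + z i) - x| <= r.
  move=> tb; apply: mx_norm_le => // j; rewrite mxE line_entry !mxE.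
  have yj k : `|y ord0 k - x ord0 k| <= r.
    by have := le_trans (entry_le_mx_norm (y - x) k) yr; rewrite !mxE.
  have [->|ji] := eqVneq j i.
    rewrite ltnn addrK; have := yj i; move: tb; rewrite ge_min le_max.
    rewrite !ler_norml => /andP[/orP[] ? /orP[] ?] /andP[? ?]; apply/andP; split; lra.
  by rewrite add0r; case: ifP; rewrite ?subrr ?normr0.
rewrite zS -[z i in X in _ - f X]add0r -[X in _ - f (X + _)](scale0r (ed i)).
have := @mvt_bound (fun t => f (t *: ed i + z i)) (fun t => D i (t *: ed i + z i)) 0
  (y ord0 i - x ord0 i) K.
rewrite subr0 [(y - x) _ _]mxE [(- x) _ _]mxE; apply.
  by move=> t /box bt; apply/is_derive_line; exact: hD.
by move=> t /box bt; exact: hK.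
Qed.

Lemma lipschitz_partial n (f : 'rV[R]_n -> R) (D : 'I_n -> 'rV[R]_n -> R) (K : R) :
  (forall i y, is_derive y (ed i) f (D i y)) -> (forall i y, `|D i y| <= K) ->
  forall x y, `|f y - f x| <= K * l1n (y - x).
Proof.
by move=> hD hK x y; apply: (@box_lipschitz _ f D x `|y - x|).
Qed.

(** The Lipschitz bound, for f minus its linearization at x. *)
Lemma taylor_partial n (f : 'rV[R]_n -> R) (D : 'I_n -> 'rV[R]_n -> R) (K : R) :
  (forall i y, is_derive y (ed i) f (D i y)) ->
  (forall i x y, `|D i y - D i x| <= K * l1n (y - x)) -> 0 <= K ->
  forall x y, `|f y - f x - \sum_i (y - x) ord0 i * D i x| <=
    K * n%:R * l1n (y - x) ^+ 2.
Proof.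
move=> hD hK K0 x y.
pose F (z : 'rV[R]_n) := f z - \sum_i (z - x) ord0 i * D i x.
have FD i z : is_derive z (ed i) F (D i z - D i x).
  apply/is_derive_line0.
  have -> : (fun h : R => F (h *: ed i + z)) =
      (fun h : R => f (h *: ed i + z) - ((h * D i x) + \sum_j (z - x) ord0 j * D j x)).
    apply/funext => h; rewrite /F; congr (_ - _).
    rewrite (bigD1 i)//= [in RHS](bigD1 i)//= addrA; congr (_ + _).
      by rewrite !mxE !eqxx /=; ring.
    apply: eq_bigr => j ji; congr (_ * _).
    by rewrite !mxE (negbTE ji) andbF mulr0 add0r.
  have /is_derive_line0 h1 := hD i z.
  have h2 : is_derive (0 : R) (1 : R) (fun h : R => h * D i x + \sum_j (z - x) ord0 j * D j x)
      (D i x).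
    have h3 : is_derive (0 : R) (1 : R) (fun h : R => h * D i x) (D i x).
      have -> : (fun h : R => h * D i x) = D i x *: (id : R -> R).
        by apply/funext => h; rewrite /= mulrC.
      by apply: is_derive_eq; rewrite /GRing.scale/= mulr1.
    have h4 := is_deriveD h3 (is_derive_cst (\sum_j (z - x) ord0 j * D j x) (0 : R) (1 : R)).
    by apply: (is_derive_eq h4); rewrite addr0.
  exact: is_deriveB h1 h2.
have := @box_lipschitz n F (fun i z => D i z - D i x) x `|y - x|
  (K * (n%:R * l1n (y - x))) (fun i z _ => FD i z) _ y (lexx _).
rewrite {2}/F subrr.
rewrite [X in _ - (_ - X)]big1 => [|i _]; last by rewrite mxE mul0r.
rewrite subr0 /F addrAC => h; rewrite expr2 !mulrA.
rewrite !mulrA in h; apply: h => i z zr.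
apply: (le_trans (hK _ _ _)); rewrite -mulrA ler_wpM2l//.
apply: (le_trans (l1n_le_norm _)); rewrite ler_wpM2l//.
exact: le_trans zr (norm_le_l1n _).
Qed.

Lemma lipschitz_continuous_at n (f : 'rV[R]_n -> R) x (d Q : R) : 0 < d -> 0 <= Q ->
  (forall y, `|y - x| <= d -> `|f y - f x| <= Q * l1n (y - x)) -> {for x, continuous f}.
Proof.
move=> d0 Q0 key; apply/(@cvgrPdist_le _ _ _ _ (nbhs_filter x)) => e e0.
have Qn : 0 < Q * n%:R + 1 by rewrite ltr_wpDl// mulr_ge0.
apply/nbhs_ballP; exists (Num.min d (e / (Q * n%:R + 1))).
  by rewrite /= lt_min d0 divr_gt0.
move=> y; rewrite -ball_normE /= distrC lt_min => /andP[/ltW yd /ltW ye].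
rewrite distrC; apply: (le_trans (key y yd)).
apply: (@le_trans _ _ ((Q * n%:R + 1) * `|y - x|)); last by rewrite mulrC -ler_pdivlMr.
apply: (@le_trans _ _ (Q * (n%:R * `|y - x|))).
  by rewrite ler_wpM2l// l1n_le_norm.
by rewrite mulrA ler_wpM2r// lerDl.
Qed.

Lemma is_derive_lin (c s : R) : is_derive s (1 : R) (fun t : R => c * t) c.
Proof.
have -> : (fun t : R => c * t) = c *: (id : R -> R) by [].
by apply: is_derive_eq; rewrite /GRing.scale/= mulr1.
Qed.

Lemma is_derive_rev (L s : R) : is_derive s (1 : R) (fun t : R => L - t) (-1).
Proof.
have h := is_deriveB (is_derive_cst L s 1) (is_derive_id s 1).
by apply: (is_derive_eq h); rewrite sub0r.
Qed.

End partials.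

(** * Smooth functions *)
Section smoothness.
Context {R : realType}.

(** [flat p] is t |-> p(1/t) exp(-1/t), extended by 0 to t <= 0; these functions
    are closed under differentiation. *)
Definition flat (p : {poly R}) (t : R) : R :=
  if 0 < t then p.[t^-1] * expR (- t^-1) else 0.

Definition flatD (p : {poly R}) : {poly R} := 'X^2 * (p - p^`()).

Lemma flat_bound (p : {poly R}) : exists2 C : R, 0 <= C &
  forall t, `|flat p t| <= C * `|t|.
Proof.
exists (\sum_(k < size p) `|p`_k| * (k.+1)`!%:R).
  by apply: sumr_ge0 => k _; rewrite mulr_ge0.
move=> t; rewrite /flat; case: ifPn => t0; last first.
  by rewrite normr0 mulr_ge0// sumr_ge0// => k _; rewrite mulr_ge0.
have s0 : 0 < t^-1 by rewrite invr_gt0.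
rewrite horner_coef mulr_suml; apply: (le_trans (ler_norm_sum _ _ _)).
rewrite mulr_suml; apply: ler_sum => k _.
rewrite -!mulrA normrM ler_wpM2l// expRN.
have e0 := expR_gt0 (t^-1).
have f0 : 0 < (k.+1)`!%:R :> R by rewrite ltr0n fact_gt0.
rewrite ger0_norm; last by rewrite mulr_ge0 ?exprn_ge0 ?invr_ge0// ltW.
rewrite (gtr0_norm t0) ler_pdivrMr//.
have := expR_ge1Dxn k (ltW s0).
set e := expR _; set f := (k.+1)`!%:R => h.
have h2 : t^-1 ^+ k.+1 / f <= e by lra.
rewrite ler_pdivrMr// in h2.
rewrite exprS -ler_pdivlMl// in h2; rewrite invrK in h2.
by rewrite (_ : f * t * e = t * (e * f))//; ring.
Qed.

Lemma is_derive_flat (p : {poly R}) (t : R) : is_derive t 1 (flat p) (flat (flatD p) t).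
Proof.
have [t0|t0|<-] := ltgtP 0 t.
- have tn0 : t != 0 by rewrite gt_eqF.
  have dV : is_derive t 1 (fun x : R => x^-1) (- t ^- 2).
    by apply: (is_derive_eq (is_deriveV _ _)) => //; rewrite /GRing.scale/= mulr1.
  have dP : is_derive (t^-1) 1 (horner p) (p^`()).[t^-1].
    rewrite derivE; rewrite derive1E; apply: derivableP; exact: derivable_horner.
  have h1 := is_derive1_comp dP dV.
  have h2 : is_derive t 1 (fun x : R => expR (- x^-1)) (expR (- t^-1) * (t ^- 2)).
    have dN : is_derive t 1 (fun x : R => - x^-1) (t ^- 2).
      by apply: (is_derive_eq (is_deriveN dV)); rewrite opprK.
    exact: (is_derive1_comp (is_derive_expR _) dN).
  apply: (is_derive_eq (near_eq_is_derive _ (is_deriveM h1 h2))).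
    near=> x; rewrite /flat ifT//; near: x.
    by apply: open_nbhs_nbhs; split => //; exact: open_gt.
  rewrite /flat t0 /flatD !hornerE /GRing.scale/= exprVn.
  by ring.
- apply: (is_derive_eq (near_eq_is_derive _ (is_derive_cst (0 : R) t (1 : R)))).
    near=> x; rewrite /flat ifF//; apply/negbTE; rewrite -leNgt ltW//; near: x.
    by apply: open_nbhs_nbhs; split => //; exact: open_lt.
  by rewrite /flat ltNge (ltW t0).
have [C C0 hC] := flat_bound ('X * p).
have lim0 : (fun h : R => h^-1 *: ((flat p \o shift 0) (h *: 1) - flat p 0)) @ 0^' --> (0 : R).
  have E : (fun h : R => h^-1 *: ((flat p \o shift 0) (h *: 1) - flat p 0)) =
      flat ('X * p).
    apply/funext => h /=; rewrite /flat ltxx subr0 addr0 /GRing.scale/= mulr1.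
    by case: ifP => _; rewrite ?mulr0// hornerM hornerX mulrA.
  rewrite E; apply/cvgrPdist_le => e e0; near=> h.
  rewrite sub0r normrN; apply: (le_trans (hC h)).
  have C1 : 0 < C + 1 by lra.
  apply: (@le_trans _ _ ((C + 1) * `|h|)); first by rewrite ler_wpM2r//; lra.
  rewrite -ler_pdivlMl//; near: h; apply: dnbhs0_le.
  by apply: mulr_gt0 => //; rewrite invr_gt0; lra.
rewrite {2}/flat ltxx; split.
  by apply/cvg_ex; exists 0.
exact: cvg_lim lim0.
Unshelve. all: by end_near. Qed.

Variable n : nat.
Notation V := 'rV[R]_n.

(** Functions whose smoothness is seen from their form: derivatives stay in the class, so
    that one continuity proof covers all orders. *)
Inductive Sm : (V -> R) -> Prop :=
| Sm_smooth f : smooth f -> Sm f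
| Sm_cst c : Sm (fun=> c)
| Sm_coord (i : 'I_n) : Sm (fun x => x ord0 i)
| Sm_add f g : Sm f -> Sm g -> Sm (fun x => f x + g x)
| Sm_mul f g : Sm f -> Sm g -> Sm (fun x => f x * g x)
| Sm_flat p f : Sm f -> Sm (fun x => flat p (f x)).

Lemma Sm_continuous f : Sm f -> continuous f.
Proof.
elim=> {f} [f /(_ [::])[] //|c|i|f g _ hf _ hg|f g _ hf _ hg|p f _ hf] x.
- exact: cst_continuous.
- exact: coord_continuous.
- exact: (cvgD (hf x) (hg x)).
- exact: (cvgM (hf x) (hg x)).
- apply: (@continuous_comp _ _ _ f (flat p)); first exact: hf.
  apply: differentiable_continuous; apply/derivable1_diffP.
  by case: (is_derive_flat p (f x)).
Qed.

Lemma Sm_derive f (i : 'I_n) : Sm f -> exists2 g, Sm g &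
  forall x, is_derive x (ed i) f (g x).
Proof.
elim=> {f} [f sf|c|j|f g _ [f' hf df] sg [g' hg dg]|f g sf [f' hf df] sg [g' hg dg]
   |p f sf [f' hf df]].
- exists (partial i f).
    apply: Sm_smooth => s; have := sf (rcons s i).
    by rewrite foldr_rcons.
  by move=> x; apply: derivableP; exact: (sf [::]).2.
- by exists (fun=> 0); [exact: Sm_cst|move=> x; exact: is_derive_cst].
- exists (fun=> (j == i)%:R); first exact: Sm_cst.
  move=> x; apply/is_derive_line0.
  under eq_fun do rewrite line_entry.
  case: eqP => _.
    have h4 := is_deriveD (is_derive_id (0 : R) (1 : R)) (is_derive_cst (x ord0 j) (0 : R) (1 : R)).
    by apply: (is_derive_eq h4); rewrite addr0.
  exact: is_derive_cst.
- exists (fun x => f' x + g' x); first exact: Sm_add.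
  by move=> x; apply: is_deriveD.
- exists (fun x => f x * g' x + g x * f' x).
    by apply: Sm_add; apply: Sm_mul.
  by move=> x; apply: is_deriveM.
- exists (fun x => flat (flatD p) (f x) * f' x).
    by apply: Sm_mul => //; apply: Sm_flat.
  move=> x; apply/is_derive_line0.
  have /is_derive_line0 h := df x.
  apply: (@is_derive1_comp _ (flat p) (fun h : R => f (h *: ed i + x)) 0) => //.
  by rewrite scale0r add0r; exact: is_derive_flat.
Qed.

Lemma Sm_partial f (i : 'I_n) : Sm f -> Sm (partial i f).
Proof.
move=> /(Sm_derive i)[g sg dg]; rewrite (_ : partial i f = g)//.
by apply/funext => x; apply: is_derive_partial.
Qed.

Lemma SmP f : Sm f -> smooth f.
Proof.
move=> sf s /=.
have {}sf : Sm (foldr (@partial R n) f s) by elim: s => //= i s; exact: Sm_partial.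
split; first exact: Sm_continuous.
by move=> i x; have [g _ /(_ x)[]] := Sm_derive i sf.
Qed.

Lemma smooth_is_derive (f : V -> R) i x : smooth f -> is_derive x (ed i) f (partial i f x).
Proof. by move=> sf; apply: derivableP; exact: (sf [::]).2. Qed.

Lemma smooth_partial (f : V -> R) i : smooth f -> smooth (partial i f).
Proof. by move=> sf; apply/SmP/Sm_partial/Sm_smooth. Qed.

Lemma smooth_continuous (f : V -> R) : smooth f -> continuous f.
Proof. by move=> /(_ [::])[]. Qed.

Lemma smoothM (f g : V -> R)  : smooth f -> smooth g -> smooth (fun x => f x * g x).
Proof. by move=> sf sg; apply/SmP/Sm_mul; exact: Sm_smooth. Qed.

Lemma partialM (f g : V -> R)  i x : smooth f -> smooth g ->
  partial i (fun x => f x * g x) x = f x * partial i g x + g x * partial i f x.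
Proof.
move=> sf sg; apply: is_derive_partial.
by apply: is_deriveM; exact: smooth_is_derive.
Qed.

Lemma dist_half (e u v w : R) :
  `|u - w| <= e / 2 -> `|v - w| <= e / 2 -> `|u - v| <= e.
Proof.
move=> h h'; rewrite [e]splitr -(subrKA w).
by apply: (le_trans (ler_normD _ _)); apply: lerD => //; rewrite distrC.
Qed.

(** By two applications of the mean value theorem, a second difference over a square of side
    s is s^2 times a value of either mixed derivative on the square. *)
Lemma partialC (f : V -> R) (i j : 'I_n) x : smooth f -> partial i (partial j f) x = partial j (partial i f) x.
Proof.
move=> sf.
have swap (s t : R) : s *: ed i + (t *: ed j + x) = t *: ed j + (s *: ed i + x).
  by rewrite addrCA.
have key (k l : 'I_n) (s : R) : 0 < s -> exists a b : R, [/\ 0 <= a <= s, 0 <= b <= s &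
    f (s *: ed k + (s *: ed l + x)) - f (s *: ed k + x) - f (s *: ed l + x) + f x
    = s * s * partial l (partial k f) (b *: ed l + (a *: ed k + x))].
  move=> s0.
  have d1 (y : R) : is_derive y (1 : R) (fun h : R => f (h *: ed k + (s *: ed l + x)) - f (h *: ed k + x))
     (partial k f (y *: ed k + (s *: ed l + x)) - partial k f (y *: ed k + x)).
    by apply: is_deriveB; apply/is_derive_line; exact: smooth_is_derive.
  have cont (g g' : R -> R) : (forall y : R, is_derive y (1 : R) g (g' y)) ->
      {within `[0, s], continuous g}.
    move=> dg; apply: continuous_subspaceT => y.
    by apply: differentiable_continuous; apply/derivable1_diffP; case: (dg y).
  have [a ha Ea] := MVT_segment (ltW s0) (fun y _ => d1 y) (cont _ _ d1).
  rewrite in_itv/= in ha.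
  have d2 (y : R) : is_derive y (1 : R) (fun h : R => partial k f (h *: ed l + (a *: ed k + x)))
     (partial l (partial k f) (y *: ed l + (a *: ed k + x))).
    by apply/is_derive_line; apply: smooth_is_derive; exact: smooth_partial.
  have [b hb Eb] := MVT_segment (ltW s0) (fun y _ => d2 y) (cont _ _ d2).
  rewrite in_itv/= in hb.
  exists a, b; split => //.
  move: Ea Eb; rewrite !scale0r !add0r !subr0 => Ea Eb.
  have -> : f (s *: ed k + (s *: ed l + x)) - f (s *: ed k + x) - f (s *: ed l + x) + f x
     = f (s *: ed k + (s *: ed l + x)) - f (s *: ed k + x) - (f (s *: ed l + x) - f x) by ring.
  rewrite Ea addrCA Eb; ring.
apply/eqP; rewrite -subr_eq0 -normr_le0; apply/ler_addgt0Pl => e e0; rewrite addr0.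
have e20 : 0 < e / 2 by rewrite divr_gt0.
have c1 : {for x, continuous (partial i (partial j f))}.
  by apply: smooth_continuous; do 2 apply: smooth_partial.
have c2 : {for x, continuous (partial j (partial i f))}.
  by apply: smooth_continuous; do 2 apply: smooth_partial.
move/cvgrPdist_le/(_ _ e20)/nbhs_ballP: c1 => [d1 /= d10 h1].
move/cvgrPdist_le/(_ _ e20)/nbhs_ballP: c2 => [d2 /= d20 h2].
have [s s0 s3] : exists2 s : R, 0 < s & s + s < Num.min d1 d2.
  have m0 : 0 < Num.min d1 d2 by rewrite lt_min d10.
  by exists (Num.min d1 d2 / 3); [rewrite divr_gt0|lra].
have [md1 md2] : Num.min d1 d2 <= d1 /\ Num.min d1 d2 <= d2.
  by rewrite !ge_min !lexx orbT.
have near_x (k l : 'I_n) (a b : R) : 0 <= a <= s -> 0 <= b <= s ->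
    `|x - (b *: ed l + (a *: ed k + x))| < Num.min d1 d2.
  move=> /andP[a0 as_] /andP[b0 bs].
  rewrite addrA opprD addrCA subrr addr0.
  apply: (le_lt_trans (norm_le_l1n _)); rewrite l1nN; apply: (le_lt_trans (l1nD _ _)).
  rewrite !l1nZ !l1n_ed !mulr1 !ger0_norm//.
  by lra.
have [a [b [ha hb E1]]] := key i j s s0.
have [a' [b' [ha' hb' E2]]] := key j i s s0.
have E : partial j (partial i f) (b *: ed j + (a *: ed i + x)) =
    partial i (partial j f) (b' *: ed i + (a' *: ed j + x)).
  have ss0 : s * s != 0 by rewrite mulf_neq0// gt_eqF.
  have cancel (u v w z X Y S : R) : S != 0 -> u - v - w + z = S * X ->
      u - w - v + z = S * Y -> X = Y.
    by move=> S0 h h'; apply: (mulfI S0); rewrite -h -h' addrAC [u - w - v]addrAC addrAC.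
  by rewrite -(swap s s) in E2; exact: cancel ss0 E1 E2.
have := h2 (b *: ed j + (a *: ed i + x)) _.
have := h1 (b' *: ed i + (a' *: ed j + x)) _.
rewrite -!ball_normE /= => H1 H2.
have {}H1 := H1 (lt_le_trans (near_x _ _ _ _ ha' hb') md1).
have {}H2 := H2 (lt_le_trans (near_x _ _ _ _ ha hb) md2).
rewrite -E in H1.
exact: dist_half H1 H2.
Qed.

Lemma test_fun_partial (U : set V) (f : V -> R) i : test_fun U f -> test_fun U (partial i f).
Proof.
move=> [sf [K [cK KU f0]]]; split; first exact: smooth_partial.
exists K; split => // x Kx; apply: is_derive_partial.
have Kcl : closed K by apply: compact_closed => //; exact: norm_hausdorff.
apply: (near_eq_is_derive _ (is_derive_cst (0 : R) x (ed i))).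
have : open (~` K) by exact: closed_openC.
move=> /(_ x Kx)/= nx; near=> y; rewrite f0//; near: y.
exact: nx.
Unshelve. all: by end_near. Qed.

Lemma test_fun_bounded (U : set V) (f : V -> R) : test_fun U f -> exists2 M, 0 <= M & forall x, `|f x| <= M.
Proof.
move=> [sf [K [cK KU f0]]].
have [[x0 Kx0]|K0] := pselect (K !=set0); last first.
  by exists 0 => // x; rewrite f0 ?normr0// => Kx; apply: K0; exists x.
have cf : {within K, continuous (fun x => `|f x|)}.
  apply: continuous_subspaceT => x.
  apply: (@continuous_comp _ _ _ f Num.norm); first exact: smooth_continuous.
  exact: norm_continuous.
have [c cK' hc] := compact_EVT_max (ex_intro _ x0 Kx0) cK cf.
exists `|f c| => // x; have [Kx|Kx] := pselect (K x); first by apply: hc; rewrite inE.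
by rewrite f0// normr0.
Qed.

Lemma test_fun_box (U : set V) (f : V -> R) : test_fun U f -> exists2 r, 0 < r &
  forall x, r < `|x| -> f x = 0.
Proof.
move=> [sf [K [cK KU f0]]].
have [M [Mr hM]] := compact_bounded cK.
exists (`|M| + 1); first by rewrite ltr_pwDr.
move=> x xr; apply: f0 => Kx.
have M1 : M < `|M| + 1 by rewrite (le_lt_trans (ler_norm _))// ltrDl.
by have := hM _ M1 x Kx; rewrite /= leNgt xr.
Qed.

Lemma test_funs_bounded (I : finType) (U : set V) (f : I -> V -> R) :
  (forall i, test_fun U (f i)) -> exists2 M, 0 <= M & forall i x, `|f i x| <= M.
Proof.
move=> tf; have /choice[K hK] : forall i, exists M, 0 <= M /\ forall x, `|f i x| <= M.
  by move=> i; have [M ? ?] := test_fun_bounded (tf i); exists M.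
exists (\sum_i K i); first by apply: sumr_ge0 => i _; case: (hK i).
move=> i x; rewrite (bigD1 i)//=; apply: (le_trans ((hK i).2 x)).
by rewrite lerDl sumr_ge0// => j _; case: (hK j).
Qed.

Lemma test_funs_box (I : finType) (U : set V) (f : I -> V -> R) :
  (forall i, test_fun U (f i)) -> exists2 r, 0 < r & forall i x, r < `|x| -> f i x = 0.
Proof.
move=> tf; have /choice[r hr] : forall i, exists r, 0 <= r /\ forall x, r < `|x| -> f i x = 0.
  by move=> i; have [r r0 h] := test_fun_box (tf i); exists r; split => //; exact: ltW.
exists (1 + \sum_i r i); first by rewrite ltr_pwDl// sumr_ge0// => i _; case: (hr i).
move=> i x hx; apply: (hr i).2; apply: le_lt_trans hx.
by rewrite (bigD1 i)//= addrCA lerDl addr_ge0// sumr_ge0// => j _; case: (hr j).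
Qed.

End smoothness.

Notation mu := (lebesgue_rV _).

(** * Measurability and supports *)
Section measurable_continuous.
Context {R : realType}.
Implicit Types n : nat.

Lemma open_rV_measurable n (U : set 'rV[R]_n) : open U -> measurable U.
Proof.
move=> oU.
pose Q (p : nat * {ffun 'I_n -> int}) : set 'rV[R]_n :=
  rV_box (fun i => `[(p.2 i)%:~R / p.1.+1%:R, (p.2 i + 1)%:~R / p.1.+1%:R]%classic).
have mQ p : measurable (Q p) by exact: measurable_box.
pose F p : set 'rV[R]_n := [set x | Q p `<=` U /\ Q p x].
have -> : U = \bigcup_p F p.
  apply/seteqP; split => [x Ux|x [p _] [QU /QU//]].
  move: (oU x Ux) => /nbhs_ballP[e /= e0 xe].
  pose k := Num.truncn (e^-1).
  have k0 : 0 < k.+1%:R :> R by [].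
  have ke : k.+1%:R^-1 < e.
    by rewrite -[e]invrK ltf_pV2 ?posrE ?invr_gt0//; exact: truncnS_gt.
  pose q : {ffun 'I_n -> int} := [ffun i => Num.floor (x ord0 i * k.+1%:R)].
  exists (k, q) => //; split; last first.
    move=> i /=; rewrite in_itv/= ffunE ler_pdivrMr// ler_pdivlMr//.
    by rewrite ge_floor ltW// floorD1_gt.
  move=> y Qy; apply: xe; rewrite -ball_normE /=.
  apply: (le_lt_trans _ ke); apply: mx_norm_le => [|i]; first by rewrite invr_ge0.
  have := Qy i; rewrite /= in_itv/= ffunE => /andP[y1 y2].
  have x1 : (Num.floor (x ord0 i * k.+1%:R))%:~R / k.+1%:R <= x ord0 i.
    by rewrite ler_pdivrMr// ge_floor.
  have x2 : x ord0 i <= (Num.floor (x ord0 i * k.+1%:R) + 1)%:~R / k.+1%:R.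
    by rewrite ler_pdivlMr// ltW// floorD1_gt.
  rewrite intrD mulrDl mul1r in x2 y2.
  have ar (u v w t : R) : w <= u -> u <= w + t -> w <= v -> v <= w + t -> `|u - v| <= t.
    by move=> *; rewrite ler_norml; apply/andP; split; lra.
  by rewrite !mxE; exact: ar x1 x2 y1 y2.
apply: countable_bigcupT_measurable => // p.
have [QU|QU] := pselect (Q p `<=` U).
  by rewrite (_ : F p = Q p)//; apply/seteqP; split => x // -[].
by rewrite (_ : F p = set0)//; apply/seteqP; split => x // -[].
Qed.

Lemma continuous_on_measurable n (U : set 'rV[R]_n) (f : 'rV[R]_n -> R) : open U ->
  (forall x, U x -> {for x, continuous f}) -> measurable_fun U f.
Proof.
move=> oU cf; apply: (@measurability _ _ _ _ U f (@RGenOInfty.G R) (RGenOInfty.measurableE R)).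
move=> _ [_ [a ->] <-]; apply: open_rV_measurable.
rewrite openE => x [Ux fx]; rewrite /= in_itv/= andbT in fx.
apply: filterI; first exact: oU.
have := cf x Ux; apply; apply: open_nbhs_nbhs; split; first exact: interval_open.
by rewrite /= in_itv/= andbT.
Qed.

Lemma continuous_mf n (f : 'rV[R]_n -> R) : continuous f -> mf f.
Proof. by move=> cf; apply: continuous_on_measurable => [|x _]; [exact: openT|exact: cf]. Qed.

Lemma smooth_mf n (f : 'rV[R]_n -> R) : smooth f -> mf f.
Proof. by move=> sf; apply: continuous_mf; exact: smooth_continuous. Qed.

Lemma cboxP n r (x : 'rV[R]_n) : 0 <= r -> cbox r x <-> `|x| <= r.
Proof.
move=> r0; split=> [h|h i /=].
  by apply: mx_norm_le => // i; have := h i; rewrite /= in_itv/= -ler_norml.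
by rewrite in_itv/= -ler_norml (le_trans (entry_le_mx_norm x i)).
Qed.

Lemma L1_indic n (A : set 'rV[R]_n) : measurable A -> (lebesgue_rV n A < +oo)%E ->
  L1 (lebesgue_rV n) (\1_A : _ -> R).
Proof.
move=> mA Aoo; apply/L1P; split; first exact: measurable_indic.
rewrite /n1; under eq_integral do rewrite ger0_norm//.
by rewrite integral_indic// setIT.
Qed.

Lemma L1_supp_bounded n (f : 'rV[R]_n -> R) (r K : R) : 0 <= r -> mf f ->
  (forall x, `|f x| <= K) -> (forall x, r < `|x| -> f x = 0) -> L1 (lebesgue_rV n) f.
Proof.
move=> r0 hf fK f0; apply: (@le_L1 _ _ _ _ _ (fun x => K * \1_(@cbox _ n r) x)) => //.
  move=> x; rewrite indicE; case: (leP `|x| r) => xr.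
    rewrite mem_set; last exact/cboxP.
    by rewrite mulr1; apply: le_trans (fK x) (ler_norm _).
  by rewrite (f0 x xr) normr0.
apply: L1Z; apply: L1_indic; [exact: measurable_cbox|exact: cbox_measure].
Qed.

Lemma L1_test n U (f : 'rV[R]_n -> R) : test_fun U f -> L1 (lebesgue_rV n) f.
Proof.
move=> tf; have [M _ hM] := test_fun_bounded tf; have [r r0 hr] := test_fun_box tf.
by apply: (L1_supp_bounded (ltW r0) _ hM hr); apply: smooth_mf; case: tf.
Qed.

Lemma Rint_affine n (c : R) h (f : 'rV[R]_n -> R) : c != 0 -> L1 (lebesgue_rV n) f ->
  \int[lebesgue_rV n]_x f (affine c h x) = `|c| ^- n * \int[lebesgue_rV n]_x f x.
Proof.
move=> c0 hf; rewrite /Rintegral (integral_affine h c0 hf) fineM//.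
exact: integrable_fin_num.
Qed.

Lemma L1_affine n (c : R) h (f : 'rV[R]_n -> R) : c != 0 -> L1 (lebesgue_rV n) f ->
  L1 (lebesgue_rV n) (fun x => f (affine c h x)).
Proof. by move=> c0 hf; exact: (integrable_affine h c0 hf). Qed.

Lemma mf_affine n (c : R) h (f : 'rV[R]_n -> R) : mf f -> mf (fun x => f (affine c h x)).
Proof. by move=> m; apply: measurableT_comp => //; exact: measurable_rV_affine. Qed.

Lemma n1_affine n (c : R) h (f : 'rV[R]_n -> R) : c != 0 -> mf f ->
  n1 (lebesgue_rV n) (fun x => f (affine c h x)) = ((`|c| ^- n)%:E * n1 (lebesgue_rV n) f)%E.
Proof.
move=> c0 hf; rewrite /n1 -(@ge0_integral_affine _ _ c h)//.
exact/mfE/mf_norm.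
Qed.

Lemma n2_affine n (c : R) h (f : 'rV[R]_n -> R) : c != 0 -> mf f ->
  n2 (lebesgue_rV n) (fun x => f (affine c h x)) = ((`|c| ^- n)%:E * n2 (lebesgue_rV n) f)%E.
Proof.
move=> c0 hf; rewrite /n2 -(@ge0_integral_affine _ _ c h)//.
  exact/mfE/mfX.
by move=> x; rewrite lee_fin sqr_ge0.
Qed.

(** The integral of a partial derivative vanishes, by translation invariance. *)
Lemma integral_partial_eq0 n (i : 'I_n) (f D : 'rV[R]_n -> R) (r K : R) :
  0 <= r -> mf f -> mf D ->
  (forall x, is_derive x (ed i) f (D x)) -> (forall x, `|D x| <= K) ->
  (forall x, `|f x| <= K) -> (forall x, r < `|x| -> f x = 0) ->
  \int[lebesgue_rV n]_x D x = 0.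
Proof.
move=> r0 hf mD fD DK fK f0.
pose s (k : nat) : R := k.+1%:R^-1.
have s0 k : 0 < s k by rewrite invr_gt0.
pose q k x := (s k)^-1 * (f (affine 1 (s k *: ed i) x) - f x).
have Lf : L1 (lebesgue_rV n) f by exact: L1_supp_bounded fK f0.
have Lfa k : L1 (lebesgue_rV n) (fun x => f (affine 1 (s k *: ed i) x)).
  by apply: L1_affine => //; exact: oner_neq0.
have q0 k : \int[lebesgue_rV n]_x q k x = 0.
  rewrite RintZ; last exact: L1B.
  rewrite RintB// Rint_affine ?oner_neq0// normr1 expr1n invr1 mul1r subrr.
  by rewrite mulr0.
have affE k x : affine 1 (s k *: ed i) x = s k *: ed i + x.
  by rewrite /affine scale1r addrC.
have q_le k x : `|q k x| <= K * \1_(@cbox _ n (r + 1)) x.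
  have [xr|xr] := leP `|x| (r + 1).
    rewrite indicE mem_set; last by apply/cboxP => //; lra.
    rewrite mulr1 /q normrM gtr0_norm ?invr_gt0// ler_pdivrMl// mulrC affE.
    have := @mvt_bound _ (fun h => f (h *: ed i + x)) (fun h => D (h *: ed i + x)) 0 (s k) K.
    rewrite scale0r add0r subr0 [X in K * X]gtr0_norm//; apply => t _ //.
    by apply/is_derive_line.
  rewrite indicE memNset ?mulr0; last by move/(cboxP _ (addr_ge0 r0 ler01)); rewrite leNgt xr.
  rewrite /q affE (f0 x); last by apply: lt_trans xr; rewrite ltrDl.
  rewrite f0 ?subrr ?mulr0 ?normr0//.
  have : `|x| <= `|s k *: ed i + x| + `|s k *: ed i|.
    by rewrite -[X in `|X| <= _](addKr (s k *: ed i)) addrC (le_trans (ler_normD _ _))// normrN addrC.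
  have : `|s k *: ed i| <= 1.
    apply: (le_trans (norm_le_l1n _)); rewrite l1nZ l1n_ed mulr1 gtr0_norm//.
    by rewrite invf_le1// ler1n.
  by move: xr; lra.
have s_cvg : s @ \oo --> (0 : R) by exact: cvg_harmonic.
have qD x : (fun k => q k x) @ \oo --> D x.
  have /is_derive_line0[dx <-] := fD x.
  have := dx; rewrite /derivable => /cvg_lim/= dxE.
  have {}dx : (fun h : R => h^-1 *: (((fun h0 : R => f (h0 *: ed i + x)) \o shift 0) (h *: 1)
     - f (0 *: ed i + x))) @ 0^' --> 'D_1 (fun h : R => f (h *: ed i + x)) 0 by exact: dx.
  have /cvgr_dnbhsP/(_ s (conj (fun k => _) s_cvg)) := dx.
  move=> /(_ (fun k => lt0r_neq0 (s0 k))) H.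
  apply: cvg_trans H; apply: near_eq_cvg; near=> k.
  have sA : (s k)%:A = s k :> R by rewrite /GRing.scale/= mulr1.
  by rewrite /q affE sA /= addr0 scale0r add0r.
have iK : (lebesgue_rV n).-integrable setT (EFin \o (fun x => K * \1_(@cbox _ n (r + 1)) x)).
  by apply: L1Z; apply: L1_indic; [exact: measurable_cbox|exact: cbox_measure].
have [||||_ _] := @dominated_convergence _ _ _ (lebesgue_rV n) setT measurableT
   (fun k x => (q k x)%:E) (fun x => (D x)%:E) _ _ _ _ iK _.
- by move=> k; apply/mfE/mfZ/mfB => //; exact: mf_affine.
- exact/mfE.
- by apply: aeW => x _; apply: cvg_EFin => //; [exact: nearW|exact: qD].
- by apply: aeW => x k _; rewrite lee_fin.
move=> H.
have E : (fun k => \int[lebesgue_rV n]_x (q k x)%:E)%E = (fun=> 0%E).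
  apply/funext => k; have := q0 k; rewrite /Rintegral => h.
  rewrite -[LHS]fineK ?h//; apply: integrable_fin_num => //.
  by apply: L1Z; apply: L1B.
rewrite /Rintegral; rewrite E in H.
by have := cvg_lim (@ereal_hausdorff R) H; rewrite lim_cst// => <-.
Unshelve. all: by end_near. Qed.

End measurable_continuous.

(** * Continuity of dilations and translations in mean *)
Section affine_continuity.
Context {R : realType} (n : nat).
Notation V := 'rV[R]_n.
Notation mu := (lebesgue_rV n).

Lemma flat1_gt0 (t : R) : 0 < t -> 0 < flat 1 t.
Proof. by move=> t0; rewrite /flat t0 hornerC mul1r expR_gt0. Qed.

Lemma flat1_le0 (t : R) : t <= 0 -> flat 1 t = 0.
Proof. by move=> t0; rewrite /flat ltNge t0. Qed.

Lemma flat1_ge0 (t : R) : 0 <= flat 1 t.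
Proof. by have [/flat1_gt0/ltW|/flat1_le0->] := ltP 0 t. Qed.

Lemma flat1_le1 (t : R) : flat 1 t <= 1.
Proof.
rewrite /flat; case: ifP => // t0; rewrite hornerC mul1r -expR0 ler_expR oppr_le0.
by rewrite invr_ge0 ltW.
Qed.

Definition boxfn (m : R) (a b : 'I_n -> R) (x : V) : R :=
  \prod_i (flat 1 (m * (x ord0 i - a i)) * flat 1 (m * (b i - x ord0 i))).

Lemma Sm_prod (s : seq 'I_n) (F : 'I_n -> V -> R) : (forall i, Sm (F i)) ->
  Sm (fun x => \prod_(i <- s) F i x).
Proof.
move=> sF; elim: s => [|i s IH].
  by under eq_fun do rewrite big_nil; exact: Sm_cst.
by under eq_fun do rewrite big_cons; exact: Sm_mul.
Qed.

Lemma Sm_sum (s : seq 'I_n) (F : 'I_n -> V -> R) : (forall i, Sm (F i)) ->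
  Sm (fun x => \sum_(i <- s) F i x).
Proof.
move=> sF; elim: s => [|i s IH].
  by under eq_fun do rewrite big_nil; exact: Sm_cst.
by under eq_fun do rewrite big_cons; exact: Sm_add.
Qed.

Lemma Sm_boxfn m a b : Sm (boxfn m a b).
Proof.
apply: Sm_prod => i; apply: Sm_mul; apply: Sm_flat.
  apply: Sm_mul; first exact: Sm_cst.
  by apply: Sm_add; [exact: Sm_coord|exact: Sm_cst].
apply: Sm_mul; first exact: Sm_cst.
apply: Sm_add; first exact: Sm_cst.
have -> : (fun x : V => - x ord0 i) = fun x : V => (-1) * x ord0 i.
  by apply/funext => x; rewrite mulN1r.
by apply: Sm_mul; [exact: Sm_cst|exact: Sm_coord].
Qed.

Lemma boxfn_ge0 m a b x : 0 <= boxfn m a b x.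
Proof. by apply: prodr_ge0 => i _; rewrite mulr_ge0// flat1_ge0. Qed.

Lemma boxfn_le1 m a b x : boxfn m a b x <= 1.
Proof.
apply: prodr_ile1 => i _.
by rewrite mulr_ge0 ?flat1_ge0// mulr_ile1// ?flat1_ge0// flat1_le1.
Qed.

Definition obox (a b : 'I_n -> R) : set V := rV_box (fun i => `]a i, b i[%classic).

Lemma boxfn_out m a b x : 0 < m -> ~ obox a b x -> boxfn m a b x = 0.
Proof.
move=> m0 /existsNP[i /negP]; rewrite in_itv/= negb_and -!leNgt => h.
rewrite /boxfn (bigD1 i)//=; case/orP: h => h.
  have h1 : m * (x ord0 i - a i) <= 0 by rewrite pmulr_rle0// subr_le0.
  by rewrite (flat1_le0 h1) !mul0r.
have h1 : m * (b i - x ord0 i) <= 0 by rewrite pmulr_rle0// subr_le0.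
by rewrite (flat1_le0 h1) mulr0 mul0r.
Qed.

Lemma compact_seg (a b : 'I_n -> R) :
  compact (rV_box (fun i => `[a i, b i]%classic) : set V).
Proof. by apply: rV_compact => i; exact: segment_compact. Qed.

Lemma test_boxfn m a b : 0 < m -> test_fun setT (boxfn m a b).
Proof.
move=> m0; split; first by apply: SmP; exact: Sm_boxfn.
exists (rV_box (fun i => `[a i, b i]%classic)); split => //; first exact: compact_seg.
move=> x nx; apply: boxfn_out => // ox; apply: nx => i.
by have := ox i; rewrite /= !in_itv/= => /andP[h1 h2]; rewrite !ltW.
Qed.

Lemma boxfn_cvg a b x : (fun k : nat => boxfn k.+1%:R a b x) @ \oo --> (\1_(obox a b) x : R).
Proof.
have [ox|ox] := pselect (obox a b x); last first.
  rewrite indicE memNset//; under eq_fun do rewrite boxfn_out//.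
  exact: cvg_cst.
rewrite indicE mem_set//.
have fl (t : R) : 0 < t -> (fun k : nat => flat 1 (k.+1%:R * t)) @ \oo --> (1 : R).
  move=> t0.
  have -> : (fun k : nat => flat 1 (k.+1%:R * t)) = (fun k : nat => expR (- (k.+1%:R^-1 * t^-1))).
    by apply/funext => k; rewrite /flat mulr_gt0// hornerC mul1r invfM.
  rewrite -[X in _ --> X]expR0.
  have h0 : (fun k : nat => - (k.+1%:R^-1 * t^-1)) @ \oo --> (- (0 * t^-1) : R).
    by apply: cvgN; apply: cvgMl; exact: cvg_harmonic.
  rewrite mul0r oppr0 in h0.
  by apply: continuous_cvg => //; exact: continuous_expR.
have E1 : \prod_(i < n) (1 * 1) = 1 :> R by rewrite big1// => i _; rewrite mul1r.
suff : (fun k : nat => boxfn k.+1%:R a b x) @ \oo --> (\prod_(i < n) (1 * 1) : R).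
  by rewrite E1.
rewrite /boxfn /=.
have H (i : 'I_n) : (fun k : nat => flat 1 (k.+1%:R * (x ord0 i - a i)) *
     flat 1 (k.+1%:R * (b i - x ord0 i))) @ \oo --> (1 * 1 : R).
  by have := ox i; rewrite /= in_itv/= => /andP[h1 h2]; apply: cvgM; apply: fl; rewrite subr_gt0.
elim: (index_enum _) => [|i s IH].
  by under eq_fun do rewrite big_nil; rewrite big_nil; exact: cvg_cst.
under eq_fun do rewrite big_cons; rewrite big_cons.
by apply: cvgM.
Qed.

Definition mean_cont (f : V -> R) := forall e : R, 0 < e -> exists2 d : R, 0 < d &
  forall c (h : V), `|c - 1| < d -> `|h| < d ->
    (n1 mu (fun x => f (affine c h x) - f x)%R <= e%:E)%E.

Lemma near1_pow (c : R) : `|c - 1| < 1 / 2 -> c != 0 /\ `|c| ^- n <= 2 ^+ n.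
Proof.
rewrite ltr_norml => /andP[c1 c2]; have c0 : 1 / 2 < c by lra.
have cp : 0 < c by lra.
split; first by rewrite gt_eqF.
rewrite -exprVn lerXn2r// ?nnegrE// ?invr_ge0// gtr0_norm//.
by rewrite -[2]invrK lef_pV2 ?posrE ?invr_gt0//; lra.
Qed.

Lemma mean_cont_closure (f : V -> R) : mf f ->
  (forall e : R, 0 < e -> exists g, [/\ mf g, mean_cont g &
     (n1 mu (fun x => f x - g x)%R <= e%:E)%E]) -> mean_cont f.
Proof.
move=> hf app e e0.
pose N : R := 2 ^+ n + 1.
have N0 : 0 < N by rewrite /N ltr_pwDr// exprn_ge0.
have e1 : 0 < e / (2 * N) by rewrite divr_gt0// mulr_gt0.
have e2 : 0 < e / 2 by rewrite divr_gt0.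
have [g [hg cg fg]] := app _ e1.
have [d d0 hd] := cg _ e2.
exists (Num.min d (1 / 2)); first by rewrite lt_min d0 /=; lra.
move=> c h; rewrite !lt_min => /andP[cd c2] /andP[hd' _].
have [c0 cN] := near1_pow c2.
pose u x := f x - g x.
have mu_ : mf u by exact: mfB.
have mua : mf (fun x => u (affine c h x)) by exact: mf_affine.
have mga : mf (fun x => g (affine c h x) - g x) by apply: mfB => //; exact: mf_affine.
have -> : (fun x => f (affine c h x) - f x) =
    (fun x => (u (affine c h x) - u x) + (g (affine c h x) - g x)).
  by apply/funext => x; rewrite /u; ring.
apply: (le_trans (n1D _ _ _)) => //; first exact: mfB.
rewrite [e]splitr EFinD; apply: leeD; last exact: hd.
apply: (le_trans (n1B _ _ _)) => //.
rewrite n1_affine//.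
apply: (@le_trans _ _ ((2 ^+ n)%:E * n1 mu u + n1 mu u)%E).
  by apply: leeD2r; apply: lee_wpmul2r; [exact: n1_ge0|rewrite lee_fin].
rewrite -[X in (_ + X)%E]mul1e -ge0_muleDl ?lee_fin ?exprn_ge0// -EFinD.
apply: (le_trans (lee_wpmul2l _ fg)); first by rewrite lee_fin ltW.
rewrite -EFinM lee_fin -/N; apply: le_of_eq.
by field; rewrite gt_eqF.
Qed.

Lemma mean_cont_lim (f : V -> R) (u : nat -> V -> R) (h : V -> R) : mf f ->
  (forall k, mf (u k)) -> (forall k, mean_cont (u k)) -> L1 mu h ->
  (forall x, (fun k => u k x) @ \oo --> f x) -> (forall k x, `|u k x| <= h x) -> mean_cont f.
Proof.
move=> hf mu_ cu Lh uf uh; apply: mean_cont_closure => // e e0.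
have ae : {ae mu, forall x, (fun k => u k x) @ \oo --> f x} by apply: aeW.
have [N hN] := dominated_to0 mu_ hf Lh ae uh e0.
exists (u N); split => //; apply: le_trans (hN N (leqnn N)); apply: le_of_eq.
by apply: eq_integral => x _; rewrite distrC.
Qed.

Lemma mean_contD (f g : V -> R) : mf f -> mf g -> mean_cont f -> mean_cont g ->
  mean_cont (fun x => f x + g x).
Proof.
move=> hf hg cf cg e e0; have e2 : 0 < e / 2 by rewrite divr_gt0.
have [d d0 hd] := cf _ e2; have [d' d'0 hd'] := cg _ e2.
exists (Num.min d d'); first by rewrite lt_min d0.
move=> c h; rewrite !lt_min => /andP[c1 c2] /andP[h1 h2].
have -> : (fun x => f (affine c h x) + g (affine c h x) - (f x + g x)) =
    (fun x => (f (affine c h x) - f x) + (g (affine c h x) - g x)).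
  by apply/funext => x; ring.
apply: (le_trans (n1D _ _ _)) => //; try by apply: mfB => //; exact: mf_affine.
by rewrite [e]splitr EFinD; apply: leeD; [exact: hd|exact: hd'].
Qed.

Lemma mean_contZ (a : R) (f : V -> R) : mf f -> mean_cont f ->
  mean_cont (fun x => a * f x).
Proof.
move=> hf cf e e0.
have a0 : 0 < `|a| + 1 by rewrite ltr_pwDr.
have [d d0 hd] := cf _ (divr_gt0 e0 a0).
exists d => // c h c1 h1.
have -> : (fun x => a * f (affine c h x) - a * f x) =
    (fun x => a * (f (affine c h x) - f x)) by apply/funext => x; ring.
rewrite n1Z; last by apply: mfB => //; exact: mf_affine.
apply: (le_trans (lee_wpmul2l _ (hd c h c1 h1))); first by rewrite lee_fin.
rewrite -EFinM lee_fin mulrA ler_pdivrMr// mulrC ler_wpM2l//; first exact: ltW.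
by lra.
Qed.

Lemma mean_cont_test U (f : V -> R) : test_fun U f -> mean_cont f.
Proof.
move=> tf e e0; have [sf _] := tf.
have [r r0 hr] := test_fun_box tf.
have [M M0 hM] := test_funs_bounded (fun i => test_fun_partial i tf).
have lip := @lipschitz_partial R n f (fun i => partial i f) M
   (fun i y => smooth_is_derive i y sf) hM.
pose r' := 2 * (r + 1).
have [m0 moo] : (0 <= mu (@cbox _ n r') /\ mu (@cbox _ n r') < +oo)%E.
  by split => //; exact: cbox_measure.
pose m := fine (mu (@cbox _ n r')).
have mE : mu (@cbox _ n r') = m%:E by rewrite fineK// ge0_fin_numE.
have mm0 : 0 <= m by rewrite fine_ge0.
pose Q : R := M * n%:R * (r' + 1) * m + 1.
have Q0 : 0 < Q by rewrite ltr_pwDr// !mulr_ge0//; rewrite /r'; lra.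
exists (Num.min (1/2) (e / Q)); first by rewrite lt_min !divr_gt0.
move=> c h; rewrite !lt_min => /andP[c1 c2] /andP[h1 h2].
apply: (@le_trans _ _ (n1 mu (fun x => M * n%:R * (r' + 1) * (e / Q) * \1_(@cbox _ n r') x))).
  apply: le_n1.
  - by apply: mfB; [apply: mf_affine|]; exact: smooth_mf.
  - by apply: mfZ; exact: measurable_indic (measurable_cbox _).
  - move=> x; have [xr|xr] := leP `|x| r'.
      rewrite indicE mem_set; last by apply/cboxP => //; rewrite /r'; lra.
      rewrite mulr1; apply: (le_trans (lip _ _)).
      apply: le_trans (ler_norm _); rewrite -!mulrA ler_wpM2l//.
      apply: (le_trans (l1n_le_norm _)); rewrite ler_wpM2l//.
      rewrite /affine addrAC -[X in _ - X + _]scale1r -scalerBl.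
      apply: (le_trans (ler_normD _ _)); rewrite normrZ mulrDl mul1r.
      apply: lerD; last exact: ltW.
      by rewrite mulrC; apply: ler_pM => //; exact: ltW.
    have -> : f x = 0 by apply: hr; rewrite /r' in xr; lra.
    have -> : f (affine c h x) = 0.
      apply: hr; rewrite /affine.
      have : `|c *: x| <= `|c *: x + h| + `|h|.
        by rewrite -[X in `|X| <= _](addrK h) (le_trans (ler_normB _ _)).
      have : `|x| / 2 <= `|c *: x|.
        rewrite normrZ mulrC ler_wpM2r//; move: c1; rewrite ltr_norml => /andP[? ?].
        by apply: le_trans (ler_norm _); lra.
      by rewrite /r' in xr; lra.
    by rewrite subrr normr0.
rewrite n1Z; last exact: measurable_indic (measurable_cbox _).
rewrite /n1; under eq_integral do rewrite ger0_norm//.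
rewrite integral_indic//; last exact: measurable_cbox.
rewrite setIT mE -EFinM lee_fin ger0_norm; last first.
  have r1 : 0 <= r' + 1 by rewrite /r'; lra.
  by rewrite mulr_ge0 ?divr_ge0 ?(ltW e0) ?(ltW Q0)// !mulr_ge0.
rewrite mulrAC mulrA ler_pdivrMr// mulrC ler_wpM2l//; first exact: ltW.
by rewrite /Q; lra.
Qed.

Lemma obox_mf (a b : 'I_n -> R) : mf (\1_(obox a b) : V -> R).
Proof. by apply: measurable_indic; exact: measurable_box. Qed.

Lemma mean_cont_obox (a b : 'I_n -> R) : mean_cont (\1_(obox a b) : V -> R).
Proof.
pose r := \sum_i (`|a i| + `|b i|).
have r0 : 0 <= r by apply: sumr_ge0 => i _; rewrite addr_ge0.
have or x : obox a b x -> cbox r x.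
  move=> ox; apply/cboxP => //; apply: mx_norm_le => // i.
  have := ox i; rewrite /= in_itv/= => /andP[h1 h2].
  rewrite /r (bigD1 i)//=.
  have : 0 <= \sum_(j < n | j != i) (`|a j| + `|b j|) by apply: sumr_ge0 => j _; rewrite addr_ge0.
  have := ler_norm (b i); have := ler_norm (- a i); rewrite normrN.
  have := normr_ge0 (a i); have := normr_ge0 (b i).
  by rewrite ler_norml => *; apply/andP; split; lra.
apply: (@mean_cont_lim _ (fun k => boxfn k.+1%:R a b) (\1_(@cbox _ n r))).
- exact: obox_mf.
- by move=> k; apply: smooth_mf; apply: SmP; exact: Sm_boxfn.
- by move=> k; apply: (@mean_cont_test setT); exact: test_boxfn.
- by apply: L1_indic; [exact: measurable_cbox|exact: cbox_measure].
- exact: boxfn_cvg.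
move=> k x; rewrite ger0_norm ?boxfn_ge0// indicE.
have [ox|ox] := pselect (obox a b x); last by rewrite boxfn_out.
by rewrite mem_set ?boxfn_le1//; exact: or.
Qed.

End affine_continuity.

Import HBSimple.

Lemma Rint_EFin d (T : measurableType d) (R : realType)
    (mu : {measure set T -> \bar R}) (f : T -> R) : L1 mu f ->
  (\int[mu]_x (f x)%:E = (\int[mu]_x f x)%:E)%E.
Proof. by move=> Lf; rewrite /Rintegral fineK//; exact: integrable_fin_num. Qed.

Section mean_continuity.
Context {R : realType} (n : nat).
Notation V := 'rV[R]_n.
Notation mu := (lebesgue_rV n).

Definition oboxes : set (set V) := [set X | exists a b, X = obox a b].

Lemma measurable_oboxE : @measurable _ V = <<s oboxes >>.
Proof.
apply/seteqP; split; last first.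
  apply: smallest_sub; first exact: sigma_algebra_measurable.
  by move=> X [a [b ->]]; exact: measurable_box.
apply: smallest_sub; first exact: smallest_sigma_algebra.
move=> X; rewrite -bigcup_seq => -[i _ [C mC <-]].
pose T := g_sigma_algebraType oboxes.
have mc : @measurable_fun _ _ T R setT (fun x : V => x ord0 i).
  apply: (@measurability _ _ T _ setT _ (@RGenOInfty.G R) (RGenOInfty.measurableE R)).
  move=> _ [_ [a ->] <-]; rewrite setTI.
  have -> : (fun x : V => x ord0 i) @^-1` `]a, +oo[ =
      \bigcup_k obox (fun j => if j == i then a else - k%:R) (fun=> k%:R).
    apply/seteqP; split => x /=.
      rewrite in_itv/= andbT => ax.
      have [K hK] : exists K : nat, forall j, `|x ord0 j| < K%:R.
        exists (\max_j Num.truncn `|x ord0 j|).+1 => j.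
        rewrite (lt_le_trans (truncnS_gt _))// ler_nat ltnS.
        exact: (leq_bigmax j).
      exists K => // j /=; rewrite in_itv/=; have := hK j.
      rewrite ltr_norml => /andP[h1 h2].
      by case: eqP => [ji|_]; apply/andP; split => //; rewrite ji.
    by move=> [k _ /(_ i)] /=; rewrite !in_itv/= eqxx andbT => /andP[].
  apply: bigcupT_measurable => k; apply: sub_sigma_algebra.
  by exists (fun j => if j == i then a else - k%:R), (fun=> k%:R).
have := mc measurableT C mC.
by [].
Qed.

Lemma oboxI (a b a' b' : 'I_n -> R) : obox a b `&` obox a' b' =
  obox (fun i => Num.max (a i) (a' i)) (fun i => Num.min (b i) (b' i)).
Proof.
apply/seteqP; split => x /=.
  move=> [h1 h2] i; have := h1 i; have := h2 i; rewrite /= !in_itv/=.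
  by rewrite gt_max lt_min => /andP[-> ->] /andP[-> ->].
move=> h; split=> i; have := h i; rewrite /= !in_itv/= gt_max lt_min => /andP[/andP[h1 h2] /andP[h3 h4]].
  by rewrite h1.
by rewrite h2.
Qed.

Definition ocube (k : nat) : set V := obox (fun=> - k%:R) (fun=> k%:R).

Lemma ocube_sub k : ocube k `<=` cbox k%:R.
Proof.
by move=> x ox i; have := ox i; rewrite /= !in_itv/= => /andP[h1 h2]; rewrite !ltW.
Qed.

Lemma measurable_ocube k : measurable (ocube k).
Proof. exact: measurable_box. Qed.

Lemma L1_ocube k (S : set V) : measurable S -> L1 mu (\1_(S `&` ocube k) : V -> R).
Proof.
move=> mS; apply: L1_indic; first by apply: measurableI => //; exact: measurable_ocube.
apply: (le_lt_trans _ (cbox_measure n k%:R)); apply: le_measure; rewrite ?inE.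
- by apply: measurableI => //; exact: measurable_ocube.
- exact: measurable_cbox.
- by apply: subIset; right; exact: ocube_sub.
Qed.

Lemma mean_cont_ext (f g : V -> R) : f =1 g -> mean_cont f -> mean_cont g.
Proof. by move=> /funext ->. Qed.

Lemma mean_cont_set (S : set V) : measurable S ->
  forall k, mean_cont (\1_(S `&` ocube k) : V -> R).
Proof.
move=> mS; have {mS} : <<s oboxes >> S by rewrite -measurable_oboxE.
move: S; apply: dynkin_induction.
- exact: measurable_oboxE.
- by move=> _ _ [a [b ->]] [a' [b' ->]]; rewrite oboxI; eexists; eexists.
- by move=> k; rewrite setTI; exact: mean_cont_obox.
- by move=> _ [a [b ->]] k; rewrite oboxI; exact: mean_cont_obox.
- move=> S mS PS k.
  have m1 : mf (\1_(S `&` ocube k) : V -> R) by apply: L1_mf (L1_ocube k mS).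
  have m2 : mf (\1_(ocube k) : V -> R) by exact: obox_mf.
  apply: (@mean_cont_ext (fun x => \1_(ocube k) x + (-1) * \1_(S `&` ocube k) x)).
    move=> x; rewrite !indicE !in_setI in_setC.
    by case: (x \in S); case: (x \in ocube k); rewrite /= ?mulr0 ?mulr1 ?addr0 ?subrr.
  apply: mean_contD => //; first exact: mfZ.
    exact: mean_cont_obox.
  exact: mean_contZ.
- move=> F mF tF PF k.
  pose U N := \bigcup_(i < N) F i.
  have mU N : measurable (U N) by apply: bigcup_measurable.
  have US N : U N.+1 = U N `|` F N by rewrite /U !bigcup_mkord big_ord_recr.
  have cU N : mean_cont (\1_(U N `&` ocube k) : V -> R).
    elim: N => [|N IH].
      apply: (@mean_cont_ext (fun x => 0 * \1_(ocube k) x)).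
        by move=> x; rewrite mul0r /U bigcup_mkord big_ord0 set0I indic0.
      by apply: mean_contZ; [exact: obox_mf|exact: mean_cont_obox].
    apply: (@mean_cont_ext (fun x => \1_(U N `&` ocube k) x + \1_(F N `&` ocube k) x)).
      move=> x; rewrite US !indicE !in_setI in_setU.
      case: (boolP (x \in U N)) => [|_]; last by rewrite /= add0r.
      rewrite inE => -[i /= iN Fi].
      case: (boolP (x \in F N)) => [|_]; last by rewrite /= addr0.
      rewrite inE => FN; have /= := tF i N I I; rewrite /setI => /(_ _) tt.
      have iN' : i = N by apply: tt; exists x.
      by rewrite iN' ltnn in iN.
    by apply: mean_contD => //; apply: L1_mf; exact: L1_ocube.
  have mUF : measurable (\bigcup_i F i) by exact: bigcupT_measurable.
  apply: (@mean_cont_lim _ _ _ (fun N => \1_(U N `&` ocube k)) (\1_(setT `&` ocube k))) => //.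
  + by apply: L1_mf; exact: L1_ocube.
  + by move=> N; apply: L1_mf; exact: L1_ocube.
  + exact: L1_ocube.
  + move=> x; apply: cvg_near_cst.
    have [[i _ Fi]|nF] := pselect ((\bigcup_i F i) x).
      exists i.+1 => // N /= iN; rewrite !indicE !in_setI.
      have h1 : x \in U N by rewrite inE; exists i.
      have h2 : x \in \bigcup_i F i by rewrite inE; exists i.
      by rewrite h1 h2.
    apply: nearW => N; rewrite !indicE !in_setI.
    have h1 : x \in U N = false.
      by apply/negbTE; rewrite notin_setE => -[i _ Fi]; apply: nF; exists i.
    have h2 : x \in \bigcup_i F i = false by apply/negbTE; rewrite notin_setE.
    by rewrite h1 h2.
  + move=> N x; rewrite ger0_norm// !indicE !in_setI in_setT /=.
    by case: (x \in U N); case: (x \in ocube k).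
Qed.

Lemma mean_cont_cut (f : V -> R) k : L1 mu f -> mean_cont (fun x => f x * \1_(ocube k) x).
Proof.
move=> Lf.
have mo : mf (\1_(ocube k) : V -> R) by exact: obox_mf.
apply: mean_cont_closure; first by apply: mfM => //; exact: (L1_mf Lf).
move=> e e0.
have [g [ig _ Hg]] := approximation_sfun_integrable measurableT Lf.
have [N hN] := cvg_to0 Hg e0.
exists (fun x : V => g N x * \1_(ocube k) x); split.
- by apply: mfM => //; exact: measurable_funPT.
- apply: (@mean_cont_ext (fun x => \sum_(y <- finmap.enum_fset (fset_set (range (g N))))
       y * \1_((g N @^-1` [set y]) `&` ocube k) x)).
    move=> x; rewrite fimfunE fsbig_finite//= mulr_suml; apply: eq_bigr => y _.
    by rewrite -mulrA; congr (_ * _); rewrite !indicE in_setI; case: (_ \in _); case: (_ \in _); rewrite /= ?mulr0 ?mulr1.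
  elim: (finmap.enum_fset _) => [|y s IH].
    apply: (@mean_cont_ext (fun x => 0 * \1_(ocube k) x)).
      by move=> x; rewrite mul0r big_nil.
    by apply: mean_contZ; [exact: mo|exact: mean_cont_obox].
  apply: (@mean_cont_ext (fun x => y * \1_((g N @^-1` [set y]) `&` ocube k) x +
    \sum_(j <- s) j * \1_((g N @^-1` [set j]) `&` ocube k) x)).
    by move=> x; rewrite big_cons.
  have mg z : mf (\1_((g N @^-1` [set z]) `&` ocube k) : V -> R).
    by apply: L1_mf; apply: L1_ocube.
  apply: mean_contD => //; first exact: mfZ.
    by apply: mf_sum => z; exact: mfZ.
  by apply: mean_contZ => //; exact: mean_cont_set.
- apply: le_trans (hN N (leqnn N)).
  have -> : (\int[mu]_z `|(EFin \o f) z - (g N z)%:E| = n1 mu (fun z => (f z - g N z)%R))%E by [].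
  apply: le_n1.
  + by apply: mfB; apply: mfM => //; [exact: (L1_mf Lf)|exact: measurable_funPT].
  + by apply: mfB => //; [exact: (L1_mf Lf)|exact: measurable_funPT].
  + move=> x; rewrite -mulrBl normrM indicE ler_piMr//.
    by rewrite ger0_norm// lern1; case: (_ \in _).
Qed.

(** Boxes are limits of smooth functions, measurable sets are reached from boxes by a Dynkin
    argument, and integrable functions are limits of simple ones. *)
Lemma mean_cont_L1 (f : V -> R) : L1 mu f -> mean_cont f.
Proof.
move=> Lf; have mo k : mf (\1_(ocube k) : V -> R) by exact: obox_mf.
apply: (@mean_cont_lim _ _ _ (fun k x => f x * \1_(ocube k) x) (fun x => `|f x|)).
- exact: (L1_mf Lf).
- by move=> k; apply: mfM => //; exact: (L1_mf Lf).
- by move=> k; exact: mean_cont_cut.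
- by apply: (le_L1 _ _ Lf) => [|x]; [exact: (mf_norm (L1_mf Lf))|rewrite normr_id].
- move=> x; apply: cvg_near_cst.
  have [K hK] : exists K : nat, `|x| < K%:R by exists (Num.truncn `|x|).+1; exact: truncnS_gt.
  exists K => // N /= KN; rewrite indicE mem_set ?mulr1// => i /=.
  rewrite in_itv/= -ltr_norml (le_lt_trans (entry_le_mx_norm x i))//.
  by rewrite (lt_le_trans hK)// ler_nat.
move=> k x; rewrite normrM indicE ler_piMr//.
by rewrite ger0_norm// lern1; case: (_ \in _).
Qed.

(** Mean-square continuity reduces to the mean continuity of [f |f|]. *)
Lemma sqr_dist_le (a b : R) : (a - b) ^+ 2 <= 2 * `|a * `|a| - b * `|b| |.
Proof.
wlog ab : a b / b <= a.
  move=> W; have [ba|/ltW ab] := leP b a; first exact: W.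
  by rewrite -sqrrN opprB distrC; exact: W.
have [a0|a0] := leP 0 a; have [b0|b0] := leP 0 b.
- rewrite (ger0_norm a0) (ger0_norm b0) ger0_norm.
    have h : 0 <= b * (a - b) by rewrite mulr_ge0// subr_ge0.
    have := sqr_ge0 (a - b); have := sqr_ge0 (a + b); nra.
  have h : 0 <= (a + b) * (a - b) by rewrite mulr_ge0 ?subr_ge0// addr_ge0.
  by nra.
- rewrite (ger0_norm a0) (ltr0_norm b0) ger0_norm.
    by have := sqr_ge0 (a + b); nra.
  by have := sqr_ge0 a; have := sqr_ge0 b; nra.
- by lra.
- rewrite (ltr0_norm a0) (ltr0_norm b0) ger0_norm.
    have h : 0 <= (- a) * (a - b) by rewrite mulr_ge0 ?subr_ge0// oppr_ge0 ltW.
    by have := sqr_ge0 (a - b); nra.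
  have h : 0 <= (- a - b) * (a - b) by rewrite mulr_ge0 ?subr_ge0//; lra.
  by nra.
Qed.

Lemma sqL_abs_L1 (f : V -> R) : sqL mu f -> L1 mu (fun x => f x * `|f x|).
Proof.
move=> hf; apply: sqLM => //; case: hf => m h; split; first exact: mf_norm.
apply: le_lt_trans h; apply: le_n2 => //; first exact: mf_norm.
by move=> x; rewrite normr_id.
Qed.

Lemma n2_le_abs (f g : V -> R) : mf f -> mf g ->
  (n2 mu (fun x => f x - g x)%R <=
   2%:E * n1 mu (fun x => f x * `|f x| - g x * `|g x|)%R)%E.
Proof.
move=> hf hg; rewrite /n1 -ge0_integralZl//; last 1 first.
  by apply: mfE; apply: mf_norm; apply: mfB; apply: mfM => //; exact: mf_norm.
apply: ge0_le_integral => //.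
- by move=> x _; rewrite lee_fin sqr_ge0.
- by apply: mfE; apply: mfX; exact: mfB.
- under eq_fun do rewrite -EFinM; apply: mfE; apply: mfZ; apply: mf_norm.
  by apply: mfB; apply: mfM => //; exact: mf_norm.
- by move=> x _; rewrite -EFinM lee_fin; exact: sqr_dist_le.
Qed.

Lemma mean_square_cont (f : V -> R) : sqL mu f ->
  forall e : R, 0 < e -> exists2 d : R, 0 < d &
  forall c (h : V), `|c - 1| < d -> `|h| < d ->
    (n2 mu (fun x => f (affine c h x) - f x)%R <= e%:E)%E.
Proof.
move=> hf e e0; have e2 : 0 < e / 2 by rewrite divr_gt0.
have [d d0 hd] := mean_cont_L1 (sqL_abs_L1 hf) e2; exists d => // c h c1 h1.
have m : mf f by case: hf.
apply: (le_trans (n2_le_abs _ _)) => //; first exact: mf_affine.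
apply: (le_trans (lee_wpmul2l _ (hd c h c1 h1))) => //.
by rewrite -EFinM lee_fin mulrC divfK.
Qed.

End mean_continuity.

(** * Mollification *)
Section mollifier.
Context {R : realType} (n : nat).
Notation V := 'rV[R]_n.
Notation mu := (lebesgue_rV n).

Lemma continuous_affine (f : V -> R) c (h : V) : continuous f ->
  continuous (fun y : V => f (c *: y + h)).
Proof.
move=> cf x.
apply: (@continuous_comp _ _ _ (fun y : V => c *: y + h) f x _ (cf _)).
have h1 : continuous (fun y : V => c *: y) by exact: scaler_continuous.
exact: (cvgD (h1 x) (@cvg_cst _ _ _ _ (nbhs_filter x))).
Qed.

Lemma partial_affine (f : V -> R) (c : R) (h : V) i y : smooth f ->
  is_derive y (ed i) (fun y => f (affine c h y)) (c * partial i f (affine c h y)).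
Proof.
move=> sf; apply/is_derive_line0.
have /is_derive_line0 dg := smooth_is_derive i (affine c h y) sf.
have E : (fun t : R => f (affine c h (t *: ed i + y))) =
    ((fun t : R => f (t *: ed i + affine c h y)) \o (fun t => c * t)).
  apply/funext => t /=; congr (f _).
  by rewrite /affine scalerDr scalerA addrA.
rewrite E mulrC; apply: is_derive1_comp; first by rewrite mulr0.
exact: is_derive_lin.
Qed.

Lemma smooth_affine (f : V -> R) (c : R) (h : V) : smooth f ->
  smooth (fun y => f (affine c h y)).
Proof.
move=> sf s /=.
have D (g : V -> R) (i : 'I_n) (k : R) y : smooth g ->
    is_derive y (ed i) (fun y => k * g (affine c h y)) (k * c * partial i g (affine c h y)).
  by move=> sg; rewrite -mulrA; apply: is_deriveZ; exact: partial_affine.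
have E t : foldr (@partial R n) (fun y => f (affine c h y)) t =
    fun y => c ^+ size t * foldr (@partial R n) f t (affine c h y).
  elim: t => [|i t IH]; first by apply/funext => y; rewrite expr0 mul1r.
  apply/funext => y /=; rewrite IH exprSr; apply: is_derive_partial.
  by apply: D; apply: SmP; elim: t {IH} => [|j t IH] /=; [exact: Sm_smooth|exact: Sm_partial].
rewrite E; have sg : smooth (foldr (@partial R n) f s).
  by apply: SmP; elim: s => [|j s IH] /=; [exact: Sm_smooth|exact: Sm_partial].
split; last by move=> i x; case: (D _ i (c ^+ size s) x sg).
set g := foldr _ f s.
have H : continuous (fun y : V => g (affine c h y)).
  have sc : continuous g by exact: smooth_continuous.
  exact: (continuous_affine sc).
move=> y; exact: (@cvgM _ _ _ (nbhs_filter y) _ _ _ _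
  (@cvg_cst _ _ _ _ (nbhs_filter y)) (H y)).
Qed.

Lemma test_affine (f : V -> R) (c : R) (h : V) : c != 0 -> test_fun setT f ->
  test_fun setT (fun y => f (affine c h y)).
Proof.
move=> c0 tf; have [sf _] := tf; split; first exact: smooth_affine.
have [r r0 hr] := test_fun_box tf.
have cn : 0 < `|c| by rewrite normr_gt0.
pose r' := (r + `|h|) / `|c|.
exists (rV_box (fun=> `[- r', r']%classic)); split => //; first exact: compact_seg.
have r'0 : 0 <= r' by rewrite divr_ge0// addr_ge0// ltW.
move=> x nx; apply: hr; rewrite ltNge; apply/negP => hx; apply: nx.
apply/cboxP => //; rewrite /r' ler_pdivlMr// mulrC -normrZ.
rewrite -[X in `|X| <= _](addrK h) (le_trans (ler_normB _ _))// lerD2r.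
exact: hx.
Qed.

Definition conv (th f : V -> R) (x : V) : R := \int[mu]_y (f y * th (x - y)).

Lemma affN1 (x y : V) : affine (-1) x y = x - y.
Proof. by rewrite /affine scaleN1r addrC. Qed.

Lemma test_reflect (th : V -> R) x : test_fun setT th -> test_fun setT (fun y => th (x - y)).
Proof.
move=> tt; have := @test_affine th (-1) x _ tt.
by under eq_fun do rewrite affN1; apply; rewrite oppr_eq0 oner_neq0.
Qed.

Lemma partial_reflect (th : V -> R) x i y : test_fun setT th ->
  partial i (fun y => th (x - y)) y = - partial i th (x - y).
Proof.
move=> [st _]; apply: is_derive_partial.
have := @partial_affine th (-1) x i y st.
by under eq_fun do rewrite affN1; rewrite mulN1r affN1.
Qed.

Section conv_theory.
Variables (th f : V -> R).
Hypotheses (tt : test_fun setT th) (Lf : L1 mu f).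

Lemma conv_L1 x : L1 mu (fun y => f y * th (x - y)).
Proof.
have [M M0 hM] := test_fun_bounded (test_reflect x tt).
under eq_fun do rewrite mulrC.
apply: (@L1Ml _ _ _ _ M) => //; apply: smooth_mf.
by have [] := test_reflect x tt.
Qed.

Lemma convE x : conv th f x = \int[mu]_y (f (x - y) * th y).
Proof.
have N1 : -1 != 0 :> R by rewrite oppr_eq0 oner_neq0.
have := Rint_affine x N1 (conv_L1 x).
rewrite normrN1 expr1n invr1 mul1r /conv => <-.
by apply: eq_Rintegral => y _; rewrite !affN1 subKr.
Qed.

Lemma conv_L1' x : L1 mu (fun y => f (x - y) * th y).
Proof.
have N1 : -1 != 0 :> R by rewrite oppr_eq0 oner_neq0.
have := L1_affine x N1 (conv_L1 x).
by under eq_fun do rewrite !affN1 subKr.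
Qed.

Lemma conv_le (M : R) x : (forall y, `|th y| <= M) ->
  (`|conv th f x|%:E <= M%:E * n1 mu f)%E.
Proof.
move=> hM; have M0 : 0 <= M by apply: le_trans (hM 0).
apply: (le_trans (le_norm_Rint (conv_L1 x))).
rewrite -[M]ger0_norm// -n1Z; last exact: (L1_mf Lf).
apply: le_n1; [exact: (L1_mf (conv_L1 x))|by apply: mfZ; exact: (L1_mf Lf)|].
by move=> y; rewrite !normrM mulrC (ger0_norm M0) ler_wpM2r.
Qed.

(** Differentiation under the integral sign. *)
Lemma conv_derive i x : is_derive x (ed i) (conv th f) (conv (partial i th) f x).
Proof.
apply/is_derive_line0.
have tp := test_fun_partial i tt.
have [M M0 hM] := test_fun_bounded tp.
pose F (h : R) (y : V) : R := f y * th ((h *: ed i + x) - y).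
have FD h y : is_derive h (1 : R) (F ^~ y) (f y * partial i th ((h *: ed i + x) - y)).
  have st : smooth th by case: tt.
  have h1 : is_derive h (1 : R) (fun t : R => th (t *: ed i + (x - y)))
     (partial i th (h *: ed i + (x - y))).
    by apply/is_derive_line; exact: smooth_is_derive.
  have -> : F ^~ y = f y *: (fun t : R => th (t *: ed i + (x - y))).
    by apply/funext => t; rewrite /F/= -addrA.
  by rewrite -addrA; exact: is_deriveZ.
have FI h : mu.-integrable setT (EFin \o F h) by exact: conv_L1.
have I0 : `]-1, 1[%classic (0 : R) by rewrite /= in_itv/= ltr01 ltrN10.
have GL : mu.-integrable setT (EFin \o (fun y => M * `|f y|)).
  by apply: L1Z; apply: (le_L1 _ _ Lf) => [|z]; [exact: (mf_norm (L1_mf Lf))|rewrite normr_id].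
have G0 y : 0 <= M * `|f y| by rewrite mulr_ge0.
have der h y : `]-1, 1[%classic h -> [set: V] y -> derivable (F ^~ y) h 1.
  by move=> _ _; case: (FD h y).
have bnd h y : `]-1, 1[%classic h -> [set: V] y -> `|partial1of2 F h y| <= M * `|f y|.
  move=> _ _; rewrite partial1of2E; have [_ ->] := FD h y.
  by rewrite normrM mulrC ler_wpM2r.
split.
  exact: (@derivable_under_integral _ _ _ _ F setT measurableT 0 (-1) 1 I0 (fun h _ => FI h)
    der _ G0 GL bnd).
have := @differentiation_under_integral _ _ _ _ F setT measurableT 0 (-1) 1 I0 (fun h _ => FI h)
    der _ G0 GL bnd.
rewrite derive1E => ->; apply: eq_Rintegral => y _.
rewrite partial1of2E; have [_ ->] := FD 0 y.
by rewrite scale0r add0r.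
Qed.

End conv_theory.

Lemma conv_smooth (th f : V -> R) : test_fun setT th -> L1 mu f -> smooth (conv th f).
Proof.
move=> tt Lf s /=.
have ts t : test_fun setT (foldr (@partial R n) th t).
  by elim: t => [|i t IH] //=; exact: test_fun_partial.
have -> : foldr (@partial R n) (conv th f) s = conv (foldr (@partial R n) th s) f.
  elim: s => [|i s IH] //=; rewrite IH; apply/funext => x.
  by apply: is_derive_partial; exact: conv_derive.
move: {s}(foldr _ _ _) (ts s) => {ts}{}th {}tt.
split; last by move=> i x; case: (conv_derive tt Lf i x).
have [N1 N1E] : exists N1 : R, n1 mu f = N1%:E.
  have /L1P[_ h] := Lf; exists (fine (n1 mu f)); rewrite fineK// ge0_fin_numE//.
  exact: n1_ge0.
have N10 : 0 <= N1 by rewrite -lee_fin -N1E n1_ge0.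
have [M M0 hM] := test_funs_bounded (fun i => test_fun_partial i tt).
have bound i y : `|conv (partial i th) f y| <= M * N1.
  by rewrite -lee_fin EFinM -N1E; apply: conv_le => //; exact: test_fun_partial.
have lip := @lipschitz_partial R n (conv th f) (fun i => conv (partial i th) f) (M * N1)
   (fun i y => conv_derive tt Lf i y) bound.
by move=> x; apply: (lipschitz_continuous_at ltr01 (mulr_ge0 M0 N10)) => y _; exact: lip.
Qed.

Lemma partial_conv (th f : V -> R) i x : test_fun setT th -> L1 mu f ->
  partial i (conv th f) x = conv (partial i th) f x.
Proof. by move=> tt Lf; apply: is_derive_partial; exact: conv_derive. Qed.

(** The kernel y |-> th (x - y) is a test function with partials - partial i th (x - y). *)
Lemma conv_weak (th f D : V -> R) i x : test_fun setT th -> L1 mu f -> L1 mu D ->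
  (forall phi, test_fun setT phi ->
     \int[mu]_y (f y * partial i phi y) = - \int[mu]_y (D y * phi y)) ->
  partial i (conv th f) x = conv th D x.
Proof.
move=> tt Lf LD /(_ _ (test_reflect x tt)) H; rewrite partial_conv//.
rewrite /conv -[RHS]opprK -H -RintN; last first.
  have -> : (fun y => f y * partial i (fun y => th (x - y)) y) =
     (fun y => - (f y * partial i th (x - y))).
    by apply/funext => y; rewrite partial_reflect// mulrN.
  by apply: L1N; apply: conv_L1 => //; exact: test_fun_partial.
by apply: eq_Rintegral => y _; rewrite partial_reflect// mulrN opprK.
Qed.

Definition bump0 (e : R) : V -> R := boxfn 1 (fun=> - e) (fun=> e).
Definition eta (e : R) : V -> R := fun x => (\int[mu]_y bump0 e y)^-1 * bump0 e x.

Lemma test_bump0 e : test_fun setT (bump0 e).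
Proof. exact: test_boxfn. Qed.

Lemma bump0_mass e : 0 < e -> 0 < \int[mu]_y bump0 e y.
Proof.
move=> e0.
have Lb : L1 mu (bump0 e) := L1_test (test_bump0 e).
rewrite lt0r Rintegral_ge0 ?andbT; last by move=> x _; exact: boxfn_ge0.
apply/eqP => I0.
have I0' : (\int[mu]_x (bump0 e x)%:E = 0)%E.
  by rewrite -[LHS]fineK -/(Rintegral _ _ _) ?I0//; exact: integrable_fin_num.
have mb : measurable_fun setT (EFin \o bump0 e) by exact: mfE (L1_mf Lb).
have /(ae_eq_integral_abs _ measurableT mb) : (\int[mu]_x `|(EFin \o bump0 e) x| = 0)%E.
  by rewrite -I0'; apply: eq_integral => x _; rewrite /= ger0_norm// boxfn_ge0.
move=> [Z [mZ Z0 subZ]].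
have : (mu (obox (fun _ : 'I_n => - e)%R (fun=> e)) <= 0)%E.
  rewrite -Z0; apply: le_measure; rewrite ?inE//; first exact: measurable_box.
  move=> x ox; apply: subZ => /= /(_ I) [] /eqP; rewrite gt_eqF//.
  apply: prodr_gt0 => i _; have := ox i; rewrite /= in_itv/= => /andP[h1 h2].
  by rewrite !mul1r mulr_gt0// flat1_gt0//; lra.
rewrite lebesgue_rV_box// (eq_bigr (fun=> (e + e)%:E)).
  by rewrite prodEFin prodr_const lee_fin leNgt exprn_gt0// addr_gt0.
move=> i _; rewrite lebesgue_measure_itv/= lte_fin ifT; last by lra.
by rewrite -EFinB opprK.
Qed.

Lemma test_eta e : test_fun setT (eta e).
Proof.
have [sb [K [cK KT b0]]] := test_bump0 e; split.
  by apply: SmP; apply: Sm_mul; [exact: Sm_cst|exact: Sm_smooth].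
by exists K; split => // x Kx; rewrite /eta b0 ?mulr0.
Qed.

Lemma eta_ge0 e x : 0 < e -> 0 <= eta e x.
Proof. by move=> e0; rewrite mulr_ge0 ?boxfn_ge0// invr_ge0 ltW// bump0_mass. Qed.

Lemma eta_mass e : 0 < e -> \int[mu]_y eta e y = 1.
Proof.
move=> e0; rewrite RintZ; last exact: L1_test (test_bump0 e).
by rewrite mulVf// gt_eqF// bump0_mass.
Qed.

Lemma eta_out e x : 0 < e -> e <= `|x| -> eta e x = 0.
Proof.
move=> e0 ex; rewrite /eta /bump0 boxfn_out ?mulr0// => ox.
have : `|x| < e.
  rewrite [`|x|]mx_normrE; apply/bigmax_ltP; split => // -[i j] _ /=.
  by rewrite (ord1 i) ltr_norml; have := ox j; rewrite /= in_itv.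
by rewrite ltNge ex.
Qed.

Definition moll (e : R) (f : V -> R) : V -> R := conv (eta e) f.

Lemma moll_smooth e f : L1 mu f -> smooth (moll e f).
Proof. by move=> Lf; apply: conv_smooth => //; exact: test_eta. Qed.

Lemma mollE e f x : L1 mu f -> moll e f x = \int[mu]_y (f (x - y) * eta e y).
Proof. by move=> Lf; rewrite /moll convE//; exact: test_eta. Qed.

Lemma moll_bounded e f K x : 0 < e -> L1 mu f -> (forall y, `|f y| <= K) ->
  `|moll e f x| <= K.
Proof.
move=> e0 Lf fK.
have Le : L1 mu (eta e) := L1_test (test_eta e).
have Lc := conv_L1' (test_eta e) Lf x.
rewrite mollE//; apply: (le_trans (le_normr_Rintegral _ Lc)) => //.
rewrite -[leRHS]mulr1 -(eta_mass e0) -RintZ//.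
apply: le_Rintegral => //.
- by apply: (le_L1 _ _ Lc) => [|y]; [exact: (mf_norm (L1_mf Lc))|rewrite normr_id].
- exact: L1Z.
- by move=> y _; rewrite normrM (ger0_norm (eta_ge0 _ e0)) ler_wpM2r// eta_ge0.
Qed.

Lemma mollB e f c x : 0 < e -> L1 mu f ->
  moll e f x - c = \int[mu]_y ((f (x - y) - c) * eta e y).
Proof.
move=> e0 Lf; rewrite mollE// -[c in LHS]mulr1 -(eta_mass e0) -RintZ; last exact: L1_test (test_eta e).
rewrite -RintB; last 2 first.
- exact: conv_L1' (test_eta e) Lf x.
- by apply: L1Z; exact: L1_test (test_eta e).
by apply: eq_Rintegral => y _; rewrite mulrBl.
Qed.

Definition oscF (e : R) (f : V -> R) (p : V * V) : \bar R :=
  (`|f (p.1 - p.2) - f p.1| * eta e p.2)%:E.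

Definition osc (e : R) (f : V -> R) (x : V) : \bar R :=
  (\int[mu]_y oscF e f (x, y))%E.

Lemma measurable_sub : measurable_fun [set: V * V] (fun p => p.1 - p.2).
Proof.
apply: measurable_fun_rV => i; under eq_fun do rewrite !mxE.
apply: measurable_funD.
  exact: (measurableT_comp (measurable_coord i) measurable_fst).
apply: measurable_funN.
exact: (measurableT_comp (measurable_coord i) measurable_snd).
Qed.

(** Tonelli: the mean of the local oscillation is an average of translation differences. *)
Lemma osc_bound e f (d : R) : 0 < e -> mf f ->
  (forall h, `|h| <= e -> (n1 mu (fun x => f (affine 1 h x) - f x)%R <= d%:E)%E) ->
  measurable_fun setT (osc e f) /\ (\int[mu]_x osc e f x <= d%:E)%E.
Proof.
move=> e0 hf hd.
pose F := oscF e f.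
have mF : measurable_fun setT F.
  apply/measurable_EFinP; apply: measurable_funM.
    apply: measurableT_comp; first exact: normr_measurable.
    apply: measurable_funB; first by apply: measurableT_comp measurable_sub.
    by apply: measurableT_comp measurable_fst.
  by apply: measurableT_comp measurable_snd; apply: smooth_mf; have [] := test_eta e.
have F0 p : (0 <= F p)%E by rewrite lee_fin mulr_ge0// eta_ge0.
have [m1 _ sw] := tonelli_sigma_finite (@lebesgue_rV_sigma_finite R n)
   (@lebesgue_rV_sigma_finite R n) mF F0.
split; first exact: m1.
rewrite /osc -/F.
have [_ m2 _] := tonelli_sigma_finite (@lebesgue_rV_sigma_finite R n)
      (@lebesgue_rV_sigma_finite R n) mF F0.
rewrite sw; apply: (@le_trans _ _ (\int[mu]_y (d * eta e y)%:E)%E).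
  apply: ge0_le_integral; rewrite -/mu.
  - exact: measurableT.
  - by move=> y _; apply: integral_ge0 => x _; exact: F0.
  - exact: m2.
  - by apply: mfE; apply: mfZ; apply: smooth_mf; have [] := test_eta e.
  - move=> y _; have [ye|ye] := leP e `|y|.
      rewrite (eta_out e0 ye) mulr0 (eq_integral (fun=> 0%E)) ?integral0; first exact: lexx.
      by move=> x _; rewrite /F /oscF /= (eta_out e0 ye) mulr0.
    rewrite (_ : (\int[mu]_x F (x, y) = (eta e y)%:E * n1 mu (fun x => f (affine 1 (- y) x) - f x)%R)%E).
      have hy : (n1 mu (fun x => f (affine 1 (- y) x) - f x)%R <= d%:E)%E.
        by apply: hd; rewrite normrN ltW.
      have ey : (0 <= (eta e y)%:E)%E by rewrite lee_fin eta_ge0.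
      by have := lee_wpmul2l ey hy; rewrite -EFinM (mulrC _ d).
    have e1 := eta_ge0 y e0.
    have m3 : mf (fun x => f (affine 1 (- y) x) - f x).
      by apply: mfB; [exact: (@mf_affine _ _ 1 (- y) f hf)|exact: hf].
    rewrite -[X in (X%:E * _)%E](ger0_norm e1) -(n1Z _ (eta e y) m3) /n1.
    apply: eq_integral => x _; rewrite /F /oscF /affine scale1r normrM (ger0_norm e1).
    by rewrite [RHS]EFinM muleC -EFinM.
have Le : L1 mu (eta e) := L1_test (test_eta e).
rewrite (Rint_EFin (L1Z d Le)) (RintZ d Le) (eta_mass e0) mulr1.
exact: lexx.
Qed.

Lemma small_shift (f : V -> R) : L1 mu f -> forall d : R, 0 < d ->
  exists2 e0, 0 < e0 & forall h : V, `|h| <= e0 ->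
    (n1 mu (fun x => f (affine 1 h x) - f x)%R <= d%:E)%E.
Proof.
move=> Lf d d0; have [r r0 hr] := mean_cont_L1 Lf d0.
exists (r / 2); first by rewrite divr_gt0.
move=> h hh; apply: hr; first by rewrite subrr normr0.
by apply: le_lt_trans hh _; lra.
Qed.

Lemma moll_n1 (f : V -> R) : L1 mu f -> forall d : R, 0 < d ->
  exists2 e0, 0 < e0 & forall e, 0 < e <= e0 ->
    (n1 mu (fun x => moll e f x - f x)%R <= d%:E)%E.
Proof.
move=> Lf d d0; have [e0 e00 he0] := small_shift Lf d0.
exists e0 => // e /andP[ep ee0].
have [mo ob] := @osc_bound e f d ep (L1_mf Lf) (fun h hh => he0 h (le_trans hh ee0)).
apply: le_trans ob; apply: ge0_le_integral => //.
- apply: mfE; apply: mf_norm; apply: mfB; last exact: (L1_mf Lf).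
  by apply: smooth_mf; exact: moll_smooth.
- move=> x _; rewrite mollB//; apply: (le_trans (le_norm_Rint _)).
    have -> : (fun y : V => (f (x - y) - f x) * eta e y) =
       (fun y : V => f (x - y) * eta e y - f x * eta e y).
      by apply/funext => y; rewrite mulrBl.
    apply: L1B; first exact: conv_L1' (test_eta e) Lf x.
    by apply: L1Z; exact: L1_test (test_eta e).
  apply: le_of_eq; apply: eq_integral => y _.
  by rewrite normrM (ger0_norm (eta_ge0 _ ep)).
Qed.

(** Jensen's inequality bounds |moll f - f|^2 by the average of |f(x - y) - f(x)|^2, which is
    at most twice the local oscillation of f |f|. *)
Lemma moll_n2 (f : V -> R) : L1 mu f -> sqL mu f -> forall d : R, 0 < d ->
  exists2 e0, 0 < e0 & forall e, 0 < e <= e0 ->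
    (n2 mu (fun x => moll e f x - f x)%R <= d%:E)%E.
Proof.
move=> Lf Qf d d0; pose F x := f x * `|f x|.
have LF : L1 mu F by exact: sqL_abs_L1.
have d2 : 0 < d / 2 by rewrite divr_gt0.
have [e0 e00 he0] := small_shift LF d2.
exists e0 => // e /andP[ep ee0].
have [mo ob] := @osc_bound e F (d / 2) ep (L1_mf LF) (fun h hh => he0 h (le_trans hh ee0)).
have Le : L1 mu (eta e) := L1_test (test_eta e).
have mf_ := L1_mf Lf.
apply: (@le_trans _ _ (\int[mu]_x (2%:E * osc e F x))%E); last first.
  rewrite ge0_integralZl//.
    apply: (le_trans (lee_wpmul2l _ ob)) => //.
    by rewrite -EFinM lee_fin mulrC divfK.
  by move=> x _; apply: integral_ge0 => y _; rewrite lee_fin mulr_ge0// eta_ge0.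
apply: ge0_le_integral => //.
- by move=> x _; rewrite lee_fin sqr_ge0.
- apply: mfE; apply: mfX; apply: mfB => //.
  by apply: smooth_mf; exact: moll_smooth.
- by apply: measurable_funeM.
move=> x _; pose u y := f (x - y) - f x.
have mu_ : mf u.
  apply: mfB; last exact: mf_cst.
  have := @mf_affine _ _ (-1) x f mf_.
  by under eq_fun do rewrite affN1.
have mF_ : mf (fun y : V => F (x - y) - F x).
  apply: mfB; last exact: mf_cst.
  have := @mf_affine _ _ (-1) x F (L1_mf LF).
  by under eq_fun do rewrite affN1.
have me : mf (eta e) by exact: (L1_mf Le).
apply: (@le_trans _ _ (\int[mu]_y (u y ^+ 2 * eta e y)%:E)%E); last first.
  rewrite /osc -ge0_integralZl//.
  - apply: ge0_le_integral => //.
    + by move=> y _; rewrite lee_fin mulr_ge0 ?sqr_ge0 ?eta_ge0.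
    + by apply: mfE; apply: mfM => //; exact: mfX.
    + under eq_fun do rewrite -EFinM; apply: mfE; apply: mfZ; apply: mfM => //; exact: mf_norm.
    + move=> y _; rewrite /oscF /= -EFinM lee_fin.
      have := sqr_dist_le (f (x - y)) (f x); have := eta_ge0 y ep.
      rewrite /u /F; move: (_ ^+ 2) `|_| (eta e y) => a b c c0 ab.
      by rewrite mulrA ler_wpM2r.
  - by apply: mfE; apply: mfM => //; exact: mf_norm.
  - by move=> y _; rewrite lee_fin mulr_ge0// eta_ge0.
rewrite mollB// -/(u _).
have Lu : L1 mu (fun y => u y * eta e y).
  have -> : (fun y : V => u y * eta e y) = (fun y : V => f (x - y) * eta e y - f x * eta e y).
    by apply/funext => y; rewrite mulrBl.
  apply: L1B; last exact: L1Z.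
  exact: conv_L1' (test_eta e) Lf x.
set c := \int[mu]_y (u y * eta e y).
have [fin|] := boolP (\int[mu]_y (u y ^+ 2 * eta e y)%:E < +oo)%E; last first.
  by rewrite -leNgt leye_eq => /eqP ->; rewrite leey.
have Lu2 : L1 mu (fun y => u y ^+ 2 * eta e y).
  apply/L1P; split; first by apply: mfM => //; exact: mfX.
  rewrite /n1 (eq_integral (fun y => (u y ^+ 2 * eta e y)%:E)) => [|y _].
    exact: fin.
  by rewrite ger0_norm// mulr_ge0 ?sqr_ge0 ?eta_ge0.
rewrite -[leRHS]fineK; last exact: integrable_fin_num.
rewrite -/(Rintegral _ _ _) lee_fin.
have : 0 <= \int[mu]_y ((u y - c) ^+ 2 * eta e y).
  by apply: Rintegral_ge0 => y _; rewrite mulr_ge0 ?sqr_ge0 ?eta_ge0.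
have -> : (fun y : V => (u y - c) ^+ 2 * eta e y) =
   (fun y : V => u y ^+ 2 * eta e y - (2 * c) * (u y * eta e y) + c ^+ 2 * eta e y).
  by apply/funext => y; ring.
have L3 : L1 mu (fun y => (2 * c) * (u y * eta e y)) by exact: L1Z.
rewrite RintD; [|exact: L1B|exact: L1Z].
rewrite RintB// RintZ// (RintZ _ Le) eta_mass// -/c.
by lra.
Qed.

End mollifier.

(** * Linear matrix differential equations *)
Section matrix_ode.
Context {R : realType} {N : nat}.
Notation mat := 'M[R]_N.+1.
Implicit Types (X Y : mat) (u v w : R -> mat) (s t : R).

Definition nm X : R := \sum_a \sum_b `|X a b|.

Lemma nm_ge0 X : 0 <= nm X.
Proof. by apply: sumr_ge0 => a _; exact: sumr_ge0. Qed.

Lemma le_nm X a b : `|X a b| <= nm X.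
Proof.
rewrite /nm (bigD1 a)//= (bigD1 b)//= -addrA lerDl.
by rewrite addr_ge0 ?sumr_ge0// => i _; exact: sumr_ge0.
Qed.

Lemma nmD X Y : nm (X + Y) <= nm X + nm Y.
Proof.
rewrite /nm -big_split/=; apply: ler_sum => a _.
rewrite -big_split/=; apply: ler_sum => b _.
by rewrite mxE ler_normD.
Qed.

Lemma nmZ (c : R) X : nm (c *: X) = `|c| * nm X.
Proof.
rewrite /nm mulr_sumr; apply: eq_bigr => a _.
by rewrite mulr_sumr; apply: eq_bigr => b _; rewrite mxE normrM.
Qed.

Lemma nmN X : nm (- X) = nm X.
Proof. by rewrite -scaleN1r nmZ normrN1 mul1r. Qed.

Lemma nmB X Y : nm (X - Y) <= nm X + nm Y.
Proof. by rewrite -[nm Y]nmN nmD. Qed.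

Lemma nm_distC X Y : nm (X - Y) = nm (Y - X).
Proof. by rewrite -nmN opprB. Qed.

Lemma nm0 : nm 0 = 0.
Proof. by apply: big1 => a _; apply: big1 => b _; rewrite mxE normr0. Qed.

Lemma nm_eq0 X : nm X <= 0 -> X = 0.
Proof.
move=> h; apply/matrixP => a b; rewrite mxE; apply/eqP; rewrite -normr_le0.
exact: le_trans (le_nm X a b) h.
Qed.

Lemma nmM X Y : nm (X * Y) <= nm X * nm Y.
Proof.
rewrite {1 2}/nm mulr_suml; apply: ler_sum => a _.
apply: (@le_trans _ _ (\sum_b \sum_c `|X a c| * `|Y c b|)).
  apply: ler_sum => b _; rewrite -mulmxE mxE (le_trans (ler_norm_sum _ _ _))//.
  by apply: ler_sum => c _; rewrite normrM.
rewrite exchange_big/= mulr_suml; apply: ler_sum => c _.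
rewrite -mulr_sumr ler_wpM2l// /nm [leRHS](bigD1 c)//= lerDl.
by apply: sumr_ge0 => i _; exact: sumr_ge0.
Qed.

Lemma nm_tr X : nm X^T = nm X.
Proof.
rewrite /nm exchange_big/=; apply: eq_bigr => a _; apply: eq_bigr => b _.
by rewrite mxE.
Qed.

Lemma nm_sum (I : finType) (F : I -> mat) : nm (\sum_i F i) <= \sum_i nm (F i).
Proof.
elim/big_rec2: _ => [|i y x _ h]; first by rewrite nm0.
by apply: (le_trans (nmD _ _)); rewrite lerD2l.
Qed.

Lemma nm_entries X (e : R) : (forall a b, `|X a b| <= e) ->
  nm X <= (N.+1 * N.+1)%:R * e.
Proof.
move=> h; apply: (@le_trans _ _ (\sum_(a < N.+1) \sum_(b < N.+1) e)).
  by apply: ler_sum => a _; apply: ler_sum => b _.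
by rewrite !sumr_const !card_ord -mulrnA mulr_natl.
Qed.

(** Entrywise, so that the rules for real functions apply. *)
Definition isD u (X : mat) s : Prop :=
  forall a b, is_derive s (1 : R) (fun t : R => u t a b) (X a b).

Lemma isd_eq (f g : R -> R) s (d d' : R) :
  is_derive s (1 : R) f d -> f =1 g -> d = d' -> is_derive s (1 : R) g d'.
Proof. by move=> h /funext <- <-. Qed.

Lemma isd_mul (f g : R -> R) s (f' g' : R) : is_derive s (1 : R) f f' ->
  is_derive s (1 : R) g g' ->
  is_derive s (1 : R) (fun t : R => f t * g t) (f s * g' + f' * g s).
Proof.
move=> hf hg; apply: (isd_eq (is_deriveM hf hg)) => //.
by rewrite /GRing.scale/= (mulrC f').
Qed.

Lemma isd_sum (I : finType) (F : I -> R -> R) (D : I -> R) s :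
  (forall i, is_derive s (1 : R) (F i) (D i)) ->
  is_derive s (1 : R) (fun t : R => \sum_i F i t) (\sum_i D i).
Proof.
move=> h; elim: (index_enum I) => [|i r IH].
  by rewrite big_nil; apply: (isd_eq (is_derive_cst (0 : R) s 1)) => // t; rewrite big_nil.
rewrite big_cons; apply: (isd_eq (is_deriveD (h i) IH)) => // t.
by rewrite big_cons.
Qed.

Lemma isd_cont (f : R -> R) (s d : R) : is_derive s (1 : R) f d ->
  {for s, continuous f}.
Proof.
by move=> [h _]; apply: differentiable_continuous; apply/derivable1_diffP.
Qed.

Lemma isD_eq u v X Y s : isD u X s -> u =1 v -> X = Y -> isD v Y s.
Proof. by move=> h /funext <- <-. Qed.

Lemma isD_cst X s : isD (fun=> X) 0 s.
Proof. by move=> a b; apply: (isd_eq (is_derive_cst (X a b) s 1)) => //; rewrite mxE. Qed.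

Lemma isD_add u v X Y s : isD u X s -> isD v Y s -> isD (fun t => u t + v t) (X + Y) s.
Proof.
move=> hu hv a b; apply: (isd_eq (is_deriveD (hu a b) (hv a b))) => [t|]; by rewrite mxE.
Qed.

Lemma isD_scale (c : R) u X s : isD u X s -> isD (fun t => c *: u t) (c *: X) s.
Proof.
move=> hu a b; apply: (isd_eq (is_deriveZ c (hu a b))) => [t|]; by rewrite mxE.
Qed.

Lemma isD_opp u X s : isD u X s -> isD (fun t => - u t) (- X) s.
Proof. by move=> h; apply: (isD_eq (isD_scale (-1) h)) => [t|]; rewrite scaleN1r. Qed.

Lemma isD_sub u v X Y s : isD u X s -> isD v Y s -> isD (fun t => u t - v t) (X - Y) s.
Proof. by move=> hu hv; exact: isD_add hu (isD_opp hv). Qed.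

Lemma isD_mul u v X Y s : isD u X s -> isD v Y s ->
  isD (fun t => u t * v t) (u s * Y + X * v s) s.
Proof.
move=> hu hv a b.
apply: (isd_eq (isd_sum (fun c => isd_mul (hu a c) (hv c b)))) => [t|].
  by rewrite -mulmxE mxE.
by rewrite -!mulmxE !mxE big_split.
Qed.

Lemma isD_tr u X s : isD u X s -> isD (fun t => (u t)^T) X^T s.
Proof. by move=> h a b; apply: (isd_eq (h b a)) => [t|]; rewrite mxE. Qed.

Lemma isD_rev u X L s : isD u X (L - s) -> isD (fun t => u (L - t)) (- X) s.
Proof.
move=> h a b.
have h2 : is_derive ((fun t : R => L - t) s) (1 : R) (fun t : R => u t a b) (X a b) := h a b.
have h3 := @is_derive1_comp R (fun t : R => u t a b) (fun t : R => L - t) s _ _ h2 (is_derive_rev L s).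
by apply: (isd_eq h3) => //; rewrite mxE mulrN1.
Qed.

Lemma le_derive (f g f' g' : R -> R) s t : s <= t ->
  (forall x, s <= x <= t -> is_derive x (1 : R) f (f' x)) ->
  (forall x, s <= x <= t -> is_derive x (1 : R) g (g' x)) ->
  (forall x, s <= x <= t -> f' x <= g' x) -> f t - f s <= g t - g s.
Proof.
move=> st hf hg fg.
have hd x : s <= x <= t -> is_derive x (1 : R) (g - f) (g' x - f' x).
  by move=> sxt; exact: is_deriveB (hg _ sxt) (hf _ sxt).
have [||c cab E] := @MVT_segment R (g - f) (fun x => g' x - f' x) s t st.
- by move=> x; rewrite in_itv/= => /andP[xa xb]; apply: hd; rewrite !ltW.
- apply: continuous_in_subspaceT => x; rewrite inE/= in_itv/= => sx.
  exact: isd_cont (hd x sx).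
suff : 0 <= (g - f) t - (g - f) s by rewrite !fctE; lra.
rewrite E mulr_ge0 ?subr_ge0//; apply: fg; by rewrite in_itv/= in cab.
Qed.

(** A matrix-valued function varies no more than a primitive of a bound for its
    derivative: test against the signs of the entries of the increment. *)
Lemma nm_derive u (u' : R -> mat) (g g' : R -> R) s t : s <= t ->
  (forall x, s <= x <= t -> isD u (u' x) x) ->
  (forall x, s <= x <= t -> is_derive x (1 : R) g (g' x)) ->
  (forall x, s <= x <= t -> nm (u' x) <= g' x) -> nm (u t - u s) <= g t - g s.
Proof.
move=> st hu hg hb.
pose e a b : R := Num.sg ((u t - u s) a b).
pose f x := \sum_a \sum_b e a b * u x a b.
have -> : nm (u t - u s) = f t - f s.
  rewrite /f -sumrB; apply: eq_bigr => a _; rewrite -sumrB; apply: eq_bigr => b _.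
  by rewrite -mulrBr /e !mxE normrEsg.
apply: (@le_derive f g (fun x => \sum_a \sum_b e a b * u' x a b) g') => // x sx.
  by apply: isd_sum => a; apply: isd_sum => b; exact: is_deriveZ (hu x sx a b).
apply: le_trans (hb x sx); apply: ler_sum => a _; apply: ler_sum => b _.
rewrite (le_trans (ler_norm _))// normrM ler_piMl// /e normr_sg.
by case: eqP => _; rewrite ?ler01.
Qed.

Lemma nm_mvt u (u' : R -> mat) (K : R) s t : s <= t ->
  (forall x, s <= x <= t -> isD u (u' x) x) ->
  (forall x, s <= x <= t -> nm (u' x) <= K) -> nm (u t - u s) <= K * (t - s).
Proof.
move=> st hu hb; rewrite mulrBr.
apply: (@nm_derive u u' (fun x => K * x) (fun=> K)) => // x _.
exact: is_derive_lin.
Qed.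

Lemma isD0_cst u s t : (forall x, isD u 0 x) -> u s = u t.
Proof.
move=> h; apply/eqP; rewrite -subr_eq0; apply/eqP/nm_eq0.
wlog st : s t / s <= t.
  move=> W; have [st|/ltW ts] := leP s t; first exact: W.
  by rewrite nm_distC; exact: W.
rewrite nm_distC; apply: (le_trans (@nm_mvt u (fun=> 0) 0 s t st _ _)); rewrite ?mul0r//.
by move=> x _; rewrite nm0.
Qed.

Definition cts u : Prop := forall a b, continuous (fun s : R => u s a b).

Lemma continuous_sum (T : topologicalType) (I : Type) (r : seq I) (F : I -> T -> R) :
  (forall i, continuous (F i)) -> continuous (fun s : T => \sum_(i <- r) F i s).
Proof.
move=> h; elim: r => [|i r IH] s.
  have -> : (fun s : T => \sum_(i <- [::]) F i s) = cst 0.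
    by apply/funext => t; rewrite big_nil.
  exact: cvg_cst.
have -> : (fun s : T => \sum_(j <- i :: r) F j s) = (fun s : T => F i s + \sum_(j <- r) F j s).
  by apply/funext => t; rewrite big_cons.
exact: (cvgD (h i s) (IH s)).
Qed.

Lemma cts_mul u v : cts u -> cts v -> cts (fun s => u s * v s).
Proof.
move=> hu hv a b; rewrite (_ : (fun s => _) = fun s => \sum_c u s a c * v s c b).
  apply: continuous_sum => c s; exact: (cvgM (hu a c s) (hv c b s)).
by apply/funext => s; rewrite -mulmxE mxE.
Qed.

Lemma isD_cts u (u' : R -> mat) : (forall s, isD u (u' s) s) -> cts u.
Proof. by move=> h a b s; exact: isd_cont (h s a b). Qed.

Lemma primitive (f : R -> R) : continuous f -> (forall s, s <= 0 -> f s = 0) ->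
  exists F : R -> R, (forall s, is_derive s (1 : R) F (f s)) /\
    forall s, s <= 0 -> F s = 0.
Proof.
move=> cf f0.
pose F (x : R) : R := \int[lebesgue_measure]_(t in `[-1, x]) f t.
have F0 s : s <= 0 -> F s = 0.
  move=> s0; rewrite /F /Rintegral integral0_eq// => x /=.
  by rewrite in_itv/= => /andP[_ xs]; rewrite f0// (le_trans xs).
exists F; split => // s.
have [s0|s0] := ltP s 0.
  rewrite f0 ?ltW//; apply: (@is_derive_eq _ _ _ _ _ _ 0) => //.
  apply: (near_eq_is_derive _ (is_derive_cst (0 : R) s 1)).
  near=> y; rewrite /cst F0//; near: y.
  by apply: filterS (lt_nbhsl s0) => y; exact: ltW.
have [|||d] := @continuous_FTC1_closed R f (-1) s (s + 1) _ _ _ (cf s).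
- by rewrite ltrDl.
- by apply: continuous_compact_integrable; [exact: segment_compact|exact: continuous_subspaceT].
- by apply: lt_le_trans s0; rewrite ltrN10.
by rewrite derive1E => e; split.
Unshelve. all: by end_near. Qed.

Lemma primitive_mx u : cts u -> (forall s, s <= 0 -> u s = 0) ->
  exists v, (forall s, isD v (u s) s) /\ forall s, s <= 0 -> v s = 0.
Proof.
move=> cu u0.
have /choice[F hF] : forall ab : 'I_N.+1 * 'I_N.+1, exists F : R -> R,
    (forall s, is_derive s (1 : R) F (u s ab.1 ab.2)) /\ forall s, s <= 0 -> F s = 0.
  by move=> [a b]; apply: primitive => [|s s0]; [exact: cu|rewrite u0// mxE].
exists (fun s => \matrix_(a, b) F (a, b) s); split.
  move=> s a b; apply: (isd_eq ((hF (a, b)).1 s)) => // t; by rewrite mxE.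
by move=> s s0; apply/matrixP => a b; rewrite !mxE; exact: (hF (a, b)).2.
Qed.

Lemma expr2n_lt (n : nat) : n%:R < 2 ^+ n :> R.
Proof. by rewrite -natrX ltr_nat ltn_expl. Qed.

Lemma le_geo0 (x C : R) : (forall n : nat, x <= C * 2 ^- n) -> x <= 0.
Proof.
move=> h; rewrite leNgt; apply/negP => x0.
pose n := (Num.truncn (C / x)).+1.
have : C / x < 2 ^+ n by apply: lt_trans (truncnS_gt _) (expr2n_lt n).
by rewrite ltr_pdivrMr// ltNge mulrC -ler_pdivlMr ?exprn_gt0// h.
Qed.

Lemma cvg_geo (p : nat -> R) (C : R) : (forall n, `|p n.+1 - p n| <= C * 2 ^- n) ->
  exists l, forall n, `|p n - l| <= 2 * C * 2 ^- n.
Proof.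
move=> h.
have q0 n : 0 < 2 ^- n :> R by rewrite invr_gt0 exprn_gt0.
have q2 n : 2 ^- n.+1 = 2 ^- n / 2 :> R by rewrite exprSr invfM.
have C0 : 0 <= C by have := le_trans (normr_ge0 _) (h 0); rewrite expr0 invr1 mulr1.
pose a n := p n - 2 * C * 2 ^- n; pose b n := p n + 2 * C * 2 ^- n.
have aS n : a n <= a n.+1 by have := h n; rewrite ler_norml /a q2 => /andP[]; lra.
have bS n : b n.+1 <= b n by have := h n; rewrite ler_norml /b q2 => /andP[]; lra.
have amono : {homo a : i j / (i <= j)%N >-> i <= j} by exact: homo_leq lexx le_trans aS.
have bmono i j : (i <= j)%N -> b j <= b i.
  move=> ij; rewrite -(subnK ij); elim: (j - i)%N => [|k IH]; first by rewrite add0n.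
  by rewrite addSn (le_trans (bS _)).
have ab n : a n <= b n by rewrite /a /b; have := mulr_ge0 C0 (ltW (q0 n)); lra.
have abm n m : a n <= b m.
  have [nm_|/ltnW mn] := leqP n m; first exact: le_trans (amono _ _ nm_) (ab m).
  exact: le_trans (ab n) (bmono _ _ mn).
have hs : has_sup (range a).
  by split; [exists (a 0); exists 0|exists (b 0) => _ [n _ <-]].
exists (sup (range a)) => n.
have h1 : a n <= sup (range a) by apply: ub_le_sup; [exact: hs.2|exists n].
have h2 : sup (range a) <= b n by apply: ge_sup; [exact: hs.1|move=> _ [m _ <-]].
by move: h1 h2; rewrite /a /b ler_norml => ? ?; apply/andP; split; lra.
Qed.

(** Picard iteration; the weight [expR (2 K s)] makes it a contraction by 1/2. *)
Lemma ode_exists (a : R -> mat) (K : R) : cts a -> 0 < K -> (forall s, nm (a s) <= K) ->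
  (forall s, s <= 0 -> a s = 0) ->
  exists u, (forall s, isD u (a s * u s) s) /\ forall s, s <= 0 -> u s = 1.
Proof.
move=> ca K0 aK a0.
have /choice[step hstep] : forall u, exists v, cts u ->
    (forall s, isD v (a s * u s) s) /\ forall s, s <= 0 -> v s = 1.
  move=> u; have [cu|nc] := pselect (cts u); last by exists u.
  have [|s s0|v [hv v0]] := @primitive_mx (fun s => a s * u s).
  - exact: cts_mul.
  - by rewrite a0// mul0r.
  exists (fun s => 1 + v s) => _; split => [s|s s0]; last by rewrite v0// addr0.
  by apply: (isD_eq (isD_add (isD_cst 1 s) (hv s))) => //; rewrite add0r.
pose p n := iter n step (fun=> 1).
have cp n : cts (p n).
  elim: n => [a' b s|n IH]; first exact: cvg_cst.
  exact: isD_cts (hstep _ IH).1.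
have hp n s : isD (p n.+1) (a s * p n s) s := (hstep _ (cp n)).1 s.
have p1 n s : s <= 0 -> p n s = 1 by case: n => [//|n] s0; exact: (hstep _ (cp n)).2.
have hE (C s : R) : is_derive s (1 : R) (fun s => C * expR (2 * K * s))
    (2 * K * (C * expR (2 * K * s))).
  have h1 := is_derive_lin (2 * K) s.
  apply: (isd_eq (is_deriveZ C (is_derive1_comp (is_derive_expR (2 * K * s)) h1))) => //.
  by rewrite /GRing.scale/=; ring.
(* variation of two functions whose derivatives differ by a times something small *)
have step_bound v1 v2 w1 w2 (C s : R) : 0 <= C -> 
    (forall s, isD v1 (a s * w1 s) s) -> (forall s, isD v2 (a s * w2 s) s) ->
    v1 0 = v2 0 -> (forall s, nm (w1 s - w2 s) <= 2 * C * expR (2 * K * s)) ->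
    0 <= s -> nm (v1 s - v2 s) <= C * expR (2 * K * s).
  move=> C0 h1 h2 v0 hw s0.
  have := @nm_derive (fun s => v1 s - v2 s) (fun s => a s * w1 s - a s * w2 s)
    (fun s => C * expR (2 * K * s)) (fun s => 2 * K * (C * expR (2 * K * s))) 0 s s0
    (fun s _ => isD_sub (h1 s) (h2 s)) (fun s _ => hE C s).
  rewrite v0 subrr subr0 mulr0 expR0 mulr1 => H.
  apply: le_trans (H _) _; last by rewrite lerBlDr lerDl.
  move=> x _; rewrite -mulrBr (le_trans (nmM _ _))//.
  apply: (le_trans (ler_pM (nm_ge0 _) (nm_ge0 _) (aK x) (hw x))).
  by apply: le_of_eq; ring.
pose C0 : R := nm (1 : mat).
have C00 : 0 <= C0 by exact: nm_ge0.
have q0 n : 0 < 2 ^- n :> R by rewrite invr_gt0 exprn_gt0.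
have q2 n : 2 ^- n.+1 = 2 ^- n / 2 :> R by rewrite exprSr invfM.
have e0 (s : R) : 0 < expR (2 * K * s) by exact: expR_gt0.
have pd n s : nm (p n.+1 s - p n s) <= C0 * 2 ^- n * expR (2 * K * s).
  have [s0|s0] := leP s 0.
    by rewrite !p1// subrr nm0 !mulr_ge0// ltW.
  elim: n s s0 => [|n IH] s s0.
    have := @nm_derive (p 1) (fun s => a s * 1) (fun s => C0 * expR (2 * K * s))
      (fun s => 2 * K * (C0 * expR (2 * K * s))) 0 s (ltW s0)
      (fun s _ => hp 0 s) (fun s _ => hE C0 s).
    rewrite (p1 1 0 (lexx _)) expr0 invr1 mulr1 mulr0 expR0 mulr1 => H.
    apply: (le_trans (H _)); last by rewrite lerBlDr lerDl.
    move=> x /andP[x0 _]; rewrite mulr1 (le_trans (aK x))//.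
    have h1 : 1 <= expR (2 * K * x) by rewrite -expR0 ler_expR !mulr_ge0// ltW.
    have h2 : 1 <= C0.
      apply: le_trans (le_nm 1 ord0 ord0); by rewrite mxE eqxx normr1.
    have h3 : 1 <= C0 * expR (2 * K * x) by rewrite mulr_ege1.
    by nra.
  apply: (step_bound (p n.+2) (p n.+1) (p n.+1) (p n)) => //; rewrite ?p1//.
  - by rewrite mulr_ge0// ltW.
  - move=> x; rewrite q2; have [x0|x0] := leP x 0.
      by rewrite !p1// subrr nm0 !mulr_ge0// ?mulr_ge0// ?divr_ge0// ltW.
    have -> : 2 * (C0 * (2 ^- n / 2)) = C0 * 2 ^- n :> R.
      by move: (2 ^- n) => q; field.
    exact: IH.
  - exact: ltW.
have /choice[u' hu'] : forall sab : R * ('I_N.+1 * 'I_N.+1), exists l,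
    forall n, `|p n sab.1 sab.2.1 sab.2.2 - l| <=
      2 * (C0 * expR (2 * K * sab.1)) * 2 ^- n.
  move=> [s [i j]] /=; apply: cvg_geo => n.
  rewrite -mulrA (mulrC _ (2 ^- n)) mulrA; apply: le_trans (pd n s).
  by apply: le_trans (le_nm _ i j); rewrite !mxE.
pose u s : mat := \matrix_(i, j) u' (s, (i, j)).
pose D : R := (N.+1 * N.+1)%:R * (2 * C0).
have D0 : 0 <= D by rewrite !mulr_ge0.
have pu n s : nm (p n s - u s) <= D * 2 ^- n * expR (2 * K * s).
  have -> : D * 2 ^- n * expR (2 * K * s) =
    (N.+1 * N.+1)%:R * (2 * (C0 * expR (2 * K * s)) * 2 ^- n) by rewrite /D; ring.
  by apply: nm_entries => i j; rewrite !mxE; exact: (hu' (s, (i, j))).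
have u1 s : s <= 0 -> u s = 1.
  move=> s0; apply/eqP; rewrite -subr_eq0; apply/eqP/nm_eq0.
  apply: (@le_geo0 _ (D * expR (2 * K * s))) => n.
  by rewrite nm_distC -(p1 n s s0) -mulrA (mulrC _ (2 ^- n)) mulrA.
have cu : cts u.
  move=> i j s; apply/cvgrPdist_le => e e_gt0.
  pose Q := D * expR (2 * K * (s + 1)).
  have Q0 : 0 <= Q by rewrite mulr_ge0// ltW.
  have [n hn] : exists n : nat, Q * 2 ^- n <= e / 3.
    apply: contrapT => hn; suff : e / 3 <= 0 by rewrite leNgt divr_gt0.
    apply: (@le_geo0 _ Q) => n; rewrite leNgt; apply/negP => lt.
    by apply: hn; exists n; exact: ltW.
  have e3 : 0 < e / 3 by rewrite divr_gt0.
  have key x : x <= s + 1 -> `|p n x i j - u x i j| <= e / 3.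
    move=> xs; apply: le_trans hn; have := le_trans (le_nm (p n x - u x) i j) (pu n x).
    rewrite !mxE => /le_trans; apply; rewrite /Q -mulrA (mulrC (2 ^- n)) mulrA.
    rewrite ler_wpM2r ?(ltW (q0 n))// ler_wpM2l// ler_expR ler_wpM2l//.
    by rewrite mulr_ge0// ltW.
  have /cvgrPdist_le/(_ _ e3) cps := cp n i j s.
  near=> x.
  have h1 : `|p n s i j - p n x i j| <= e / 3 by near: x; exact: cps.
  have h2 : `|p n s i j - u s i j| <= e / 3 by apply: key; rewrite lerDl.
  have h3 : `|p n x i j - u x i j| <= e / 3.
    apply: key; near: x; apply: filterS (lt_nbhsl (_ : s < s + 1)); last by rewrite ltrDl.
    by move=> y; exact: ltW.
  move: h1 h2 h3; rewrite !ler_norml => /andP[? ?] /andP[? ?] /andP[? ?].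
  by apply/andP; split; lra.
have [|s s0|U [hU U0]] := @primitive_mx (fun s => a s * u s).
- exact: cts_mul.
- by rewrite a0// mul0r.
have hU1 s : isD (fun s => 1 + U s) (a s * u s) s.
  by apply: (isD_eq (isD_add (isD_cst 1 s) (hU s))) => //; rewrite add0r.
suff E s : u s = 1 + U s.
  by exists u; split => // s; apply: (isD_eq (hU1 s)) => // t; rewrite E.
have [s0|s0] := leP s 0; first by rewrite u1// U0// addr0.
apply/eqP; rewrite -subr_eq0; apply/eqP/nm_eq0.
apply: (@le_geo0 _ (2 * D * expR (2 * K * s))) => n.
have h1 : nm (p n.+1 s - (1 + U s)) <= D * 2 ^- n * expR (2 * K * s).
  apply: (step_bound (p n.+1) (fun s => 1 + U s) (p n) u) => //; last exact: ltW.
  - by rewrite mulr_ge0// ltW.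
  - by rewrite p1// U0// addr0.
  - move=> x; apply: (le_trans (pu n x)); rewrite -!mulrA ler_peMl ?ler1n//.
    by rewrite !mulr_ge0// ltW.
have h2 := pu n.+1 s.
have -> : u s - (1 + U s) = (p n.+1 s - (1 + U s)) - (p n.+1 s - u s) 
  by rewrite [RHS]addrC opprB addrA subrK.
apply: (le_trans (nmB _ _)); apply: (le_trans (lerD h1 h2)).
rewrite q2; have := mulr_ge0 (mulr_ge0 D0 (ltW (q0 n))) (ltW (e0 s)); lra.
Unshelve. all: by end_near. Qed.

(** The equation is solved backwards from L. The inverse w is the transpose of a solution of
    the adjoint equation; that w v is constant makes it inverse to v everywhere. *)
Lemma transport_exists (a : R -> mat) (K L : R) : cts a -> 0 < K ->
  (forall s, nm (a s) <= K) -> (forall s, L <= s -> a s = 0) ->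
  exists v w, [/\ forall s, isD v (- (a s * v s)) s, forall s, isD w (w s * a s) s,
    forall s, w s * v s = 1, forall s, L <= s -> v s = 1 & forall s, L <= s -> w s = 1].
Proof.
move=> ca K0 aK aL.
have crev (b : R -> mat) : cts b -> cts (fun s => b (L - s)).
  move=> cb i j s; apply: (@continuous_comp _ _ _ (fun s => L - s) (fun s => b s i j)).
    by apply: cvgB; [exact: cvg_cst|exact: cvg_id].
  exact: cb.
have [|s|s s0|u [hu u1]] := @ode_exists (fun s => a (L - s)) K _ K0.
- exact: crev.
- exact: aK.
- by rewrite aL// lerBrDr gerDl.
have [|s|s s0|y [hy y1]] := @ode_exists (fun s => - (a (L - s))^T) K _ K0.
- move=> i j; rewrite (_ : (fun s => _) = fun s => - (a (L - s) j i)).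
    by move=> s; apply: cvgN; exact: (crev a ca j i s).
  by apply/funext => s; rewrite !mxE.
- by rewrite nmN nm_tr.
- by rewrite aL ?lerBrDr ?gerDl// trmx0 oppr0.
pose v s := u (L - s); pose w s := (y (L - s))^T.
have hv s : isD v (- (a s * v s)) s.
  by apply: (isD_eq (isD_rev (hu (L - s)))) => //; rewrite subKr.
have hw s : isD w (w s * a s) s.
  apply: (isD_eq (isD_tr (isD_rev (hy (L - s))))) => //.
  by rewrite subKr mulNr opprK -mulmxE trmx_mul trmxK.
have v1 s : L <= s -> v s = 1 by move=> Ls; rewrite /v u1// subr_le0.
have w1 s : L <= s -> w s = 1.
  by move=> Ls; rewrite /w y1 ?subr_le0// trmx1.
exists v, w; split => // s.
rewrite (@isD0_cst (fun s => w s * v s) s L); first by rewrite v1// w1// mulr1.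
move=> x; apply: (isD_eq (isD_mul (hw x) (hv x))) => //.
by rewrite mulrN !mulrA addNr.
Qed.

Lemma transport_unique (a v v' w : R -> mat) (L : R) :
  (forall s, isD w (w s * a s) s) -> (forall s, isD v' (- (a s * v' s)) s) ->
  (forall s, w s * v s = 1) -> w L = 1 -> v' L = 1 -> v' =1 v.
Proof.
move=> hw hv' wv w1 v1 s.
have E : w s * v' s = 1.
  rewrite (@isD0_cst (fun s => w s * v' s) s L); first by rewrite v1 w1 mulr1.
  move=> x; apply: (isD_eq (isD_mul (hw x) (hv' x))) => //.
  by rewrite mulrN !mulrA addNr.
have vw : v s * w s = 1 by rewrite -mulmxE; apply: mulmx1C; exact: wv.
by rewrite -[LHS]mul1r -vw -mulrA E mulr1.
Qed.

End matrix_ode.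

(** * Matrix groups and their Lie algebras *)
Section matrix_group.
Context {R : realType} {N : nat}.
Notation mat := 'M[R]_N.+1.
Implicit Types (X Y : mat) (u v w : R -> mat) (s t : R).

Lemma isDP u X s : is_derive s (1 : R) u X <-> isD u X s.
Proof.
split=> [[hd hX] a b|h].
  split; first by move/derivable_mxP : hd; exact.
  by rewrite -hX derive_mx// mxE.
have hd : derivable u s 1 by apply/derivable_mxP => a b; case: (h a b).
split=> //; rewrite derive_mx//; apply/matrixP => a b; rewrite mxE.
by case: (h a b).
Qed.

(** The difference quotient, multiplied out so that it makes sense at h = 0. *)
Lemma derive_expand (f : R -> R) s (d : R) : is_derive s (1 : R) f d ->
  forall e : R, 0 < e -> \forall h \near (0 : R), `|f (h + s) - f s - h * d| <= e * `|h|.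
Proof.
move=> [hd hX] e e0; move: hd; rewrite /derivable => /cvg_ex[l hl].
have ld : l = d by rewrite -hX; apply/esym/cvg_lim.
move: hl; rewrite ld => /cvgrPdist_le/(_ _ e0)/= H.
have : \forall h \near (0 : R), h != 0 ->
    `|d - h^-1 *: (f (h *: (1 : R) + s) - f s)| <= e.
  exact: H.
apply: filterS => h; have [->|h0] := eqVneq h 0.
  by rewrite add0r subrr mul0r subr0 !normr0 mulr0.
move=> /(_ isT) H1; rewrite -ler_pdivrMr ?normr_gt0// -normfV -normrM.
move: H1; rewrite distrC /GRing.scale/= mulr1.
by congr (`|_| <= _); field.
Qed.

Lemma isD_expand u X s : isD u X s ->
  forall e : R, 0 < e -> \forall h \near (0 : R), nm (u (h + s) - u s - h *: X) <= e * `|h|.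
Proof.
move=> hu e e0; pose c : R := (N.+1 * N.+1)%:R.
have c0 : 0 < c by rewrite ltr0n.
have ec : 0 < e / c by rewrite divr_gt0.
have := @filter_forall R _ (fun (ab : 'I_N.+1 * 'I_N.+1) (h : R) =>
    `|u (h + s) ab.1 ab.2 - u s ab.1 ab.2 - h * X ab.1 ab.2| <= e / c * `|h|)
  (nbhs (0 : R)) (nbhs_filter _) (fun ab => derive_expand (hu ab.1 ab.2) ec).
apply: filterS => h H.
have -> : e * `|h| = c * (e / c * `|h|) by field; rewrite gt_eqF.
by apply: nm_entries => a b; rewrite !mxE; exact: (H (a, b)).
Qed.

Lemma nm_continuous X : continuous (fun Y : mat => nm (X - Y)).
Proof.
apply: (@continuous_sum R mat _ _ (fun a (Y : mat) => \sum_b `|(X - Y) a b|)) => a.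
apply: (@continuous_sum R mat _ _ (fun b (Y : mat) => `|(X - Y) a b|)) => b Y.
rewrite (_ : (fun Y => _) = fun Y : mat => `|X a b - Y a b|); last first.
  by apply/funext => Z; rewrite !mxE.
have h : (fun Y : mat => X a b - Y a b) y @[y --> Y] --> X a b - Y a b.
  exact: (cvgB (@cvg_cst _ _ _ _ (nbhs_filter Y)) (@coord_continuous _ _ _ a b Y)).
exact: (cvg_norm h).
Qed.

Variable G : set mat.
Hypothesis hG : compact_matrix_group G.

Lemma group1G : G 1. Proof. by case: hG. Qed.

Lemma groupM X Y : G X -> G Y -> G (X * Y). Proof. by case: hG => _ _ h _; exact: h. Qed.

Lemma groupV X : G X -> G X^-1. Proof. by case: hG => _ _ _ h /h[]. Qed.

Lemma group_unit X : G X -> X \is a GRing.unit. Proof. by case: hG => _ _ _ h /h[]. Qed.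

Lemma group_bounded : exists2 C : R, 0 < C & forall X, G X -> nm X <= C.
Proof.
have [cG g1 _ _] := hG.
have ne : G !=set0 by exists 1.
have [X GX hX] := compact_EVT_max ne cG (continuous_subspaceT (nm_continuous (X := 0))).
exists (nm (0 - X) + 1); first by rewrite ltr_wpDl// nm_ge0.
move=> Y GY; have := hX Y; rewrite inE => /(_ GY).
by rewrite !sub0r !nmN => /le_trans; apply; rewrite lerDl.
Qed.

Lemma group_nearest X : exists2 q, G q & forall Y, G Y -> nm (X - q) <= nm (X - Y).
Proof.
have [cG g1 _ _] := hG.
have ne : G !=set0 by exists 1.
have [q Gq hq] := compact_EVT_min ne cG (continuous_subspaceT (nm_continuous (X := X))).
by exists q; [rewrite inE in Gq|move=> Y GY; apply: hq; rewrite inE].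
Qed.

Lemma lieP X : lie_algebra G X <->
  exists u, [/\ forall s, G (u s), u 0 = 1 & isD u X 0].
Proof.
by split=> -[u [h1 h2 h3]]; exists u; split => //; apply/isDP.
Qed.

Lemma lie0 : lie_algebra G 0.
Proof. by apply/lieP; exists (fun=> 1); split => //; [move=> _; exact: group1G|exact: isD_cst]. Qed.

Lemma lieD X Y : lie_algebra G X -> lie_algebra G Y -> lie_algebra G (X + Y).
Proof.
move=> /lieP[u [u1 u2 u3]] /lieP[v [v1 v2 v3]]; apply/lieP.
exists (fun s => u s * v s); split=> [s||]; first exact: groupM.
  by rewrite u2 v2 mulr1.
by apply: (isD_eq (isD_mul u3 v3)) => //; rewrite u2 v2 mul1r mulr1 addrC.
Qed.

Lemma lieZ (c : R) X : lie_algebra G X -> lie_algebra G (c *: X).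
Proof.
move=> /lieP[u [u1 u2 u3]]; apply/lieP.
exists (fun s => u (c * s)); split=> [s||]; [exact: u1|by rewrite mulr0|].
move=> a b.
have h2 : is_derive ((fun t : R => c * t) 0) (1 : R) (fun t : R => u t a b) (X a b).
  by rewrite mulr0; exact: u3.
have h3 := @is_derive1_comp R (fun t : R => u t a b) (fun t : R => c * t) 0 _ _ h2 (is_derive_lin c 0).
by apply: (isd_eq h3) => //; rewrite mxE mulrC.
Qed.

Lemma lie_Ad g X : G g -> lie_algebra G X -> lie_algebra G (g^-1 * X * g).
Proof.
move=> Gg /lieP[u [u1 u2 u3]]; apply/lieP.
exists (fun s => g^-1 * u s * g); split=> [s||].
- by apply: groupM => //; apply: groupM => //; exact: groupV.
- by rewrite u2 mulr1 mulVr// group_unit.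
- apply: (isD_eq (isD_mul (isD_mul (isD_cst g^-1 0) u3) (isD_cst g 0))) => //.
  by rewrite mulr0 add0r mul0r addr0.
Qed.

Lemma lie_curve u X : (forall s, G (u s)) -> isD u X 0 -> lie_algebra G ((u 0)^-1 * X).
Proof.
move=> Gu hu; apply/lieP; exists (fun s => (u 0)^-1 * u s); split=> [s||].
- by apply: groupM => //; exact: groupV.
- by rewrite mulVr// group_unit.
- by apply: (isD_eq (isD_mul (isD_cst (u 0)^-1 0) hu)) => //; rewrite mul0r addr0.
Qed.

(** Dini's argument: where the flow is at distance d from the group, moving the
    nearest group element along a curve with the same velocity shows that the
    distance grows at rate at most K d, so it stays zero. *)
Lemma flow_in_group (a u : R -> mat) (K : R) : 0 <= K ->
  (forall s, isD u (a s * u s) s) -> (forall s, nm (a s) <= K) ->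
  (forall s, lie_algebra G (a s)) -> G (u 0) -> forall s, 0 <= s -> G (u s).
Proof.
move=> K0 hu aK aG G0.
have /choice[near_ hnear] : forall X, exists q, G q /\ forall Y, G Y -> nm (X - q) <= nm (X - Y).
  by move=> X; have [q ? ?] := group_nearest X; exists q.
pose f s := nm (u s - near_ (u s)).
have f_le s q : G q -> f s <= nm (u s - q) by exact: (hnear (u s)).2.
have [C C0 hC] := group_bounded.
suff H (e : R) : 0 < e -> forall s, 0 <= s -> f s <= e * expR ((K + 1) * s).
  move=> s s0; suff -> : u s = near_ (u s) by exact: (hnear (u s)).1.
  apply/eqP; rewrite -subr_eq0; apply/eqP/nm_eq0; rewrite leNgt; apply/negP => fs.
  have E0 : 0 < expR ((K + 1) * s) by exact: expR_gt0.
  have e0 : 0 < f s / (2 * expR ((K + 1) * s)) by rewrite divr_gt0// mulr_gt0.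
  have := H _ e0 s s0.
  have -> : f s / (2 * expR ((K + 1) * s)) * expR ((K + 1) * s) = f s / 2.
    by field; rewrite gt_eqF.
  by move: fs; rewrite -/(f s); lra.
move=> e0 S S0; pose g s := e * expR ((K + 1) * s).
have gE : forall s, g s = e * expR ((K + 1) * s) by [].
have gmono s t : s <= t -> g s <= g t.
  by move=> st; rewrite ler_pM2l// ler_expR ler_pM2l// ltr_wpDl.
rewrite -gE leNgt; apply/negP => fS.
pose T := [set s | 0 <= s <= S /\ f s <= g s].
have T0 : T 0.
  split; first by rewrite lexx.
  rewrite (le_trans (f_le 0 _ G0))// subrr nm0 mulr_ge0// ?ltW// expR_gt0//.
have supT : has_sup T by split; [exists 0|exists S => s [/andP[]]].
pose z := sup T.
have z0 : 0 <= z by apply: ub_le_sup => //; exact: supT.2.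
have zS : z <= S by apply: ge_sup; [exact: supT.1|move=> s [/andP[]]].
have fz : f z <= g z.
  apply/ler_addgt0Pr => d d0.
  pose M := nm (a z * u z) + 1.
  have M0 : 0 < M by rewrite ltr_wpDl// nm_ge0.
  have /nbhs_ballP[r /= r0 hr] := isD_expand (hu z) ltr01.
  pose r1 := Num.min r (d / M).
  have r10 : 0 < r1 by rewrite lt_min r0 divr_gt0.
  have [s Ts zs] := sup_adherent r10 supT.
  have sz : s <= z by apply: ub_le_sup => //; exact: supT.2.
  have szr : `|s - z| < r1 by rewrite ler0_norm ?subr_le0//; rewrite -/z in zs; lra.
  have := hr (s - z); rewrite /ball/= sub0r normrN => /(_ _) H.
  have r1r : r1 <= r by rewrite /r1 ge_min lexx.
  have r1d : r1 <= d / M by rewrite /r1 ge_min lexx orbT.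
  have {H} := H (lt_le_trans szr r1r); rewrite subrK mul1r => H.
  have us : nm (u z - u s) <= d.
    rewrite nm_distC.
    have -> : u s - u z = (u s - u z - (s - z) *: (a z * u z)) + (s - z) *: (a z * u z) by rewrite subrK.
    apply: (le_trans (nmD _ _)); rewrite nmZ.
    have h1 : `|s - z| <= d / M by apply: ltW (lt_le_trans szr r1d).
    have h2 : M * `|s - z| <= d by rewrite mulrC -ler_pdivlMr.
    by move: h2; rewrite /M mulrDl mul1r; move: H; lra.
  apply: (le_trans (f_le z _ (hnear (u s)).1)).
  have -> : u z - near_ (u s) = (u s - near_ (u s)) + (u z - u s) by rewrite [RHS]addrC addrA subrK.
  apply: (le_trans (nmD _ _)); rewrite lerD//.
  by apply: le_trans (gmono _ _ sz); case: Ts.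
have zltS : z < S.
  by rewrite lt_neqAle zS andbT; apply/eqP => E; move: fS; rewrite -E ltNge fz.
have /lieP[c [cG c0 hc]] := aG z.
pose q := near_ (u z).
have Gq : G q by exact: (hnear (u z)).1.
pose e' := e / (1 + C).
have C1 : 0 < 1 + C by rewrite addr_gt0.
have e'0 : 0 < e' by rewrite divr_gt0.
have /nbhs_ballP[r1 /= r10 hr1] := isD_expand (hu z) e'0.
have /nbhs_ballP[r2 /= r20 hr2] := isD_expand hc e'0.
pose h := Num.min (S - z) (Num.min (r1 / 2) (r2 / 2)).
have h0 : 0 < h by rewrite !lt_min subr_gt0 zltS !divr_gt0.
have hS : h <= S - z by rewrite ge_min lexx.
have hh1 : h < r1.
  by rewrite (@le_lt_trans _ _ (r1 / 2))// ?ge_min ?lexx ?orbT//; lra.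
have hh2 : h < r2.
  by rewrite (@le_lt_trans _ _ (r2 / 2))// ?ge_min ?lexx ?orbT//; lra.
have nh : `|h| = h by rewrite gtr0_norm.
have H1 : nm (u (h + z) - u z - h *: (a z * u z)) <= e' * h.
  by have := hr1 h; rewrite /ball/= sub0r normrN nh => /(_ hh1).
have H2 : nm (c h - 1 - h *: a z) <= e' * h.
  by have := hr2 h; rewrite /ball/= sub0r normrN nh addr0 c0 => /(_ hh2).
have fzh : f (h + z) <= g (h + z).
  have := f_le (h + z) _ (groupM (cG h) Gq).
  set D := u z - q.
  have -> : u (h + z) - c h * q = (u (h + z) - u z - h *: (a z * u z)) + (D + h *: (a z * D))
      - (c h - 1 - h *: a z) * q.
    rewrite /D mulrBr scalerBr !mulrBl mul1r -scalerAl.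
    set x1 := u (h + z); set x2 := u z; set x3 := h *: _; set x4 := c h * q; set x5 := h *: _.
    by apply/matrixP => i j; rewrite !mxE; ring.
  move=> /le_trans; apply; apply: (le_trans (nmB _ _)).
  have b1 : nm ((c h - 1 - h *: a z) * q) <= e' * h * C.
    apply: (le_trans (nmM _ _)); apply: ler_pM => //; rewrite ?nm_ge0//; exact: hC.
  have b2 : nm (D + h *: (a z * D)) <= f z + h * (K * f z).
    apply: (le_trans (nmD _ _)); rewrite nmZ nh lerD2l ler_pM2l//.
    by apply: (le_trans (nmM _ _)); rewrite ler_wpM2r// nm_ge0.
  have b3 := le_trans (nmD _ _) (lerD H1 b2).
  apply: (le_trans (lerD b3 b1)).
  have ge : e <= g z.
    rewrite /g ler_peMr//; first exact: ltW.
    by rewrite -expR0 ler_expR mulr_ge0// addr_ge0.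
  have gz0 : 0 <= g z by apply: le_trans ge; exact: ltW.
  have E1 : e' * h + e' * h * C = e * h by rewrite /e'; field; rewrite gt_eqF.
  have b4 : h * (K * f z) <= h * (K * g z) by rewrite !ler_wpM2l// ltW.
  have b5 : e * h <= g z * h by rewrite ler_wpM2r// ltW.
  have b6 : g z * (1 + (K + 1) * h) <= g (h + z).
    have -> : g (h + z) = g z * expR ((K + 1) * h) by rewrite /g mulrDr expRD; ring.
    by rewrite ler_wpM2l// expR_ge1Dx.
  have fzg := fz.
  move: b4 b5 b6 E1 fzg; clear; lra.
have : T (h + z).
  split=> //; apply/andP; split; first by rewrite addr_ge0// ltW.
  by move: hS; lra.
by move=> /(ub_le_sup supT.2); rewrite -/z; lra.
Qed.

Definition pair X Y : R := \sum_a \sum_b X a b * Y a b.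

Lemma pair_vec (v : 'cV[R]_(N.+1 * N.+1)) X :
  (mxvec X *m v) ord0 ord0 = pair (vec_mx v^T) X.
Proof.
rewrite mxE /pair pair_bigA /=.
rewrite (reindex (uncurry (@mxvec_index N.+1 N.+1))) /=; last exact: (subon_bij _ (curry_mxvec_bij _ _)).
apply: eq_bigr => -[a b] _ /=; rewrite mxvecE mulrC; congr (_ * _).
by rewrite -[v in LHS]trmxK -[v^T]vec_mxK mxE mxvecE vec_mxK.
Qed.

(** A matrix of maximal rank whose rows lie in the Lie algebra spans it, and the columns of
    its cokernel are the functionals. They turn membership in the Lie algebra into linear
    equations, which pass to integrals and to weak limits. *)
Lemma lie_functionals : exists (m : nat) (L : 'I_m -> mat),
  forall X, lie_algebra G X <-> forall k, pair (L k) X = 0.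
Proof.
pose d := (N.+1 * N.+1)%N.
pose ok (M : 'M[R]_d) := forall i, lie_algebra G (vec_mx (row i M)).
have ok0 : ok 0 by move=> i; rewrite row0 linear0; exact: lie0.
pose P r := `[< exists2 M, ok M & \rank M = r >].
have exP : exists r, P r by exists 0%N; apply/asboolP; exists 0 => //; exact: mxrank0.
have ubP r : P r -> (r <= d)%N by move=> /asboolP[M _ <-]; exact: rank_leq_row.
have [r /asboolP[M okM rM] maxr] := ex_maxnP exP ubP.
have span X : (mxvec X <= M)%MS -> lie_algebra G X.
  move=> /submxP[D E]; rewrite -[X]mxvecK E mulmx_sum_row linear_sum.
  elim/big_ind: _ => [|x y|i _]; [exact: lie0|exact: lieD|].
  by rewrite linearZ; apply: lieZ; exact: okM.
have mem X : lie_algebra G X -> (mxvec X <= M)%MS.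
  move=> gX; apply/negPn/negP => nX.
  have fullM : (\rank M < d)%N.
    rewrite ltn_neqAle rank_leq_row andbT; apply/negP => /eqP full.
    by move/negP : nX; apply; apply: submx_full; rewrite /row_full full.
  (* a square matrix with the row space of M and mxvec X together *)
  pose M' := (M + mxvec X)%MS.
  have okM' : ok M'.
    move=> i; have /sub_addsmxP[[A B] /= E] : (row i M' <= M + mxvec X)%MS by exact: row_sub.
    rewrite E linearD /=; apply: lieD; first by apply: span; rewrite vec_mxK submxMl.
    have -> : B *m mxvec X = B ord0 ord0 *: mxvec X.
      by rewrite [B]mx11_scalar mul_scalar_mx mxE eqxx mulr1n.
    by rewrite linearZ /= mxvecK; exact: lieZ.
  have : (\rank M' <= r)%N by apply: maxr; apply/asboolP; exists M'.
  rewrite -rM leqNgt; move/negP; apply.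
  have lf := mxrank_leqif_sup (addsmxSl M (mxvec X)).
  rewrite ltn_neqAle lf.1 lf.2 andbT; apply: contra nX => h.
  by apply: submx_trans h; exact: addsmxSr.
exists d, (fun k => vec_mx (col k (cokermx M))^T) => X.
have E k : pair (vec_mx (col k (cokermx M))^T) X = (mxvec X *m cokermx M) ord0 k.
  by rewrite -pair_vec !mxE; apply: eq_bigr => j _; rewrite !mxE.
split=> [/mem|h].
  by rewrite submxE => /eqP E0 k; rewrite E E0 mxE.
apply: span; rewrite submxE; apply/eqP/rowP => k.
by rewrite -E h mxE.
Qed.

End matrix_group.

(** * Equivalence of norms *)
Section norm_equivalence.
Context {R : realType} {N : nat}.
Notation mat := 'M[R]_N.+1.
Variable nrm : mat -> R.
Hypothesis hn : is_norm nrm.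

Lemma nrm0 : nrm 0 = 0.
Proof. by case: hn => _ h _; rewrite -(scale0r (0 : mat)) h normr0 mul0r. Qed.

Lemma nrmN X : nrm (- X) = nrm X.
Proof. by case: hn => _ h _; rewrite -scaleN1r h normrN1 mul1r. Qed.

Lemma nrm_ge0 X : 0 <= nrm X.
Proof.
case: hn => h1 _ _; have := h1 X (- X); rewrite subrr nrm0 nrmN; lra.
Qed.

Lemma nrm_upper : exists2 C : R, 0 < C & forall X, nrm X <= C * nm X.
Proof.
case: (hn) => hD hZ _.
pose C := 1 + \sum_a \sum_b nrm (delta_mx a b).
have C_ge a b : nrm (delta_mx a b) <= C.
  rewrite /C (bigD1 a)//= (bigD1 b)//=.
  have h1 : 0 <= \sum_(j < N.+1 | j != b) nrm (delta_mx a j) by apply: sumr_ge0 => j _; exact: nrm_ge0.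
  have h2 : 0 <= \sum_(i < N.+1 | i != a) \sum_b0 nrm (delta_mx i b0).
    by apply: sumr_ge0 => i _; apply: sumr_ge0 => j _; exact: nrm_ge0.
  by lra.
exists C.
  rewrite ltr_pwDl// sumr_ge0// => a _; apply: sumr_ge0 => b _; exact: nrm_ge0.
move=> X; rewrite [X in nrm X]matrix_sum_delta /nm mulr_sumr.
have nsum (I : finType) (F : I -> mat) : nrm (\sum_i F i) <= \sum_i nrm (F i).
  elim/big_rec2: _ => [|i y x _ h]; first by rewrite nrm0.
  by apply: (le_trans (hD _ _)); rewrite lerD2l.
apply: (le_trans (nsum _ _)); apply: ler_sum => a _; rewrite mulr_sumr.
apply: (le_trans (nsum _ _)); apply: ler_sum => b _.
by rewrite hZ mulrC ler_wpM2r.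
Qed.

Lemma nrm_continuous : continuous (fun v : 'rV[R]_(N.+1 * N.+1) => nrm (vec_mx v)).
Proof.
case: (hn) => hD hZ _; have [C C0 hC] := nrm_upper.
pose D : R := C * (N.+1 * N.+1)%:R.
have D0 : 0 < D by rewrite mulr_gt0// ltr0n.
move=> v; apply/(@cvgrPdist_le _ _ _ _ (nbhs_filter v)) => e e0.
apply/nbhs_ballP; exists (e / D) => /=; first by rewrite divr_gt0.
move=> w; rewrite -ball_normE/= => vw.
have key : nrm (vec_mx (v - w)) <= e.
  apply: (le_trans (hC _)); apply: (@le_trans _ _ (D * `|v - w|)); last first.
    by rewrite mulrC -ler_pdivlMr// ltW.
  rewrite -mulrA ler_pM2l//; apply: nm_entries => a b; rewrite mxE.
  exact: entry_le_mx_norm.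
have h1 := hD (vec_mx (v - w)) (vec_mx w).
have h2 := hD (vec_mx (w - v)) (vec_mx v).
have h3 : nrm (vec_mx (w - v)) = nrm (vec_mx (v - w)) by rewrite -opprB linearN nrmN.
rewrite -!linearD /= !subrK in h1 h2.
by rewrite ler_norml; move: h1 h2; rewrite h3; move: key => ? ? ?; apply/andP; split; lra.
Qed.

Lemma nrm_lower : exists2 C : R, 0 < C & forall X, nm X <= C * nrm X.
Proof.
case: (hn) => hD hZ h0.
pose S := [set v : 'rV[R]_(N.+1 * N.+1) | `|v| = 1].
have cS : compact S.
  apply: bounded_closed_compact.
    exists 1; split => // x x1 v /= ->; exact: ltW.
  have -> : S = (fun v : 'rV[R]_(N.+1 * N.+1) => `|v|) @^-1` [set 1] by [].
  by apply: preimage_closed; [move=> x _; exact: norm_continuous|exact: closed_eq].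
have neS : S !=set0.
  exists (const_mx 1); rewrite /S/=; apply/eqP; rewrite eq_le; apply/andP; split.
    by apply: mx_norm_le => // i; rewrite mxE normr1.
  have := @entry_le_mx_norm R _ (const_mx 1 : 'rV[R]_(N.+1 * N.+1)) ord0.
  by rewrite mxE normr1.
have [v0 Sv0 hv0] := compact_EVT_min neS cS (continuous_subspaceT nrm_continuous).
rewrite inE in Sv0.
pose m := nrm (vec_mx v0).
have m0 : 0 < m.
  rewrite lt_neqAle nrm_ge0 andbT; apply/eqP => /esym /h0 E.
  have : v0 = 0 by rewrite -[v0]vec_mxK E linear0.
  by move=> E0; move: Sv0; rewrite /S/= E0 normr0 => /esym/eqP; rewrite oner_eq0.
exists ((N.+1 * N.+1)%:R / m); first by rewrite divr_gt0// ltr0n.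
move=> X; rewrite -mulrA; apply: nm_entries => a b.
rewrite -(mxvecE X); apply: (le_trans (entry_le_mx_norm _ _)).
have [->|X0] := eqVneq (mxvec X) 0; first by rewrite normr0 mulr_ge0 ?nrm_ge0// invr_ge0 ltW.
have nX : 0 < `|mxvec X| by rewrite normr_gt0.
have := hv0 (`|mxvec X|^-1 *: mxvec X); rewrite inE => /(_ _) H.
have {H} := H _; rewrite linearZ /= mxvecK hZ normfV normr_id => H.
have {}H : nrm (vec_mx v0) <= `|mxvec X|^-1 * nrm X.
  by apply: H; rewrite /S/= normrZ normfV normr_id mulVf// gt_eqF.
by rewrite mulrC ler_pdivlMr// mulrC -ler_pdivlMr// mulrC.
Qed.

End norm_equivalence.

(** * The gauge along rays, for smooth connections *)
Section expansions.
Context {R : realType}.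

Lemma derive_of_little (f : R -> R) (s d : R) :
  (forall e : R, 0 < e -> \forall h \near (0 : R), `|f (h + s) - f s - h * d| <= e * `|h|) ->
  is_derive s (1 : R) f d.
Proof.
move=> H.
have cv : h^-1 *: (f (h *: (1 : R) + s) - f s) @[h --> (0 : R)^'] --> d.
  apply/cvgrPdist_le => e e0.
  suff : \forall h \near (0 : R), h != 0 -> `|d - h^-1 *: (f (h *: (1 : R) + s) - f s)| <= e.
    by move=> near_h; exact: near_h.
  apply: filterS (H e e0) => h hh h0.
  rewrite /GRing.scale/= mulr1.
  have -> : d - h^-1 * (f (h + s) - f s) = - (h^-1 * (f (h + s) - f s - h * d)) by field.
  by rewrite normrN normrM normfV mulrC ler_pdivrMr ?normr_gt0.
split; first by apply/cvg_ex; exists d.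
exact: cvg_lim cv.
Qed.

Lemma derive_of_expand (f : R -> R) (s d C r : R) : 0 < r ->
  (forall h, `|h| <= r -> `|f (h + s) - f s - h * d| <= C * h ^+ 2) ->
  is_derive s (1 : R) f d.
Proof.
move=> r0 H.
have C0 : 0 <= C.
  have rr : `|r| <= r by rewrite gtr0_norm.
  have h1 : 0 <= C * r ^+ 2 by exact: le_trans (normr_ge0 _) (H r rr).
  by rewrite -(pmulr_lge0 _ (exprn_gt0 2 r0)).
apply: derive_of_little => e e0; have C1 : 0 < C + 1 by rewrite ltr_wpDl.
apply/nbhs_ballP; exists (Num.min r (e / (C + 1))) => /=; first by rewrite lt_min r0 divr_gt0.
move=> h; rewrite /ball/= sub0r normrN lt_min => /andP[/ltW hr /ltW he].
apply: (le_trans (H h hr)); rewrite -(real_normK (num_real h)) expr2 mulrA ler_wpM2r//.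
apply: (@le_trans _ _ ((C + 1) * `|h|)); first by rewrite ler_wpM2r// lerDl.
by rewrite mulrC -ler_pdivlMr.
Qed.

Lemma test_taylor n (f : 'rV[R]_n -> R) : test_fun setT f ->
  exists M, [/\ 0 <= M, forall x, `|f x| <= M, forall k x, `|partial k f x| <= M,
    forall x y, `|f y - f x| <= M * l1n (y - x) &
    forall x y, `|f y - f x - \sum_k (y - x) ord0 k * partial k f x| <=
       M * l1n (y - x) ^+ 2].
Proof.
move=> tf; have tp k := test_fun_partial k tf.
have [M0 M00 hM0] := test_fun_bounded tf; have [M1 M10 hM1] := test_funs_bounded tp.
have [M2 M20 hM2] := test_funs_bounded (fun kl : 'I_n * 'I_n => test_fun_partial kl.1 (tp kl.2)).
pose M := M0 + M1 + M2; have Mp : 0 <= M by rewrite !addr_ge0.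
have b0 x : `|f x| <= M by apply: le_trans (hM0 x) _; rewrite /M -addrA lerDl addr_ge0.
have b1 k x : `|partial k f x| <= M.
  by apply: le_trans (hM1 k x) _; rewrite /M addrAC lerDr addr_ge0.
have b2 k l x : `|partial k (partial l f) x| <= M.
  by apply: le_trans (hM2 (k, l) x) _; rewrite /M lerDr addr_ge0.
have df k x : is_derive x (ed k) f (partial k f x).
  by apply: smooth_is_derive; case: tf.
have dpf k l x : is_derive x (ed k) (partial l f) (partial k (partial l f) x).
  by apply: smooth_is_derive; case: (tp l).
have lp := lipschitz_partial df b1.
have lp2 l x y : `|partial l f y - partial l f x| <= M * l1n (y - x).
  exact: (lipschitz_partial (fun k x => dpf k l x) (fun k x => b2 k l x)).
exists (M * (n%:R + 1)).
have MM : M <= M * (n%:R + 1) by rewrite ler_peMr// lerDr.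
split => [|x|k x|x y|x y].
- by rewrite mulr_ge0// addr_ge0.
- exact: le_trans (b0 x) MM.
- exact: le_trans (b1 k x) MM.
- by apply: le_trans (lp x y) _; rewrite ler_wpM2r// l1n_ge0.
- apply: (le_trans (taylor_partial df (fun k x y => lp2 k x y) Mp x y)).
  by rewrite ler_wpM2r ?sqr_ge0// ler_wpM2l// lerDl.
Qed.

Lemma test_line n (f : 'rV[R]_n -> R) (x : 'rV[R]_n) (s : R) : test_fun setT f ->
  is_derive s (1 : R) (fun s : R => f (s *: x)) (\sum_k x ord0 k * partial k f (s *: x)).
Proof.
move=> tf; have [M [M0 _ _ _ hT]] := test_taylor tf.
apply: (@derive_of_expand _ _ _ (M * l1n x ^+ 2) 1) => // h _.
have := hT (s *: x) ((h + s) *: x).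
have E : (h + s) *: x - s *: x = h *: x by rewrite scalerDl addrK.
rewrite E l1nZ exprMn real_normK ?num_real// mulrCA mulrA.
rewrite mulrC mulrA [X in _ -> _ <= X](_ : _ = h ^+ 2 * (M * l1n x ^+ 2)); last by ring.
congr (`|_ - _| <= _); last by ring.
by rewrite mulr_sumr; apply: eq_bigr => k _; rewrite mxE mulrA.
Qed.

End expansions.

Section matrix_integral_bound.
Context {R : realType} {N : nat}.
Notation mat := 'M[R]_N.+1.

Lemma cts_nm (u : R -> mat) : cts u -> continuous (fun s => nm (u s)).
Proof.
move=> cu; apply: continuous_sum => a; apply: continuous_sum => b s.
exact: (cvg_norm (cu a b s)).
Qed.

Lemma cts_add (u v : R -> mat) : cts u -> cts v -> cts (fun s => u s + v s).
Proof.
move=> cu cv a b; rewrite (_ : (fun s => _) = fun s => u s a b + v s a b).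
  by move=> s; exact: (cvgD (cu a b s) (cv a b s)).
by apply/funext => s; rewrite mxE.
Qed.

Lemma cts_opp (u : R -> mat) : cts u -> cts (fun s => - u s).
Proof.
move=> cu a b; rewrite (_ : (fun s => _) = fun s => - u s a b).
  by move=> s; exact: (cvgN (cu a b s)).
by apply/funext => s; rewrite mxE.
Qed.

Lemma cts_scale (c : R -> R) (u : R -> mat) : continuous c -> cts u ->
  cts (fun s => c s *: u s).
Proof.
move=> cc cu a b; rewrite (_ : (fun s => _) = fun s => c s * u s a b).
  by move=> s; exact: (cvgM (cc s) (cu a b s)).
by apply/funext => s; rewrite mxE.
Qed.

Lemma cts_sum (I : finType) (u : I -> R -> mat) : (forall i, cts (u i)) ->
  cts (fun s => \sum_i u i s).
Proof.
move=> cu a b; rewrite (_ : (fun s => _) = fun s => \sum_i u i s a b).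
  by apply: continuous_sum => i; exact: cu.
by apply/funext => s; rewrite summxE.
Qed.

Lemma continuous_rev (f : R -> R) (L : R) : continuous f -> continuous (fun s => f (L - s)).
Proof.
move=> cf s; apply: (@continuous_comp _ _ _ (fun s : R => L - s) f).
  by apply: cvgB; [exact: cvg_cst|exact: cvg_id].
exact: cf.
Qed.

(** The integral over the half-line is the increment of a primitive of p on [1, L]. *)
Lemma nm_le_int (u u' : R -> mat) (p : R -> R) (L : R) : 1 < L ->
  (forall s, isD u (u' s) s) -> continuous p -> (forall s, 0 <= p s) ->
  (forall s, L <= s -> p s = 0) -> (forall s, 1 <= s <= L -> nm (u' s) <= p s) ->
  ((nm (u L - u 1))%:E <= \int[lebesgue_measure]_(s in `[1%R, +oo[) (p s)%:E)%E.
Proof.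
move=> L1 hu cp p0 pL hb.
have [|s s0|P [hP P0]] := @primitive R (fun s => p (L - s)).
- exact: continuous_rev.
- by rewrite pL// lerBrDr gerDl.
pose Q s := - P (L - s).
have hQ s : is_derive s (1 : R) Q (p s).
  have h2 := @is_derive1_comp R P (fun t : R => L - t) s _ _ (hP (L - s)) (is_derive_rev L s).
  by apply: (isd_eq (is_deriveN h2)) => //; rewrite mulrN1 opprK subKr.
have cQ : continuous Q by move=> s; exact: isd_cont (hQ s).
have h1 : nm (u L - u 1) <= Q L - Q 1.
  by apply: (@nm_derive _ _ u u' Q p 1 L (ltW L1)) => // s _.
have mp : measurable_fun setT p by exact: continuous_measurable_fun.
apply: (@le_trans _ _ (\int[lebesgue_measure]_(s in `[1%R, L]) (p s)%:E)%E); last first.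
  apply: ge0_subset_integral => //.
  - by apply/measurable_EFinP; exact: measurable_funTS.
  - by move=> s _; rewrite lee_fin.
  - by move=> s /=; rewrite !in_itv/= => /andP[-> _].
rewrite (@continuous_FTC2 R p Q 1 L L1).
- by rewrite -EFinB lee_fin.
- exact: continuous_subspaceT.
- split.
  + by move=> s _; case: (hQ s).
  + exact: cvg_at_right_filter (cQ 1).
  + exact: cvg_at_left_filter (cQ L).
- by move=> s _; rewrite derive1E; case: (hQ s).
Qed.

End matrix_integral_bound.

Section forms.
Context {R : realType} {n N : nat}.
Notation V := 'rV[R]_n.
Notation mat := 'M[R]_N.+1.
Implicit Types (A : 'I_n -> V -> mat) (x y : V).

Definition dmx (k : 'I_n) (f : V -> mat) x : mat :=
  \matrix_(a, b) partial k (fun y => f y a b) x.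

Definition curv A j i x : mat :=
  dmx j (A i) x - dmx i (A j) x + (A j x * A i x - A i x * A j x).

Definition ray A x (s : R) : mat := \sum_j x ord0 j *: A j (s *: x).

Definition test_form A : Prop := forall i a b, test_fun setT (fun x => A i x a b).

Lemma sum_ed (i : 'I_n) (t : R) x (F : 'I_n -> mat) :
  \sum_j (t *: ed i + x) ord0 j *: F j = t *: F i + \sum_j x ord0 j *: F j.
Proof.
rewrite (bigD1 i)//= [in RHS](bigD1 i)//= line_entry eqxx scalerDl addrA; congr (_ + _).
by apply: eq_bigr => j ji; rewrite line_entry (negbTE ji) add0r.
Qed.

Lemma sum_ed0 (i : 'I_n) (t : R) (F : 'I_n -> mat) :
  \sum_j (t *: ed i) ord0 j *: F j = t *: F i.
Proof.
rewrite -[t *: ed i]addr0 sum_ed big1 ?addr0// => j _.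
by rewrite mxE scale0r.
Qed.

Lemma nm_sum_le x (F : 'I_n -> mat) (K : R) : (forall j, nm (F j) <= K) ->
  nm (\sum_j x ord0 j *: F j) <= l1n x * K.
Proof.
move=> h; apply: (le_trans (nm_sum _)); rewrite /l1n mulr_suml.
by apply: ler_sum => j _; rewrite nmZ ler_wpM2l.
Qed.

Lemma form_bounds A : test_form A -> exists K, [/\ 0 < K, forall i x, nm (A i x) <= K,
  forall k i x, nm (dmx k (A i) x) <= K,
  forall i x y, nm (A i y - A i x) <= K * l1n (y - x) &
  forall i x y, nm (A i y - A i x - \sum_k (y - x) ord0 k *: dmx k (A i) x) <=
    K * l1n (y - x) ^+ 2].
Proof.
move=> tA.
have /choice[M hM] : forall ab : 'I_n * ('I_N.+1 * 'I_N.+1), exists M,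
   [/\ 0 <= M, forall x, `|A ab.1 x ab.2.1 ab.2.2| <= M,
     forall k x, `|partial k (fun x => A ab.1 x ab.2.1 ab.2.2) x| <= M,
     forall x y, `|A ab.1 y ab.2.1 ab.2.2 - A ab.1 x ab.2.1 ab.2.2| <= M * l1n (y - x) &
    forall x y, `|A ab.1 y ab.2.1 ab.2.2 - A ab.1 x ab.2.1 ab.2.2 -
       \sum_k (y - x) ord0 k * partial k (fun x => A ab.1 x ab.2.1 ab.2.2) x| <=
       M * l1n (y - x) ^+ 2].
  by move=> [i [a b]]; have [M] := test_taylor (tA i a b); exists M.
pose M1 := 1 + \sum_ab M ab.
have M_le ab : M ab <= M1.
  rewrite /M1 (bigD1 ab)//= addrCA lerDl addr_ge0// sumr_ge0// => j _.
  by case: (hM j).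
have M10 : 0 < M1 by rewrite ltr_pwDl// sumr_ge0// => j _; case: (hM j).
pose c : R := (N.+1 * N.+1)%:R.
have c0 : 0 < c by rewrite ltr0n.
exists (c * M1); split => [|i x|k i x|i x y|i x y]; rewrite -?mulrA.
- by rewrite mulr_gt0.
- apply: nm_entries => a b; case: (hM (i, (a, b))) => _ /= h _ _ _.
  exact: le_trans (h x) (M_le _).
- apply: nm_entries => a b; rewrite mxE; case: (hM (i, (a, b))) => _ /= _ h _ _.
  exact: le_trans (h k x) (M_le _).
- apply: nm_entries => a b; rewrite !mxE; case: (hM (i, (a, b))) => _ /= _ _ h _.
  by apply: le_trans (h x y) _; rewrite ler_wpM2r// l1n_ge0.
- apply: nm_entries => a b; case: (hM (i, (a, b))) => _ /= _ _ _ h.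
  apply: le_trans (_ : M (i, (a, b)) * l1n (y - x) ^+ 2 <= _); last first.
    by rewrite ler_wpM2r// sqr_ge0.
  apply: le_trans (h x y); rewrite !mxE summxE.
  apply: le_of_eq; congr `|_ - _|.
  by apply: eq_bigr => k _; rewrite !mxE.
Qed.

Lemma form_supp A : test_form A -> exists2 r, 0 < r & forall x, r < `|x| ->
  forall i, A i x = 0 /\ forall k, dmx k (A i) x = 0.
Proof.
move=> tA.
have [r r0 hr] := test_funs_box
  (fun t : 'I_n * ('I_N.+1 * 'I_N.+1) => tA t.1 t.2.1 t.2.2).
have [q q0 hq] := test_funs_box (fun t : 'I_n * ('I_n * ('I_N.+1 * 'I_N.+1)) =>
  test_fun_partial t.1 (tA t.2.1 t.2.2.1 t.2.2.2)).
exists (r + q); first exact: addr_gt0.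
move=> x hx i; split=> [|k]; apply/matrixP => a b; rewrite !mxE.
  by apply: (hr (i, (a, b))); apply: lt_trans hx; rewrite ltrDl.
by apply: (hq (k, (i, (a, b)))); apply: lt_trans hx; rewrite ltrDr.
Qed.

Lemma line_isD A i x s : test_form A ->
  isD (fun s => A i (s *: x)) (\sum_k x ord0 k *: dmx k (A i) (s *: x)) s.
Proof.
move=> tA a b; apply: (isd_eq (test_line x s (tA i a b))) => //.
by rewrite summxE; apply: eq_bigr => k _; rewrite !mxE.
Qed.

Lemma line_cts A i x : test_form A -> cts (fun s => A i (s *: x)).
Proof. by move=> tA; apply: isD_cts => s; exact: line_isD. Qed.

Lemma line_cts_dmx A k i x : test_form A -> cts (fun s => dmx k (A i) (s *: x)).
Proof.
move=> tA a b; rewrite (_ : (fun s => _) = fun s => partial k (fun y => A i y a b) (s *: x)).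
  by move=> s; exact: isd_cont (test_line x s (test_fun_partial k (tA i a b))).
by apply/funext => s; rewrite mxE.
Qed.

Lemma cst_cts (c : R) : continuous (fun _ : R => c).
Proof. by move=> s; exact: cvg_cst. Qed.

Lemma ray_cts A x : test_form A -> cts (ray A x).
Proof.
move=> tA; apply: cts_sum => j; apply: cts_scale; first exact: cst_cts.
exact: line_cts.
Qed.

Lemma curv_cts A j i x : test_form A -> cts (fun s => curv A j i (s *: x)).
Proof.
move=> tA; apply: cts_add.
  by apply: cts_add; [|apply: cts_opp]; exact: line_cts_dmx.
by apply: cts_add; [|apply: cts_opp]; apply: cts_mul; exact: line_cts.
Qed.

Lemma curv_anti A j i x : curv A j i x = - curv A i j x.
Proof. by rewrite /curv opprD !opprB. Qed.

(** Skew-symmetry of the curvature, contracted twice with the same vector. *)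
Lemma curv_radial A x y : \sum_i x ord0 i *: (\sum_j x ord0 j *: curv A j i y) = 0.
Proof.
set S := LHS.
have SE : S = \sum_i \sum_j (x ord0 i * x ord0 j) *: curv A j i y.
  by apply: eq_bigr => i _; rewrite scaler_sumr; apply: eq_bigr => j _; rewrite scalerA.
have S2 : S = - S.
  rewrite {1}SE exchange_big/= SE -sumrN; apply: eq_bigr => i _; rewrite -sumrN.
  by apply: eq_bigr => j _; rewrite curv_anti scalerN mulrC.
apply/matrixP => a b; rewrite mxE.
have : S a b = - S a b by rewrite {1}S2 mxE.
by lra.
Qed.

End forms.

Section ray_gauge.
Context {R : realType} {n N : nat}.
Notation V := 'rV[R]_n.
Notation mat := 'M[R]_N.+1.
Variables (G : set mat) (hG : compact_matrix_group G).
Implicit Types (A : 'I_n -> V -> mat) (x y : V) (v w : R -> mat).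

Definition vanish A x (L : R) : Prop := forall s, L <= s -> forall i,
  A i (s *: x) = 0 /\ forall k, dmx k (A i) (s *: x) = 0.

Lemma curv0 A j i x : vanish A x 1 -> curv A j i x = 0.
Proof.
move=> v; rewrite -[x]scale1r /curv !(v 1 (lexx _) _).2 !(v 1 (lexx _) _).1.
by rewrite !mul0r !subrr addr0.
Qed.

Definition transport A x v w (L : R) : Prop :=
  [/\ forall s, isD v (- (ray A x s * v s)) s, forall s, isD w (w s * ray A x s) s,
    forall s, w s * v s = 1, forall s, L <= s -> v s = 1 /\ w s = 1 &
    forall s, G (v s) /\ G (w s)].

(** The solution of the gauge equation along rays, normalized at infinity. *)
Definition is_gauge A (g : V -> mat) : Prop := forall x L, x != 0 -> 1 < L -> vanish A x L ->
  exists v w, transport A x v w L /\ g x = v 1.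

Definition lie_form A : Prop := forall i x, lie_algebra G (A i x).

Lemma ray_lie A x s : lie_form A -> lie_algebra G (ray A x s).
Proof.
move=> lA; rewrite /ray; elim/big_ind: _ => [|X Y|i _]; [exact: lie0|exact: lieD|].
exact/lieZ/lA.
Qed.

Lemma ray0 A x L s : vanish A x L -> L <= s -> ray A x s = 0.
Proof. by move=> h Ls; apply: big1 => j _; rewrite (h s Ls j).1 scaler0. Qed.

Lemma transport_ex A x L : test_form A -> lie_form A -> vanish A x L ->
  exists v w, transport A x v w L.
Proof.
move=> tA lA vA; have [K [K0 bA _ _ _]] := form_bounds tA.
pose K' := l1n x * K + 1.
have K'0 : 0 < K' by rewrite ltr_wpDl// mulr_ge0 ?l1n_ge0// ltW.
have aK s : nm (ray A x s) <= K'.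
  by apply: (le_trans (nm_sum_le _ (fun j => bA j (s *: x)))); rewrite lerDl.
have [s Ls|v [w [hv hw wv v1 w1]]] :=
  @transport_exists _ _ (ray A x) K' L (ray_cts (x := x) tA) K'0 aK.
  exact: ray0 vA Ls.
exists v, w; split => // [s Ls|s]; first by rewrite v1// w1.
suff Gv : G (v s).
  have -> : w s = (v s)^-1.
    have u := group_unit hG Gv.
    by rewrite -[LHS]mulr1 -(mulrV u) mulrA wv mul1r.
  by split=> //; exact: groupV.
have [Ls|/ltW sL] := leP L s; first by rewrite v1//; exact: group1G.
have -> : v s = (fun t => v (L - t)) (L - s) by rewrite /= subKr.
apply: (@flow_in_group _ _ G hG (fun t => ray A x (L - t)) (fun t => v (L - t)) K' (ltW K'0)).
- by move=> t; apply: (isD_eq (isD_rev (hv (L - t)))) => //; rewrite opprK.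
- by move=> t; exact: aK.
- by move=> t; exact: ray_lie.
- by rewrite subr0 v1//; exact: group1G.
- by rewrite subr_ge0.
Qed.

Lemma common_length A x : test_form A -> x != 0 -> exists L d, [/\ 1 < L, 0 < d,
  vanish A x L & forall y, `|y - x| <= d -> y != 0 /\ vanish A y L].
Proof.
move=> tA x0; have [r r0 hr] := form_supp tA.
have nx : 0 < `|x| by rewrite normr_gt0.
pose L := 1 + 2 * (r + 1) / `|x|.
suff H y : `|y - x| <= `|x| / 2 -> y != 0 /\ vanish A y L.
  exists L, (`|x| / 2); split => //; last by case: (H x); rewrite // subrr normr0 divr_ge0.
  - by rewrite ltrDl divr_gt0// mulr_gt0// addr_gt0.
  - by rewrite divr_gt0.
move=> hy.
have y2 : `|x| / 2 <= `|y|.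
  have : `|x| <= `|y - x| + `|y|.
    by rewrite distrC -[X in `|X| <= _](subrK y) ler_normD.
  by lra.
split; first by rewrite -normr_gt0 (lt_le_trans _ y2)// divr_gt0.
move=> s Ls i; apply: hr; rewrite normrZ.
have s0 : 0 <= s.
  by apply: le_trans Ls; rewrite addr_ge0// divr_ge0// ?mulr_ge0 ?addr_ge0// ltW.
rewrite (ger0_norm s0); apply: (@lt_le_trans _ _ (s * (`|x| / 2))); last by rewrite ler_wpM2l.
apply: (@lt_le_trans _ _ ((1 + 2 * (r + 1) / `|x|) * (`|x| / 2))).
  have -> : (1 + 2 * (r + 1) / `|x|) * (`|x| / 2) = `|x| / 2 + (r + 1) by field; rewrite gt_eqF.
  by rewrite addrCA ltrDl addr_gt0// divr_gt0.
by rewrite ler_wpM2r// divr_ge0// ltW.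
Qed.

Lemma transport_agree A x v w L v' w' L' : transport A x v w L -> transport A x v' w' L' ->
  v' =1 v.
Proof.
move=> [hv hw wv vw1 _] [hv' _ _ vw1' _].
apply: (@transport_unique _ _ (ray A x) v v' w (Num.max L L')) => //.
- by apply: (vw1 _ _).2; rewrite le_max lexx.
- by apply: (vw1' _ _).1; rewrite le_max lexx orbT.
Qed.

Lemma is_gauge_exists A : test_form A -> lie_form A ->
  exists g, (forall x, G (g x)) /\ is_gauge A g.
Proof.
move=> tA lA.
have /choice[g hg] : forall x, exists X : mat, G X /\ (x != 0 -> exists L v w,
    transport A x v w L /\ X = v 1).
  move=> x; have [->|x0] := eqVneq x 0; first by exists 1; split=> //; exact: group1G.
  have [L [_ [_ _ vx _]]] := common_length tA x0.
  have [v [w t]] := transport_ex tA lA vx.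
  exists (v 1); split; first by case: t => _ _ _ _ h; exact: (h 1).1.
  by move=> _; exists L, v, w.
exists g; split=> [x|x L x0 L1 vx]; first exact: (hg x).1.
have [v [w t]] := transport_ex tA lA vx; exists v, w; split=> //.
have [L' [v' [w' [t' ->]]]] := (hg x).2 x0.
exact: transport_agree t t' 1.
Qed.

Variables (C : R) (C0 : 0 < C) (hC : forall X, G X -> nm X <= C).

Lemma nm3 X Y Z : G X -> G Z -> nm (X * Y * Z) <= C * C * nm Y.
Proof.
move=> GX GZ; apply: (le_trans (nmM _ _)); rewrite mulrAC.
by apply: ler_pM => //; rewrite ?nm_ge0// ?hC// (le_trans (nmM _ _))// ler_wpM2r ?nm_ge0// hC.
Qed.

Lemma duhamel_derive A A' x x' v w v' w' L L' :
  transport A x v w L -> transport A' x' v' w' L' ->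
  forall s, isD (fun s => w s * v' s) (w s * (ray A x s - ray A' x' s) * v' s) s.
Proof.
move=> [_ hw _ _ _] [hv' _ _ _ _] s; apply: (isD_eq (isD_mul (hw s) (hv' s))) => //.
by rewrite mulrN mulrBr mulrBl !mulrA addrC.
Qed.

(** Duhamel's formula: the gauges of two connections differ by at most the
    integral of the difference of the connections along the ray. *)
Lemma gauge_stable A A' g g' x : test_form A -> test_form A' -> is_gauge A g ->
  is_gauge A' g' -> x != 0 ->
  ((nm (g x - g' x))%:E <= C%:E * \int[lebesgue_measure]_(s in `[1%R, +oo[)
     (C * C * nm (ray A x s - ray A' x s))%:E)%E.
Proof.
move=> tA tA' gA gA' x0.
have [L1 [_ [L11 _ v1 _]]] := common_length tA x0.
have [L2 [_ [_ _ v2 _]]] := common_length tA' x0.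
pose L := Num.max L1 L2.
have vA : vanish A x L by move=> s Ls; apply: v1; apply: le_trans Ls; rewrite le_max lexx.
have vA' : vanish A' x L.
  by move=> s Ls; apply: v2; apply: le_trans Ls; rewrite le_max lexx orbT.
have L_1 : 1 < L by rewrite lt_max L11.
have [v [w [t gx]]] := gA x L x0 L_1 vA.
have [v' [w' [t' gx']]] := gA' x L x0 L_1 vA'.
have dd := duhamel_derive t t'.
case: t => hv hw wv vw1 GG; case: t' => hv' hw' wv' vw1' GG'.
have H := @nm_le_int R N (fun s => w s * v' s) (fun s => w s * (ray A x s - ray A' x s) * v' s)
  (fun s => C * C * nm (ray A x s - ray A' x s)) L L_1 dd _ _ _ _.
have -> : g x - g' x = v 1 * (w L * v' L - w 1 * v' 1).
  rewrite gx gx' (vw1 _ (lexx L)).2 (vw1' _ (lexx L)).1 mul1r mulrBr mulr1 mulrA.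
  have -> : v 1 * w 1 = 1 by rewrite -mulmxE; apply: mulmx1C; exact: wv.
  by rewrite mul1r.
apply: (@le_trans _ _ (C%:E * (nm (w L * v' L - w 1 * v' 1))%:E)%E).
  rewrite -EFinM lee_fin (le_trans (nmM _ _))// ler_wpM2r ?nm_ge0// hC//.
  exact: (GG 1).1.
apply: lee_wpmul2l; first by rewrite lee_fin ltW.
apply: H.
- have cn : continuous (fun s => nm (ray A x s - ray A' x s)).
    by apply: cts_nm; apply: cts_add; [|apply: cts_opp]; exact: ray_cts.
  by move=> s; exact: (cvgM (cvg_cst _) (cn s)).
- by move=> s; rewrite mulr_ge0 ?nm_ge0// mulr_ge0// ltW.
- by move=> s Ls; rewrite (ray0 vA Ls) (ray0 vA' Ls) subrr nm0 mulr0.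
- by move=> s _; apply: nm3; [exact: (GG s).2|exact: (GG' s).1].
Qed.

(** Duhamel's formula for two rays: the ray components are Lipschitz in the ray. *)
Lemma transport_lipschitz A x L : test_form A -> 1 < L -> exists2 Q, 0 <= Q &
  forall y v w v' w', transport A x v w L -> transport A y v' w' L ->
    forall s, 1 <= s <= L -> nm (v' s - v s) <= Q * l1n (y - x).
Proof.
move=> tA L1; have [K [K0 bA _ lA _]] := form_bounds tA.
pose D := C * C * (l1n x * K * L + K).
have L0 : 0 < L by apply: lt_trans L1.
have D0 : 0 <= D by rewrite !mulr_ge0 ?addr_ge0 ?mulr_ge0 ?l1n_ge0// ltW.
exists (C * (D * L)); first by rewrite mulr_ge0 ?(ltW C0)// mulr_ge0// ltW.
move=> y v w v' w' tr tr'; have hE := duhamel_derive tr tr'.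
move: tr tr' => [hv hw wv vw1 GG] [hv' hw' wv' vw1' GG'] s /andP[s1 sL].
have bR t : 1 <= t <= L -> nm (ray A x t - ray A y t) <= (l1n x * K * L + K) * l1n (y - x).
  move=> /andP[t1 tL].
  have t0 : 0 <= t by apply: le_trans t1.
  have -> : ray A x t - ray A y t = - (\sum_j x ord0 j *: (A j (t *: y) - A j (t *: x)) +
      \sum_j (y - x) ord0 j *: A j (t *: y)).
    rewrite -big_split/= /ray -sumrB -sumrN; apply: eq_bigr => j _.
    by rewrite !mxE scalerBr scalerBl; set a := _ *: _; set b := _ *: _; set c := _ *: _;
       apply/matrixP => ? ?; rewrite !mxE; ring.
  rewrite nmN (le_trans (nmD _ _))// mulrDl lerD//; last first.
    by apply: (le_trans (nm_sum_le _ (fun j => bA j _))); rewrite mulrC.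
  apply: (@le_trans _ _ (l1n x * (K * (t * l1n (y - x))))).
    apply: nm_sum_le => j; apply: (le_trans (lA _ _ _)).
    by rewrite -scalerBr l1nZ ger0_norm.
  rewrite -!mulrA ler_wpM2l ?l1n_ge0// ler_wpM2l ?(ltW K0)//.
  by rewrite ler_wpM2r// l1n_ge0.
have H := @nm_mvt _ _ (fun s => w s * v' s) _ (D * l1n (y - x)) s L sL (fun t _ => hE t) _.
have -> : v' s - v s = v s * (- (w L * v' L - w s * v' s)).
  rewrite (vw1 _ (lexx L)).2 (vw1' _ (lexx L)).1 mul1r opprB mulrBr mulr1 mulrA.
  have -> : v s * w s = 1 by rewrite -mulmxE; apply: mulmx1C; exact: wv.
  by rewrite mul1r.
apply: (le_trans (nmM _ _)); rewrite nmN -mulrA; apply: ler_pM; rewrite ?nm_ge0//.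
  by apply: hC; exact: (GG s).1.
apply: (le_trans (H _)).
  move=> t /andP[st tL]; apply: (le_trans (nm3 _ (GG t).2 (GG' t).1)).
  rewrite /D -[X in _ <= X]mulrA ler_wpM2l ?mulr_ge0 ?(ltW C0)//; apply: bR.
  by rewrite tL (le_trans s1).
rewrite mulrAC ler_wpM2r ?l1n_ge0// ler_wpM2l//.
by have := le_trans ler01 s1; lra.
Qed.

Lemma gauge_continuous A g x a b : test_form A -> is_gauge A g -> x != 0 ->
  {for x, continuous (fun y => g y a b)}.
Proof.
move=> tA gA x0; have [L [d [L1 d0 vx hL]]] := common_length tA x0.
have [Q Q0 hQ] := @transport_lipschitz A x L tA L1.
have [v [w [t gx]]] := gA x L x0 L1 vx.
have key y : `|y - x| <= d -> `|g y a b - g x a b| <= Q * l1n (y - x).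
  move=> yd; have [y0 vy] := hL y yd.
  have [v' [w' [t' gy]]] := gA y L y0 L1 vy.
  have := hQ y v w v' w' t t' 1; rewrite lexx (ltW L1) -gx -gy => /(_ isT).
  by apply: le_trans; apply: le_trans (le_nm _ a b); rewrite !mxE.
exact: lipschitz_continuous_at d0 Q0 key.
Qed.

(** With v the transport along the ray of x and w its inverse, b i s = s (A^g)_i(s x) satisfies
    (b i)' = w F_i v, where F_i is the curvature contracted with the ray and e_i: the
    component of A along the ray is 0 in the gauge, so only one term of the curvature is left.
    As b vanishes for large s, it is the integral of - w F_i v over the rest of the ray, and
    X i = b i 1. That g has these derivatives is Duhamel's formula for the rays of x + h e_i
    and x, with an error of order h^2. *)
Lemma gauge_derive A g x : test_form A -> is_gauge A g -> x != 0 ->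
  exists X : 'I_n -> mat, [/\
    forall i a b, is_derive x (ed i) (fun y => g y a b) ((g x * X i - A i x * g x) a b),
    forall i, ((nm (X i))%:E <= \int[lebesgue_measure]_(s in `[1%R, +oo[)
      (C * C * nm (\sum_j (s *: x) ord0 j *: curv A j i (s *: x)))%:E)%E,
    \sum_i x ord0 i *: X i = 0 &
    vanish A x 1 -> g x = 1 /\ forall i, X i = 0].
Proof.
move=> tA gA x0; have [K [K0 bA bdA lA taA]] := form_bounds tA.
have [L [d [L1 d0 vx hL]]] := common_length tA x0.
have [Q Q0 hQ] := @transport_lipschitz A x L tA L1.
have [v [w [t gx]]] := gA x L x0 L1 vx.
have L0 : 0 < L by apply: lt_trans L1.
have := t; move=> [hv hw wv vw1 GG].
have vw s : v s * w s = 1 by rewrite -mulmxE; apply: mulmx1C; exact: wv.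
have cv : cts v by exact: isD_cts hv.
have cw : cts w by exact: isD_cts hw.
(* the derivative of the ray component in the direction i *)
pose c i s := A i (s *: x) + s *: \sum_j x ord0 j *: dmx i (A j) (s *: x).
have cid : continuous (fun s : R => s) by move=> s; exact: cvg_id.
have cc i : cts (c i).
  apply: cts_add; first exact: line_cts.
  apply: cts_scale => //; apply: cts_sum => j; apply: cts_scale; first exact: cst_cts.
  exact: line_cts_dmx.
have c0 i s : L <= s -> c i s = 0.
  move=> Ls; rewrite /c (vx s Ls i).1 big1 ?scaler0 ?addr0// => j _.
  by rewrite (vx s Ls j).2 scaler0.
have /choice[J hJ] : forall i, exists J : R -> mat,
    (forall s, isD J (- (w s * c i s * v s)) s) /\ J L = 0.
  move=> i.
  have [||P [hP P0]] := @primitive_mx _ _ (fun s => w (L - s) * c i (L - s) * v (L - s)).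
  - move=> a b; apply: (continuous_rev (f := fun s => (w s * c i s * v s) a b)).
    by apply: cts_mul => //; exact: cts_mul.
  - by move=> s s0; rewrite c0 ?mulr0 ?mul0r// lerBrDr gerDl.
  exists (fun s => P (L - s)); split; last by rewrite subrr P0.
  by move=> s; apply: (isD_eq (isD_rev (hP (L - s)))) => //; rewrite subKr.
pose F i s := \sum_j (s *: x) ord0 j *: curv A j i (s *: x).
pose b i s := J i s + s *: (w s * A i (s *: x) * v s).
have FE i s : F i s = s *: (\sum_k x ord0 k *: dmx k (A i) (s *: x)
    - \sum_j x ord0 j *: dmx i (A j) (s *: x)
    + (ray A x s * A i (s *: x) - A i (s *: x) * ray A x s)).
  rewrite /F /ray mulr_suml mulr_sumr -!sumrB -big_split/= scaler_sumr.
  apply: eq_bigr => j _; rewrite mxE -scalerA; congr (_ *: _).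
  by rewrite /curv scalerDr !scalerBr -scalerAl -scalerAr.
have hb i s : isD (b i) (w s * F i s * v s) s.
  have h1 := isD_mul (isD_mul (hw s) (line_isD i x s tA)) (hv s).
  have h2 : isD (fun s => s *: (w s * A i (s *: x) * v s)) (s *: (w s * A i (s *: x) *
      - (ray A x s * v s) + (w s * (\sum_k x ord0 k *: dmx k (A i) (s *: x)) +
        w s * ray A x s * A i (s *: x)) * v s) + w s * A i (s *: x) * v s) s.
    move=> p q.
    apply: (isd_eq (isd_mul (is_derive_id s (1 : R)) (h1 p q))) => [r|].
      by rewrite [RHS]mxE.
    by rewrite mul1r [RHS]mxE [X in _ = X + _]mxE.
  apply: (isD_eq (isD_add ((hJ i).1 s) h2)) => //.
  rewrite FE /c.
  set D1 := \sum_k x ord0 k *: dmx k (A i) (s *: x).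
  set D2 := \sum_j x ord0 j *: dmx i (A j) (s *: x); set a := ray A x s.
  set Ai := A i _; set W := w s; set U := v s.
  rewrite -!(scalerAl, scalerAr) !(mulrDr, mulrDl, mulrN, mulNr, scalerDr, scalerN) -!(scalerAl, scalerAr) !mulrA.
  move: (W * Ai * U) (W * D1 * U) (W * D2 * U) (W * a * Ai * U) (W * Ai * a * U).
  by move=> X1 X2 X3 X4 X5; apply/matrixP => p q; rewrite !mxE; ring.
have bL i : b i L = 0 by rewrite /b (hJ i).2 (vx L (lexx L) i).1 mulr0 mul0r scaler0 addr0.
have F0 i s : L <= s -> F i s = 0.
  move=> Ls; apply: big1 => j _; rewrite /curv !(vx s Ls _).2 !(vx s Ls _).1.
  by rewrite !mul0r !subrr addr0 scaler0.
exists (fun i => b i 1); split.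
- move=> i p q.
  pose M := C * C * (l1n x * (K * L ^+ 2) + K * L) + C * (K + L * (l1n x * K)) * Q.
  pose r := Num.min d 1.
  have r0 : 0 < r by rewrite lt_min d0 ltr01.
  suff H h : `|h| <= r -> nm (g (h *: ed i + x) - g x - h *: (g x * J i 1)) <= C * (M * (L - 1)) * h ^+ 2.
    have EX : g x * b i 1 - A i x * g x = g x * J i 1.
      rewrite /b scale1r mulrDr -gx mulrA mulrA scale1r.
      have -> : g x * w 1 = 1 by rewrite gx vw.
      by rewrite mul1r addrK.
    rewrite EX; apply/is_derive_line0.
    apply: (@derive_of_expand _ _ _ _ (C * (M * (L - 1))) r r0) => h hr.
    rewrite addr0 scale0r add0r; apply: le_trans (H h hr).
    by apply: le_trans (le_nm _ p q); rewrite !mxE.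
  move=> hr; set x' := h *: ed i + x.
  have xx' : x' - x = h *: ed i by rewrite /x' addrK.
  have xd : `|x' - x| <= d.
    rewrite xx' normrZ; apply: (@le_trans _ _ (`|h| * 1)).
      by rewrite ler_wpM2l// (le_trans (norm_le_l1n _))// l1n_ed.
    by rewrite mulr1 (le_trans hr)// /r ge_min lexx.
  have [x'0 vx'] := hL x' xd.
  have [v' [w' [t' gx']]] := gA x' L x'0 L1 vx'.
  have := t'; move=> [hv' hw' wv' vw1' GG'].
  have l1h : l1n (x' - x) = `|h| by rewrite xx' l1nZ l1n_ed mulr1.
  pose E s := w s * v' s - 1 - h *: J i s.
  pose E' s := - (w s * (ray A x' s - ray A x s - h *: c i s) * v' s)
     - h *: (w s * c i s * (v' s - v s)).
  have hE s : isD E (E' s) s.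
    have h1 := isD_sub (isD_sub (duhamel_derive t t' s) (isD_cst 1 s)) (isD_scale h ((hJ i).1 s)).
    apply: (isD_eq h1) => //; rewrite /E'.
    rewrite !(mulrDr, mulrDl, mulrN, mulNr, scalerDr, scalerN, opprD, opprK) -!(scalerAl, scalerAr) ?mulrA.
    move: (w s * ray A x s * v' s) (w s * ray A x' s * v' s) (w s * c i s * v' s) (w s * c i s * v s).
    rewrite -?scalerAl.
    by move=> X1 X2 X3 X4; apply/matrixP => a1 b1; rewrite !mxE; ring.
  have bE s : 1 <= s <= L -> nm (E' s) <= M * h ^+ 2.
    move=> /andP[s1 sL]; have s0 : 0 <= s by apply: le_trans s1.
    have h2 : `|h| * `|h| = h ^+ 2 by rewrite -expr2 real_normK// num_real.
    have bc : nm (c i s) <= K + L * (l1n x * K).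
      apply: (le_trans (nmD _ _)); apply: lerD => //; rewrite nmZ ger0_norm//.
      by apply: ler_pM => //; [exact: nm_ge0|exact: nm_sum_le].
    have br : nm (ray A x' s - ray A x s - h *: c i s) <= (l1n x * (K * L ^+ 2) + K * L) * h ^+ 2.
      have -> : ray A x' s - ray A x s - h *: c i s =
          \sum_j x ord0 j *: (A j (s *: x') - A j (s *: x) - \sum_k (s *: x' - s *: x) ord0 k *: dmx k (A j) (s *: x))
          + h *: (A i (s *: x') - A i (s *: x)).
        have E1 j : \sum_k (s *: x' - s *: x) ord0 k *: dmx k (A j) (s *: x) =
            (s * h) *: dmx i (A j) (s *: x).
          by rewrite -scalerBr xx' scalerA sum_ed0.
        under [in RHS]eq_bigr do rewrite E1 !scalerBr.
        rewrite !sumrB {1}/ray /x' sum_ed -/x' /c.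
        have -> : \sum_j x ord0 j *: ((s * h) *: dmx i (A j) (s *: x)) =
            h *: (s *: \sum_j x ord0 j *: dmx i (A j) (s *: x)).
          rewrite !scaler_sumr; apply: eq_bigr => j _; rewrite !scalerA; congr (_ *: _); ring.
        rewrite -/(ray A x s) !scalerDr !scalerN.
        move: (\sum_j x ord0 j *: A j (s *: x')) (ray A x s) (A i (s *: x')) (A i (s *: x)).
        move: (s *: \sum_j _) => X1 X2 X3 X4 X5.
        by apply/matrixP => a1 b1; rewrite !mxE; ring.
      apply: (le_trans (nmD _ _)); rewrite mulrDl; apply: lerD.
        rewrite -mulrA; apply: nm_sum_le => j; apply: (le_trans (taA _ _ _)).
        rewrite -scalerBr l1nZ l1h ger0_norm// exprMn [X in s ^+ 2 * X]expr2 h2 mulrA.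
        rewrite ler_wpM2r ?sqr_ge0// ler_wpM2l ?(ltW K0)//.
        by rewrite !expr2 ler_pM.
      rewrite nmZ; apply: (@le_trans _ _ (`|h| * (K * (L * `|h|)))); last first.
        by rewrite !mulrA [`|h| * K]mulrC -!mulrA [`|h| * (L * _)]mulrCA h2.
      rewrite ler_wpM2l//; apply: (le_trans (lA _ _ _)).
      rewrite -scalerBr l1nZ l1h ger0_norm// ler_wpM2l ?(ltW K0)//.
      by rewrite ler_wpM2r.
    rewrite /E' (le_trans (nmB _ _))// nmN /M mulrDl; apply: lerD.
      by apply: (le_trans (nm3 _ (GG s).2 (GG' s).1)); rewrite -[X in _ <= X]mulrA ler_wpM2l// mulr_ge0// ltW.
    rewrite nmZ; apply: (@le_trans _ _ (`|h| * (C * (K + L * (l1n x * K)) * (Q * `|h|)))); last first.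
      by rewrite -h2; apply: le_of_eq; ring.
    rewrite ler_wpM2l//; apply: (le_trans (nmM _ _)); apply: ler_pM; rewrite ?nm_ge0//.
      apply: (le_trans (nmM _ _)); apply: ler_pM; rewrite ?nm_ge0//.
      by apply: hC; exact: (GG s).2.
    by rewrite -l1h; apply: (hQ x' v w v' w' t t'); rewrite s1.
  have EL : E L = 0.
    by rewrite /E (vw1 _ (lexx L)).2 (vw1' _ (lexx L)).1 (hJ i).2 scaler0 mulr1 subr0 subrr.
  have H := @nm_mvt _ _ E E' (M * h ^+ 2) 1 L (ltW L1) (fun s _ => hE s) bE.
  have -> : g x' - g x - h *: (g x * J i 1) = v 1 * E 1.
    by rewrite gx gx' /E !mulrBr mulr1 mulrA vw mul1r -scalerAr.
  apply: (le_trans (nmM _ _)); rewrite -mulrA; apply: ler_pM; rewrite ?nm_ge0//.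
    by apply: hC; exact: (GG 1).1.
  by move: H; rewrite EL sub0r nmN mulrAC.
- move=> i.
  have H := @nm_le_int R N (b i) (fun s => w s * F i s * v s)
    (fun s => C * C * nm (F i s)) L L1 (hb i).
  have -> : nm (b i 1) = nm (b i L - b i 1) by rewrite bL sub0r nmN.
  apply: H.
  + have cn : continuous (fun s => nm (F i s)).
      apply: cts_nm; apply: cts_sum => j; apply: cts_scale; last exact: curv_cts.
      rewrite (_ : (fun s => _) = (fun s : R => s * x ord0 j)); last first.
        by apply/funext => s; rewrite mxE.
      by move=> s; exact: (cvgM (cid s) (cvg_cst _)).
    by move=> s; exact: (cvgM (cvg_cst _) (cn s)).
  + by move=> s; rewrite mulr_ge0 ?nm_ge0// mulr_ge0// ltW.
  + by move=> s Ls; rewrite F0// nm0 mulr0.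
  + by move=> s _; apply: nm3; [exact: (GG s).2|exact: (GG s).1].
- have h s : isD (fun s => \sum_i x ord0 i *: b i s) 0 s.
    have h1 : isD (fun s => \sum_i x ord0 i *: b i s)
        (\sum_i x ord0 i *: (w s * F i s * v s)) s.
      move=> p q.
      apply: (isd_eq (isd_sum (fun i => is_deriveZ (x ord0 i) (hb i s p q)))) => [r|].
        by rewrite summxE; apply: eq_bigr => i _; rewrite mxE.
      by rewrite summxE; apply: eq_bigr => i _; rewrite [RHS]mxE.
    apply: (isD_eq h1) => //.
    have -> : \sum_i x ord0 i *: (w s * F i s * v s) =
        w s * (s *: \sum_i x ord0 i *: \sum_j x ord0 j *: curv A j i (s *: x)) * v s.
      rewrite scaler_sumr mulr_sumr mulr_suml; apply: eq_bigr => i _.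
      rewrite scalerA mulrC -scalerA -scalerAr -scalerAl; congr (_ *: (_ * _ * _)).
      by rewrite scaler_sumr; apply: eq_bigr => j _; rewrite mxE scalerA.
    by rewrite curv_radial scaler0 mulr0 mul0r.
  rewrite (isD0_cst 1 L h); apply: big1 => i _; by rewrite bL scaler0.
- move=> vx1.
  have v1L : v 1 = v L.
    apply/eqP; rewrite eq_sym -subr_eq0; apply/eqP/nm_eq0.
    apply: (le_trans (@nm_mvt _ _ v _ 0 1 L (ltW L1) (fun s _ => hv s) _)); last by rewrite mul0r.
    by move=> s /andP[s1 _]; rewrite (ray0 vx1 s1) mul0r oppr0 nm0.
  split=> [|i]; first by rewrite gx v1L (vw1 L (lexx L)).1.
  apply: nm_eq0; have -> : nm (b i 1) = nm (b i L - b i 1) by rewrite bL sub0r nmN.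
  apply: (le_trans (@nm_mvt _ _ (b i) _ 0 1 L (ltW L1) (fun s _ => hb i s) _)); last by rewrite mul0r.
  move=> s /andP[s1 _]; rewrite [F i s]big1 ?mulr0 ?mul0r ?nm0// => j _.
  by rewrite /curv !(vx1 s s1 _).2 !(vx1 s s1 _).1 !mul0r !subrr addr0 scaler0.
Qed.

Lemma gauge_derive_lie A g x i X : lie_form A -> (forall y, G (g y)) ->
  (forall a b, is_derive x (ed i) (fun y => g y a b) ((g x * X - A i x * g x) a b)) ->
  lie_algebra G X.
Proof.
move=> lA Gg hX.
have h : isD (fun s => g (s *: ed i + x)) (g x * X - A i x * g x) 0.
  by move=> a b; exact/is_derive_line0.
have := lie_curve hG (fun s => Gg (s *: ed i + x)) h.
rewrite scale0r add0r => H.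
have u := group_unit hG (Gg x).
have -> : X = (g x)^-1 * (g x * X - A i x * g x) + (g x)^-1 * A i x * g x.
  by rewrite mulrBr mulKr// mulrA subrK.
by apply: (lieD hG H); apply: lie_Ad.
Qed.

End ray_gauge.

(** * Integration along rays *)
Section rays.
Context {R : realType} (n : nat).
Notation V := 'rV[R]_n.
Notation mu := (lebesgue_rV n).
Notation leb := (@lebesgue_measure R).
Implicit Types (f g : V -> R) (x : V).

Definition T f x : \bar R := (\int[leb]_(s in `[1%R, +oo[) (f (s *: x))%:E)%E.

Lemma measurable_dilation : measurable_fun [set: V * measurableTypeR R]
  (fun p => p.2 *: p.1 : V).
Proof.
apply: measurable_fun_rV => i; under eq_fun do rewrite !mxE.
apply: measurable_funM; first exact: measurable_snd.
exact: (measurableT_comp (measurable_coord i) measurable_fst).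
Qed.

Lemma mf_ray f x : mf f -> measurable_fun [set: measurableTypeR R] (fun s : R => f (s *: x)).
Proof.
move=> hf; apply: (measurableT_comp hf).
apply: measurable_fun_rV => i; under eq_fun do rewrite !mxE.
by apply: measurable_funM; [exact: measurable_id|exact: measurable_cst].
Qed.

Lemma T_ge0 f x : (forall y, 0 <= f y) -> (0 <= T f x)%E.
Proof. by move=> f0; apply: integral_ge0 => s _; rewrite lee_fin. Qed.

Lemma le_T f g x : mf f -> mf g -> (forall y, 0 <= f y) -> (forall y, f y <= g y) ->
  (T f x <= T g x)%E.
Proof.
move=> hf hg f0 fg; apply: ge0_le_integral => //.
- by move=> s _; rewrite lee_fin.
- by apply/measurable_EFinP; apply: measurable_funTS; exact: mf_ray.
- by apply/measurable_EFinP; apply: measurable_funTS; exact: mf_ray.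
- by move=> s _; rewrite lee_fin.
Qed.

Lemma TD f g x : mf f -> mf g -> (forall y, 0 <= f y) -> (forall y, 0 <= g y) ->
  T (fun y => f y + g y) x = (T f x + T g x)%E.
Proof.
move=> hf hg f0 g0; rewrite /T -ge0_integralD//.
- by move=> s _; rewrite lee_fin.
- by apply/measurable_EFinP; apply: measurable_funTS; exact: mf_ray.
- by move=> s _; rewrite lee_fin.
- by apply/measurable_EFinP; apply: measurable_funTS; exact: mf_ray.
Qed.

Lemma TZ (c : R) f x : mf f -> (forall y, 0 <= f y) -> 0 <= c ->
  T (fun y => c * f y) x = (c%:E * T f x)%E.
Proof.
move=> hf f0 c0; rewrite /T -ge0_integralZl//.
- by apply/measurable_EFinP; apply: measurable_funTS; exact: mf_ray.
- by move=> s _; rewrite lee_fin.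
Qed.

Lemma continuous_inv_pow (p : nat) :
  {within `[1%R, +oo[%classic, continuous (fun s : R => s ^- p)}.
Proof.
apply: continuous_in_subspaceT => s; rewrite inE/= in_itv/= andbT => s1.
have sn : s != 0 by rewrite gt_eqF// (lt_le_trans ltr01).
apply: (@cvgV _ _ _ _ (fun s => s ^+ p)); first by rewrite expf_neq0.
exact: exprn_continuous.
Qed.

Lemma measurable_inv_pow (p : nat) :
  measurable_fun (`[1%R, +oo[%classic : set (measurableTypeR R)) (fun s : R => s ^- p).
Proof.
by apply: subspace_continuous_measurable_fun; [exact: measurable_itv|exact: continuous_inv_pow].
Qed.

Lemma integral_inv_sqr : (\int[leb]_(s in `[1%R, +oo[) (s ^- 2)%:E <= 1)%E.
Proof.
have d (s : R) : 0 < s -> is_derive s (1 : R) (fun s => - s^-1) (s ^- 2).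
  move=> s0; have sn : s != 0 by rewrite gt_eqF.
  have h := is_deriveN (@is_deriveV _ (fun s : R => s) s 1 1 sn (is_derive_id s 1)).
  apply: (is_derive_eq h).
  by rewrite /GRing.scale/= mulr1 opprK.
rewrite (@ge0_continuous_FTC2y R (fun s => s ^- 2) (fun s => - s^-1) 1 0).
- by rewrite invr1 -EFinB sub0r opprK.
- by move=> s s1; rewrite invr_ge0 exprn_ge0// (le_trans ler01).
- exact: continuous_inv_pow.
- apply/cvgrPdist_le => e e0; near=> s.
  have s0 : 0 < s by near: s; exact: nbhs_pinfty_gt.
  have es : e^-1 <= s by near: s; apply: nbhs_pinfty_ge; exact: num_real.
  have si0 : 0 <= s^-1 by rewrite invr_ge0 ltW.
  rewrite sub0r opprK (ger0_norm si0) -[e]invrK lef_pV2 ?posrE ?invr_gt0 //.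
- by move=> s s1; case: (d s (lt_trans ltr01 s1)).
- have [h _] := d 1 ltr01.
  have c : {for (1 : R), continuous (fun s : R => - s^-1)}.
    by apply: differentiable_continuous; apply/derivable1_diffP.
  exact: cvg_at_right_filter c.
- move=> s; rewrite in_itv/= andbT => s1; rewrite derive1E.
  by case: (d s (lt_trans ltr01 s1)).
Unshelve. all: by end_near. Qed.

(** Dilating by s multiplies integrals by s^-n, which is integrable at infinity:
    this is what replaces polar coordinates. *)
Lemma ray_integral (p : nat) f : (p + 2 <= n)%N -> mf f -> (forall y, 0 <= f y) ->
  measurable_fun setT (fun x => \int[leb]_(s in `[1%R, +oo[) (s ^+ p * f (s *: x))%:E)%E /\
  (\int[mu]_x (\int[leb]_(s in `[1%R, +oo[) (s ^+ p * f (s *: x))%:E) <= n1 mu f)%E.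
Proof.
move=> pn hf f0.
pose D : set R := `[1%R, +oo[%classic.
have mD : measurable (D : set (measurableTypeR R)) by exact: measurable_itv.
pose F (q : V * measurableTypeR R) : \bar R := (q.2 ^+ p * f (q.2 *: q.1) * \1_D q.2)%:E.
have mF : measurable_fun setT F.
  apply/measurable_EFinP; apply: measurable_funM; last first.
    exact: (measurableT_comp (measurable_indic mD) measurable_snd).
  apply: measurable_funM; last exact: (measurableT_comp hf measurable_dilation).
  exact: (measurableT_comp (exprn_measurable p) measurable_snd).
have F0 q : (0 <= F q)%E.
  rewrite lee_fin indicE; case: (boolP (q.2 \in D)) => [|_]; last by rewrite mulr0.
  rewrite inE /D/= in_itv/= andbT => q1; rewrite mulr1 mulr_ge0// exprn_ge0//.
  exact: le_trans ler01 q1.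
have E x : (\int[leb]_(s in `[1%R, +oo[) (s ^+ p * f (s *: x))%:E = \int[leb]_s F (x, s))%E.
  rewrite integral_mkcond; apply: eq_integral => s _; rewrite /F patchE indicE/=.
  by case: (s \in _); rewrite ?mulr1 ?mulr0.
have [m1 m2 sw] := tonelli_sigma_finite (@lebesgue_rV_sigma_finite R n)
   (@sigma_finiteT _ _ _ leb) mF F0.
split; first by under eq_fun do rewrite E; exact: m1.
under eq_integral do rewrite E.
rewrite sw; apply: (@le_trans _ _ (\int[leb]_(s in `[1%R, +oo[) ((s ^- 2)%:E * n1 mu f))%E); last first.
  rewrite ge0_integralZr//; last 3 first.
  - by apply/measurable_EFinP; exact: measurable_inv_pow.
  - by move=> s; rewrite /= in_itv/= andbT => s1; rewrite lee_fin invr_ge0 exprn_ge0// (le_trans ler01).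
  - exact: n1_ge0.
  rewrite -[leRHS]mul1e; apply: lee_wpmul2r; [exact: n1_ge0|exact: integral_inv_sqr].
rewrite [leRHS]integral_mkcond; apply: ge0_le_integral => //.
- by move=> s _; apply: integral_ge0 => x _; exact: F0.
- apply/(measurable_restrictT _ _).1 => //.
  apply: emeasurable_funM; last exact: measurable_cst.
  by apply/measurable_EFinP; exact: measurable_inv_pow.
move=> s _; rewrite patchE; case: ifP => hs; last first.
  rewrite (eq_integral (fun=> 0%E)) ?integral0// => x _.
  by rewrite /F/= indicE (_ : s \in D = false) ?mulr0.
move: (hs); rewrite inE/= in_itv/= andbT => s1.
have s0 : 0 < s by apply: lt_le_trans s1.
rewrite (eq_integral (fun x => (s ^+ p * f (affine s 0 x))%:E)); last first.
  by move=> x _; rewrite /F/= indicE (_ : s \in D)//= mulr1 /affine addr0.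
have -> : (\int[mu]_x (s ^+ p * f (affine s 0 x))%:E =
    n1 mu (fun x => s ^+ p * f (affine s 0 x))%R)%E.
  by apply: eq_integral => x _; rewrite ger0_norm// mulr_ge0// exprn_ge0// ltW.
have sn : s != 0 by rewrite gt_eqF.
rewrite (n1Z _ _ (mf_affine _ _ hf)) (n1_affine _ sn hf).
rewrite muleA; apply: lee_wpmul2r; first exact: n1_ge0.
rewrite -EFinM lee_fin !(ger0_norm (ltW s0)) ger0_norm ?exprn_ge0 ?(ltW s0)//.
rewrite -(subnK pn) addnCA exprD invfM mulrA mulfV ?expf_neq0 ?gt_eqF// mul1r.
rewrite addnC exprD invfM ler_piMr ?invr_ge0 ?exprn_ge0 ?(ltW s0)//.
by rewrite invf_le1 ?exprn_gt0// exprn_ege1.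
Qed.

(** Cauchy-Schwarz, in the form of its discriminant. *)
Lemma cauchy_schwarz_weight (D : set R) (f p q : R -> R) (t : R) :
  measurable (D : set (measurableTypeR R)) ->
  measurable_fun D f -> measurable_fun D p -> measurable_fun D q ->
  (forall s, D s -> [/\ 0 <= f s, 0 <= p s & 0 <= q s]) ->
  (forall c s, 0 <= c -> D s -> 2 * c * f s <= c ^+ 2 * p s + q s) ->
  (\int[leb]_(s in D) (p s)%:E <= 1)%E -> 0 <= t ->
  (t%:E <= \int[leb]_(s in D) (f s)%:E -> (t ^+ 2)%:E <= \int[leb]_(s in D) (q s)%:E)%E.
Proof.
move=> mD hf hp hq pos H ip t0 ht.
have [qfin|] := boolP (\int[leb]_(s in D) (q s)%:E < +oo)%E; last first.
  by rewrite -leNgt leye_eq => /eqP ->; rewrite leey.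
have ef : measurable_fun D (EFin \o f) by exact/measurable_EFinP.
have ep : measurable_fun D (EFin \o p) by exact/measurable_EFinP.
have eq_ : measurable_fun D (EFin \o q) by exact/measurable_EFinP.
have h1 : ((2 * t)%:E * \int[leb]_(s in D) (f s)%:E <=
   (t ^+ 2)%:E * \int[leb]_(s in D) (p s)%:E + \int[leb]_(s in D) (q s)%:E)%E.
  have f0 s : D s -> (0 <= (f s)%:E)%E by move=> /pos[h _ _]; rewrite lee_fin.
  have p0 s : D s -> (0 <= (p s)%:E)%E by move=> /pos[_ h _]; rewrite lee_fin.
  have t20 : (0 <= (t ^+ 2)%:E)%E by rewrite lee_fin sqr_ge0.
  have tt0 : (0 <= (2 * t)%:E)%E by rewrite lee_fin mulr_ge0.
  rewrite -(ge0_integralZl leb mD ef f0 tt0) -(ge0_integralZl leb mD ep p0 t20).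
  rewrite -ge0_integralD//; last 3 first.
  - by move=> s /pos[_ h _]; rewrite -EFinM lee_fin mulr_ge0 ?sqr_ge0.
  - exact: measurable_funeM.
  - by move=> s /pos[]; rewrite lee_fin.
  apply: ge0_le_integral => //.
  - by move=> s /pos[h _ _]; rewrite -EFinM lee_fin !mulr_ge0.
  - exact: measurable_funeM.
  - by apply: emeasurable_funD => //; exact: measurable_funeM.
  - by move=> s Ds; rewrite -!EFinM -EFinD lee_fin; exact: H.
have q0 : (0 <= \int[leb]_(s in D) (q s)%:E)%E.
  by apply: integral_ge0 => s /pos[]; rewrite lee_fin.
have h2 : ((2 * t)%:E * t%:E <= (t ^+ 2)%:E * 1 + \int[leb]_(s in D) (q s)%:E)%E.
  apply: (le_trans (lee_wpmul2l _ ht)); first by rewrite lee_fin mulr_ge0.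
  apply: (le_trans h1); rewrite leeD2r//; apply: lee_wpmul2l => //.
  by rewrite lee_fin sqr_ge0.
move: h2 q0 qfin; case: (integral _ _ _) => // r h2 _ _.
move: h2; rewrite mule1 -EFinM -EFinD !lee_fin expr2; lra.
Qed.

Definition Tr f x : R := fine (T f x).

Lemma T_meas f : (2 <= n)%N -> mf f -> (forall y, 0 <= f y) ->
  measurable_fun setT (T f) /\ (\int[mu]_x T f x <= n1 mu f)%E.
Proof.
move=> n2_ hf f0; have [] := @ray_integral 0 f n2_ hf f0.
rewrite (_ : (fun x => _) = T f) //.
by apply/funext => x; apply: eq_integral => s _; rewrite expr0 mul1r.
Qed.

Lemma mf_Tr f : (2 <= n)%N -> mf f -> (forall y, 0 <= f y) -> mf (Tr f).
Proof.
move=> n2_ hf f0; have [m _] := T_meas n2_ hf f0.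
exact: (measurableT_comp (fine_measurable measurableT) m).
Qed.

Lemma Tr_ge0 f x : (forall y, 0 <= f y) -> 0 <= Tr f x.
Proof. by move=> f0; apply: fine_ge0; exact: T_ge0. Qed.

Lemma Tr_le f x : (forall y, 0 <= f y) -> ((Tr f x)%:E <= T f x)%E.
Proof.
move=> f0; by have := T_ge0 x f0; rewrite /Tr; case: (T f x) => [r||]//= _; rewrite leey.
Qed.

Lemma Tr_fin f : (2 <= n)%N -> mf f -> (forall y, 0 <= f y) -> (n1 mu f < +oo)%E ->
  {ae mu, forall x, T f x = (Tr f x)%:E}.
Proof.
move=> n2_ hf f0 fin; have [m i] := T_meas n2_ hf f0.
have : mu.-integrable setT (T f).
  apply/integrableP; split => //.
  rewrite (eq_integral (T f)); first exact: le_lt_trans i fin.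
  by move=> x _; rewrite gee0_abs// T_ge0.
move=> /(integrable_ae measurableT); apply: filterS => x /(_ I) h.
by rewrite /Tr fineK.
Qed.

Lemma n1_Tr f : (2 <= n)%N -> mf f -> (forall y, 0 <= f y) -> (n1 mu (Tr f) <= n1 mu f)%E.
Proof.
move=> n2_ hf f0; have [m i] := T_meas n2_ hf f0; apply: le_trans i.
apply: ge0_le_integral => //.
- by apply: mfE; apply: mf_norm; exact: mf_Tr.
- by move=> x _; rewrite ger0_norm ?Tr_ge0//; exact: Tr_le.
Qed.

(** The inequality of Cauchy and Schwarz on each ray, with a weight w of integral at most 1:
    what is left to integrate is c s^p f(s x)^2, to which [ray_integral] applies. *)
Lemma n2_Tr_weight (c : R) (p : nat) (w : R -> V -> R) f : (2 <= n)%N -> (p + 2 <= n)%N ->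
  mf f -> (forall y, 0 <= f y) -> 0 <= c ->
  (forall x, measurable_fun (`[1%R, +oo[%classic : set (measurableTypeR R)) (w ^~ x)) ->
  (forall s x, 1 <= s -> 0 <= w s x) ->
  (forall a s x, 0 <= a -> 1 <= s ->
     2 * a * f (s *: x) <= a ^+ 2 * w s x + c * (s ^+ p * f (s *: x) ^+ 2)) ->
  (forall x, \int[leb]_(s in `[1%R, +oo[) (w s x)%:E <= 1)%E ->
  (n2 mu (Tr f) <= c%:E * n2 mu f)%E.
Proof.
move=> n2_ pn hf f0 c0 mw w0 H iw.
have hf2 : mf (fun y => f y ^+ 2) by exact: mfX.
have f20 y : 0 <= f y ^+ 2 by exact: sqr_ge0.
have [m i] := ray_integral pn hf2 f20.
have n12 : n1 mu (fun y => f y ^+ 2) = n2 mu f.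
  by apply: eq_integral => x _; rewrite ger0_norm.
rewrite -n12; apply: (@le_trans _ _ (\int[mu]_x (c%:E * \int[leb]_(s in `[1%R, +oo[) (s ^+ p * f (s *: x) ^+ 2)%:E))%E); last first.
  rewrite ge0_integralZl//; first by apply: lee_wpmul2l.
  move=> x _; apply: integral_ge0 => s; rewrite /= in_itv/= andbT => s1.
  by rewrite lee_fin mulr_ge0// exprn_ge0// (le_trans ler01).
have s1P (s : R) : `[1%R, +oo[%classic s -> 1 <= s by rewrite /= in_itv/= andbT.
apply: ge0_le_integral => //.
- by move=> x _; rewrite lee_fin sqr_ge0.
- by apply: mfE; apply: mfX; exact: mf_Tr.
- exact: measurable_funeM.
move=> x _; rewrite -ge0_integralZl//; last 2 first.
- apply/measurable_EFinP; apply: measurable_funTS; apply: measurable_funM.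
    exact: exprn_measurable.
  exact: (mf_ray x hf2).
- by move=> s /s1P s1; rewrite lee_fin mulr_ge0// exprn_ge0// (le_trans ler01).
under eq_integral do rewrite -EFinM.
apply: (@cauchy_schwarz_weight _ (fun s => f (s *: x)) (w ^~ x)) => //.
- by apply: measurable_funTS; exact: mf_ray.
- exact: mw.
- apply: measurable_funTS; apply: measurable_funM; first exact: measurable_cst.
  apply: measurable_funM; first exact: exprn_measurable.
  exact: (mf_ray x hf2).
- move=> s /s1P s1; split => //; first exact: w0.
  by rewrite mulr_ge0// mulr_ge0// exprn_ge0// (le_trans ler01).
- by move=> a s a0 /s1P s1; exact: H.
- exact: Tr_ge0.
- exact: Tr_le.
Qed.

(** The weight s^-2 leaves s^2 f(s x)^2, of finite integral in dimension at least 4. *)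
Lemma n2_Tr f : (4 <= n)%N -> mf f -> (forall y, 0 <= f y) -> (n2 mu (Tr f) <= n2 mu f)%E.
Proof.
move=> n4 hf f0; rewrite -[leRHS]mul1e.
apply: (@n2_Tr_weight 1 2 (fun s _ => s ^- 2)) => //.
- exact: leq_trans n4.
- by move=> _; exact: measurable_inv_pow.
- by move=> s _ s1; rewrite invr_ge0 exprn_ge0// (le_trans ler01).
- move=> a s x a0 s1; have s0 : 0 < s by apply: lt_le_trans s1.
  have := sqr_ge0 (a / s - s * f (s *: x)).
  have -> : (a / s - s * f (s *: x)) ^+ 2 =
    a ^+ 2 * s ^- 2 - 2 * a * f (s *: x) + s ^+ 2 * f (s *: x) ^+ 2 by field; rewrite gt_eqF.
  by rewrite mul1r; lra.
- by move=> _; exact: integral_inv_sqr.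
Qed.

Lemma enormZ (s : R) x : 0 <= s -> enorm (s *: x) = s * enorm x.
Proof.
move=> s0; rewrite /enorm (eq_bigr (fun i => s ^+ 2 * x ord0 i ^+ 2)).
  by rewrite -mulr_sumr sqrtrM ?sqr_ge0// sqrtr_sqr ger0_norm.
by move=> i _; rewrite mxE exprMn.
Qed.

(** A function carried by a thin shell meets every ray in a short segment. *)
Lemma n2_Tr_shell (d : R) f : (3 <= n)%N -> 0 < d -> d <= 1 / 2 -> mf f -> (forall y, 0 <= f y) ->
  (forall y, f y != 0 -> 1 - d <= enorm y <= 1) ->
  (n2 mu (Tr f) <= (2 * d)%:E * n2 mu f)%E.
Proof.
move=> n3 d0 d1 hf f0 fS.
pose S x : set R := [set s | 1 - d <= s * enorm x <= 1].
have mS x : measurable (S x : set (measurableTypeR R)).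
  have -> : S x = (fun s : R => s * enorm x) @^-1` `[1 - d, 1].
    by apply/seteqP; split=> s /=; rewrite in_itv.
  rewrite -[X in measurable X]setTI.
  by apply: measurable_funM.
have mw x : measurable_fun (`[1%R, +oo[%classic : set (measurableTypeR R))
    (fun s : R => \1_(S x) s * (2 * d * s)^-1).
  apply: measurable_funM; first by apply: measurable_funTS; exact: measurable_indic.
  have -> : (fun s : R => (2 * d * s)^-1) = (fun s : R => (2 * d)^-1 * s ^- 1).
    by apply/funext => s; rewrite invfM expr1.
  by apply: measurable_funM; [exact: measurable_cst|exact: measurable_inv_pow].
have w0 s x : 1 <= s -> 0 <= \1_(S x) s / (2 * d * s).
  move=> s1; apply: mulr_ge0 => //; rewrite invr_ge0 !mulr_ge0 ?(ltW d0)//.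
  exact: le_trans ler01 s1.
apply: (@n2_Tr_weight (2 * d) 1 (fun s x => \1_(S x) s * (2 * d * s)^-1)) => //.
- exact: leq_trans n3.
- by rewrite mulr_ge0// ltW.
- move=> a s x a0 s1; have s0 : 0 < s by apply: lt_le_trans s1.
  have [->|fn] := eqVneq (f (s *: x)) 0.
    rewrite mulr0 expr0n/= !mulr0 addr0; apply: mulr_ge0; first exact: sqr_ge0.
    by apply: mulr_ge0 => //; rewrite invr_ge0 !mulr_ge0// ltW.
  have Ss : s \in S x.
    by have := fS _ fn; rewrite (enormZ _ (ltW s0)) => h; rewrite inE.
  rewrite indicE Ss mul1r expr1.
  have h0 : 0 < 2 * d * s by rewrite !mulr_gt0.
  have : 0 <= (a - 2 * d * s * f (s *: x)) ^+ 2 / (2 * d * s).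
    by rewrite divr_ge0 ?sqr_ge0 ?ltW.
  have -> : (a - 2 * d * s * f (s *: x)) ^+ 2 / (2 * d * s) =
     a ^+ 2 * (2 * d * s)^-1 + 2 * d * (s * f (s *: x) ^+ 2) - 2 * a * f (s *: x).
    by field; rewrite !gt_eqF.
  by rewrite subr_ge0.
- move=> x; have [e0|e0] := leP (enorm x) 0.
    rewrite (eq_integral (fun=> 0%E)) ?integral0// => s.
    rewrite inE/= in_itv/= andbT => s1; rewrite indicE memNset ?mul0r//.
    rewrite /S/= => /andP[h _].
    have : s * enorm x <= 0 by rewrite mulr_ge0_le0// (le_trans ler01).
    by move: d1 h; lra.
  pose a := (1 - d) / enorm x; pose b := 1 / enorm x.
  have ab : a <= b by rewrite ler_pM2r ?invr_gt0//; lra.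
  apply: (@le_trans _ _ (\int[leb]_(s in `[a, b]) (enorm x / d)%:E)%E).
    rewrite integral_mkcond [leRHS]integral_mkcond; apply: ge0_le_integral => //.
    + move=> s _; rewrite patchE; case: ifP => // hs; rewrite lee_fin.
      move: hs; rewrite inE/= in_itv/= andbT => s1.
      exact: w0.
    + apply/(measurable_restrictT _ _).1 => //; apply/measurable_EFinP; exact: mw.
    + apply/(measurable_restrictT _ _).1 => //.
    + move=> s _; rewrite !patchE; case: ifP => hs; last first.
        by case: ifP => // _; rewrite lee_fin divr_ge0// ltW.
      move: hs; rewrite inE/= in_itv/= andbT => s1.
      have s0 : 0 < s by apply: lt_le_trans s1.
      rewrite indicE; case: (boolP (s \in S x)) => Ss; last first.
        by rewrite mul0r; case: ifP => // _; rewrite lee_fin divr_ge0// ltW.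
      rewrite inE /S/= in Ss; move: Ss => /andP[h1 h2].
      rewrite mem_set/=; last first.
        by rewrite in_itv/= /a /b ler_pdivrMr// h1 ler_pdivlMr.
      rewrite lee_fin mul1r -[leRHS]invrK lef_pV2 ?posrE ?invr_gt0 ?divr_gt0 ?mulr_gt0//.
      rewrite invf_div ler_pdivrMr//; move: h1 d1 d0; nra.
  rewrite integral_cst//= lebesgue_measure_itv/= lte_fin.
  case: ifP => _; last by rewrite mule0.
  rewrite -EFinB -EFinM lee_fin /a /b; apply: le_of_eq.
  by field; rewrite !gt_eqF.
Qed.

End rays.

(** * Radial cutoffs *)
Section cutoff.
Context {R : realType} (n : nat).
Notation V := 'rV[R]_n.
Implicit Types (x y : V).

Definition sq x : R := \sum_i x ord0 i ^+ 2.

Lemma sq_ge0 x : 0 <= sq x.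
Proof. by apply: sumr_ge0 => i _; exact: sqr_ge0. Qed.

Lemma enorm_sq x : enorm x ^+ 2 = sq x.
Proof. by rewrite /enorm sqr_sqrtr// sq_ge0. Qed.

Lemma enorm_ge0 x : 0 <= enorm x. Proof. exact: sqrtr_ge0. Qed.

Lemma le_enorm x (r : R) : 0 <= r -> (enorm x <= r) = (sq x <= r ^+ 2).
Proof.
by move=> r0; rewrite -enorm_sq -(ler_pXn2r (_ : (0 < 2)%N)) ?nnegrE ?enorm_ge0.
Qed.

Lemma ge_enorm x (r : R) : 0 <= r -> (r <= enorm x) = (r ^+ 2 <= sq x).
Proof.
by move=> r0; rewrite -enorm_sq -(ler_pXn2r (_ : (0 < 2)%N) r0 (enorm_ge0 x)).
Qed.

Lemma sqZ (s : R) x : sq (s *: x) = s ^+ 2 * sq x.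
Proof. by rewrite /sq mulr_sumr; apply: eq_bigr => i _; rewrite mxE exprMn. Qed.

Lemma entry_sq x i : x ord0 i ^+ 2 <= sq x.
Proof. by rewrite /sq (bigD1 i)//= lerDl sumr_ge0// => j _; exact: sqr_ge0. Qed.

Lemma entry_sq1 x i : sq x <= 1 -> `|x ord0 i| <= 1.
Proof.
move=> h; rewrite -(ler_pXn2r (_ : (0 < 2)%N)) ?nnegrE// real_normK ?num_real// expr1n.
exact: le_trans (entry_sq x i) h.
Qed.

Lemma Sm_sq : Sm (sq : V -> R).
Proof. by apply: Sm_sum => i; apply: Sm_mul; exact: Sm_coord. Qed.

Lemma sq_line x i (h : R) : sq (h *: ed i + x) = sq x + 2 * x ord0 i * h + h ^+ 2.
Proof.
rewrite /sq (bigD1 i)//= [in RHS](bigD1 i)//= line_entry eqxx.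
rewrite (eq_bigr (fun j => x ord0 j ^+ 2)); first by ring.
by move=> j ji; rewrite line_entry (negbTE ji) add0r.
Qed.

Lemma derive_sq x i : is_derive (0 : R) (1 : R) (fun h : R => sq (h *: ed i + x)) (2 * x ord0 i).
Proof.
have h1 := is_deriveZ (2 * x ord0 i) (is_derive_id (0 : R) (1 : R)).
have h2 := isd_mul (is_derive_id (0 : R) (1 : R)) (is_derive_id (0 : R) (1 : R)).
have h3 := is_deriveD (is_derive_cst (sq x) (0 : R) (1 : R)) (is_deriveD h1 h2).
apply: (isd_eq h3) => [h|].
  by rewrite sq_line /= !fctE /cst/= /GRing.scale/=; ring.
by rewrite /GRing.scale/=; ring.
Qed.

Lemma flat1_ge_half (s : R) : 2 <= s -> 1 / 2 <= flat 1 s.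
Proof.
move=> s2; have s0 : 0 < s by lra.
rewrite /flat s0 hornerC mul1r.
have : s^-1 <= 2^-1 by rewrite lef_pV2 ?posrE.
have := expR_ge1Dx (- s^-1); lra.
Qed.

Lemma flat_zero (p : {poly R}) (s : R) : s <= 0 -> flat p s = 0.
Proof. by move=> s0; rewrite /flat ltNge s0. Qed.

(** The profile: 1 for s <= 0 and 0 for s >= 2. *)
Definition step (s : R) : R := (flat 1 (1 / 2))^-1 * flat 1 (1 / 2 - flat 1 s).

Definition step' (s : R) : R :=
  (flat 1 (1 / 2))^-1 * (flat (flatD 1) (1 / 2 - flat 1 s) * - flat (flatD 1) s).

Lemma is_derive_step (s : R) : is_derive s (1 : R) step (step' s).
Proof.
have h1 : is_derive s (1 : R) (fun s => 1 / 2 - flat 1 s) (- flat (flatD 1) s).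
  apply: (isd_eq (is_deriveB (is_derive_cst (1 / 2 : R) s (1 : R)) (is_derive_flat 1 s))) => //.
  by rewrite sub0r.
have h2 := @is_derive1_comp R (flat 1) (fun s => 1 / 2 - flat 1 s) s _ _ (is_derive_flat 1 _) h1.
exact: is_deriveZ.
Qed.

Lemma step1 (s : R) : s <= 0 -> step s = 1.
Proof.
move=> s0; rewrite /step (flat_zero _ s0) subr0 mulVf// gt_eqF// flat1_gt0//; lra.
Qed.

Lemma step0 (s : R) : 2 <= s -> step s = 0.
Proof.
by move=> s2; rewrite /step (flat_zero _ (_ : 1 / 2 - flat 1 s <= 0)) ?mulr0// subr_le0 flat1_ge_half.
Qed.

Lemma step_bound : exists2 K : R, 0 < K & forall s, `|step s| <= K /\ `|step' s| <= K.
Proof.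
have [C C0 hC] := @flat_bound R (flatD 1).
pose k : R := (flat 1 (1 / 2))^-1.
have k0 : 0 < k by rewrite invr_gt0 flat1_gt0//; lra.
exists (k * (1 + C * (C * 2))).
  by rewrite mulr_gt0// ltr_pwDl// !mulr_ge0.
move=> s; split.
  rewrite /step normrM (gtr0_norm k0) ler_pM2l// ger0_norm ?flat1_ge0//.
  by apply: (le_trans (flat1_le1 _)); rewrite lerDl !mulr_ge0.
rewrite /step' normrM (gtr0_norm k0) ler_pM2l// normrM normrN.
have [s0|s0] := leP s 0.
  by rewrite (flat_zero (flatD 1) s0) normr0 mulr0 addr_ge0// !mulr_ge0.
have [s2|s2] := leP 2 s.
  rewrite (flat_zero _ (_ : 1 / 2 - flat 1 s <= 0)) ?subr_le0 ?flat1_ge_half//.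
  by rewrite normr0 mul0r addr_ge0// !mulr_ge0.
apply: (@le_trans _ _ (C * (C * 2))); last by rewrite lerDr.
apply: ler_pM => //.
  apply: (le_trans (hC _)); rewrite ler_piMr//.
  have := flat1_ge0 s; have := flat1_le1 s => h1 h2.
  by rewrite ler_norml; apply/andP; split; lra.
by apply: (le_trans (hC _)); rewrite ler_wpM2l// gtr0_norm// ltW.
Qed.

Definition chi (d : R) x : R := step ((3 - 3 / d) + 3 / d * sq x).

Lemma Sm_chi d : Sm (chi d).
Proof.
apply: Sm_mul; first exact: Sm_cst.
apply: Sm_flat; have -> : (fun x : V => 1 / 2 - flat 1 (3 - 3 / d + 3 / d * sq x)) =
    (fun x => 1 / 2 + (-1) * flat 1 ((3 - 3 / d) + 3 / d * sq x)).
  by apply/funext => x; rewrite mulN1r.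
apply: Sm_add; first exact: Sm_cst.
apply: Sm_mul; first exact: Sm_cst.
apply: Sm_flat; apply: Sm_add; first exact: Sm_cst.
by apply: Sm_mul; [exact: Sm_cst|exact: Sm_sq].
Qed.

Lemma partial_chi d i x : partial i (chi d) x =
  step' ((3 - 3 / d) + 3 / d * sq x) * (3 / d * (2 * x ord0 i)).
Proof.
apply: is_derive_partial; apply/is_derive_line0.
have h1 : is_derive (0 : R) (1 : R) (fun h : R => (3 - 3 / d) + 3 / d * sq (h *: ed i + x))
    (3 / d * (2 * x ord0 i)).
  apply: (isd_eq (is_deriveD (is_derive_cst (3 - 3 / d) (0 : R) (1 : R))
    (is_deriveZ (3 / d) (derive_sq x i)))) => //.
  by rewrite add0r.
have E : 3 - 3 / d + 3 / d * sq x = (fun h : R => (3 - 3 / d) + 3 / d * sq (h *: ed i + x)) 0.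
  by rewrite /= scale0r add0r.
rewrite E; apply: is_derive1_comp h1; exact: is_derive_step.
Qed.

Section fixed_scale.
Variable d : R.
Hypotheses (d0 : 0 < d) (d1 : d <= 1 / 2).

Lemma chi1 x : enorm x <= 1 - d -> chi d x = 1.
Proof.
rewrite le_enorm; last by move: d1; lra.
move=> h; apply: step1; have -> : 3 - 3 / d + 3 / d * sq x = (d - 1 + sq x) * (3 / d).
  by field; rewrite gt_eqF.
rewrite mulr_le0_ge0 ?divr_ge0 ?ltW//; move: d1 d0 h; nra.
Qed.

Lemma chi0 x : 1 - d / 3 <= sq x -> chi d x = 0.
Proof.
move=> h; apply: step0; have -> : 3 - 3 / d + 3 / d * sq x = 2 + (sq x - (1 - d / 3)) * (3 / d).
  by field; rewrite gt_eqF.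
by rewrite lerDl mulr_ge0 ?subr_ge0// divr_ge0// ltW.
Qed.

Lemma partial_chi0 i x : ~~ (1 - d <= enorm x <= 1) -> partial i (chi d) x = 0.
Proof.
rewrite partial_chi negb_and -!ltNge => /orP[h|h].
  have h1 : sq x <= (1 - d) ^+ 2.
    by rewrite -le_enorm ?ltW//; move: d1; lra.
  have s0 : 3 - 3 / d + 3 / d * sq x <= 0.
    have -> : 3 - 3 / d + 3 / d * sq x = (d - 1 + sq x) * (3 / d) by field; rewrite gt_eqF.
    rewrite mulr_le0_ge0 ?divr_ge0 ?ltW//; move: d1 d0 h1; nra.
  by rewrite /step' (flat_zero (flatD 1) s0) oppr0 !mulr0 mul0r.
have h1 : 1 <= sq x by rewrite -[1](expr1n _ 2) -ge_enorm// ltW.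
rewrite /step' [flat (flatD 1) (1 / 2 - _)]flat_zero ?mul0r ?mulr0 ?mul0r//.
rewrite subr_le0; apply: flat1_ge_half.
have -> : 3 - 3 / d + 3 / d * sq x = 2 + (sq x - (1 - d / 3)) * (3 / d).
  by field; rewrite gt_eqF.
rewrite lerDl mulr_ge0 ?divr_ge0 ?ltW// subr_gt0; move: d0 h1; lra.
Qed.

Lemma partial_chi_bound (K : R) : 0 <= K -> (forall s, `|step' s| <= K) -> forall i x,
  `|partial i (chi d) x| <= 6 * K / d.
Proof.
move=> K0 hK i x; have [/andP[_ x1]|/(partial_chi0 i) ->] := boolP (1 - d <= enorm x <= 1); last first.
  by rewrite normr0 divr_ge0 ?mulr_ge0// ltW.
rewrite partial_chi normrM.
have xi : `|x ord0 i| <= 1 by apply: entry_sq1; move: x1; rewrite le_enorm// expr1n.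
have -> : 6 * K / d = K * (3 / d * 2) by field; rewrite gt_eqF.
apply: ler_pM => //; rewrite normrM (ger0_norm (_ : 0 <= 3 / d)); last by rewrite divr_ge0// ltW.
rewrite ler_pM2l ?divr_gt0// normrM ger0_norm//.
by move: xi; lra.
Qed.

Lemma test_chi : test_fun (eball 0 1) (chi d).
Proof.
split; first by apply: SmP; exact: Sm_chi.
exists [set x | sq x <= 1 - d / 3]; split.
- apply: bounded_closed_compact.
    exists 1; split => // r r1 x /= sx; apply: mx_norm_le; first by rewrite ltW// (lt_trans ltr01).
    move=> i; apply: le_trans (ltW r1).
    by apply: entry_sq1; apply: (le_trans sx); rewrite gerBl divr_ge0// ltW.
  have -> : [set x | sq x <= 1 - d / 3] = sq @^-1` [set t | t <= 1 - d / 3] by [].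
  apply: closed_comp; last exact: closed_le.
  by move=> x _; exact: Sm_continuous Sm_sq x.
- move=> x /= sx; rewrite /eball/= subr0 ltNge; apply/negP => h.
  have : 1 <= sq x by rewrite -[1](expr1n _ 2) -ge_enorm.
  by move: sx d0; lra.
- by move=> x /= /negP; rewrite -ltNge => /ltW; exact: chi0.
Qed.

End fixed_scale.

Lemma partial_open (U : set V) (f : V -> R) i x : open U -> U x ->
  (forall y, U y -> f y = 0) -> partial i f x = 0.
Proof.
move=> oU Ux f0; apply: is_derive_partial; apply/is_derive_line0.
have /nbhs_ballP[e /= e0 xe] : nbhs x U by apply: open_nbhs_nbhs.
apply: (@is_derive_eq _ _ _ _ _ _ 0) => //.
apply: (near_eq_is_derive _ (is_derive_cst (0 : R) (0 : R) (1 : R))).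
apply/nbhs_ballP; exists e => // h; rewrite /ball/= sub0r normrN => he.
rewrite /cst f0//; apply: xe; rewrite -ball_normE/= opprD addrCA subrr addr0 normrN normrZ.
apply: le_lt_trans he; rewrite ler_piMr//.
by apply: (le_trans (norm_le_l1n _)); rewrite l1n_ed.
Qed.

Lemma open_sq (c : R) : open [set x : V | c < sq x].
Proof.
have -> : [set x : V | c < sq x] = sq @^-1` [set t | c < t] by [].
apply: open_comp; last exact: open_gt.
by move=> x _; exact: Sm_continuous Sm_sq x.
Qed.

End cutoff.

(** * Smooth approximation of a connection with square-integrable curvature *)
Section toolbox.
Context {R : realType} (n : nat).
Notation V := 'rV[R]_n.
Notation mu := (lebesgue_rV n).
Implicit Types (f g : V -> R).

Lemma mulmx_entry (N : nat) (X Y : 'M[R]_N.+1) a b : (X * Y) a b = \sum_c X a c * Y c b.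
Proof. by rewrite -mulmxE mxE. Qed.

Lemma to0_prod f g (fk gk : nat -> V -> R) : sqL mu f -> sqL mu g ->
  (forall k, mf (fk k)) -> (forall k, mf (gk k)) ->
  to0 (fun k => n2 mu (fun x => fk k x - g x + (g x - f x))%R) ->
  to0 (fun k => n2 mu (fun x => gk k x - g x)%R) ->
  to0 (fun k => n1 mu (fun x => fk k x * gk k x - f x * g x)%R).
Proof.
move=> [mf_ f2] [mg g2] mfk mgk hf hg.
have {}hf : to0 (fun k => n2 mu (fun x => fk k x - f x)%R).
  apply: to0_le hf => k; apply: le_of_eq; apply: eq_n2 => x; ring.
have md k : mf (fun x => fk k x - f x) by exact: mfB.
have me k : mf (fun x => gk k x - g x) by exact: mfB.
have h1 : to0 (fun k => n1 mu (fun x => (fk k x - f x) * (gk k x - g x))%R).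
  apply: to0_le (to0D hf hg) => k.
  by have := n1M_young mu ltr01 (md k) (me k); rewrite invr1 !mul1e.
have [Cf hCf] : exists C : R, (n2 mu f <= C%:E)%E.
  by exists (fine (n2 mu f)); rewrite fineK// ge0_fin_numE// n2_ge0.
have [Cg hCg] : exists C : R, (n2 mu g <= C%:E)%E.
  by exists (fine (n2 mu g)); rewrite fineK// ge0_fin_numE// n2_ge0.
have h2 := to0_L2M (fun _ => mf_) me (fun _ => hCf) hg.
have h3 := to0_L2M (fun _ => mg) md (fun _ => hCg) hf.
apply: to0_le (to0D h1 (to0D h2 h3)) => k.
apply: le_trans (leeD2l _ (n1D mu (mfM mf_ (me k)) (mfM mg (md k)))).
apply: le_trans (n1D mu (mfM (md k) (me k)) (mfD (mfM mf_ (me k)) (mfM mg (md k)))).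
apply: le_of_eq; apply: eq_n1 => x; ring.
Qed.

Lemma harmonic_small (c e : R) : 0 < e -> exists N, forall k, (N <= k)%N -> c / k.+1%:R <= e.
Proof.
move=> e0; exists (Num.truncn (c / e)).+1 => k Nk.
rewrite ler_pdivrMr ?ltr0n// mulrC -ler_pdivrMr//.
apply: ltW; apply: lt_le_trans (truncnS_gt _) _; rewrite ler_nat; exact: leqW.
Qed.

Lemma moll_to0_1 f (c : R) : 0 < c -> L1 mu f ->
  to0 (fun k => n1 mu (fun x => moll (c / k.+1%:R) f x - f x)%R).
Proof.
move=> c0 Lf e e0; have [e1 e10 he] := moll_n1 Lf e0.
have [N hN] := @harmonic_small c e1 e10; exists N => k Nk; apply: he.
by rewrite divr_gt0// hN.
Qed.

Lemma moll_to0_2 f (c : R) : 0 < c -> L1 mu f -> sqL mu f ->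
  to0 (fun k => n2 mu (fun x => moll (c / k.+1%:R) f x - f x)%R).
Proof.
move=> c0 Lf Qf e e0; have [e1 e10 he] := moll_n2 Lf Qf e0.
have [N hN] := @harmonic_small c e1 e10; exists N => k Nk; apply: he.
by rewrite divr_gt0// hN.
Qed.

Lemma sqL_cbox (r : R) : sqL mu (\1_(@cbox R n r) : V -> R).
Proof.
have L : L1 mu (\1_(@cbox R n r) : V -> R).
  by apply: L1_indic; [exact: measurable_cbox|exact: cbox_measure].
split; first exact: (L1_mf L).
have /L1P[_] := L; apply: le_lt_trans; apply: le_of_eq.
apply: eq_integral => x _; rewrite indicE; case: (x \in _); rewrite ?expr1n ?normr1//.
by rewrite expr0n normr0.
Qed.

Lemma sqL_L1 f (r : R) : 0 <= r -> sqL mu f -> (forall x, r < `|x| -> f x = 0) -> L1 mu f.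
Proof.
move=> r0 [m h] f0.
have s1 := sqL_cbox r.
have -> : f = (fun x => f x * \1_(@cbox R n r) x).
  apply/funext => x; rewrite indicE; case: (leP `|x| r) => xr.
    by rewrite mem_set ?mulr1//; apply/cboxP.
  by rewrite f0// mul0r.
exact: sqLM.
Qed.

Lemma L1_mul_test f phi : L1 mu f -> test_fun setT phi -> L1 mu (fun x => f x * phi x).
Proof.
move=> Lf tp; have [M _ hM] := test_fun_bounded tp.
under eq_fun do rewrite mulrC.
by apply: (L1Ml _ hM Lf); apply: smooth_mf; case: tp.
Qed.

Lemma test_funT U (phi : V -> R) : test_fun U phi -> test_fun setT phi.
Proof. by move=> [sp [K [cK _ h]]]; split=> //; exists K; split. Qed.

Lemma test_mul U (f phi : V -> R) : test_fun U f -> smooth phi -> test_fun U (fun x => f x * phi x).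
Proof.
move=> [sf [K [cK KU h]]] sp; split; first exact: smoothM.
by exists K; split=> // x Kx; rewrite h// mul0r.
Qed.

Lemma n2_sum_le (I : Type) (s : seq I) (F : I -> V -> R) : (forall i, mf (F i)) ->
  (n2 mu (fun x => \sum_(i <- s) F i x)%R <= (2 ^+ size s)%:E * \sum_(i <- s) n2 mu (F i))%E.
Proof.
move=> hF; elim: s => [|i s IH].
  rewrite big_nil mule0 (_ : n2 _ _ = 0%E)//.
  rewrite /n2; under eq_integral do rewrite big_nil expr0n/=.
  by rewrite integral0.
have -> : (fun x => \sum_(j <- i :: s) F j x) = (fun x => F i x + \sum_(j <- s) F j x).
  by apply/funext => x; rewrite big_cons.
apply: (le_trans (n2D mu (hF i) (mf_sum s xpredT hF))).
have h1 := n2_ge0 mu (F i).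
have h2 : (0 <= \sum_(j <- s) n2 mu (F j))%E by apply: sume_ge0 => j _; exact: n2_ge0.
rewrite big_cons /= exprS EFinM -muleA.
move: (n2 mu (F i)) (\sum_(j <- s) n2 mu (F j))%E IH h1 h2 => u v IH u0 v0.
rewrite [X in (_ <= _ * X)%E]ge0_muleDr// [leRHS]ge0_muleDr ?mule_ge0 ?lee_fin ?exprn_ge0//.
apply: leeD; last by rewrite lee_wpmul2l ?lee_fin.
rewrite lee_wpmul2l ?lee_fin//;  rewrite -[leLHS]mul1e; apply: lee_wpmul2r => //.
by rewrite lee_fin exprn_ege1// ler1n.
Qed.

Lemma sq_le_entry (x : V) : `|x| <= 1 \/ 1 < sq x.
Proof.
have [x1|x1] := leP `|x| 1; [by left|right].
rewrite ltNge; apply/negP => h; move: x1; rewrite ltNge => /negP; apply.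
by apply: mx_norm_le => // i; exact: entry_sq1.
Qed.

Lemma mf_sq_set (c : R) : measurable [set x : V | c <= sq x].
Proof.
have m : mf (@sq R n) by apply: continuous_mf; apply: Sm_continuous; exact: Sm_sq.
have -> : [set x : V | c <= sq x] = (@sq R n) @^-1` `[c, +oo[.
  by apply/seteqP; split=> x /=; rewrite in_itv/= andbT.
by rewrite -[X in measurable X]setTI; exact: m.
Qed.

(** Dominated convergence. *)
Lemma vanishing_to0 (h : V -> R) (c : nat -> V -> R) (K : R) : L1 mu h -> (forall k, mf (c k)) ->
  (forall k x, `|c k x| <= K) ->
  {ae mu, forall x, exists N, forall k, (N <= k)%N -> c k x * h x = 0} ->
  to0 (fun k => n1 mu (fun x => c k x * h x)%R).
Proof.
move=> Lh mc cK c0.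
have iK : mu.-integrable setT (EFin \o (fun x => K * `|h x|)).
  apply: L1Z; apply: (le_L1 _ _ Lh) => [|x]; last by rewrite normr_id.
  exact: (mf_norm (L1_mf Lh)).
have H := @dominated_to0 _ _ _ mu (fun k x => c k x * h x) (fun=> 0) _ _ _ iK.
apply: to0_le (H _ _ _ _) => [k||||k x].
- by apply: le_of_eq; apply: eq_n1 => x; rewrite subr0.
- by move=> k; apply: mfM => //; exact: (L1_mf Lh).
- exact: mf_cst.
- apply: filterS c0 => x [N hN]; apply: cvg_near_cst.
  by exists N => // k /= Nk; rewrite hN.
- by rewrite normrM ler_wpM2r.
Qed.

Lemma Tr_D f g x : mf f -> mf g -> (forall y, 0 <= f y) -> (forall y, 0 <= g y) ->
  Tr (fun y => f y + g y) x <= Tr f x + Tr g x.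
Proof.
move=> hf hg f0 g0; have := T_ge0 x f0; have := T_ge0 x g0.
rewrite /Tr TD//; case: (T f x) => [a||]//; case: (T g x) => [b||]//=;
  rewrite ?lee_fin => h1 h2; by rewrite ?addr_ge0// ?addr0 ?add0r.
Qed.

Lemma eventually_all (I : finType) (P : I -> nat -> Prop) :
  (forall i, exists K, forall k, (K <= k)%N -> P i k) ->
  exists K, forall k, (K <= k)%N -> forall i, P i k.
Proof.
move=> /choice[K hK]; exists (\max_i K i) => k hk i; apply: hK.
exact: leq_trans (leq_bigmax i) hk.
Qed.

Lemma n1_absE f : n1 mu (fun x => `|f x|) = n1 mu f.
Proof. by apply: eq_integral => x _; rewrite normr_id. Qed.

Lemma n2_absE f : n2 mu (fun x => `|f x|) = n2 mu f.
Proof. by apply: eq_integral => x _; rewrite real_normK ?num_real. Qed.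

Lemma L1_nm (N : nat) (X : V -> 'M[R]_N.+1) : (forall a b, L1 mu (fun x => X x a b)) ->
  L1 mu (fun x => nm (X x)).
Proof.
move=> h; apply: L1_sum => a; apply: L1_sum => b; apply: (le_L1 _ _ (h a b)) => [|x].
  exact: mf_norm (L1_mf (h a b)).
by rewrite normr_id.
Qed.

Lemma sqL_nm (N : nat) (X : V -> 'M[R]_N.+1) : (forall a b, sqL mu (fun x => X x a b)) ->
  sqL mu (fun x => nm (X x)).
Proof.
move=> h; apply: sqL_sum => a; apply: sqL_sum => b; apply: (le_sqL _ _ (h a b)) => [|x].
  by apply: mf_norm; case: (h a b).
by rewrite normr_id.
Qed.

End toolbox.

(** The integrand of the curvature of A tested against phi. *)
Definition curl_density {R : realType} {n N : nat} (A : 'I_n -> 'rV[R]_n -> 'M[R]_N.+1) i j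
    (phi : 'rV[R]_n -> R) a b x : R :=
  A i x a b * partial j phi x - A j x a b * partial i phi x
  + (A i x * A j x - A j x * A i x) a b * phi x.

(** The error e bounds both A' - A and the part E of the curvature in L1; the part q only
    has to have ray integrals bounded in L2, with C0 independent of e. *)
Definition approximates {R : realType} {n N : nat} (G : set 'M[R]_N.+1)
    (A A' : 'I_n -> 'rV[R]_n -> 'M[R]_N.+1) (C0 e : R) (q E : 'rV[R]_n -> R) : Prop :=
  [/\ [/\ test_form A', lie_form G A' & forall x : 'rV[R]_n, 1 <= sq x -> vanish A' x 1],
    (forall i a b, n1 (lebesgue_rV n) (fun x => A' i x a b - A i x a b)%R <= e%:E)%E,
    [/\ mf q, forall y, 0 <= q y, (n1 (lebesgue_rV n) q < +oo)%E &
      (n2 (lebesgue_rV n) (Tr q) <= C0%:E)%E],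
    [/\ mf E, forall y, 0 <= E y & (n1 (lebesgue_rV n) E <= e%:E)%E] &
    forall i (y : 'rV[R]_n), nm (\sum_j y ord0 j *: curv A' j i y) <= q y + E y].

Section approximation.
Context {R : realType} {n N : nat}.
Notation V := 'rV[R]_n.
Notation mat := 'M[R]_N.+1.
Notation mu := (lebesgue_rV n).
Variables (G : set mat) (hG : compact_matrix_group G).
Variables (A : 'I_n -> V -> mat) (F : 'I_n -> 'I_n -> V -> mat).
Hypothesis n4 : (4 <= n)%N.
Hypothesis QA : forall i a b, sqL mu (fun x => A i x a b).
Hypothesis lieA : forall i x, lie_algebra G (A i x).
Hypothesis A0 : forall i x, 1 <= sq x -> A i x = 0.
Hypothesis QF : forall i j a b, sqL mu (fun x => F i j x a b).
Hypothesis F0 : forall i j x, 1 <= sq x -> F i j x = 0.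
Hypothesis hF : forall i j phi a b, test_fun (eball 0 1) phi ->
  \int[mu]_x curl_density A i j phi a b x = \int[mu]_x (F i j x a b * phi x).

Let sA x := \sum_i nm (A i x).
Let sF x := \sum_i \sum_j nm (F i j x).

Variables (l d0 : R).
Hypothesis d00 : 0 < d0.
Hypothesis hlim : forall d, 0 < d -> d < d0 ->
  (n2 mu (fun x => \1_[set x | (1 - d) ^+ 2 <= sq x] x * sA x)%R <= (l * d)%:E)%E.

Let br i j x : mat := A i x * A j x - A j x * A i x.

Lemma far (x : V) : 1 < `|x| -> 1 <= sq x.
Proof. by case: (sq_le_entry x) => [|/ltW//]; rewrite leNgt => /negbTE ->. Qed.

Lemma LA i a b : L1 mu (fun x => A i x a b).
Proof. by apply: (sqL_L1 ler01 (QA i a b)) => x /far h; rewrite A0// mxE. Qed.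

Lemma LF i j a b : L1 mu (fun x => F i j x a b).
Proof. by apply: (sqL_L1 ler01 (QF i j a b)) => x /far h; rewrite F0// mxE. Qed.

Lemma Lbr i j a b : L1 mu (fun x => br i j x a b).
Proof.
have -> : (fun x => br i j x a b) = (fun x => \sum_c A i x a c * A j x c b -
   \sum_c A j x a c * A i x c b).
  by apply/funext => x; rewrite !mxE -!mulmx_entry.
by apply: L1B; apply: L1_sum => c; exact: sqLM.
Qed.

Lemma br0 i j x : 1 <= sq x -> br i j x = 0.
Proof. by move=> h; rewrite /br !A0// mul0r subrr. Qed.

Section fixed_cut.
Variable d : R.
Hypotheses (dp : 0 < d) (d1 : d <= 1 / 2).

Let tchi : test_fun setT (chi d : V -> R). Proof. exact: (@test_funT _ _ _ _ (test_chi n dp)). Qed.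
Let mchi : mf (chi d : V -> R). Proof. by apply: smooth_mf; case: tchi. Qed.

Let f i a b x := chi d x * A i x a b.

(** The curl of the cut off form: [curl_moll]. *)
Let m i j a b x := - (chi d x * F i j x a b) + chi d x * br i j x a b
  + (partial j (chi d) x * A i x a b - partial i (chi d) x * A j x a b).

Lemma Lcut (h : V -> R) : L1 mu h -> L1 mu (fun x => chi d x * h x).
Proof. by move=> Lh; under eq_fun do rewrite mulrC; exact: L1_mul_test. Qed.

Lemma Qcut (h : V -> R) : sqL mu h -> sqL mu (fun x => chi d x * h x).
Proof. by move=> Qh; have [M _ hM] := test_fun_bounded tchi; exact: (sqLMl mchi hM Qh). Qed.

Lemma Lpcut i (h : V -> R) : L1 mu h -> L1 mu (fun x => partial i (chi d) x * h x).
Proof.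
move=> Lh; under eq_fun do rewrite mulrC; apply: L1_mul_test => //.
exact: test_fun_partial.
Qed.

Lemma Lm i j a b : L1 mu (m i j a b).
Proof.
apply: L1D; last by apply: L1B; apply: Lpcut; exact: LA.
by apply: L1D; [apply: L1N|]; apply: Lcut; [exact: LF|exact: Lbr].
Qed.

Lemma curl_arith (X Y Z I1 I2 I4 : R) : X = - I1 -> Y = - I2 ->
  I1 - I2 + (Z + I4) = I4 -> X - Y = Z.
Proof. by move=> -> -> h; lra. Qed.

Lemma product_arith (a1 a2 c p dp1 dp2 dc1 dc2 z u : R) :
  a1 * (c * dp1 + p * dc1) - a2 * (c * dp2 + p * dc2) + z * (c * p) =
  (a1 * (c * dp1) - a2 * (c * dp2)) +
  ((- (c * u) + c * z + (dc1 * a1 - dc2 * a2)) * p + u * (c * p)).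
Proof. ring. Qed.

Lemma curl_moll e i j a b x :
  partial j (moll e (f i a b)) x - partial i (moll e (f j a b)) x = moll e (m i j a b) x.
Proof.
have te := test_eta n e.
have Lf k : L1 mu (f k a b) by apply: Lcut; exact: LA.
have [sphi _] := test_reflect x te.
pose phi y := eta e (x - y).
have tphi : test_fun setT phi := test_reflect x te.
have dphi k y : partial k phi y = - partial k (eta e) (x - y) by exact: partial_reflect.
have L1_ h k : L1 mu (fun y => A h y a b * (chi d y * partial k phi y)).
  have -> : (fun y => A h y a b * (chi d y * partial k phi y)) =
    (fun y => (chi d y * A h y a b) * partial k phi y).
    by apply/funext => y; rewrite mulrA (mulrC (A h y a b)).
  by apply: L1_mul_test; [exact: Lf|exact: test_fun_partial].
have E k h : conv (partial k (eta e)) (f h a b) x =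
    - \int[mu]_y (A h y a b * (chi d y * partial k phi y)).
  rewrite -(RintN (L1_ h k)); apply: eq_Rintegral => y _.
  by rewrite dphi !mulrN opprK /f mulrA (mulrC (A h y a b)).
have e1 := etrans (partial_conv j x te (Lf i)) (E j i).
have e2 := etrans (partial_conv i x te (Lf j)) (E i j).
have schi : smooth (chi d : V -> R) by case: tchi.
have tpsi : test_fun (eball 0 1) (fun y => chi d y * phi y).
  by apply: test_mul => //; exact: test_chi.
have := hF i j a b tpsi; rewrite /curl_density.
have Lr : L1 mu (fun y => m i j a b y * phi y) by apply: L1_mul_test => //; exact: Lm.
have LFc : L1 mu (fun y => F i j y a b * (chi d y * phi y)).
  have -> : (fun y => F i j y a b * (chi d y * phi y)) =
    (fun y => (chi d y * F i j y a b) * phi y) by apply/funext => y; ring.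
  by apply: L1_mul_test => //; apply: Lcut; exact: LF.
have E0 y : A i y a b * partial j (fun y => chi d y * phi y) y -
     A j y a b * partial i (fun y => chi d y * phi y) y +
     (A i y * A j y - A j y * A i y) a b * (chi d y * phi y) =
   (A i y a b * (chi d y * partial j phi y) - A j y a b * (chi d y * partial i phi y)) +
   (m i j a b y * phi y + F i j y a b * (chi d y * phi y)).
  rewrite (partialM j y schi sphi) (partialM i y schi sphi) /m /br.
  exact: product_arith.
under eq_Rintegral => y _ do rewrite E0.
rewrite RintD; [|exact: L1B|exact: L1D].
rewrite (RintB (L1_ i j) (L1_ j i)) (RintD Lr LFc).
exact: curl_arith e1 e2.
Qed.

Definition Am (e : R) i x : mat := \matrix_(a, b) moll e (f i a b) x.

Lemma Lf i a b : L1 mu (f i a b). Proof. by apply: Lcut; exact: LA. Qed.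

Lemma Qf i a b : sqL mu (f i a b). Proof. exact: Qcut. Qed.

Lemma f_far i a b x : 1 - d / 3 <= sq x -> f i a b x = 0.
Proof. by move=> h; rewrite /f (chi0 dp)// mul0r. Qed.

Lemma Am_far e i x : 0 < e -> e <= d / (18 * n.+1%:R) -> 1 - d / 6 <= sq x -> Am e i x = 0.
Proof.
move=> e0 ed hx; apply/matrixP => a b; rewrite !mxE mollE; last exact: Lf.
rewrite (_ : (fun y => _) = fun=> 0); first by rewrite /Rintegral integral0.
apply/funext => y; have [ye|ye] := leP e `|y|; first by rewrite eta_out// mulr0.
rewrite f_far ?mul0r// leNgt; apply/negP => h.
have n1_ : 1 <= n.+1%:R :> R by rewrite ler1n.
have en : 18 * n.+1%:R * e <= d by rewrite mulrC -ler_pdivlMr// mulr_gt0// ltr0n.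
have e1 : e <= 1 by move: en d1 e0; nra.
have key : sq x <= sq (x - y) + n%:R * (3 * e).
  have -> : n%:R * (3 * e) = \sum_(i < n) (3 * e) by rewrite sumr_const card_ord mulr_natl.
  rewrite /sq -big_split/=; apply: ler_sum => k _.
  have h1 : `|(x - y) ord0 k| <= 1.
    by apply: entry_sq1; apply: (le_trans (ltW h)); rewrite gerBl divr_ge0// ltW.
  have h2 : `|y ord0 k| <= e by apply: le_trans (entry_le_mx_norm y k) (ltW ye).
  have -> : x ord0 k = (x - y) ord0 k + y ord0 k by rewrite !mxE subrK.
  move: h1 h2; move: (_ ord0 k) (y ord0 k) => s t; rewrite !ler_norml => /andP[? ?] /andP[? ?].
  by nra.
have : n%:R * (3 * e) <= d / 6.
  have : (n%:R : R) <= n.+1%:R by rewrite ler_nat.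
  by move: en e0; nra.
move: hx h key; lra.
Qed.

Lemma Am_test e : 0 < e -> e <= d / (18 * n.+1%:R) -> test_form (Am e).
Proof.
move=> e0 ed i a b.
have -> : (fun x => Am e i x a b) = moll e (f i a b) by apply/funext => x; rewrite mxE.
split; first by apply: moll_smooth; exact: Lf.
exists (@cbox R n 1); split => //; first exact: compact_seg.
move=> x nx; have : Am e i x = 0.
  apply: Am_far => //.
  apply: le_trans (_ : 1 <= sq x); first by rewrite gerBl divr_ge0// ltW.
  by apply: far; rewrite ltNge; apply/negP => h; apply: nx; apply/cboxP.
by move=> /matrixP/(_ a b); rewrite !mxE.
Qed.

Lemma Am_lie e i x : 0 < e -> lie_algebra G (Am e i x).
Proof.
move=> e0; have [k [L hL]] := lie_functionals hG.
apply/hL => j; rewrite /pair.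
have E a b : L j a b * Am e i x a b = \int[mu]_y (L j a b * (f i a b y * eta e (x - y))).
  by rewrite mxE RintZ//; apply: (conv_L1 (test_eta n e)); exact: Lf.
under eq_bigr do under eq_bigr do rewrite E.
have Lab a b : L1 mu (fun y => L j a b * (f i a b y * eta e (x - y))).
  by apply: L1Z; apply: (conv_L1 (test_eta n e)); exact: Lf.
under eq_bigr do rewrite -Rint_sum//.
rewrite -Rint_sum; last by move=> a; exact: L1_sum.
rewrite (_ : (fun y => _) = fun=> 0); first by rewrite /Rintegral integral0.
apply/funext => y; have /hL/(_ j) := lieA i y; rewrite /pair => H.
apply: (@eq_trans _ _ (chi d y * eta e (x - y) * \sum_a \sum_b L j a b * A i y a b)).
  2: by rewrite H mulr0.
rewrite mulr_sumr; apply: eq_bigr => a _; rewrite mulr_sumr; apply: eq_bigr => b _; rewrite /f; ring.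
Qed.

Lemma Am_vanish e x : 0 < e -> e <= d / (18 * n.+1%:R) -> 1 <= sq x -> vanish (Am e) x 1.
Proof.
move=> e0 ed x1 s s1 i.
have c1 : 1 - d / 6 < 1 by rewrite gtrBl divr_gt0.
have sx : 1 <= sq (s *: x) by rewrite sqZ mulr_ege1// exprn_ege1.
split=> [|k]; first by apply: Am_far => //; apply: le_trans sx; exact: ltW.
apply/matrixP => a b; rewrite !mxE; rewrite (@partial_open _ _ [set y | 1 - d / 6 < sq y] (fun y => Am e i y a b))//.
- exact: open_sq.
- exact: lt_le_trans c1 sx.
- by move=> y /ltW hy; have /matrixP/(_ a b) := Am_far i e0 ed hy; rewrite [X in _ = X]mxE.
Qed.

(** What remains of the curvature besides the cut off curvature and the terms with
    derivatives of the cutoff. *)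
Definition rest e j i a b x := (moll e (m i j a b) x - m i j a b x)
  + ((Am e j x * Am e i x - Am e i x * Am e j x) a b - chi d x ^+ 2 * br j i x a b)
  + (chi d x ^+ 2 - chi d x) * br j i x a b.

Lemma mxE2 (X Y : mat) a b : (X - Y) a b = X a b - Y a b.
Proof. by rewrite !mxE. Qed.

Lemma mxE3 (X Y Z : mat) a b : (X - Y + Z) a b = X a b - Y a b + Z a b.
Proof. by rewrite !mxE. Qed.

Lemma rest_arith (Y p q B M u v w c z z' : R) :
  Y = p - q + B -> p - q = M -> z' = - z ->
  Y = - u + (v - w) + (M - (- u + c * z' + (v - w)) + (B - c ^+ 2 * z) + (c ^+ 2 - c) * z).
Proof. move=> -> <- ->; ring. Qed.

Lemma curv_Am e j i a b x : curv (Am e) j i x a b =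
  - (chi d x * F i j x a b) + (partial j (chi d) x * A i x a b - partial i (chi d) x * A j x a b)
  + rest e j i a b x.
Proof.
have dE k h : dmx k (Am e h) x a b = partial k (moll e (f h a b)) x.
  by rewrite mxE; congr partial; apply/funext => y; rewrite mxE.
have E1 : curv (Am e) j i x a b = partial j (moll e (f i a b)) x -
    partial i (moll e (f j a b)) x + (Am e j x * Am e i x - Am e i x * Am e j x) a b.
  exact: (etrans (mxE3 _ _ _ a b) (congr2 (fun p q => p - q + _) (dE j i) (dE i j))).
have E2 : br i j x a b = - br j i x a b by rewrite /br mxE2 [in RHS]mxE2 opprB.
exact: (rest_arith _ _ _ _ E1 (curl_moll e i j a b x) E2).
Qed.

Lemma mAm e i a b : mf (fun x => Am e i x a b).
Proof.
have -> : (fun x => Am e i x a b) = moll e (f i a b) by apply/funext => x; rewrite mxE.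
by apply: smooth_mf; apply: moll_smooth; exact: Lf.
Qed.

Lemma m_rest e j i a b : mf (rest e j i a b).
Proof.
have mb k h : mf (fun x => br k h x a b) by exact: (L1_mf (Lbr k h a b)).
apply: mfD; last by apply: mfM => //; apply: mfB => //; exact: mfX.
apply: mfD; last first.
  apply: mfB; last by apply: mfM => //; exact: mfX.
  have -> : (fun x => (Am e j x * Am e i x - Am e i x * Am e j x) a b) =
    (fun x => \sum_c Am e j x a c * Am e i x c b - \sum_c Am e i x a c * Am e j x c b).
    by apply/funext => x; rewrite !mxE -!mulmx_entry.
  by apply: mfB; apply: mf_sum => c; apply: mfM; exact: mAm.
apply: mfB; last exact: (L1_mf (Lm i j a b)).
by apply: smooth_mf; apply: moll_smooth; exact: Lm.
Qed.

Lemma Am_to0 (c : R) i a b : 0 < c ->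
  to0 (fun k => n1 mu (fun x => Am (c / k.+1%:R) i x a b - f i a b x)%R).
Proof.
move=> c0; apply: to0_le (moll_to0_1 c0 (Lf i a b)) => k.
by apply: le_of_eq; apply: eq_n1 => x; rewrite mxE.
Qed.

Lemma Am_to0_2 (c : R) i a b : 0 < c ->
  to0 (fun k => n2 mu (fun x => Am (c / k.+1%:R) i x a b - f i a b x)%R).
Proof.
move=> c0; apply: to0_le (moll_to0_2 c0 (Lf i a b) (Qf i a b)) => k.
by apply: le_of_eq; apply: eq_n2 => x; rewrite mxE.
Qed.

Lemma prod_to0 (c : R) i j a b s : 0 < c ->
  to0 (fun k => n1 mu (fun x => Am (c / k.+1%:R) i x a s * Am (c / k.+1%:R) j x s b
    - f i a s x * f j s b x)%R).
Proof.
move=> c0; apply: to0_prod; [exact: Qf|exact: Qf|by move=> k; exact: mAm|by move=> k; exact: mAm| |].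
  apply: to0_le (Am_to0_2 i a s c0) => k.
  by apply: le_of_eq; apply: eq_n2 => x; ring.
exact: Am_to0_2.
Qed.

Lemma rest_to0 (c r : R) j i a b : 0 < c ->
  (n1 mu (fun x => (chi d x ^+ 2 - chi d x) * br j i x a b)%R <= r%:E)%E ->
  forall e, 0 < e -> exists K, forall k, (K <= k)%N ->
    (n1 mu (rest (c / k.+1%:R) j i a b) <= (r + e)%:E)%E.
Proof.
move=> c0 hr e e0.
have mb k h : mf (fun x => br k h x a b) by exact: (L1_mf (Lbr k h a b)).
have t1 := moll_to0_1 c0 (Lm i j a b).
pose P k x := (Am (c / k.+1%:R) j x * Am (c / k.+1%:R) i x -
   Am (c / k.+1%:R) i x * Am (c / k.+1%:R) j x) a b - chi d x ^+ 2 * br j i x a b.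
have PE k x : P k x = \sum_s (Am (c / k.+1%:R) j x a s * Am (c / k.+1%:R) i x s b - f j a s x * f i s b x)
   - \sum_s (Am (c / k.+1%:R) i x a s * Am (c / k.+1%:R) j x s b - f i a s x * f j s b x).
  rewrite /P !sumrB !mxE -!mulmx_entry.
  have -> : \sum_s f j a s x * f i s b x = chi d x ^+ 2 * (A j x * A i x) a b.
    by rewrite mulmx_entry mulr_sumr; apply: eq_bigr => s _; rewrite /f; ring.
  have -> : \sum_s f i a s x * f j s b x = chi d x ^+ 2 * (A i x * A j x) a b.
    by rewrite mulmx_entry mulr_sumr; apply: eq_bigr => s _; rewrite /f; ring.
  ring.
have mQ k h1 h2 s : mf (fun x => Am (c / k.+1%:R) h1 x a s * Am (c / k.+1%:R) h2 x s b - f h1 a s x * f h2 s b x).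
  apply: mfB; apply: mfM; try exact: mAm; exact: (L1_mf (Lf _ _ _)).
have t2 : to0 (fun k => n1 mu (P k)).
  apply: to0_le (to0D (to0_sum (index_enum _) (fun s => prod_to0 j i a b s c0))
     (to0_sum (index_enum _) (fun s => prod_to0 i j a b s c0))) => k.
  rewrite (eq_n1 mu (PE k)).
  apply: (le_trans (n1B mu _ _)); [by apply: mf_sum => s; exact: mQ|by apply: mf_sum => s; exact: mQ|].
  by apply: leeD; apply: n1_sum => s; exact: mQ.
have [K hK] := to0D t1 t2 e0; exists K => k Kk.
rewrite addrC EFinD; apply: le_trans (leeD (hK k Kk) hr).
have mP : mf (P k) by rewrite (funext (PE k)); apply: mfB; apply: mf_sum => s; exact: mQ.
have mm1 : mf (fun x => moll (c / k.+1%:R) (m i j a b) x - m i j a b x).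
  apply: mfB; last exact: (L1_mf (Lm i j a b)).
  by apply: smooth_mf; apply: moll_smooth; exact: Lm.
have mm2 : mf (fun x => (chi d x ^+ 2 - chi d x) * br j i x a b).
  by apply: mfM => //; apply: mfB => //; exact: mfX.
apply: (le_trans (n1D mu (mfD mm1 mP) mm2)); apply: leeD => //.
exact: (n1D mu mm1 mP).
Qed.

Lemma cut_approximation (r : R) : 0 < r ->
  (forall i a b, n1 mu (fun x => f i a b x - A i x a b)%R <= r%:E)%E ->
  (forall j i a b, n1 mu (fun x => (chi d x ^+ 2 - chi d x) * br j i x a b)%R <= r%:E)%E ->
  exists e, [/\ 0 < e, e <= d / (18 * n.+1%:R),
    (forall i a b, n1 mu (fun x => Am e i x a b - A i x a b)%R <= (2 * r)%:E)%E &
    (forall j i a b, n1 mu (rest e j i a b) <= (2 * r)%:E)%E].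
Proof.
move=> r0 h1 h2; pose c := d / (18 * n.+1%:R).
have n0 : 0 < 18 * n.+1%:R :> R by rewrite mulr_gt0// ltr0n.
have c0 : 0 < c by rewrite divr_gt0.
have [K1 hK1] := @eventually_all _ (fun t k => (n1 mu (fun x => Am (c / k.+1%:R) t.1 x t.2.1 t.2.2
    - f t.1 t.2.1 t.2.2 x)%R <= r%:E)%E) (fun t => Am_to0 t.1 t.2.1 t.2.2 c0 r0).
have [K2 hK2] := @eventually_all _ (fun t k => (n1 mu (rest (c / k.+1%:R) t.1.1 t.1.2 t.2.1 t.2.2)
    <= (r + r)%:E)%E) (fun t => rest_to0 c0 (h2 t.1.1 t.1.2 t.2.1 t.2.2) r0).
pose k := maxn K1 K2; exists (c / k.+1%:R); split.
- by rewrite divr_gt0.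
- by rewrite ler_pdivrMr ?ltr0n// ler_peMr ?ler1n// ltW.
- move=> i a b; have := hK1 k (leq_maxl _ _) (i, (a, b)) => /= h3.
  rewrite mulr2n mulrDl mul1r EFinD.
  apply: le_trans (leeD h3 (h1 i a b)).
  have m1 := mAm (c / k.+1%:R) i a b; have m2 := L1_mf (Lf i a b).
  apply: le_trans (n1D mu (mfB m1 m2) (mfB m2 (L1_mf (LA i a b)))).
  by apply: le_of_eq; apply: eq_n1 => x; rewrite addrA subrK.
move=> j i a b; have := hK2 k (leq_maxr _ _) ((j, i), (a, b)) => /=.
by rewrite mulr2n mulrDl mul1r.
Qed.

Variable K : R.
Hypotheses (K0 : 0 < K) (hK : forall s : R, `|step s| <= K /\ `|step' s| <= K).

(** The part of the bound for the curvature that is square integrable along rays: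
    the derivative of the cutoff is of size 1/d, but lives on a shell of width d. *)
Let q1 y := K * sF y.
Let q2 y := 6 * K / d * n.+1%:R * (\1_[set x | (1 - d) ^+ 2 <= sq x] y * sA y).
Definition E e y := \sum_j \sum_i \sum_a \sum_b `|rest e j i a b y|.

Lemma shell_indic i y : 0 < d -> `|partial i (chi d) y| <= 6 * K / d * \1_[set x : V | (1 - d) ^+ 2 <= sq x] y.
Proof.
move=> d0_; rewrite indicE; have [|h] := boolP (y \in _).
  by rewrite mulr1 => _; apply: partial_chi_bound => //; [exact: ltW|move=> s; case: (hK s)].
rewrite mulr0 partial_chi0 ?normr0//; apply: contra h => /andP[h _]; rewrite inE/= -ge_enorm//.
by rewrite subr_ge0; move: d1; lra.
Qed.

Lemma curv_Am_nm e j i y : nm (curv (Am e) j i y) <=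
  K * nm (F i j y) + 6 * K / d * \1_[set x : V | (1 - d) ^+ 2 <= sq x] y * (nm (A i y) + nm (A j y))
  + \sum_a \sum_b `|rest e j i a b y|.
Proof.
rewrite /nm !mulr_sumr -big_split mulr_sumr -!big_split/=; apply: ler_sum => a _.
rewrite !mulr_sumr -big_split mulr_sumr -!big_split/=; apply: ler_sum => b _.
rewrite curv_Am; apply: (le_trans (ler_normD _ _)); rewrite lerD2r.
apply: (le_trans (ler_normD _ _)); apply: lerD.
  by rewrite normrN normrM ler_wpM2r//; case: (hK ((3 - 3 / d) + 3 / d * sq y)).
apply: (le_trans (ler_normB _ _)); rewrite !normrM mulrDr.
by apply: lerD; rewrite ler_wpM2r// shell_indic.
Qed.

Lemma sA0 y : 1 <= sq y -> sA y = 0.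
Proof. by move=> h; rewrite /sA big1// => i _; rewrite A0// nm0. Qed.

Lemma E_ge0 e y : 0 <= E e y.
Proof. by do 4 (apply: sumr_ge0 => ? _). Qed.

Lemma sA_ge0 y : 0 <= sA y. Proof. by apply: sumr_ge0 => i _; exact: nm_ge0. Qed.

Lemma sF_ge0 y : 0 <= sF y.
Proof. by apply: sumr_ge0 => i _; apply: sumr_ge0 => j _; exact: nm_ge0. Qed.

Lemma q1_ge0 y : 0 <= q1 y. Proof. by rewrite mulr_ge0 ?sF_ge0// ltW. Qed.

Lemma q2_ge0 y : 0 <= q2 y.
Proof.
by rewrite mulr_ge0 ?mulr_ge0 ?sA_ge0// ?invr_ge0 ?ltW// indicE.
Qed.

Lemma curv_Am_bound e i (y : V) : 0 < e -> e <= d / (18 * n.+1%:R) ->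
  nm (\sum_j y ord0 j *: curv (Am e) j i y) <= q1 y + q2 y + E e y.
Proof.
move=> e0 ed; have [y1|y1] := ltP 1 (sq y).
  rewrite big1 ?nm0; first by rewrite !addr_ge0 ?q1_ge0 ?q2_ge0 ?E_ge0.
  by move=> j _; rewrite curv0 ?scaler0//; exact: (Am_vanish e0 ed (ltW y1)).
apply: (le_trans (nm_sum _)).
apply: (@le_trans _ _ (\sum_j nm (curv (Am e) j i y))).
  by apply: ler_sum => j _; rewrite nmZ ler_piMl ?nm_ge0// entry_sq1.
apply: (le_trans (ler_sum _ (fun j _ => curv_Am_nm e j i y))).
rewrite !big_split/=; apply: lerD; first apply: lerD.
- rewrite -mulr_sumr ler_wpM2l ?(ltW K0)// /sF [leRHS](bigD1 i)//= lerDl.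
  by apply: sumr_ge0 => k _; apply: sumr_ge0 => j _; exact: nm_ge0.
- rewrite -mulr_sumr /q2 -!mulrA.
  have c0 : 0 <= 6 * (K * d^-1) by rewrite !mulr_ge0 ?invr_ge0 ?ltW.
  apply: ler_wpM2l => //; apply: ler_wpM2l; first exact: ltW.
  apply: ler_wpM2l; first by rewrite invr_ge0 ltW.
  rewrite [leRHS]mulrCA; apply: ler_wpM2l; first by rewrite indicE.
  rewrite big_split/= sumr_const card_ord -(mulr_natl (nm (A i y))).
  have -> : n.+1%:R * sA y = n%:R * sA y + sA y by rewrite -natr1 mulrDl mul1r.
  apply: lerD => //; apply: ler_wpM2l => //.
  rewrite /sA [leRHS](bigD1 i)//= lerDl; apply: sumr_ge0 => k _; exact: nm_ge0.
apply: ler_sum => j _; rewrite [leRHS](bigD1 i)//= lerDl.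
by do 3 (apply: sumr_ge0 => ? _).
Qed.

Lemma mf_E e : mf (E e).
Proof.
apply: mf_sum => j; apply: mf_sum => i; apply: mf_sum => a; apply: mf_sum => b.
exact: mf_norm (m_rest e j i a b).
Qed.

Lemma n1_E e (r : R) : (forall j i a b, n1 mu (rest e j i a b) <= r%:E)%E ->
  (n1 mu (E e) <= (n%:R * (n%:R * (N.+1%:R * (N.+1%:R * r))))%:E)%E.
Proof.
have S (p : nat) (H : 'I_p -> V -> R) (c : R) : (forall j, mf (H j)) ->
    (forall j, (n1 mu (H j) <= c%:E)%E) -> (n1 mu (fun x => \sum_j H j x)%R <= (p%:R * c)%:E)%E.
  move=> mH hH; apply: (le_trans (n1_sum _ _ mH)).
  have -> : p%:R * c = \sum_(j < p) c by rewrite sumr_const card_ord mulr_natl.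
  by rewrite -sumEFin; exact: lee_sum.
move=> h.
have mr j i a b : mf (fun y => `|rest e j i a b y|) by exact: mf_norm (m_rest e j i a b).
apply: (S) => [j|j]; first by do 3 (apply: mf_sum => ?).
apply: (S) => [i|i]; first by do 2 (apply: mf_sum => ?).
apply: (S) => [a|a]; first by (apply: mf_sum => ?).
by apply: (S) => [b|b] //; rewrite n1_absE.
Qed.

Lemma QsF : sqL mu sF.
Proof. by apply: sqL_sum => i; apply: sqL_sum => j; exact: sqL_nm. Qed.

Lemma LsF : L1 mu sF.
Proof. by apply: L1_sum => i; apply: L1_sum => j; apply: L1_nm => a b; exact: LF. Qed.

Lemma LsA : L1 mu sA.
Proof. by apply: L1_sum => j; apply: L1_nm => a b; exact: LA. Qed.

Lemma mf_shell : mf (\1_[set x : V | (1 - d) ^+ 2 <= sq x] : V -> R).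
Proof. by apply: measurable_indic; exact: mf_sq_set. Qed.

Lemma L_q : L1 mu (fun y => q1 y + q2 y).
Proof.
apply: L1D; first by apply: L1Z; exact: LsF.
apply: L1Z; apply: (@L1Ml _ _ _ _ 1 _ _ mf_shell _ LsA) => x.
by rewrite indicE; case: (_ \in _); rewrite ?normr1// normr0.
Qed.

Lemma n2_Tr_q : d < d0 ->
  (n2 mu (Tr (fun y => q1 y + q2 y)%R) <=
   (2 * (K ^+ 2 * fine (n2 mu sF)) + 144 * K ^+ 2 * n.+1%:R ^+ 2 * l)%:E)%E.
Proof.
move=> dd0; have n2_ : (2 <= n)%N by exact: leq_trans n4.
have n3_ : (3 <= n)%N by exact: leq_trans n4.
have m1 : mf q1 by apply: mfZ; exact: (L1_mf LsF).
have m2' : mf (fun y => \1_[set x : V | (1 - d) ^+ 2 <= sq x] y * sA y).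
  by apply: mfM; [exact: mf_shell|exact: (L1_mf LsA)].
have m2 : mf q2 by exact: mfZ.
have t1 := mf_Tr n2_ m1 q1_ge0; have t2 := mf_Tr n2_ m2 q2_ge0.
apply: (@le_trans _ _ (n2 mu (fun x => Tr q1 x + Tr q2 x)%R)).
  apply: le_n2; [apply: mf_Tr => // [|y]; [exact: mfD|by rewrite addr_ge0 ?q1_ge0 ?q2_ge0]|exact: mfD|].
  move=> x; have h1 := Tr_ge0 x q1_ge0; have h2 := Tr_ge0 x q2_ge0.
  have h3 : 0 <= Tr (fun y => q1 y + q2 y) x.
    by apply: Tr_ge0 => y; rewrite addr_ge0 ?q1_ge0 ?q2_ge0.
  rewrite !ger0_norm ?addr_ge0//.
  by apply: Tr_D => // y; [exact: q1_ge0|exact: q2_ge0].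
apply: (le_trans (n2D mu t1 t2)); rewrite [leRHS]EFinD; apply: leeD.
  rewrite EFinM lee_wpmul2l ?lee_fin//; apply: (le_trans (n2_Tr n4 m1 q1_ge0)).
  rewrite n2Z; last exact: (L1_mf LsF).
  by rewrite [leRHS]EFinM fineK// ge0_fin_numE ?n2_ge0//; case: QsF.
have h2 : (n2 mu (Tr q2) <= (2 * d)%:E * n2 mu q2)%E.
  apply: n2_Tr_shell => //; [exact: q2_ge0|move=> y; rewrite /q2 => h].
  have dd : 0 <= 1 - d by move: d1; lra.
  rewrite ge_enorm// le_enorm// expr1n; apply/andP; split.
    apply/negPn/negP => /negP h'; move: h; rewrite indicE memNset ?mul0r ?mulr0 ?eqxx//.
  by rewrite leNgt; apply/negP => /ltW/sA0 h'; move: h; rewrite h' !mulr0 eqxx.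
apply: (@le_trans _ _ (2%:E * ((2 * d)%:E * ((6 * K / d * n.+1%:R) ^+ 2 * (l * d))%:E))%E).
  rewrite lee_wpmul2l ?lee_fin//; apply: (le_trans h2); rewrite lee_wpmul2l ?lee_fin ?mulr_ge0 ?(ltW dp)//.
  rewrite n2Z// [leRHS]EFinM lee_wpmul2l ?lee_fin ?sqr_ge0//; exact: hlim.
rewrite -!EFinM lee_fin; apply: le_of_eq.
by field; rewrite gt_eqF.
Qed.

End fixed_cut.

(** First the width d of the shell is chosen, so that cutting off changes A and A /\ A little;
    then the scale of the mollification. *)
Theorem approximation : exists C0 : R, forall e, 0 < e -> exists A' q E,
  approximates G A A' C0 e q E.
Proof.
have [K K0 hK] := @step_bound R.
exists (2 * (K ^+ 2 * fine (n2 mu sF)) + 144 * K ^+ 2 * n.+1%:R ^+ 2 * l) => e e0.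
pose c : R := n%:R * (n%:R * (N.+1%:R * N.+1%:R)).
have c0 : 0 <= c by rewrite !mulr_ge0.
pose r := e / (2 * (1 + c)).
have c1 : 0 < 1 + c by rewrite ltr_pwDl.
have r0 : 0 < r by rewrite divr_gt0// mulr_gt0.
pose dd (k : nat) : R := (Num.min d0 (1 / 2)) / k.+2%:R.
have m0 : 0 < Num.min d0 (1 / 2) by rewrite lt_min d00 divr_gt0.
have dk0 k : 0 < dd k by rewrite divr_gt0// ltr0n.
have dkm k : dd k < Num.min d0 (1 / 2).
  by rewrite ltr_pdivrMr ?ltr0n// ltr_pMr// ltr1n.
have dk1 k : dd k <= 1 / 2 by apply: ltW; apply: lt_le_trans (dkm k) _; rewrite ge_min lexx orbT.
have dkd k : dd k < d0 by apply: lt_le_trans (dkm k) _; rewrite ge_min lexx.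
have mchi d : 0 < d -> mf (chi d : V -> R).
  by move=> d0_; apply: smooth_mf; case: (@test_chi R n d d0_).
have bchi d x : `|chi d (x : V)| <= K by case: (hK ((3 - 3 / d) + 3 / d * sq x)).
have ev (x : V) : sq x < 1 -> exists N, forall k, (N <= k)%N -> chi (dd k) x = 1.
  move=> x1; have en1 : enorm x < 1.
    by rewrite -[ltRHS]sqrtr1 /enorm ltr_sqrt// -/(sq x).
  have [M hM] := @harmonic_small _ (Num.min d0 (1 / 2)) (1 - enorm x) ltac:(by rewrite subr_gt0).
  exists M => k Mk; apply: chi1; [exact: dk0|exact: dk1|].
  have := hM k.+1 (leqW Mk); rewrite -/(dd k); lra.
have s1 i a b : to0 (fun k => n1 mu (fun x => (chi (dd k) x - 1) * A i x a b)%R).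
  apply: (@vanishing_to0 _ _ _ _ (K + 1)); [exact: LA| | |].
  - by move=> k; apply: mfB; [exact: mchi|exact: mf_cst].
  - by move=> k x; apply: (le_trans (ler_normB _ _)); rewrite normr1 lerD2r.
  apply: aeW => x; have [x1|x1] := leP 1 (sq x); first by exists 0%N => k _; rewrite A0// mxE mulr0.
  by have [M hM] := ev x x1; exists M => k Mk; rewrite hM// subrr mul0r.
have s2 j i a b : to0 (fun k => n1 mu (fun x => (chi (dd k) x ^+ 2 - chi (dd k) x) * br j i x a b)%R).
  apply: (@vanishing_to0 _ _ _ _ (K ^+ 2 + K)); [exact: Lbr| | |].
  - by move=> k; apply: mfB; [apply: mfX|]; exact: mchi.
  - move=> k x; apply: (le_trans (ler_normB _ _)); rewrite normrX lerD//.
    by rewrite lerXn2r ?nnegrE// ltW.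
  apply: aeW => x; have [x1|x1] := leP 1 (sq x); first by exists 0%N => k _; rewrite br0// mxE mulr0.
  by have [M hM] := ev x x1; exists M => k Mk; rewrite hM// expr1n subrr mul0r.
have [K1 hK1] := @eventually_all _ (fun t k => (n1 mu (fun x => (chi (dd k) x - 1) * A t.1 x t.2.1 t.2.2)%R
    <= r%:E)%E) (fun t => s1 t.1 t.2.1 t.2.2 r r0).
have [K2 hK2] := @eventually_all _ (fun t k => (n1 mu (fun x => (chi (dd k) x ^+ 2 - chi (dd k) x) *
    br t.1.1 t.1.2 x t.2.1 t.2.2)%R <= r%:E)%E) (fun t => s2 t.1.1 t.1.2 t.2.1 t.2.2 r r0).
pose k := maxn K1 K2; pose d := dd k.
have g1 i a b : (n1 mu (fun x => chi d x * A i x a b - A i x a b)%R <= r%:E)%E.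
  apply: le_trans (hK1 k (leq_maxl _ _) (i, (a, b))).
  by apply: le_of_eq; apply: eq_n1 => x /=; rewrite mulrBl mul1r.
have g2 j i a b : (n1 mu (fun x => (chi d x ^+ 2 - chi d x) * br j i x a b)%R <= r%:E)%E.
  exact: (hK2 k (leq_maxr _ _) ((j, i), (a, b))).
have [eps [ep0 ep1 ha hr]] := cut_approximation (dk0 k) r0 g1 g2.
have er : e = 2 * r + c * (2 * r).
  rewrite -{1}[2 * r]mul1r -mulrDl /r; field; exact: lt0r_neq0.
exists (Am d eps), (fun y => K * sF y + 6 * K / d * n.+1%:R * (\1_[set x | (1 - d) ^+ 2 <= sq x] y * sA y)).
exists (E d eps); split; [| | |split|].
- split; [exact: (Am_test (dk0 k) (dk1 k))|by move=> i x; exact: (Am_lie (dk0 k))|by move=> x x1; exact: (Am_vanish (dk0 k) (dk1 k))].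
- move=> i a b; apply: (le_trans (ha i a b)); rewrite lee_fin er lerDl mulr_ge0// mulr_ge0// ltW//.
- split; [exact: (L1_mf (L_q d K))|by move=> y; rewrite addr_ge0 ?q1_ge0 ?q2_ge0 ?dk0|
    by have /L1P[] := L_q d K|].
  exact: (n2_Tr_q (dk0 k) (dk1 k) K0 (dkd k)).
- exact: (mf_E (dk0 k)).
- by move=> y; exact: E_ge0.
- apply: (le_trans (n1_E (dk0 k) hr)); rewrite lee_fin er; apply: ler_wpDl; first by rewrite mulr_ge0// ltW.
  by rewrite /c !mulrA.
- by move=> i y; apply: (curv_Am_bound (dk0 k) (dk1 k)).
Qed.

End approximation.

(** * The gauges of the approximating connections *)
Section measurability.
Context {R : realType} (n : nat).
Notation V := 'rV[R]_n.
Notation mu := (lebesgue_rV n).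

Lemma originE : [set 0 : V] = rV_box (fun=> [set 0]).
Proof.
apply/seteqP; split=> [x -> i|x h]; first by rewrite mxE.
by apply/rowP => i; rewrite mxE; exact: h.
Qed.

Lemma measurable_origin : measurable [set 0 : V].
Proof. by rewrite originE; exact: measurable_box. Qed.

Lemma ae_neq0 : (0 < n)%N -> {ae mu, forall x : V, x != 0}.
Proof.
move=> n0; exists [set 0]; split; first exact: measurable_origin.
  rewrite originE (@lebesgue_rV_box R n (fun=> [set 0]))//; case: n n0 => // m _.
  by rewrite big_ord_recl lebesgue_measure_set1 mul0e.
by move=> x /= /negP; rewrite negbK => /eqP.
Qed.

Lemma mf_off0 (f : V -> R) : (forall x, x != 0 -> {for x, continuous f}) -> mf f.
Proof.
move=> cf; rewrite /mf -(setUv [set 0 : V]); apply/measurable_funU.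
- exact: measurable_origin.
- by apply: measurableC; exact: measurable_origin.
split; first exact: measurable_fun_set1.
apply: continuous_on_measurable => [|x x0]; last by apply: cf; apply/eqP.
apply: closed_openC; apply: accessible_closed_set1; apply: hausdorff_accessible.
exact: norm_hausdorff.
Qed.

Lemma mf_derive (f D : V -> R) i : mf f ->
  (forall x, x != 0 -> is_derive x (ed i) f (D x)) ->
  mf (fun x => \1_(~` [set 0 : V]) x * D x).
Proof.
move=> hf hD.
have m1 : mf (\1_(~` [set 0 : V]) : V -> R).
  by apply: measurable_indic; apply: measurableC; exact: measurable_origin.
pose q (k : nat) (x : V) := \1_(~` [set 0 : V]) x * (k.+1%:R * (f (affine 1 (k.+1%:R^-1 *: ed i) x) - f x)).
apply: (@measurable_fun_cvg _ _ _ setT q).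
  by move=> k; apply: mfM => //; apply: mfZ; apply: mfB => //; exact: mf_affine.
move=> x _; rewrite /q; have [->|x0] := eqVneq x 0.
  rewrite indicE memNset; last by move=> /=; exact.
  rewrite mul0r (_ : (fun k => _) = fun=> 0); first exact: cvg_cst.
  by apply/funext => k; rewrite mul0r.
rewrite indicE mem_set; last by move=> /= /eqP; rewrite (negbTE x0).
rewrite mul1r; have [dx <-] := hD x x0.
have u0 : (fun k : nat => (k.+1%:R : R)^-1) @ \oo --> (0 : R)^'.
  move=> P hP.
  have H : \forall k \near \oo, (k.+1%:R : R)^-1 != 0 -> P (k.+1%:R^-1).
    exact: (@cvg_harmonic R _ hP).
  suff : \forall k \near \oo, P ((k.+1%:R : R)^-1) by [].
  by apply: filterS H => k; apply; apply: invr_neq0; rewrite pnatr_eq0.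
have := cvg_comp _ _ u0 dx; apply: cvg_trans.
apply: near_eq_cvg; apply: nearW => k /=.
by rewrite invrK /affine scale1r (addrC x) mul1r.
Qed.

Lemma mf_inv (f : V -> R) : mf f -> mf (fun x => (f x)^-1).
Proof.
move=> hf; suff h : measurable_fun [set: R] (@GRing.inv R) by exact: measurableT_comp h hf.
rewrite -(setUv [set 0 : R]); apply/measurable_funU => //.
  by apply: measurableC.
split; first exact: measurable_fun_set1.
apply: open_continuous_measurable_fun.
  by apply: closed_openC; exact: closed_eq.
by move=> x; rewrite inE/= => /eqP x0; exact: inv_continuous.
Qed.

Lemma mf_prod (I : Type) (s : seq I) (F : I -> V -> R) : (forall i, mf (F i)) ->
  mf (fun x => \prod_(i <- s) F i x).
Proof.
move=> h; elim: s => [|i s IH].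
  by under eq_fun do rewrite big_nil; exact: mf_cst.
by under eq_fun do rewrite big_cons; exact: mfM.
Qed.

Lemma mf_det m (X : V -> 'M[R]_m) : (forall a b, mf (fun x => X x a b)) ->
  mf (fun x => \det (X x)).
Proof.
by move=> h; apply: mf_sum => s; apply: mfM; [exact: mf_cst|exact: mf_prod].
Qed.

Lemma mf_invmx N (X : V -> 'M[R]_N.+1) : (forall x, X x \is a GRing.unit) ->
  (forall a b, mf (fun x => X x a b)) -> forall a b, mf (fun x => (X x)^-1 a b).
Proof.
move=> uX mX a b.
have -> : (fun x => (X x)^-1 a b) = (fun x => (\det (X x))^-1 * ((-1) ^+ (b + a) *
    \det (row' b (col' a (X x))))).
  apply/funext => x; rewrite /GRing.inv/= /invmx.
  have -> : X x \in unitmx by exact: uX.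
  by rewrite !mxE.
apply: mfM; first by apply: mf_inv; exact: mf_det.
apply: mfM; first exact: mf_cst.
apply: mf_det => c e; rewrite (_ : (fun x => _) = fun x => X x (lift b c) (lift a e))//.
by apply/funext => x; rewrite !mxE.
Qed.

Lemma mf_mulmx N (X Y : V -> 'M[R]_N.+1) : (forall a b, mf (fun x => X x a b)) ->
  (forall a b, mf (fun x => Y x a b)) -> forall a b, mf (fun x => (X x * Y x) a b).
Proof.
move=> hX hY a b; under eq_fun do rewrite mulmx_entry.
by apply: mf_sum => c; exact: mfM.
Qed.

Lemma mf_nm N (X : V -> 'M[R]_N.+1) : (forall a b, mf (fun x => X x a b)) ->
  mf (fun x => nm (X x)).
Proof. by move=> h; apply: mf_sum => a; apply: mf_sum => b; exact: mf_norm. Qed.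

End measurability.

Section gauge_form.
Context {R : realType} {n N : nat}.
Notation V := 'rV[R]_n.
Notation mat := 'M[R]_N.+1.
Notation mu := (lebesgue_rV n).
Variables (G : set mat) (hG : compact_matrix_group G).
Variables (C : R) (C0 : 0 < C) (hC : forall X, G X -> nm X <= C).
Hypothesis n2_ : (2 <= n)%N.

Lemma sq_neq0 (x : V) : 1 <= sq x -> x != 0.
Proof.
move=> h; apply/eqP => x0; move: h; rewrite x0 /sq big1 => [|i _]; first by rewrite ler10.
by rewrite mxE expr0n.
Qed.

Section one.
Variables (A : 'I_n -> V -> mat) (g : V -> mat).
Hypotheses (tA : test_form A) (lA : lie_form G A) (gA : is_gauge G A g).
Hypotheses (gG : forall x, G (g x)) (vA : forall x : V, 1 <= sq x -> vanish A x 1).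

Lemma gauge_mf a b : mf (fun x => g x a b).
Proof. by apply: mf_off0 => x x0; exact: (gauge_continuous C0 hC tA gA). Qed.

Lemma gauge_inv_mf a b : mf (fun x => (g x)^-1 a b).
Proof. by apply: mf_invmx => [x|]; [exact: (group_unit hG)|exact: gauge_mf]. Qed.

Lemma test_form_mf i a b : mf (fun x => A i x a b).
Proof. by apply: smooth_mf; case: (tA i a b). Qed.

(** A choice of the derivatives at each point; it is measurable since B is g^-1 (dg + A g) and
    dg is a limit of difference quotients. *)
Lemma gauge_form : exists B : 'I_n -> V -> mat,
  [/\ forall x, x != 0 -> forall i a b,
        is_derive x (ed i) (fun y => g y a b) ((g x * B i x - A i x * g x) a b),
      forall x, x != 0 -> forall i, ((nm (B i x))%:E <=
        T (fun y : V => (C * C * nm (\sum_j y ord0 j *: curv A j i y))%R) x)%E,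
      forall x : V, \sum_i x ord0 i *: B i x = 0,
      forall x : V, 1 <= sq x -> g x = 1 /\ forall i, B i x = 0 &
      (forall i x, lie_algebra G (B i x)) /\ forall i a b, mf (fun x => B i x a b)].
Proof.
have : forall x : V, exists X : 'I_n -> mat, [/\ x != 0 -> [/\
    forall i a b, is_derive x (ed i) (fun y => g y a b) ((g x * X i - A i x * g x) a b),
    forall i, ((nm (X i))%:E <= T (fun y : V => (C * C * nm (\sum_j y ord0 j *: curv A j i y))%R) x)%E &
    vanish A x 1 -> g x = 1 /\ forall i, X i = 0], \sum_i x ord0 i *: X i = 0 &
    x = 0 -> forall i, X i = 0].
  move=> x; have [->|x0] := eqVneq x 0.
    by exists (fun=> 0); split=> //; apply: big1 => i _; rewrite scaler0.
  have [X [h1 h2 h3 h4]] := gauge_derive C0 hC tA gA x0.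
  by exists X; split=> // xx; move: x0; rewrite xx eqxx.
move=> /choice[B' hB']; pose B i x := B' x i.
have hD x : x != 0 -> forall i a b,
    is_derive x (ed i) (fun y => g y a b) ((g x * B i x - A i x * g x) a b).
  by move=> x0; have [/(_ x0)[]] := hB' x.
have B0 i : B i 0 = 0 by have [_ _ h] := hB' 0; exact: h.
exists B; split=> //.
- by move=> x x0; have [/(_ x0)[]] := hB' x.
- by move=> x; have [] := hB' x.
- move=> x x1; have [h _ _] := hB' x; have [_ _ h'] := h (sq_neq0 x1).
  by apply: h'; exact: vA.
split=> [i x|i].
  have [->|x0] := eqVneq x 0; first by rewrite B0; exact: lie0.
  exact: (gauge_derive_lie hG lA gG (hD x x0 i)).
pose D x := g x * B i x - A i x * g x.
pose D1 x : mat := \1_(~` [set 0 : V]) x *: (D x + A i x * g x).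
have mD1 a b : mf (fun x => D1 x a b).
  have -> : (fun x => D1 x a b) = (fun x => \1_(~` [set 0 : V]) x * D x a b +
      \1_(~` [set 0 : V]) x * (A i x * g x) a b).
    by apply/funext => x; rewrite /D1 mxE [X in _ * X]mxE mulrDr.
  apply: mfD; first by apply: (mf_derive (gauge_mf a b)) => x x0; exact: hD.
  apply: mfM; last by apply: mf_mulmx; [exact: test_form_mf|exact: gauge_mf].
  by apply: measurable_indic; apply: measurableC; exact: measurable_origin.
have -> : B i = fun x => (g x)^-1 * D1 x.
  apply/funext => x; rewrite /D1 /D subrK; have [->|x0] := eqVneq x 0.
    by rewrite B0 mulr0 scaler0 mulr0.
  rewrite indicE mem_set ?scale1r; last by move=> /= /eqP; rewrite (negbTE x0).
  by rewrite mulrA mulVr ?mul1r//; exact: (group_unit hG).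
exact: (mf_mulmx gauge_inv_mf mD1).
Qed.

Lemma curv_mf j i a b : mf (fun x => curv A j i x a b).
Proof.
have md k h : mf (fun x => dmx k (A h) x a b).
  under eq_fun do rewrite mxE; apply: smooth_mf; apply: smooth_partial.
  by case: (tA h a b).
under eq_fun do rewrite mxE3; apply: mfD; first exact: mfB.
under eq_fun do rewrite mxE2; apply: mfB; apply: mf_mulmx; exact: test_form_mf.
Qed.

Lemma curv_ray_mf i : mf (fun x : V => nm (\sum_j x ord0 j *: curv A j i x)).
Proof.
apply: mf_nm => a b; under eq_fun do rewrite summxE; apply: mf_sum => j.
by under eq_fun do rewrite mxE; apply: mfM; [exact: measurable_coord|exact: curv_mf].
Qed.

Lemma gauge_form_bound i x (q : V -> R) : mf q -> (forall y, 0 <= q y) ->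
  (forall y : V, nm (\sum_j y ord0 j *: curv A j i y) <= q y) ->
  (T (fun y : V => (C * C * nm (\sum_j y ord0 j *: curv A j i y))%R) x <= (C * C)%:E * T q x)%E.
Proof.
move=> mq q0 hq; have C2 : 0 <= C * C by rewrite mulr_ge0// ltW.
rewrite -TZ//; apply: le_T => //.
- by apply: mfZ; exact: curv_ray_mf.
- exact: mfZ.
- by move=> y; rewrite mulr_ge0// nm_ge0.
- by move=> y; rewrite ler_wpM2l.
Qed.

(** Away from the origin a gauge has bounded derivatives: only a bounded part of each ray
    meets the support of the connection. *)
Lemma gauge_form_bounded (r : R) : 0 < r -> exists K, forall i x, r <= sq x ->
  (T (fun y : V => (C * C * nm (\sum_j y ord0 j *: curv A j i y))%R) x <= K%:E)%E.
Proof.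
move=> r0; have [K [K0 hK1 hK2 _ _]] := form_bounds tA.
have C2 : 0 <= C * C by rewrite mulr_ge0// ltW.
pose K1 := C * C * (n%:R * (K + K + (K * K + K * K))).
have K10 : 0 <= K1 by rewrite !(mulr_ge0, addr_ge0)// ltW.
pose M := 1 + r^-1.
have M1 : 1 <= M by rewrite lerDl invr_ge0 ltW.
exists (K1 * M) => i x rx.
pose f (y : V) := C * C * nm (\sum_j y ord0 j *: curv A j i y).
have f1 y : f y <= K1.
  rewrite /f /K1; apply: ler_wpM2l => //; have [y1|y1] := leP 1 (sq y).
    rewrite big1 ?nm0; first by rewrite !(mulr_ge0, addr_ge0)// ltW.
    by move=> j _; rewrite curv0 ?scaler0//; exact: vA.
  apply: (le_trans (nm_sum _)); have -> : n%:R * (K + K + (K * K + K * K)) = \sum_(j < n) (K + K + (K * K + K * K)).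
    by rewrite sumr_const card_ord mulr_natl.
  apply: ler_sum => j _; rewrite nmZ.
  apply: (@le_trans _ _ (nm (curv A j i y))).
    by rewrite ler_piMl ?nm_ge0// entry_sq1// ltW.
  apply: (le_trans (nmD _ _)); apply: lerD.
    by apply: (le_trans (nmB _ _)); apply: lerD.
  by apply: (le_trans (nmB _ _)); apply: lerD; apply: (le_trans (nmM _ _));
     apply: ler_pM => //; exact: nm_ge0.
have f0 y : 1 <= sq y -> f y = 0.
  by move=> y1; rewrite /f big1 ?nm0 ?mulr0// => j _; rewrite curv0 ?scaler0//; exact: vA.
have mf_ : mf f by apply: mfZ; exact: curv_ray_mf.
apply: (@le_trans _ _ (\int[lebesgue_measure]_(s in `[1%R, +oo[) (K1%:E * (\1_(`[1%R, M]%classic) s)%:E))%E).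
  apply: ge0_le_integral => //.
  - by move=> s _; rewrite lee_fin mulr_ge0// nm_ge0.
  - by apply/measurable_EFinP; apply: measurable_funTS; exact: (mf_ray x mf_).
  - apply: measurable_funTS; apply: measurable_funeM; apply/measurable_EFinP.
    exact: measurable_indic.
  move=> s; rewrite /= in_itv/= andbT => s1; rewrite lee_fin indicE.
  have [sM|sM] := leP s M.
    by rewrite mem_set ?mulr1; [exact: f1|rewrite /= in_itv/= s1].
  rewrite memNset ?mulr0; last by rewrite /= in_itv/= s1 leNgt sM.
  apply: le_of_eq; apply: f0.
  have ss : s <= s ^+ 2 by rewrite expr2 ler_peMl// (le_trans _ s1).
  have s0 : 0 <= s ^+ 2 by exact: sqr_ge0.
  rewrite sqZ; apply: le_trans (ler_wpM2l s0 rx); rewrite -ler_pdivrMr// div1r.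
  by apply: le_trans ss; rewrite ltW// (le_lt_trans _ sM)// lerDr.
rewrite ge0_integralZl//; last first.
  by apply/measurable_EFinP; exact: measurable_indic.
rewrite [leRHS]EFinM; apply: lee_wpmul2l; first by rewrite lee_fin.
rewrite integral_indic// setIidl; last by move=> s /=; rewrite !in_itv/= andbT => /andP[].
have H : (lebesgue_measure `[1%R, M]%classic = (M - 1)%:E)%E.
  by rewrite lebesgue_measure_itv/= lte_fin ltrDl invr_gt0 r0 -EFinD.
change (lebesgue_measure `[1%R, M]%classic <= M%:E)%E.
by rewrite H lee_fin gerDl lerN10.
Qed.

End one.

(** Duhamel's bound is T |A - A'|, and T is bounded on L1. *)
Lemma gauge_n1 A A' g g' : test_form A -> test_form A' -> is_gauge G A g -> is_gauge G A' g' ->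
  (forall x, G (g x)) -> (forall x, G (g' x)) ->
  (forall x : V, 1 <= sq x -> vanish A x 1) -> (forall x : V, 1 <= sq x -> vanish A' x 1) ->
  (n1 mu (fun x => nm (g x - g' x)) <=
   (C * (C * C))%:E * n1 mu (fun x => \sum_j nm (A j x - A' j x))%R)%E.
Proof.
move=> tA tA' gA gA' gG gG' vA vA'.
have mg := gauge_mf tA gA; have mg' := gauge_mf tA' gA'.
pose f x := C * (C * C) * \sum_j nm (A j x - A' j x).
have C3 : 0 <= C * (C * C) by rewrite !mulr_ge0// ltW.
have f0 x : 0 <= f x by rewrite mulr_ge0//; apply: sumr_ge0 => j _; exact: nm_ge0.
have mAA j a b : mf (fun x => (A j x - A' j x) a b).
  by under eq_fun do rewrite mxE2; apply: mfB; exact: test_form_mf.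
have ms : mf (fun x => \sum_j nm (A j x - A' j x)) by apply: mf_sum => j; exact: mf_nm.
have mf_ : mf f by exact: mfZ.
have mgg : mf (fun x => nm (g x - g' x)).
  by apply: mf_nm => a b; under eq_fun do rewrite mxE2; exact: mfB.
have <- : n1 mu f = ((C * (C * C))%:E * n1 mu (fun x => \sum_j nm (A j x - A' j x))%R)%E.
  by rewrite n1Z// ger0_norm.
have [mT iT] := T_meas n2_ mf_ f0; apply: le_trans iT.
apply: ae_ge0_le_integral => //.
- by apply: mfE; exact: mf_norm.
- by move=> x _; exact: T_ge0.
apply: filterS (ae_neq0 (ltnW n2_)) => x x0 _.
rewrite ger0_norm ?nm_ge0//.
apply: (le_trans (gauge_stable C0 hC tA tA' gA gA' x0)).
have C2 : 0 <= C * C by rewrite mulr_ge0// ltW.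
pose h y := C * C * \sum_j nm (A j y - A' j y).
have h0 y : 0 <= h y by rewrite mulr_ge0//; apply: sumr_ge0 => j _; exact: nm_ge0.
have mh : mf h by exact: mfZ.
have -> : T f x = (C%:E * T h x)%E.
  rewrite -TZ// ?ltW//; congr (T _ x); apply/funext => y; rewrite /f /h; ring.
apply: lee_wpmul2l; first by rewrite lee_fin ltW.
apply: ge0_le_integral => //.
- by move=> s _; rewrite lee_fin mulr_ge0// nm_ge0.
- apply/measurable_EFinP; apply: measurable_funTS; 
  apply: (@mf_ray _ _ (fun y => C * C * nm (\sum_j x ord0 j *: A j y - \sum_j x ord0 j *: A' j y))).
  apply: mfZ; apply: mf_nm => a b.
  have E (B : 'I_n -> V -> mat) : test_form B -> mf (fun y => (\sum_j x ord0 j *: B j y) a b).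
    move=> tB; under eq_fun do rewrite summxE; apply: mf_sum => j.
    by under eq_fun do rewrite mxE; apply: mfZ; exact: test_form_mf.
  by under eq_fun do rewrite mxE2; apply: mfB; exact: E.
- by apply/measurable_EFinP; apply: measurable_funTS; exact: mf_ray.
move=> s s1; rewrite lee_fin; apply: ler_wpM2l => //.
move: s1; rewrite /= in_itv/= andbT => s1.
have -> : ray A x s - ray A' x s = \sum_j x ord0 j *: (A j (s *: x) - A' j (s *: x)).
  by rewrite /ray -sumrB; apply: eq_bigr => j _; rewrite scalerBr.
have [y1|y1] := leP 1 (sq (s *: x)).
  have E (B : 'I_n -> V -> mat) j : (forall x : V, 1 <= sq x -> vanish B x 1) -> B j (s *: x) = 0.
    by move=> vB; have [+ _] := vB _ y1 1 (lexx 1) j; rewrite scale1r.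
  rewrite big1 ?nm0; first by apply: sumr_ge0 => j _; exact: nm_ge0.
  by move=> j _; rewrite !E// subrr scaler0.
apply: (le_trans (nm_sum _)); apply: ler_sum => j _; rewrite nmZ ler_piMl ?nm_ge0//.
apply: le_trans (_ : `|(s *: x) ord0 j| <= 1); last exact: entry_sq1 (ltW y1).
by rewrite mxE normrM ler_peMl// (le_trans s1)// ler_norm.
Qed.

End gauge_form.

(** * The limit of the gauges *)
Section limit_gauge.
Context {R : realType} {n N : nat}.
Notation V := 'rV[R]_n.
Notation mat := 'M[R]_N.+1.
Notation mu := (lebesgue_rV n).
Implicit Types (X Y : V -> mat).

Definition mfx X := forall a b, mf (fun x => X x a b).

Lemma to0_harmonic (u : nat -> \bar R) :
  (forall k, (u k <= (k.+1%:R^-1)%:E)%E) -> to0 u.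
Proof.
move=> h e e0; have [M hM] := @harmonic_small R 1 e e0; exists M => k /hM hk.
by apply: (le_trans (h k)); rewrite lee_fin -[leLHS]mul1r.
Qed.

Lemma n1_nm_entry X a b : mfx X -> (n1 mu (fun x => X x a b) <= n1 mu (fun x => nm (X x)))%E.
Proof.
move=> mX; apply: le_n1 => //; first exact: mf_nm.
by move=> x; rewrite (ger0_norm (nm_ge0 _)) le_nm.
Qed.

Lemma to0_nm (X : nat -> V -> mat) : (forall k, mfx (X k)) ->
  (forall a b, to0 (fun k => n1 mu (fun x => X k x a b))) ->
  to0 (fun k => n1 mu (fun x => nm (X k x))).
Proof.
move=> mX h; apply: to0_le (to0_sum (index_enum _) (fun a => to0_sum (index_enum _) (h a))) => k.
apply: (le_trans (n1_sum _ _ _)) => [a|]; first by apply: mf_sum => b; exact: mf_norm (mX k a b).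
apply: lee_sum => a _; apply: (le_trans (n1_sum _ _ _)) => [b|]; first exact: mf_norm (mX k a b).
by apply: lee_sum => b _; rewrite n1_absE.
Qed.

Lemma mfx_sub X Y : mfx X -> mfx Y -> mfx (fun x => X x - Y x).
Proof. by move=> hX hY a b; under eq_fun do rewrite mxE2; exact: mfB. Qed.

(** The distance of the limit to its nearest group element is at most its distance to u k,
    which tends to 0 almost everywhere along a subsequence. *)
Lemma group_limit (G : set mat) (u : nat -> V -> mat) : compact_matrix_group G ->
  (forall k, mfx (u k)) -> (forall k x, G (u k x)) ->
  (forall e : R, 0 < e -> exists M, forall k m, (M <= k)%N -> (M <= m)%N ->
     (n1 mu (fun x => nm (u k x - u m x)) <= e%:E)%E) ->
  exists g : V -> mat, [/\ mfx g, forall x, G (g x),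
    to0 (fun k => n1 mu (fun x => nm (u k x - g x))) &
    forall S : set V, (forall k x, S x -> u k x = 1) -> forall x, S x -> g x = 1].
Proof.
move=> hG mu_ uG hu.
have /choice[g' hg'] : forall ab : 'I_N.+1 * 'I_N.+1, exists f : V -> R, mf f /\
    to0 (fun k => n1 mu (fun x => u k x ab.1 ab.2 - f x)%R).
  move=> [a b] /=.
  have hc e : 0 < e -> exists M, forall k m, (M <= k)%N -> (M <= m)%N ->
     (n1 mu (fun x => u k x a b - u m x a b)%R <= e%:E)%E.
    move=> /hu[M hM]; exists M => k m Mk Mm; apply: le_trans (hM k m Mk Mm).
    have := n1_nm_entry a b (mfx_sub (mu_ k) (mu_ m)); congr (_ <= _)%E.
    by apply: eq_n1 => x; rewrite mxE2.
  have [f [s [mf_ _ _ h]]] := L1_complete (fun k => mu_ k a b) hc.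
  by exists f.
pose g0 x : mat := \matrix_(a, b) g' (a, b) x.
have mg0 : mfx g0 by move=> a b; under eq_fun do rewrite mxE; case: (hg' (a, b)).
have md k : mfx (fun x => u k x - g0 x) by exact: mfx_sub.
have t0 : to0 (fun k => n1 mu (fun x => nm (u k x - g0 x))).
  apply: to0_nm => // a b; have [_] := hg' (a, b); apply: to0_le => k.
  by apply: le_of_eq; apply: eq_n1 => x; rewrite !mxE.
have md' k : mf (fun x => nm (u k x - g0 x)) by exact: mf_nm (md k).
have hc : forall e : R, 0 < e -> exists M, forall k m, (M <= k)%N -> (M <= m)%N ->
     (n1 mu (fun x => nm (u k x - g0 x) - nm (u m x - g0 x))%R <= e%:E)%E.
  move=> e e0; have [M hM] := t0 (e / 2) (divr_gt0 e0 (ltr0n _ 2)); exists M => k m Mk Mm.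
  apply: (le_trans (n1B mu (md' k) (md' m))).
  by rewrite (splitr e) EFinD; apply: leeD; exact: hM.
have [f [s [mf_ hs sf tf]]] := L1_complete md' hc.
have f0 : {ae mu, forall x, f x = 0}.
  apply: n1_small_ae0 => // e e0; have e2 := divr_gt0 e0 (ltr0n _ 2).
  have [M1 h1] := t0 _ e2; have [M2 h2] := tf _ e2; pose k := maxn M1 M2.
  have := n1B mu (md' k) (mfB (md' k) mf_).
  rewrite (_ : n1 mu _ = n1 mu f); last by apply: eq_n1 => x; rewrite subKr.
  move=> h; apply: (le_trans h); rewrite (splitr e) EFinD; apply: leeD.
    by apply: h1; exact: leq_maxl.
  by apply: h2; exact: leq_maxr.
have ae1 : {ae mu, forall x, G (g0 x) /\ forall S : set V, (forall k x, S x -> u k x = 1) -> S x -> g0 x = 1}.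
  apply: filterS2 f0 sf => x fx; rewrite fx => cx.
  have key q : (forall k, nm (g0 x - q) <= nm (u (s k) x - g0 x)) -> g0 x = q.
    move=> hq; apply/eqP; rewrite -subr_eq0; apply/eqP/nm_eq0.
    apply: (cvgr_to_ge cx); exact: nearW.
  split; last first.
    by move=> S hS Sx; apply: key => k; rewrite hS// nm_distC.
  have [q Gq hq] := group_nearest hG (g0 x).
  rewrite (key q)// => k; rewrite [leRHS]nm_distC; exact: hq.
have [N0 [mN0 N00 hN0]] := ae1.
pose g x : mat := if x \in N0 then 1 else g0 x.
have gE a b : (fun x => g x a b) = (fun x => \1_N0 x * (1 : mat) a b + \1_(~` N0) x * g0 x a b).
  apply/funext => x; rewrite /g !indicE in_setC; case: (x \in N0) => /=.
    by rewrite mul1r mul0r addr0.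
  by rewrite mul1r mul0r add0r.
have off x : x \notin N0 -> G (g0 x) /\ forall S : set V, (forall k x, S x -> u k x = 1) -> S x -> g0 x = 1.
  by move=> /negP h; apply: contrapT => h'; apply: h; rewrite inE; exact: hN0.
have mg : mfx g.
  move=> a b; rewrite gE; apply: mfD; apply: mfM => //; try exact: mf_cst.
    by apply: measurable_indic.
  by apply: measurable_indic; exact: measurableC.
exists g; split=> //.
- move=> x; rewrite /g; case: ifPn => [_|/off[]//]; exact: group1G hG.
- apply: to0_le t0 => k; apply: le_of_eq.
  apply: ae_eq_integral => //.
  + by apply: mfE; apply: mf_norm; apply: mf_nm; exact: mfx_sub.
  + by apply: mfE; apply: mf_norm.
  exists N0; split=> // x /= h; apply: contrapT => xN; apply: h => _.
  by rewrite /g memNset.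
- by move=> S hS x Sx; rewrite /g; case: ifPn => // /off[_ h]; exact: (h S).
Qed.

(** b restricted to the interval [-t, t], in a form that is visibly measurable. *)
Definition clip (t b : R) : R := (`|b + t| - `|b - t|) / 2.

Lemma clip_le (t b : R) : 0 <= t -> `|clip t b| <= t.
Proof.
move=> t0; have := ler_dist_dist (b + t) (b - t).
have -> : b + t - (b - t) = t + t by ring.
rewrite (ger0_norm (addr_ge0 t0 t0)) /clip normrM (@ger0_norm _ (2^-1))//.
by lra.
Qed.

Lemma clip_dist (t b e : R) : 0 <= t -> 0 <= e -> `|b| <= t + e -> `|b - clip t b| <= e.
Proof.
move=> t0 e0; rewrite /clip; case: (ger0P (b + t)) => h1; case: (ger0P (b - t)) => h2;
 rewrite !ler_norml => /andP[h3 h4]; apply/andP; split; lra.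
Qed.

Lemma clip0 (t : R) : clip t 0 = 0.
Proof. by rewrite /clip add0r sub0r normrN subrr mul0r. Qed.

Lemma mf_clip (t b : V -> R) : mf t -> mf b -> mf (fun x => clip (t x) (b x)).
Proof.
move=> mt mb; apply: mfM; last exact: mf_cst.
by apply: mfB; apply: mf_norm; [exact: mfD|exact: mfB].
Qed.

Section sequences.
Variables (G : set mat) (A : 'I_n -> V -> mat).
Hypotheses (hG : compact_matrix_group G) (n4 : (4 <= n)%N).
Hypothesis mA : forall i, mfx (A i).
Hypothesis happrox : exists C0 : R, forall e, 0 < e -> exists A' q E,
  approximates G A A' C0 e q E.

(** B k is bounded by C^2 (T q + T E) with T q bounded in L2 and T E small in L1. Its entries
    clipped at C^2 T q form P k, bounded in L2 and close to B k in L1. *)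
Theorem approximating_gauges :
  exists (g : V -> mat) (gk : nat -> V -> mat) (Ak Bk Pk : nat -> 'I_n -> V -> mat) (C1 : R),
  [/\ [/\ mfx g, forall x, G (g x) & forall x, 1 <= sq x -> g x = 1],
    [/\ forall k, mfx (gk k), forall k x, G (gk k x) &
      to0 (fun k => n1 mu (fun x => nm (gk k x - g x)))],
    [/\ forall k, test_form (Ak k) &
      forall i, to0 (fun k => n1 mu (fun x => nm (Ak k i x - A i x)))],
    (forall k (r : R), 0 < r -> exists K, forall i x, r <= sq x -> nm (Bk k i x) <= K) /\
    [/\ forall k x, x != 0 -> forall i a b, is_derive x (ed i) (fun y => gk k y a b)
        ((gk k x * Bk k i x - Ak k i x * gk k x) a b),
      forall k (x : V), \sum_i x ord0 i *: Bk k i x = 0,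
      forall k i x, lie_algebra G (Bk k i x),
      (forall k i, mfx (Bk k i)) &
      forall k i x, 1 <= sq x -> Bk k i x = 0] &
    [/\ forall k i, mfx (Pk k i),
      forall k i a b, (n2 mu (fun x => Pk k i x a b) <= C1%:E)%E,
      forall k i x, 1 <= sq x -> Pk k i x = 0 &
      forall i, to0 (fun k => n1 mu (fun x => nm (Bk k i x - Pk k i x)))]].
Proof.
have [C0 hap] := happrox; have [C Cp hC] := group_bounded hG.
have n2_ : (2 <= n)%N by exact: leq_trans n4.
have k0 (k : nat) : 0 < k.+1%:R^-1 :> R by rewrite invr_gt0 ltr0n.
have /choice[t ht] : forall k : nat, exists t : ('I_n -> V -> mat) * (V -> R) * (V -> R),
  approximates G A t.1.1 C0 k.+1%:R^-1 t.1.2 t.2.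
  by move=> k; have [A' [q [E h]]] := hap _ (k0 k); exists (A', q, E).
pose Ak k := (t k).1.1; pose q k := (t k).1.2; pose E k := (t k).2.
have tA k : test_form (Ak k) by have [[]] := ht k.
have lA k : lie_form G (Ak k) by have [[]] := ht k.
have vA k (x : V) : 1 <= sq x -> vanish (Ak k) x 1 by have [[_ _ h] _ _ _ _] := ht k; exact: h.
have nA k i a b : (n1 mu (fun x => Ak k i x a b - A i x a b)%R <= (k.+1%:R^-1)%:E)%E.
  by have [_ h _ _ _] := ht k; exact: h.
have /choice[gk hgk] : forall k, exists g, (forall x, G (g x)) /\ is_gauge G (Ak k) g.
  by move=> k; exact: is_gauge_exists.
have gG k x : G (gk k x) by have [h _] := hgk k; exact: h.
have gA k : is_gauge G (Ak k) (gk k) by have [] := hgk k.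
have mg k : mfx (gk k) by move=> a b; exact: (gauge_mf Cp hC (tA k) (gA k)).
have hB k := gauge_form hG Cp hC (tA k) (lA k) (gA k) (gG k) (vA k).
have /choice[Bk hBk] := hB; move=> {hB}.
have mAk k i : mfx (Ak k i) by move=> a b; exact: test_form_mf.
have mAA k i : mfx (fun x => Ak k i x - A i x) by exact: mfx_sub.
have toA i : to0 (fun k => n1 mu (fun x => nm (Ak k i x - A i x))).
  apply: to0_nm => // a b; apply: to0_harmonic => k; apply: le_trans (nA k i a b).
  by apply: le_of_eq; apply: eq_n1 => x; rewrite mxE2.
pose w k := n1 mu (fun x => \sum_j nm (Ak k j x - A j x)).
have mS k : mf (fun x => \sum_j nm (Ak k j x - A j x)) by apply: mf_sum => j; exact: mf_nm (mAA k j).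
have tow : to0 w.
  apply: to0_le (to0_sum (index_enum _) toA) => k.
  by apply: n1_sum => j; exact: mf_nm (mAA k j).
have C3 : 0 < C * (C * C) by rewrite !mulr_gt0.
have [] := @group_limit G gk hG mg gG.
  move=> e e0; have e2 : 0 < e / 2 / (C * (C * C)) by rewrite !divr_gt0.
  have [M hM] := tow _ e2; exists M => k m Mk Mm.
  apply: (le_trans (gauge_n1 Cp hC n2_ (tA k) (tA m) (gA k) (gA m) (gG k) (gG m) (vA k) (vA m))).
  have h : (n1 mu (fun x => \sum_j nm (Ak k j x - Ak m j x))%R <= w k + w m)%E.
    apply: le_trans (n1D mu (mS k) (mS m)); apply: le_n1.
    - by apply: mf_sum => j; apply: mf_nm; exact: mfx_sub.
    - exact: mfD.
    move=> x; rewrite !ger0_norm ?addr_ge0 ?sumr_ge0// => [|j _|j _|j _]; try exact: nm_ge0.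
    rewrite -big_split; apply: ler_sum => j _ /=; rewrite [X in _ <= _ + X]nm_distC.
    by apply: le_trans (nmD _ _); rewrite addrA subrK.
  have C3e : (0 <= (C * (C * C))%:E)%E by rewrite lee_fin ltW.
  apply: (le_trans (lee_wpmul2l C3e (le_trans h (leeD (hM k Mk) (hM m Mm))))).
  rewrite -EFinD -EFinM lee_fin; apply: le_of_eq; field.
  by rewrite gt_eqF.
move=> g [mg_ Gg tog gone].
pose tau k x := C * C * Tr (q k) x.
have mq k : mf (q k) by have [_ _ [h _ _ _] _ _] := ht k.
have q0 k y : 0 <= q k y by have [_ _ [_ h _ _] _ _] := ht k; exact: h.
have fq k : (n1 mu (q k) < +oo)%E by have [_ _ [_ _ h _] _ _] := ht k.
have nq k : (n2 mu (Tr (q k)) <= C0%:E)%E by have [_ _ [_ _ _ h] _ _] := ht k.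
have mE k : mf (E k) by have [_ _ _ [h _ _] _] := ht k.
have E0 k y : 0 <= E k y by have [_ _ _ [_ h _] _] := ht k; exact: h.
have nE k : (n1 mu (E k) <= (k.+1%:R^-1)%:E)%E by have [_ _ _ [_ _ h] _] := ht k.
have hq k i (y : V) : nm (\sum_j y ord0 j *: curv (Ak k) j i y) <= q k y + E k y.
  by have [_ _ _ _ h] := ht k; exact: h.
have mTq k : mf (Tr (q k)) by exact: mf_Tr.
have mTE k : mf (Tr (E k)) by exact: mf_Tr.
have C2 : 0 <= C * C by rewrite mulr_ge0// ltW.
have mtau k : mf (tau k) by exact: mfZ.
have tau0 k x : 0 <= tau k x by rewrite mulr_ge0// Tr_ge0.
pose Pk k i x : mat := \matrix_(a, b) clip (tau k x) (Bk k i x a b).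
have mB k i : mfx (Bk k i) by have [_ _ _ _ [_ h]] := hBk k; exact: h.
have mP k i : mfx (Pk k i).
  by move=> a b; under eq_fun do rewrite mxE; exact: mf_clip (mtau k) (mB k i a b).
have B1 k i x : 1 <= sq x -> Bk k i x = 0.
  by move=> x1; have [_ _ _ h _] := hBk k; have [_] := h x x1; apply.
exists g, gk, Ak, Bk, Pk, ((C * C) ^+ 2 * C0); split.
- split=> // x x1; apply: (gone [set x | 1 <= sq x]) => // k y /= y1.
  by have [_ _ _ h _] := hBk k; have [] := h y y1.
- by split.
- by split.
- split.
    move=> k r r0; have [K hK] := gauge_form_bounded Cp (tA k) (vA k) r0.
    exists K => i x rx; rewrite -lee_fin; apply: le_trans (hK i x rx).
    have [_ h _ _ _] := hBk k; apply: h; apply: contraTneq rx => ->.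
    by rewrite -ltNge /sq big1// => j _; rewrite mxE expr0n.
  split=> //.
  + by move=> k; have [h _ _ _ _] := hBk k; exact: h.
  + by move=> k; have [_ _ h _ _] := hBk k; exact: h.
  + by move=> k; have [_ _ _ _ [h _]] := hBk k; exact: h.
split=> //.
- move=> k i a b; apply: (@le_trans _ _ (n2 mu (tau k))).
    apply: le_n2 => // [|x]; first exact: mP.
    by rewrite mxE (ger0_norm (tau0 k x)) clip_le.
  rewrite n2Z// [leRHS]EFinM; apply: lee_wpmul2l; last exact: nq.
  by rewrite lee_fin sqr_ge0.
- by move=> k i x x1; apply/matrixP => a b; rewrite !mxE B1// mxE clip0.
move=> i; apply: to0_nm => [k|a b]; first exact: mfx_sub.
have tC : to0 (fun k => (C * C)%:E * (k.+1%:R^-1)%:E)%E.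
  by apply: to0Z => //; apply: to0_harmonic.
apply: to0_le tC => k.
have mTEk : mf (fun x => C * C * Tr (E k) x) by exact: mfZ.
apply: (@le_trans _ _ (n1 mu (fun x => C * C * Tr (E k) x)%R)).
  apply: ae_le_n1 => //; first exact: mfx_sub.
  have fE : (n1 mu (E k) < +oo)%E by apply: le_lt_trans (nE k) _; rewrite ltry.
  apply: filterS3 (Tr_fin n2_ (mq k) (q0 k) (fq k)) (Tr_fin n2_ (mE k) (E0 k) fE)
    (ae_neq0 (ltnW n2_)) => x hx1 hx2 x0.
  have e0 : 0 <= C * C * Tr (E k) x by rewrite mulr_ge0// Tr_ge0.
  rewrite (ger0_norm e0) mxE2 [X in _ - X]mxE; apply: clip_dist => //.
  apply: (le_trans (le_nm _ _ _)); rewrite -lee_fin.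
  have [_ h _ _ _] := hBk k; apply: (le_trans (h x x0 i)).
  have mqE : mf (fun y => q k y + E k y) by exact: mfD.
  have qE0 y : 0 <= q k y + E k y by rewrite addr_ge0.
  apply: (le_trans (gauge_form_bound Cp (tA k) x mqE qE0 (hq k i))).
  by rewrite TD// hx1 hx2 -EFinD -EFinM lee_fin /tau mulrDr.
rewrite n1Z// (ger0_norm C2); apply: lee_wpmul2l; first by rewrite lee_fin.
exact: le_trans (n1_Tr n2_ (mE k) (E0 k)) (nE k).
Qed.

End sequences.
End limit_gauge.

(** * Weak limits *)
Section weak_limit.
Context {R : realType} {n : nat}.
Notation V := 'rV[R]_n.
Notation mu := (lebesgue_rV n).
Implicit Types (f g : V -> R).

Lemma Rint_lim (f : nat -> V -> R) g : (forall k, L1 mu (f k)) -> L1 mu g ->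
  to0 (fun k => n1 mu (fun x => f k x - g x)%R) ->
  (fun k => \int[mu]_x f k x) @ \oo --> \int[mu]_x g x.
Proof.
move=> Lf Lg h; apply/cvgrPdist_le => e e0; have [M hM] := h e e0.
exists M => // k /= Mk; rewrite distrC -RintB//.
have Ld : L1 mu (fun x => f k x - g x) by exact: L1B.
rewrite -lee_fin; apply: le_trans (hM k Mk).
exact: le_norm_Rint.
Qed.

Lemma Rint_sqr f : sqL mu f -> fine (n2 mu f) = \int[mu]_x (f x ^+ 2).
Proof. by []. Qed.

Lemma L1_sqr f : sqL mu f -> L1 mu (fun x => f x ^+ 2).
Proof. by move=> h; under eq_fun do rewrite expr2; exact: sqLM. Qed.

Lemma n2_fine f : sqL mu f -> n2 mu f = (fine (n2 mu f))%:E.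
Proof. by move=> [_ h]; rewrite fineK// ge0_fin_numE// n2_ge0. Qed.

Lemma parallelogram f g : sqL mu f -> sqL mu g ->
  fine (n2 mu (fun x => f x + g x)%R) + fine (n2 mu (fun x => f x - g x)%R) =
  2 * fine (n2 mu f) + 2 * fine (n2 mu g).
Proof.
move=> hf hg; have [h1 h2] := (sqLD hf hg, sqLB hf hg).
rewrite !Rint_sqr// -RintD; [|exact: L1_sqr|exact: L1_sqr].
rewrite -!RintZ; [|exact: L1_sqr|exact: L1_sqr].
rewrite -RintD; [|by apply: L1Z; exact: L1_sqr|by apply: L1Z; exact: L1_sqr].
by apply: eq_Rintegral => x _; ring.
Qed.

(** The inequality of Cauchy and Schwarz with the indicator of the unit box. *)
Lemma small_n2_n1 (e : R) : 0 < e -> exists2 d : R, 0 < d & forall f, mf f ->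
  (forall x, 1 <= sq x -> f x = 0) -> (n2 mu f <= d%:E)%E -> (n1 mu f <= e%:E)%E.
Proof.
move=> e0; pose u := \1_(@cbox R n 1) : V -> R.
have Qu : sqL mu u := sqL_cbox n 1.
pose M := fine (n2 mu u); have M0 : 0 <= M by rewrite fine_ge0// n2_ge0.
have M1 : 0 < 1 + M by rewrite ltr_pwDl.
pose c := e / 2 / (1 + M); have c0 : 0 < c by rewrite !divr_gt0.
exists (c * (e / 2)); first by rewrite mulr_gt0// divr_gt0.
move=> f mf_ f0 hf.
have -> : n1 mu f = n1 mu (fun x => u x * f x).
  apply: eq_n1 => x; rewrite /u indicE; case: (leP `|x| 1) => xr.
    by rewrite mem_set ?mul1r//; apply/cboxP.
  by rewrite f0 ?mulr0//; exact: far.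
apply: (le_trans (n1M_young mu c0 Qu.1 mf_)).
rewrite (n2_fine Qu) -/M; apply: (@le_trans _ _ ((c * M)%:E + (e / 2)%:E)%E).
  apply: leeD; first by rewrite EFinM.
  apply: (@le_trans _ _ ((c^-1)%:E * (c * (e / 2))%:E)%E).
    by apply: lee_wpmul2l => //; rewrite lee_fin invr_ge0 ltW.
  by rewrite -EFinM mulKf ?gt_eqF.
rewrite -EFinD lee_fin; have : c * M <= e / 2.
  rewrite /c mulrAC ler_pdivrMr// ler_wpM2l ?lerDr ?divr_ge0// ltW//.
lra.
Qed.

Lemma n2_mid f g (K : R) : mf f -> mf g -> (n2 mu f <= K%:E)%E -> (n2 mu g <= K%:E)%E ->
  (n2 mu (fun x => 2^-1 * (f x + g x))%R <= K%:E)%E.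
Proof.
move=> mf_ mg hf hg; rewrite n2Z; last exact: mfD.
have p2 : (0 <= 2%:E :> \bar R)%E by rewrite lee_fin.
have p4 : (0 <= ((2^-1) ^+ 2)%:E :> \bar R)%E by rewrite lee_fin sqr_ge0.
have h := le_trans (n2D mu mf_ mg) (leeD (lee_wpmul2l p2 hf) (lee_wpmul2l p2 hg)).
apply: (le_trans (lee_wpmul2l p4 h)).
have -> : (2%:E * K%:E + 2%:E * K%:E)%E = (4 * K)%:E by rewrite -EFinM -EFinD; congr EFin; ring.
by rewrite -EFinM lee_fin; apply: le_of_eq; field.
Qed.

Variable (I : finType).
Let W := (I * V -> R^o)%type.

Let part (u : W) t : V -> R := fun x => u (t, x).

(** Convex combinations of the tails that converge strongly; on their limit a functional takes
    the value to which it tends along the sequence. All components are treated at once, since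
    the functionals mix them. *)
Theorem weak_limit (v : nat -> I -> V -> R) (K : R) :
  (forall k t, mf (v k t)) -> (forall k t, (n2 mu (v k t) <= K%:E)%E) ->
  (forall k t x, 1 <= sq x -> v k t x = 0) ->
  exists B : I -> V -> R, [/\ forall t, sqL mu (B t), forall t x, 1 <= sq x -> B t x = 0 &
    forall (J : finType) (s : J -> I) (c : J -> V -> R) (M L : R),
    (forall j, mf (c j)) -> (forall j x, `|c j x| <= M) ->
    (fun k => \int[mu]_x \sum_j c j x * v k (s j) x) @ \oo --> L ->
    \int[mu]_x \sum_j c j x * B (s j) x = L].
Proof.
move=> mv nv v0.
pose P (u : W) := [/\ forall t, mf (part u t), forall t, (n2 mu (part u t) < +oo)%E &
  forall t x, 1 <= sq x -> part u t x = 0].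
have PQ u : P u -> forall t, sqL mu (part u t) by move=> [h1 h2 _] t; split.
pose q (u : W) : R := \sum_t fine (n2 mu (part u t)).
pose vW k : W := fun p => v k p.1 p.2.
have Pv k : P (vW k).
  by split => [t|t|t x x1]; [exact: mv|exact: le_lt_trans (nv k t) (ltry _)|exact: v0].
have PD u w : P u -> P w -> P (u + w).
  move=> Pu Pw; have hu := PQ _ Pu; have hw := PQ _ Pw; split=> [t|t|t x x1].
  - by have [] := sqLD (hu t) (hw t).
  - by have [] := sqLD (hu t) (hw t).
  by rewrite /part fctE; case: Pu => _ _ h; case: Pw => _ _ h'; rewrite [u _]h// [w _]h'// addr0.
have PZ (c : R) u : P u -> P (c *: u).
  move=> Pu; have hu := PQ _ Pu; split=> [t|t|t x x1].
  - by have [] := sqLZ c (hu t).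
  - by have [] := sqLZ c (hu t).
  by rewrite /part fctE; case: Pu => _ _ h; rewrite [u _]h// scaler0.
have q0 u : 0 <= q u by apply: sumr_ge0 => t _; rewrite fine_ge0// n2_ge0.
have qP u w : P u -> P w -> q (u + w) + q (u - w) = 2 * q u + 2 * q w.
  move=> Pu Pw; rewrite /q -big_split !mulr_sumr -big_split/=; apply: eq_bigr => t _.
  exact: parallelogram (PQ _ Pu t) (PQ _ Pw t).
have qZ (c : R) u : P u -> q (c *: u) = c ^+ 2 * q u.
  move=> Pu; rewrite /q mulr_sumr; apply: eq_bigr => t _.
  have [m _] := PQ _ Pu t.
  have -> : n2 mu (part (c *: u) t) = ((c ^+ 2)%:E * n2 mu (part u t))%E by exact: n2Z.
  by rewrite (n2_fine (PQ _ Pu t)).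
have qv k : q (vW k) <= \sum_(t : I) K.
  apply: ler_sum => t _; rewrite -lee_fin -n2_fine; first exact: nv.
  exact: (PQ _ (Pv k)).
have [w [hw cw]] := mazur PD PZ q0 qP qZ Pv qv.
pose Q (u : W) := P u /\ forall t, (n2 mu (part u t) <= K%:E)%E.
have Qw k : Q (w k).
  elim: (hw k) => [j _|u u' _ [Pu hu] _ [Pu' hu']]; first by split=> // t; exact: nv.
  split; first by apply: (PZ); exact: PD.
  move=> t; apply: (n2_mid _ _ (hu t) (hu' t)); [by case: Pu|by case: Pu'].
have mw k t : mf (part (w k) t) by have [[h _ _] _] := Qw k; exact: h.
have w0 k t x : 1 <= sq x -> part (w k) t x = 0 by have [[_ _ h] _] := Qw k; exact: h.
have cauchy t : forall e : R, 0 < e -> exists M, forall k m, (M <= k)%N -> (M <= m)%N ->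
     (n1 mu (fun x => part (w k) t x - part (w m) t x)%R <= e%:E)%E.
  move=> e e0; have [d dp hd] := small_n2_n1 e0; have [M hM] := cw d dp.
  exists M => k m Mk Mm; apply: hd; first exact: mfB.
    by move=> x x1; rewrite !w0// subrr.
  have [Pk _] := Qw k; have [Pm _] := Qw m.
  have Qd := sqLB (PQ _ Pk t) (PQ _ Pm t).
  rewrite (n2_fine Qd) lee_fin; apply: le_trans (hM k m Mk Mm).
  rewrite /q (bigD1 t)//= lerDl; apply: sumr_ge0 => j _; by rewrite fine_ge0// n2_ge0.
have /choice[B0 hB0] : forall t, exists f, [/\ sqL mu f, forall x, 1 <= sq x -> f x = 0 &
    to0 (fun k => n1 mu (fun x => part (w k) t x - f x)%R)].
  move=> t; have [g [s [mg hs cg tg]]] := L1_complete (mw ^~ t) (cauchy t).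
  pose S := [set x : V | 1 <= sq x].
  have mS : measurable (~` S) by apply: measurableC; exact: mf_sq_set.
  have m1 : mf (\1_(~` S) : V -> R) by exact: measurable_indic.
  have Qg : sqL mu g.
    split=> //; apply: le_lt_trans (ltry K).
    apply: (@fatou_n2 _ _ _ mu (fun k => part (w (s k)) t)) => //.
    by exists 0%N => k _; have [_] := Qw (s k); exact.
  exists (fun x => \1_(~` S) x * g x); split.
  - apply: (@sqLMl _ _ _ _ 1) => // x; rewrite indicE.
    by case: (_ \in _); rewrite ?normr1// normr0.
  - by move=> x x1; rewrite indicE memNset ?mul0r//= => h; exact: h.
  apply: to0_le tg => k; apply: le_n1; [by apply: mfB => //; exact: mfM|exact: mfB|].
  move=> x; rewrite indicE; have [xS|xS] := boolP (x \in ~` S); rewrite ?mul1r//.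
  rewrite w0 ?mul0r ?subr0 ?normr0//.
  by move: xS; rewrite in_setC negbK inE.
pose B t := B0 t; exists B; split.
- by move=> t; have [] := hB0 t.
- by move=> t x x1; have [_ h _] := hB0 t; exact: h.
move=> J s c M L mc cM cv.
pose l (u : W) := \int[mu]_x \sum_j c j x * part u (s j) x.
have Lc u j : P u -> L1 mu (fun x => c j x * part u (s j) x).
  move=> Pu; apply: (L1Ml (mc j) (cM j)); apply: (sqL_L1 ler01 (PQ _ Pu _)) => x /far.
  by case: Pu => _ _ h; exact: h.
have LB j : L1 mu (fun x => c j x * B (s j) x).
  apply: (L1Ml (mc j) (cM j)); have [h1 h2 _] := hB0 (s j).
  by apply: (sqL_L1 ler01 h1) => x /far; exact: h2.
have lw : (fun k => l (w k)) @ \oo --> L.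
  apply: (@hull_lim _ _ l vW w P) => //.
  - by move=> u u' Pu Pu'; apply: (PZ); exact: PD.
  move=> u u' Pu Pu'; rewrite /l.
  have Ls z : P z -> L1 mu (fun x => \sum_j c j x * part z (s j) x).
    by move=> Pz; apply: L1_sum => j; exact: Lc.
  rewrite -RintD; [|exact: Ls|exact: Ls]; rewrite [RHS]mulrC -RintZ; last first.
    by apply: L1D; exact: Ls.
  apply: eq_Rintegral => x _; rewrite -big_split mulr_sumr/=; apply: eq_bigr => j _.
  have -> : part (2^-1 *: (u + u')) (s j) x = 2^-1 * (part u (s j) x + part u' (s j) x) by [].
  ring.
have lB : (fun k => l (w k)) @ \oo --> \int[mu]_x \sum_j c j x * B (s j) x.
  apply: Rint_lim; [by move=> k; apply: L1_sum => j; apply: Lc; case: (Qw k)|exact: L1_sum|].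
  have tz : to0 (fun k => \sum_j (`|M|%:E * n1 mu (fun x => part (w k) (s j) x - B (s j) x)%R))%E.
    by apply: to0_sum => j; apply: to0Z => //; have [] := hB0 (s j).
  apply: to0_le tz => k.
  have mB j : mf (B j) by have [[]] := hB0 j.
  have md j : mf (fun x => c j x * (part (w k) (s j) x - B (s j) x)) by apply: mfM => //; exact: mfB.
  rewrite (_ : n1 mu _ = n1 mu (fun x => \sum_j c j x * (part (w k) (s j) x - B (s j) x))); last first.
    by apply: eq_n1 => x; rewrite -sumrB; apply: eq_bigr => j _; rewrite mulrBr.
  apply: (le_trans (n1_sum _ _ md)); apply: lee_sum => j _.
  rewrite -{1}(normr_id M) -n1Z; last exact: mfB.
  apply: le_n1 => // [|x]; first by apply: mfZ; exact: mfB.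
  by rewrite !normrM ler_wpM2r// normr_id (le_trans (cM j x))// ler_norm.
exact: (cvg_unique _ lB lw).
Qed.

End weak_limit.

(** * Weak derivatives across the origin *)
Section inverse.
Context {R : realType} {N : nat}.
Notation mat := 'M[R]_N.+1.

Lemma isD_of_little (u : R -> mat) X s :
  (forall e : R, 0 < e -> \forall h \near (0 : R), nm (u (h + s) - u s - h *: X) <= e * `|h|) ->
  isD u X s.
Proof.
move=> H a b; apply: derive_of_little => e e0; apply: filterS (H e e0) => h; apply: le_trans.
have -> : u (h + s) a b - u s a b - h * X a b = (u (h + s) - u s - h *: X) a b by rewrite !mxE.
exact: le_nm.
Qed.

Variables (G : set mat) (hG : compact_matrix_group G).
Variables (C : R) (C0 : 0 < C) (hC : forall X, G X -> nm X <= C).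

Lemma inv_sub (X Y : mat) : G X -> G Y -> X^-1 - Y^-1 = X^-1 * (Y - X) * Y^-1.
Proof.
move=> /(group_unit hG) uX /(group_unit hG) uY.
by rewrite mulrBr mulrBl mulVr// -mulrA mulrV// mulr1 mul1r.
Qed.

Lemma nm_inv_sub (X Y : mat) : G X -> G Y -> nm (X^-1 - Y^-1) <= C * C * nm (X - Y).
Proof.
move=> GX GY; rewrite inv_sub// [nm (X - Y)]nm_distC.
have h1 := hC (groupV hG GX); have h2 := hC (groupV hG GY).
apply: (le_trans (nmM _ _)).
apply: (@le_trans _ _ (C * nm (Y - X) * C)); last by rewrite mulrAC.
apply: ler_pM => //; try exact: nm_ge0.
apply: (le_trans (nmM _ _)); apply: ler_wpM2r => //; exact: nm_ge0.
Qed.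

Lemma inv_expand_arith (X Y Z U : mat) (h : R) : X - U = h *: Z + Y ->
  forall V W : mat, V - W = - (V * (X - U) * W) ->
  V - W - h *: (- (W * Z * W)) = h *: ((W - V) * Z * W) - V * Y * W.
Proof.
move=> E V W E2; rewrite E2 E.
have -> : V * (h *: Z + Y) * W = h *: (V * Z * W) + V * Y * W.
  by rewrite mulrDr mulrDl -scalerAr -scalerAl.
have -> : (W - V) * Z * W = W * Z * W - V * Z * W by rewrite !mulrBl.
rewrite scalerBr scalerN; move: (h *: _) (V * Y * W) (h *: _) => a b c.
by rewrite opprK opprD addrC addrA.
Qed.

Lemma isD_inv (u : R -> mat) X s : (forall t, G (u t)) -> isD u X s ->
  isD (fun t => (u t)^-1) (- ((u s)^-1 * X * (u s)^-1)) s.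
Proof.
move=> Gu uX; apply: isD_of_little => e e0.
have C2 : 0 < C * C by rewrite mulr_gt0.
have X0 := nm_ge0 X.
pose e1 := Num.min 1 (e / 2 / (C * C)).
have e10 : 0 < e1 by rewrite lt_min ltr01 !divr_gt0.
pose D := C * C * (nm X + 1) * nm X * C.
have D0 : 0 <= D by rewrite !mulr_ge0// ?addr_ge0// ltW.
pose r := e / 2 / (D + 1).
have r0 : 0 < r by rewrite !divr_gt0// ltr_wpDl.
have nr : \forall h \near (0 : R), `|h| <= r.
  apply/nbhs_ballP; exists r => // h; rewrite -ball_normE /ball_/= sub0r normrN => /ltW//.
apply: filterS2 (isD_expand uX e10) nr => h hh hr.
pose Y := u (h + s) - u s - h *: X.
have EY : u (h + s) - u s = h *: X + Y by rewrite /Y [in RHS]addrC subrK.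
have E2 : (u (h + s))^-1 - (u s)^-1 = - ((u (h + s))^-1 * (u (h + s) - u s) * (u s)^-1).
  by rewrite (inv_sub (Gu _) (Gu _)) -mulNr -mulrN opprB.
rewrite (inv_expand_arith EY E2).
have nY : nm Y <= e1 * `|h| by exact: hh.
have a1 : nm (h *: (((u s)^-1 - (u (h + s))^-1) * X * (u s)^-1)) <= e / 2 * `|h|.
  rewrite nmZ mulrC; apply: ler_wpM2r => //.
  apply: (@le_trans _ _ (C * C * nm (u (h + s) - u s) * nm X * C)).
    apply: (le_trans (nmM _ _)); apply: ler_pM; [exact: nm_ge0|exact: nm_ge0| |exact: (hC (groupV hG (Gu _)))].
    apply: (le_trans (nmM _ _)); apply: ler_wpM2r => //.
    by rewrite nm_distC; exact: nm_inv_sub.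
  have h1 : nm (u (h + s) - u s) <= (nm X + 1) * `|h|.
    rewrite EY; apply: (le_trans (nmD _ _)); rewrite nmZ mulrDl mulrC; apply: lerD => //.
    by apply: (le_trans nY); apply: ler_wpM2r => //; rewrite /e1 ge_min lexx.
  apply: (@le_trans _ _ (D * `|h|)).
    have -> : D * `|h| = C * C * ((nm X + 1) * `|h|) * nm X * C by rewrite /D; ring.
    apply: ler_wpM2r; first exact: ltW.
    by apply: ler_wpM2r => //; apply: ler_wpM2l => //; exact: ltW.
  apply: (@le_trans _ _ (D * r)); first exact: ler_wpM2l.
  rewrite /r mulrA ler_pdivrMr ?ltr_wpDl// mulrC.
  by apply: ler_wpM2l; [rewrite ltW// divr_gt0|rewrite lerDl].
have a2 : nm ((u (h + s))^-1 * Y * (u s)^-1) <= e / 2 * `|h|.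
  apply: (@le_trans _ _ (C * nm Y * C)).
    apply: (le_trans (nmM _ _)); apply: ler_pM; [exact: nm_ge0|exact: nm_ge0| |exact: (hC (groupV hG (Gu _)))].
    by apply: (le_trans (nmM _ _)); apply: ler_wpM2r; [exact: nm_ge0|exact: (hC (groupV hG (Gu _)))].
  rewrite mulrAC; apply: (@le_trans _ _ (C * C * (e1 * `|h|))).
    by apply: ler_wpM2l => //; exact: ltW.
  rewrite mulrA; apply: ler_wpM2r => //.
  by rewrite mulrC -ler_pdivlMr// /e1 ge_min lexx orbT.
apply: (le_trans (nmB _ _)); apply: (le_trans (lerD a1 a2)).
by rewrite -mulrDl -splitr.
Qed.

Lemma derive_inv n (g : 'rV[R]_n -> mat) x i (X : mat) : (forall y, G (g y)) ->
  (forall a b, is_derive x (ed i) (fun y => g y a b) (X a b)) ->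
  forall a b, is_derive x (ed i) (fun y => (g y)^-1 a b) ((- ((g x)^-1 * X * (g x)^-1)) a b).
Proof.
move=> Gg hX a b; apply/is_derive_line0.
have h : isD (fun t : R => g (t *: ed i + x)) X 0.
  by move=> c d; have /is_derive_line0 := hX c d.
have := isD_inv (fun t => Gg (t *: ed i + x)) h a b.
by rewrite scale0r add0r.
Qed.

End inverse.

Section weak.
Context {R : realType} {n : nat}.
Notation V := 'rV[R]_n.
Notation mu := (lebesgue_rV n).

Lemma L1_bounded_test (f phi : V -> R) (K : R) : mf f -> (forall x, `|f x| <= K) ->
  test_fun setT phi -> L1 mu (fun x => f x * phi x).
Proof. by move=> mf_ hK tp; apply: (L1Ml mf_ hK); exact: (L1_test tp). Qed.

(** phi vanishes near the origin, where f may be singular, so that f phi is smooth. *)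
Lemma weak_off_origin i (f D phi : V -> R) (K r : R) : mf f -> mf D ->
  (forall x, `|f x| <= K) -> (forall x, x != 0 -> is_derive x (ed i) f (D x)) ->
  0 < r -> (forall x, r <= sq x -> `|D x| <= K) ->
  test_fun setT phi -> (forall x, sq x <= r -> phi x = 0) ->
  L1 mu (fun x => D x * phi x) /\
  \int[mu]_x (f x * partial i phi x) = - \int[mu]_x (D x * phi x).
Proof.
move=> mf_ mD fK hD r0 DK tp phi0.
have K0 : 0 <= K by exact: le_trans (normr_ge0 _) (fK 0).
have tdp := test_fun_partial i tp.
have [s s0 hs] := test_fun_box tp.
have [M1 M10 hM1] := test_fun_bounded tp; have [M2 M20 hM2] := test_fun_bounded tdp.
have mp : mf phi by apply: smooth_mf; case: tp.
have mdp : mf (partial i phi) by apply: smooth_mf; case: tdp.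
have Dphi x : `|D x * phi x| <= K * M1.
  rewrite normrM; have [xr|xr] := leP (sq x) r.
    by rewrite phi0// normr0 mulr0 mulr_ge0.
  by apply: ler_pM => //; apply: DK; exact: ltW.
have LD : L1 mu (fun x => D x * phi x).
  apply: (@L1_supp_bounded _ _ _ s (K * M1)) => //; [exact: ltW|exact: mfM|].
  by move=> x xs; rewrite hs// mulr0.
have Lf : L1 mu (fun x => f x * partial i phi x) by exact: L1_bounded_test fK tdp.
split=> //.
have near0 (h : R) : `|h| <= Num.min 1 r -> sq (h *: ed i + 0 : V) <= r.
  rewrite le_min => /andP[h1 h2]; rewrite sq_line /sq big1 => [|j _]; last by rewrite mxE expr0n.
  rewrite mxE mulr0 mul0r !add0r; apply: le_trans h2.
  by rewrite -(real_normK (num_real h)) expr2 ler_piMl.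
have m0 : 0 < Num.min 1 r by rewrite lt_min ltr01.
have loc (F : V -> R) : (forall x, sq x <= r -> F x = 0) -> is_derive 0 (ed i) F 0.
  move=> F0; apply/is_derive_line0.
  apply: (@derive_of_expand _ _ _ _ 0 _ m0) => h hr.
  have hz : `|0 : R| <= Num.min 1 r by rewrite normr0; exact: ltW.
  by rewrite [h + 0]addr0 (F0 _ (near0 h hr)) (F0 _ (near0 0 hz)) mulr0 !subr0 normr0 mul0r.
have dphi0 : partial i phi 0 = 0 by apply: is_derive_partial; exact: loc.
have phi00 : phi 0 = 0 by apply: phi0; rewrite /sq big1 ?ltW// => j _; rewrite mxE expr0n.
have H : \int[mu]_x (D x * phi x + f x * partial i phi x) = 0.
  apply: (@integral_partial_eq0 _ _ i (fun x => f x * phi x) _ s (K * M1 + K * M2)).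
  - exact: ltW.
  - exact: mfM.
  - by apply: mfD; exact: mfM.
  - move=> x; have [->|x0] := eqVneq x 0.
      rewrite dphi0 phi00 !mulr0 addr0; apply: loc => y yr.
      by rewrite phi0// mulr0.
    have h1 := hD x x0.
    have h2 : is_derive x (ed i) phi (partial i phi x).
      by apply: smooth_is_derive; case: tp.
    have h3 := is_deriveM h1 h2.
    apply: (is_derive_eq h3).
    by rewrite /GRing.scale/= addrC (mulrC (phi x)).
  - move=> x; apply: (le_trans (ler_normD _ _)); apply: lerD => //.
    by rewrite normrM; apply: ler_pM.
  - move=> x; apply: (@le_trans _ _ (K * M1)); last by rewrite lerDl mulr_ge0// ltW.
    by rewrite normrM; apply: ler_pM.
  - by move=> x xs; rewrite hs// mulr0.
by move: H; rewrite RintD// => /eqP; rewrite addrC addr_eq0 => /eqP.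
Qed.

Lemma removable_arith (P Q a d x y z : R) :
  P = - Q -> P = a - x - y -> Q = d - z -> a + d = x + y + z.
Proof. by move=> h1 h2 h3; move: h1; rewrite h2 h3; lra. Qed.

Lemma Rint_small (f : V -> R) (e : R) : L1 mu f -> (n1 mu f <= e%:E)%E -> `|\int[mu]_x f x| <= e.
Proof. by move=> Lf h; rewrite -lee_fin; exact: le_trans (le_norm_Rint Lf) h. Qed.

Lemma thirds (e : R) : e / 3 + e / 3 + e / 3 = e.
Proof. lra. Qed.

(** The gradient of a cutoff of width 1/k at the origin has mean k^(1-n), which tends to 0 in
    dimension at least 2. *)
Lemma removable_origin i (f D : V -> R) (K : R) : (2 <= n)%N -> mf f -> (forall x, `|f x| <= K) ->
  L1 mu D ->
  (forall phi r, 0 < r -> test_fun setT phi -> (forall x, sq x <= r -> phi x = 0) ->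
    \int[mu]_x (f x * partial i phi x) = - \int[mu]_x (D x * phi x)) ->
  forall phi, test_fun setT phi ->
    \int[mu]_x (f x * partial i phi x) = - \int[mu]_x (D x * phi x).
Proof.
move=> n2_ mf_ fK LD H phi tp.
have K0 : 0 <= K by exact: le_trans (normr_ge0 _) (fK 0).
have half : 0 < 1 / 2 :> R by rewrite divr_gt0.
have [u tu [hu1 hu0]] : exists2 u : V -> R, test_fun setT u &
    (forall x, sq x <= (1 / 2) ^+ 2 -> u x = 1) /\ (forall x, 1 <= sq x -> u x = 0).
  exists (chi (1 / 2)); first exact: (test_funT (@test_chi R n _ half)).
  split=> x hx; last by rewrite chi0// (le_trans _ hx)// gerBl !divr_ge0.
  rewrite chi1//; have -> : 1 - 1 / 2 = 1 / 2 :> R by lra.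
  by rewrite le_enorm// ltW.
have [su _] := tu; have [sp _] := tp.
have tdp := test_fun_partial i tp; have tdu := test_fun_partial i tu.
have [Mu Mu0 hMu] := test_fun_bounded tu.
have [M1 M10 hM1] := test_fun_bounded tp.
pose uk (k : nat) x := u (affine k.+1%:R 0 x).
have kn (k : nat) : (k.+1%:R : R) != 0 by rewrite pnatr_eq0.
have tuk k : test_fun setT (uk k) by exact: test_affine.
have duk k x : partial i (uk k) x = k.+1%:R * partial i u (affine k.+1%:R 0 x).
  by apply: is_derive_partial; exact: partial_affine.
have suk k : smooth (uk k) by case: (tuk k).
have muk k : mf (uk k) by exact: smooth_mf.
pose psi k x := phi x - uk k x * phi x.
have tpsi k : test_fun setT (psi k).
  split; last by have [_ [Kc [cK KU h]]] := tp; exists Kc; split=> // x xK; rewrite /psi h// mulr0 subrr.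
  have -> : psi k = (fun x => phi x + -1 * (uk k x * phi x)).
    by apply/funext => x; rewrite mulN1r.
  apply/SmP/Sm_add; first exact: Sm_smooth.
  apply: Sm_mul; first exact: Sm_cst.
  exact: (Sm_mul (Sm_smooth (suk k)) (Sm_smooth sp)).
have dpsi k x : partial i (psi k) x = partial i phi x - uk k x * partial i phi x
   - phi x * (k.+1%:R * partial i u (affine k.+1%:R 0 x)).
  apply: is_derive_partial.
  have h1 : is_derive x (ed i) phi (partial i phi x) by exact: smooth_is_derive.
  have h2 : is_derive x (ed i) (uk k) (k.+1%:R * partial i u (affine k.+1%:R 0 x)).
    exact: partial_affine.
  apply: (is_derive_eq (is_deriveB h1 (is_deriveM h2 h1))).
  by rewrite /GRing.scale/= opprD addrA.
have psi0 k x : sq x <= (1 / 2 / k.+1%:R) ^+ 2 -> psi k x = 0.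
  move=> h; rewrite /psi /uk hu1 ?mul1r ?subrr//.
  rewrite /affine addr0 sqZ mulrC -ler_pdivlMr ?exprn_gt0 ?ltr0n//.
  by move: h; rewrite expr_div_n div1r.
have eqk k := H (psi k) _ (exprn_gt0 2 (divr_gt0 half (ltr0Sn R k))) (tpsi k) (@psi0 k).
have Ld : L1 mu (fun x => D x * phi x) by exact: L1_mul_test.
have La : L1 mu (fun x => f x * partial i phi x) by exact: L1_bounded_test fK tdp.
have La' k : L1 mu (fun x => uk k x * (f x * partial i phi x)).
  by apply: (L1Ml (muk k) _ La) => x; exact: hMu.
have Ld' k : L1 mu (fun x => uk k x * (D x * phi x)).
  by apply: (L1Ml (muk k) _ Ld) => x; exact: hMu.
have tdk k : test_fun setT (fun x => partial i u (affine k.+1%:R 0 x)) by exact: test_affine.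
have mp : mf phi by apply: smooth_mf.
have mfp : mf (fun x => f x * phi x) by exact: mfM.
have fpK x : `|f x * phi x| <= K * M1 by rewrite normrM; apply: ler_pM.
have Lb k : L1 mu (fun x => (f x * phi x) * (k.+1%:R * partial i u (affine k.+1%:R 0 x))).
  apply: (L1Ml mfp fpK); apply: L1Z; exact: (L1_test (tdk k)).
have key k : \int[mu]_x (f x * partial i phi x) + \int[mu]_x (D x * phi x) =
   \int[mu]_x (uk k x * (f x * partial i phi x)) +
   \int[mu]_x ((f x * phi x) * (k.+1%:R * partial i u (affine k.+1%:R 0 x))) +
   \int[mu]_x (uk k x * (D x * phi x)).
  have e1 : \int[mu]_x (f x * partial i (psi k) x) = \int[mu]_x (f x * partial i phi x)
     - \int[mu]_x (uk k x * (f x * partial i phi x))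
     - \int[mu]_x ((f x * phi x) * (k.+1%:R * partial i u (affine k.+1%:R 0 x))).
    rewrite -RintB// -RintB//; last exact: L1B.
    by apply: eq_Rintegral => x _; rewrite dpsi; ring.
  have e2 : \int[mu]_x (D x * psi k x) = \int[mu]_x (D x * phi x) - \int[mu]_x (uk k x * (D x * phi x)).
    by rewrite -RintB//; apply: eq_Rintegral => x _; rewrite /psi; ring.
  exact: (removable_arith (eqk k) e1 e2).
have ukz : {ae mu, forall x : V, exists N, forall k, (N <= k)%N -> uk k x = 0}.
  apply: filterS (ae_neq0 (ltnW n2_)) => x x0.
  have s0 : 0 < sq x.
    rewrite lt_neqAle sq_ge0 andbT; apply: contra x0 => /eqP/esym h.
    apply/eqP/rowP => j; rewrite mxE; apply/eqP; rewrite -sqrf_eq0 eq_le sqr_ge0 andbT -h.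
    exact: entry_sq.
  have [M hM] := @harmonic_small R (sq x)^-1 1 ltr01; exists M => k /hM hk.
  rewrite /uk hu0// /affine addr0 sqZ.
  have k1 : 1 <= (k.+1%:R : R) by rewrite ler1n.
  have h1 : 1 <= k.+1%:R * sq x.
    by move: hk; rewrite ler_pdivrMr ?ltr0n// mul1r -div1r ler_pdivrMr.
  apply: (le_trans h1); apply: ler_wpM2r; first exact: sq_ge0.
  by rewrite expr2 ler_peMl.
have t1 : to0 (fun k => n1 mu (fun x => uk k x * (f x * partial i phi x))%R).
  apply: (vanishing_to0 La muk (fun k x => hMu _)).
  by apply: filterS ukz => x [M hM]; exists M => k /hM ->; rewrite mul0r.
have t2 : to0 (fun k => n1 mu (fun x => uk k x * (D x * phi x))%R).
  apply: (vanishing_to0 Ld muk (fun k x => hMu _)).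
  by apply: filterS ukz => x [M hM]; exists M => k /hM ->; rewrite mul0r.
have mdu : mf (partial i u) by apply: smooth_mf; case: tdu.
have /L1P[_ Ldu] := L1_test tdu.
pose c := K * M1 * fine (n1 mu (partial i u)).
have c0 : 0 <= c by rewrite !mulr_ge0// fine_ge0// n1_ge0.
have t3 : to0 (fun k => n1 mu (fun x => (f x * phi x) * (k.+1%:R * partial i u (affine k.+1%:R 0 x)))%R).
  apply: to0_le (to0Z c0 (@to0_harmonic R (fun k => (k.+1%:R^-1)%:E) (fun=> lexx _))) => k.
  have mk : mf (fun x => partial i u (affine k.+1%:R 0 x)) by apply: smooth_mf; case: (tdk k).
  apply: (@le_trans _ _ (n1 mu (fun x => (K * M1 * k.+1%:R) * partial i u (affine k.+1%:R 0 x))%R)).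
    apply: le_n1; [by apply: mfM => //; exact: mfZ|exact: mfZ|move=> x].
    rewrite mulrA normrM [leRHS]normrM; apply: ler_wpM2r => //.
    rewrite normrM [leRHS]normrM; apply: ler_wpM2r => //.
    by apply: (le_trans (fpK x)); exact: ler_norm.
  rewrite n1Z// n1_affine// -(fineK (_ : n1 mu (partial i u) \is a fin_num)); last first.
    by rewrite ge0_fin_numE// n1_ge0.
  rewrite -!EFinM lee_fin ger0_norm ?mulr_ge0// (@ger0_norm _ k.+1%:R)//.
  have -> : K * M1 * k.+1%:R * (k.+1%:R ^- n * fine (n1 mu (partial i u))) =
     c * (k.+1%:R * k.+1%:R ^- n) by rewrite /c; ring.
  apply: ler_wpM2l => //; case: n n2_ => [//|[//|m]] _.
  rewrite exprS invfM mulrA divff// mul1r exprS invfM -[leRHS]mulr1.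
  apply: ler_wpM2l; first by rewrite invr_ge0.
  by rewrite invf_le1 ?exprn_gt0 ?ltr0n// exprn_ege1// ler1n.
apply/eqP; rewrite -addr_eq0 -normr_le0; apply/ler_addgt0Pr => e e0; rewrite add0r.
have e3 : 0 < e / 3 by rewrite divr_gt0.
have [N1 h1] := t1 _ e3; have [N2 h2] := t2 _ e3; have [N3 h3] := t3 _ e3.
pose k := maxn N1 (maxn N2 N3).
have g1 := h1 k (leq_maxl _ _).
have g2 := h2 k (leq_trans (leq_maxl _ _) (leq_maxr _ _)).
have g3 := h3 k (leq_trans (leq_maxr _ _) (leq_maxr _ _)).
rewrite (key k).
have j1 := Rint_small (La' k) g1.
have j2 := Rint_small (Ld' k) g2.
have j3 := Rint_small (Lb k) g3.
apply: (le_trans (ler_normD _ _)); apply: (le_trans (lerD (ler_normD _ _) j2)).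
by apply: (le_trans (lerD (lerD j1 j3) (lexx _))); rewrite thirds.
Qed.

Lemma fundamental_lemma (f : V -> R) : L1 mu f ->
  (forall phi, test_fun setT phi -> \int[mu]_x (f x * phi x) = 0) -> {ae mu, forall x, f x = 0}.
Proof.
move=> Lf H.
apply: (n1_small_ae0 (L1_mf Lf)) => e e0.
have [d d0 hd] := moll_n1 Lf e0; apply: le_trans (hd d _); last by rewrite d0 lexx.
apply: le_of_eq; rewrite -(n1N mu f); apply: eq_n1 => x.
by rewrite /moll /conv H ?sub0r//; apply: test_reflect; exact: test_eta.
Qed.

End weak.

(** * The radial gauge of a connection with square-integrable curvature *)
Section products.
Context {R : realType} {n N : nat}.
Notation V := 'rV[R]_n.
Notation mat := 'M[R]_N.+1.
Notation mu := (lebesgue_rV n).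

Lemma n2_nm (X : V -> mat) (K : R) : mfx X -> (forall a b, n2 mu (fun x => X x a b) <= K%:E)%E ->
  (n2 mu (fun x => nm (X x)) <=
    (2 ^+ size (index_enum 'I_N.+1) * (\sum_(a < N.+1) 2 ^+ size (index_enum 'I_N.+1) * \sum_(b < N.+1) K))%:E)%E.
Proof.
move=> mX hK; set s := size _.
have p0 : (0 <= (2 ^+ s)%:E :> \bar R)%E by rewrite lee_fin exprn_ge0.
have ma a b : mf (fun x => `|X x a b|) by exact: mf_norm (mX a b).
have ms a : mf (fun x => \sum_b `|X x a b|) by exact: mf_sum.
apply: (le_trans (n2_sum_le _ ms)); rewrite EFinM; apply: lee_wpmul2l => //.
rewrite -sumEFin; apply: lee_sum => a _.
apply: (le_trans (n2_sum_le _ (ma a))); rewrite EFinM; apply: lee_wpmul2l => //.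
by rewrite -sumEFin; apply: lee_sum => b _; rewrite n2_absE.
Qed.

Lemma to0_bound (Z : nat -> V -> mat) (u v w : nat -> V -> R) (C K : R) :
  (forall k, mfx (Z k)) -> (forall k, mf (u k)) -> (forall k, mf (v k)) -> (forall k, mf (w k)) ->
  0 <= C -> (forall k x, nm (Z k x) <= C * u k x + w k x * v k x) ->
  to0 (fun k => n1 mu (u k)) -> to0 (fun k => n2 mu (v k)) ->
  (forall k, n2 mu (w k) <= K%:E)%E -> to0 (fun k => n1 mu (fun x => nm (Z k x))).
Proof.
move=> mZ mu_ mv mw C0 hZ hu hv hw.
apply: to0_le (to0D (to0Z C0 hu) (to0_L2M mw mv hw hv)) => k.
have mwv : mf (fun x => w k x * v k x) by exact: mfM.
rewrite -{1}(ger0_norm C0) -n1Z//; apply: le_trans (n1D mu (mfZ C (mu_ k)) mwv).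
apply: le_n1; [exact: mf_nm (mZ k)|by apply: mfD => //; exact: mfZ|move=> x].
by rewrite (ger0_norm (nm_ge0 _)); apply: (le_trans (hZ k x)); exact: ler_norm.
Qed.

Lemma to0_mul (X X' Y Y' : nat -> V -> mat) (C K : R) :
  (forall k, mfx (X k)) -> (forall k, mfx (X' k)) -> (forall k, mfx (Y k)) -> (forall k, mfx (Y' k)) ->
  0 <= C -> (forall k x, nm (X k x) <= C) ->
  (forall k, n2 mu (fun x => nm (Y' k x)) <= K%:E)%E ->
  to0 (fun k => n2 mu (fun x => nm (X k x - X' k x))) ->
  to0 (fun k => n1 mu (fun x => nm (Y k x - Y' k x))) ->
  to0 (fun k => n1 mu (fun x => nm (X k x * Y k x - X' k x * Y' k x))) /\
  to0 (fun k => n1 mu (fun x => nm (Y k x * X k x - Y' k x * X' k x))).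
Proof.
move=> mX mX' mY mY' C0 XC hK hX hY.
have md k := mf_nm (mfx_sub (mX k) (mX' k)).
have me k := mf_nm (mfx_sub (mY k) (mY' k)).
have mm (U W : V -> mat) : mfx U -> mfx W -> mfx (fun x => U x * W x) by exact: mf_mulmx.
split; (apply: (to0_bound _ me md (fun k => mf_nm (mY' k)) C0 _ hY hX hK);
  first by move=> k; apply: mfx_sub; exact: mm) => k x.
  have -> : X k x * Y k x - X' k x * Y' k x = X k x * (Y k x - Y' k x) + (X k x - X' k x) * Y' k x.
    by rewrite mulrBr mulrBl addrA subrK.
  apply: (le_trans (nmD _ _)); apply: lerD; apply: (le_trans (nmM _ _)); last by rewrite mulrC.
  by apply: ler_wpM2r => //; exact: nm_ge0.
have -> : Y k x * X k x - Y' k x * X' k x = (Y k x - Y' k x) * X k x + Y' k x * (X k x - X' k x).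
  by rewrite mulrBr mulrBl addrA subrK.
apply: (le_trans (nmD _ _)); apply: lerD; apply: (le_trans (nmM _ _)) => //.
by rewrite mulrC; apply: ler_wpM2r => //; exact: nm_ge0.
Qed.

Lemma Rint_transfer (X Y : nat -> V -> mat) (th : V -> R) a b (M L : R) :
  (forall k, mfx (X k)) -> (forall k, mfx (Y k)) -> mf th -> (forall x, `|th x| <= M) ->
  (forall k, L1 mu (fun x => X k x a b * th x)) -> (forall k, L1 mu (fun x => Y k x a b * th x)) ->
  to0 (fun k => n1 mu (fun x => nm (X k x - Y k x))) ->
  (fun k => \int[mu]_x (X k x a b * th x)) @ \oo --> L ->
  (fun k => \int[mu]_x (Y k x a b * th x)) @ \oo --> L.
Proof.
move=> mX mY mth thM LX LY h cX.
have M0 : 0 <= M by exact: le_trans (normr_ge0 _) (thM 0).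
have : (fun k => \int[mu]_x (X k x a b * th x) - \int[mu]_x (Y k x a b * th x)) @ \oo --> (0 : R).
  apply/cvgrPdist_le => e e0.
  have [K hK] := to0Z M0 h e0; exists K => // k /= Kk.
  rewrite sub0r normrN -RintB// -lee_fin; apply: le_trans (hK k Kk).
  apply: (le_trans (le_norm_Rint (L1B (LX k) (LY k)))).
  rewrite -{1}(ger0_norm M0) -n1Z; last by apply: mf_nm; exact: mfx_sub.
  apply: le_n1; [exact: (L1_mf (L1B (LX k) (LY k)))|by apply: mfZ; apply: mf_nm; exact: mfx_sub|move=> x].
  rewrite -mulrBl normrM mulrC [leRHS]normrM (ger0_norm M0) (ger0_norm (nm_ge0 _)).
  by apply: ler_pM => //; rewrite -mxE2 le_nm.
move=> /(cvgB cX); rewrite subr0; apply: cvg_trans; apply: near_eq_cvg; apply: nearW => k /=.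
by rewrite fctE opprB addrC subrK.
Qed.

Lemma seq_identity (c : R) (a q s q' : nat -> R) (a0 q0 s0 : R) : c * c = 1 ->
  (forall k, a k = - (c * (q k - s k))) -> a @ \oo --> a0 -> s @ \oo --> s0 ->
  (forall L : R, q @ \oo --> L -> q' @ \oo --> L) -> (forall L : R, q' @ \oo --> L -> q0 = L) ->
  a0 = - (c * (q0 - s0)).
Proof.
move=> cc E ca cs hq hq'; have -> : q0 = s0 - c * a0.
  apply: hq'; apply: hq.
  have h : (fun k => s k - c * a k) @ \oo --> s0 - c * a0.
    by apply: cvgB => //; apply: cvgM => //; exact: cvg_cst.
  rewrite (_ : q = (fun k => s k - c * a k))//; apply/funext => k.
  by rewrite E mulrN mulrA cc mul1r opprK addrC subrK.
by rewrite addrC addrA [- s0 + _]addrC subrr add0r mulrN mulrA cc mul1r opprK.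
Qed.

Lemma ae_all (I : finType) (P : I -> V -> Prop) : (forall i, {ae mu, forall x, P i x}) ->
  {ae mu, forall x, forall i, P i x}.
Proof. by move=> h; apply: filter_forall. Qed.

Lemma entry_bound (X : V -> mat) (C : R) x a b : nm (X x) <= C -> `|X x a b| <= C.
Proof. by apply: le_trans; exact: le_nm. Qed.

Lemma L1_mulmx (X Y : V -> mat) (C : R) a b : mfx X -> (forall x, nm (X x) <= C) ->
  (forall a b, L1 mu (fun x => Y x a b)) ->
  L1 mu (fun x => (X x * Y x) a b) /\ L1 mu (fun x => (Y x * X x) a b).
Proof.
move=> mX hX LY; split; under eq_fun do rewrite mulmx_entry; apply: L1_sum => c.
  exact: (L1Ml (mX a c) (fun x => entry_bound a c (hX x))).
under eq_fun do rewrite mulrC; exact: (L1Ml (mX c b) (fun x => entry_bound c b (hX x))).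
Qed.

Lemma Rint_entry_lim (X : nat -> V -> mat) Y phi a b : (forall k, mfx (X k)) -> mfx Y ->
  test_fun setT phi -> (forall k, L1 mu (fun x => X k x a b * phi x)) ->
  L1 mu (fun x => Y x a b * phi x) -> to0 (fun k => n1 mu (fun x => nm (X k x - Y x))) ->
  (fun k => \int[mu]_x (X k x a b * phi x)) @ \oo --> \int[mu]_x (Y x a b * phi x).
Proof.
move=> mX mY tp LX LY t; have [M _ hM] := test_fun_bounded tp.
have mp : mf phi by apply: smooth_mf; case: tp.
apply: (Rint_transfer (fun=> mY) mX mp hM (fun=> LY) LX _ (cvg_cst _)).
apply: to0_le t => k; apply: le_of_eq; apply: eq_n1 => x.
by rewrite nm_distC.
Qed.

(** The integrals of S k and of u k converge, hence so do those of Q k; the limit of the latter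
    is found from Q' k, which is close to Q k and converges weakly. The sign c = 1 serves for
    a gauge, c = -1 for its inverse. *)
Lemma weak_pass (c C : R) (uk : nat -> V -> mat) (u : V -> mat) (Q Q' S : nat -> V -> mat)
    (Q0 S0 : V -> mat) i phi a b (r : R) : c * c = 1 ->
  (forall k, mfx (uk k)) -> mfx u -> (forall k x, nm (uk k x) <= C) -> (forall x, nm (u x) <= C) ->
  to0 (fun k => n1 mu (fun x => nm (uk k x - u x))) ->
  (forall k x, x != 0 -> is_derive x (ed i) (fun y => uk k y a b) (c * (Q k x a b - S k x a b))) ->
  (forall k, mfx (Q k)) -> (forall k, mfx (Q' k)) -> (forall k, mfx (S k)) -> mfx S0 ->
  (forall k, exists K, forall x, r <= sq x -> nm (Q k x) <= K) ->
  (forall k, exists K, forall x, nm (S k x) <= K) ->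
  to0 (fun k => n1 mu (fun x => nm (Q k x - Q' k x))) ->
  to0 (fun k => n1 mu (fun x => nm (S k x - S0 x))) ->
  (forall k, L1 mu (fun x => Q' k x a b)) -> L1 mu (fun x => Q0 x a b) -> L1 mu (fun x => S0 x a b) ->
  0 < r -> test_fun setT phi -> (forall x, sq x <= r -> phi x = 0) ->
  (forall L : R, (fun k => \int[mu]_x (Q' k x a b * phi x)) @ \oo --> L ->
    \int[mu]_x (Q0 x a b * phi x) = L) ->
  \int[mu]_x (u x a b * partial i phi x) = - \int[mu]_x (c * (Q0 x a b - S0 x a b) * phi x).
Proof.
move=> cc muk mu_ ukC uC tu du mQ mQ' mS mS0 bQ bS tQ tS LQ' LQ0 LS0 r0 tp phi0 hQ.
have [M _ hM] := test_fun_bounded tp.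
have mp : mf phi by apply: smooth_mf; case: tp.
have tdp := test_fun_partial i tp.
have LS k : L1 mu (fun x => S k x a b * phi x).
  have [K hK] := bS k; apply: (L1_bounded_test (mS k a b) _ tp) => x.
  exact: (entry_bound a b (hK x)).
have W k : L1 mu (fun x => c * (Q k x a b - S k x a b) * phi x) /\
    \int[mu]_x (uk k x a b * partial i phi x) = - \int[mu]_x (c * (Q k x a b - S k x a b) * phi x).
  have [K1 hK1] := bQ k; have [K2 hK2] := bS k.
  have mD : mf (fun x => c * (Q k x a b - S k x a b)) by apply: mfZ; apply: mfB; [exact: mQ|exact: mS].
  apply: (@weak_off_origin _ _ i _ _ phi (Num.max C (`|c| * (K1 + K2))) r (muk k a b) mD) => //.
  - by move=> x; rewrite le_max; apply/orP; left; exact: entry_bound.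
  - move=> x xr; rewrite le_max; apply/orP; right; rewrite normrM; apply: ler_wpM2l => //.
    apply: (le_trans (ler_normB _ _)); apply: lerD; apply: entry_bound; [exact: hK1|exact: hK2].
have LQ k : L1 mu (fun x => Q k x a b * phi x).
  have -> : (fun x => Q k x a b * phi x) = (fun x => c * (c * (Q k x a b - S k x a b) * phi x) + S k x a b * phi x).
    by apply/funext => x; rewrite -mulrA mulrA cc mul1r mulrBl subrK.
  by apply: L1D => //; apply: L1Z; case: (W k).
have LQ0p := L1_mul_test LQ0 tp; have LS0p := L1_mul_test LS0 tp.
have E (X Y : V -> mat) : L1 mu (fun x => X x a b * phi x) -> L1 mu (fun x => Y x a b * phi x) ->
    \int[mu]_x (c * (X x a b - Y x a b) * phi x) =
    c * (\int[mu]_x (X x a b * phi x) - \int[mu]_x (Y x a b * phi x)).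
  move=> LX LY; rewrite -RintB// -RintZ; last exact: L1B.
  by apply: eq_Rintegral => x _; ring.
rewrite E//.
apply: (@seq_identity c (fun k => \int[mu]_x (uk k x a b * partial i phi x))
  (fun k => \int[mu]_x (Q k x a b * phi x)) (fun k => \int[mu]_x (S k x a b * phi x))
  (fun k => \int[mu]_x (Q' k x a b * phi x))) => //.
- by move=> k; rewrite -E//; case: (W k).
- apply: Rint_entry_lim => // [k|]; last exact: (L1_bounded_test (mu_ a b) (fun x => entry_bound a b (uC x)) tdp).
  exact: (L1_bounded_test (muk k a b) (fun x => entry_bound a b (ukC k x)) tdp).
- exact: Rint_entry_lim.
move=> L; apply: (Rint_transfer mQ mQ' mp hM LQ _ tQ) => k.
exact: L1_mul_test.
Qed.

End products.

Section radial_gauge.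
Context {R : realType} {n N : nat}.
Notation V := 'rV[R]_n.
Notation mat := 'M[R]_N.+1.
Notation mu := (lebesgue_rV n).
Variables (G : set mat) (A : 'I_n -> V -> mat).
Hypotheses (hG : compact_matrix_group G) (n4 : (4 <= n)%N).
Hypothesis QA : forall i a b, sqL mu (fun x => A i x a b).
Hypothesis A0 : forall i x, 1 <= sq x -> A i x = 0.
Hypothesis happrox : exists C0 : R, forall e, 0 < e -> exists A' q E,
  approximates G A A' C0 e q E.

(** Products converge because the gauges are bounded and converge in L2 as well. The relations
    of B, linear with smooth coefficients, pass to the weak limit. *)
Theorem radial_gauge : exists (g : V -> mat) (B : 'I_n -> V -> mat),
  [/\ [/\ mfx g, forall x, G (g x) & forall x, 1 <= sq x -> g x = 1],
    [/\ forall i a b, sqL mu (fun x => B i x a b), forall i x, 1 <= sq x -> B i x = 0,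
       forall i, {ae mu, forall x, lie_algebra G (B i x)} &
       {ae mu, forall x : V, \sum_i x ord0 i *: B i x = 0}],
    forall phi, test_fun setT phi -> forall i a b,
      \int[mu]_x (g x a b * partial i phi x) =
      - \int[mu]_x ((g x * B i x - A i x * g x) a b * phi x) &
    forall phi, test_fun setT phi -> forall i a b,
      \int[mu]_x ((g x)^-1 a b * partial i phi x) =
      - \int[mu]_x (((g x)^-1 * A i x - B i x * (g x)^-1) a b * phi x)].
Proof.
have mA i : mfx (A i) by move=> a b; have [] := QA i a b.
have [g [gk [Ak [Bk [Pk [C1 [[mg Gg g1] [mgk Gk tgk] [tAk tA] [bB [dB rB lB mB B1]] [mP nP P1 tBP]]]]]]]] :=
  approximating_gauges hG n4 mA happrox.
have [C Cp hC] := group_bounded hG; have C0 := ltW Cp.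
have n2_ : (2 <= n)%N by exact: leq_trans n4.
have mAk k i : mfx (Ak k i) by move=> a b; apply: smooth_mf; case: (tAk k i a b).
pose v k (t : 'I_n * ('I_N.+1 * 'I_N.+1)) x := Pk k t.1 x t.2.1 t.2.2.
have [||| B' [QB' B'0 hB']] := @weak_limit R n _ v C1.
- by move=> k t; exact: mP.
- by move=> k t; exact: nP.
- by move=> k t x x1; rewrite /v P1// mxE.
pose B i x : mat := \matrix_(a, b) B' (i, (a, b)) x.
have BE i a b x : B i x a b = B' (i, (a, b)) x by rewrite mxE.
have QB i a b : sqL mu (fun x => B i x a b) by under eq_fun do rewrite BE; exact: QB'.
have B0 i x : 1 <= sq x -> B i x = 0 by move=> x1; apply/matrixP => a b; rewrite BE B'0// mxE.
have LB i a b : L1 mu (fun x => B i x a b).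
  by apply: (sqL_L1 ler01 (QB i a b)) => x /far h; rewrite B0// mxE.
have LA_ i a b : L1 mu (fun x => A i x a b).
  by apply: (sqL_L1 ler01 (QA i a b)) => x /far h; rewrite A0// mxE.
have LP k i a b : L1 mu (fun x => Pk k i x a b).
  apply: (sqL_L1 ler01) => [|x /far h]; last by rewrite P1// mxE.
  by split; [exact: mP|exact: le_lt_trans (nP k i a b) (ltry _)].
pose h x := (g x)^-1; pose hk k x := (gk k x)^-1.
have mh : mfx h by move=> a b; apply: mf_invmx => // x; exact: (group_unit hG (Gg x)).
have mhk k : mfx (hk k) by move=> a b; apply: (mf_invmx _ (mgk k)) => x; exact: (group_unit hG (Gk k x)).
have Gh x : G (h x) by exact: groupV.
have Ghk k x : G (hk k x) by exact: groupV.
have mdg k := mf_nm (mfx_sub (mgk k) mg).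
have mdh k := mf_nm (mfx_sub (mhk k) mh).
have th : to0 (fun k => n1 mu (fun x => nm (hk k x - h x))).
  have C2 : 0 <= C * C by rewrite mulr_ge0.
  apply: to0_le (to0Z C2 tgk) => k; rewrite -{1}(ger0_norm C2) -n1Z//.
  apply: le_n1 => // [|x]; first exact: mfZ.
  rewrite (ger0_norm (nm_ge0 _)) ger0_norm ?mulr_ge0 ?nm_ge0//.
  exact: (nm_inv_sub hG hC).
pose K2 := 2 ^+ size (index_enum 'I_N.+1) * (\sum_(a < N.+1) 2 ^+ size (index_enum 'I_N.+1) * \sum_(b < N.+1) C1).
have nP2 i k : (n2 mu (fun x => nm (Pk k i x)) <= K2%:E)%E by apply: n2_nm.
have nA2 i : (n2 mu (fun x => nm (A i x)) <= (fine (n2 mu (fun x => nm (A i x))))%:E)%E.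
  by rewrite -n2_fine//; apply: sqL_nm.
(* g is multiplied by B on the right and its inverse on the left: o tells which *)
pose mul (o : bool) (X Y : mat) : mat := if o then Y * X else X * Y.
have half (o : bool) (c : R) (uk : nat -> V -> mat) (u : V -> mat) : c * c = 1 ->
    (forall k, mfx (uk k)) -> mfx u -> (forall k x, G (uk k x)) -> (forall x, G (u x)) ->
    to0 (fun k => n1 mu (fun x => nm (uk k x - u x))) ->
    (forall k i x, x != 0 -> forall a b, is_derive x (ed i) (fun y => uk k y a b)
      (c * (mul o (uk k x) (Bk k i x) a b - mul o (Ak k i x) (uk k x) a b))) ->
    forall phi, test_fun setT phi -> forall i a b, \int[mu]_x (u x a b * partial i phi x) =
      - \int[mu]_x (c * (mul o (u x) (B i x) a b - mul o (A i x) (u x) a b) * phi x).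
  move=> cc muk mu_ Guk Gu tu du phi tp i a b.
  have uC x := hC _ (Gu x); have ukC k x := hC _ (Guk k x).
  have md k := mf_nm (mfx_sub (muk k) mu_).
  have tu2 : to0 (fun k => n2 mu (fun x => nm (uk k x - u x))).
    have CC : 0 <= C + C by rewrite addr_ge0.
    apply: to0_le (to0Z CC tu) => k; rewrite -{1}(ger0_norm CC) -n1Z//.
    apply: ge0_le_integral => //.
    - by move=> x _; rewrite lee_fin sqr_ge0.
    - by apply: mfE; exact: mfX.
    - by apply: mfE; apply: mf_norm; exact: mfZ.
    move=> x _; rewrite lee_fin ger0_norm ?mulr_ge0 ?nm_ge0// expr2.
    apply: ler_wpM2r; first exact: nm_ge0.
    by apply: (le_trans (nmB _ _)); apply: lerD.
  have [tB1 tB2] := to0_mul muk (fun=> mu_) (mB ^~ i) (mP ^~ i) C0 ukC (nP2 i) tu2 (tBP i).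
  have [tA1 tA2] := to0_mul muk (fun=> mu_) (mAk ^~ i) (fun=> mA i) C0 ukC (fun=> nA2 i) tu2 (tA i).
  have mm (U W : V -> mat) : mfx U -> mfx W -> mfx (fun x => mul o (U x) (W x)).
    by move=> hU hW; rewrite /mul; case: (o); exact: mf_mulmx.
  have nmul X Y : nm (mul o X Y) <= nm X * nm Y.
    by rewrite /mul; case: (o); [rewrite mulrC|]; exact: nmM.
  have Lu (X : V -> mat) : (forall a b, L1 mu (fun x => X x a b)) ->
      L1 mu (fun x => mul o (u x) (X x) a b) /\ L1 mu (fun x => mul o (X x) (u x) a b).
    by move=> /(L1_mulmx a b mu_ uC); rewrite /mul; case: (o) => -[l1 l2]; split.
  have Lq : L1 mu (fun x => c * (mul o (u x) (B i x) a b - mul o (A i x) (u x) a b)).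
    by apply: L1Z; apply: L1B; [case: (Lu _ (LB i))|case: (Lu _ (LA_ i))].
  apply: (removable_origin n2_ (mu_ a b) (fun x => entry_bound a b (uC x)) Lq) tp => {}phi r r0 tp phi0.
  apply: (@weak_pass R n N c C uk u (fun k x => mul o (uk k x) (Bk k i x))
    (fun k x => mul o (u x) (Pk k i x)) (fun k x => mul o (Ak k i x) (uk k x))
    (fun x => mul o (u x) (B i x)) (fun x => mul o (A i x) (u x)) i phi a b r cc muk mu_ ukC uC tu
    _ _ _ _ _ _ _ _ _ _ _ _ r0 tp phi0).
  - by move=> k x x0; exact: du.
  - by move=> k; exact: mm.
  - by move=> k; exact: mm.
  - by move=> k; exact: mm.
  - exact: mm.
  - move=> k; have [K hK] := bB k r r0; exists (C * K) => x xr.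
    by apply: (le_trans (nmul _ _)); apply: ler_pM; rewrite ?nm_ge0//; exact: hK.
  - move=> k; have [K [_ hK _ _ _]] := form_bounds (tAk k); exists (K * C) => x.
    by apply: (le_trans (nmul _ _)); apply: ler_pM; rewrite ?nm_ge0.
  - by rewrite /mul; case: (o); [exact: tB2|exact: tB1].
  - by rewrite /mul; case: (o); [exact: tA1|exact: tA2].
  - by move=> k; case: (Lu _ (LP k i)).
  - by case: (Lu _ (LB i)).
  - by case: (Lu _ (LA_ i)).
  move=> L hL; pose ce e x := if o then u x e b else u x a e.
  pose se e := (i, if o then (a, e) else (e, b)).
  have cE x X : mul o (u x) X a b = \sum_e ce e x * X (se e).2.1 (se e).2.2.
    by rewrite /mul /ce /se; case: (o); rewrite mulmx_entry//=; apply: eq_bigr => e _; rewrite mulrC.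
  rewrite (_ : (fun x => _) = fun x => \sum_e ce e x * phi x * B' (se e) x); last first.
    apply/funext => x; rewrite cE mulr_suml; apply: eq_bigr => e _; rewrite BE /se.
    by case: (o) => /=; ring.
  have [M _ hM] := test_fun_bounded tp.
  apply: (hB' _ se (fun e x => ce e x * phi x) (C * M)).
  - move=> e; apply: mfM; last by apply: smooth_mf; case: tp.
    by rewrite /ce; case: (o); exact: mu_.
  - move=> e x; rewrite normrM; apply: ler_pM => //.
    by rewrite /ce; case: (o); exact: entry_bound.
  apply: cvg_trans hL; apply: near_eq_cvg; apply: nearW => k.
  by apply: eq_Rintegral => x _; rewrite cE mulr_suml; apply: eq_bigr => e _; rewrite /v /se/=; ring.
have sym (X Y : nat -> V -> mat) : to0 (fun k => n1 mu (fun x => nm (X k x - Y k x))) ->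
    to0 (fun k => n1 mu (fun x => nm (Y k x - X k x))).
  by apply: to0_le => k; apply: le_of_eq; apply: eq_n1 => x; rewrite nm_distC.
have relation (J : finType) (s : J -> 'I_n * ('I_N.+1 * 'I_N.+1)) (c : J -> V -> R) (M : R) :
    (forall j, mf (c j)) -> (forall j x, `|c j x| <= M) ->
    (forall k x, \sum_j c j x * Bk k (s j).1 x (s j).2.1 (s j).2.2 = 0) ->
    \int[mu]_x \sum_j c j x * B' (s j) x = 0.
  move=> mc hM h0; apply: (hB' J s c M 0 mc hM).
  have Ls k : L1 mu (fun x => \sum_j c j x * v k (s j) x).
    by apply: L1_sum => j; apply: (L1Ml (mc j) (hM j)); exact: LP.
  have M0 : 0 <= `|M| by [].
  have t := to0_sum (index_enum J) (fun j => to0Z M0 (sym _ _ (tBP (s j).1))).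
  apply/cvgrPdist_le => e e0; have [K hK] := t e e0; exists K => // k /= Kk.
  rewrite sub0r normrN; apply: (Rint_small (Ls k)); apply: le_trans (hK k Kk).
  have md i := mfx_sub (mP k i) (mB k i).
  have mcd j : mf (fun x => c j x * (Pk k (s j).1 x - Bk k (s j).1 x) (s j).2.1 (s j).2.2).
    by apply: mfM => //; exact: md.
  have -> : n1 mu (fun x => \sum_j c j x * v k (s j) x)%R =
      n1 mu (fun x => \sum_j c j x * (Pk k (s j).1 x - Bk k (s j).1 x) (s j).2.1 (s j).2.2)%R.
    apply: eq_n1 => x; under [RHS]eq_bigr do rewrite mxE2 mulrBr.
    by rewrite sumrB h0 subr0.
  apply: (le_trans (n1_sum _ _ mcd)); apply: lee_sum => j _.
  rewrite -{1}(normr_id M) -n1Z; last exact: mf_nm (md _).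
  apply: le_n1 => // [|x]; first by apply: mfZ; exact: mf_nm (md _).
  rewrite normrM [leRHS]normrM normr_id (ger0_norm (nm_ge0 _)).
  by apply: ler_pM => //; [exact: le_trans (hM j x) (ler_norm _)|exact: le_nm].
exists g, B; split => //.
- split=> //.
  + move=> i; have [m [L hL]] := lie_functionals hG.
    suff ae0 : {ae mu, forall x, forall j, pair (L j) (B i x) = 0}.
      by apply: filterS ae0 => x hx; apply/hL.
    apply: ae_all => j.
    have Lp : L1 mu (fun x => pair (L j) (B i x)).
      by apply: L1_sum => a; apply: L1_sum => b; apply: L1Z; exact: LB.
    apply: (fundamental_lemma Lp) => phi tp; have [M _ hM] := test_fun_bounded tp.
    have mp : mf phi by apply: smooth_mf; case: tp.
    have -> : (fun x => pair (L j) (B i x) * phi x) = (fun x => \sum_ab L j ab.1 ab.2 * phi x * B' (i, ab) x).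
      apply/funext => x; rewrite /pair mulr_suml; under eq_bigr do rewrite mulr_suml.
      rewrite pair_bigA/=; apply: eq_bigr => -[a b] _ /=; rewrite BE; ring.
    apply: (relation _ (fun ab : 'I_N.+1 * 'I_N.+1 => (i, ab)) (fun ab x => L j ab.1 ab.2 * phi x) (nm (L j) * M)).
    - by move=> ab; exact: mfZ.
    - by move=> ab x; rewrite normrM; apply: ler_pM => //; exact: le_nm.
    move=> k x /=; have /hL/(_ j) := lB k i x; rewrite /pair => hp.
    apply: (@eq_trans _ _ (phi x * \sum_a \sum_b L j a b * Bk k i x a b)); last by rewrite hp mulr0.
    rewrite pair_bigA/= mulr_sumr; apply: eq_bigr => ab _; ring.
  + suff ae0 : {ae mu, forall x : V, forall ab : 'I_N.+1 * 'I_N.+1, \sum_i x ord0 i * B i x ab.1 ab.2 = 0}.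
      apply: filterS ae0 => x hx; apply/matrixP => a b; rewrite summxE [RHS]mxE -[RHS](hx (a, b)).
      by apply: eq_bigr => i _; rewrite mxE.
    apply: ae_all => -[a b] /=.
    have Lx : L1 mu (fun x : V => \sum_i x ord0 i * B i x a b).
      apply: L1_sum => i; apply: (le_L1 _ _ (LB i a b)) => [|x].
        by apply: mfM; [exact: measurable_coord|exact: (L1_mf (LB i a b))].
      rewrite normrM; have [x1|x1] := leP 1 (sq x); first by rewrite B0// mxE normr0 mulr0.
      by rewrite ler_piMl// entry_sq1// ltW.
    apply: (fundamental_lemma Lx) => phi tp.
    have tx (i : 'I_n) : test_fun setT (fun x : V => phi x * x ord0 i).
      by apply: test_mul => //; apply: SmP; exact: Sm_coord.
    have /choice[M hM] : forall i : 'I_n, exists M, forall x : V, `|phi x * x ord0 i| <= M.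
      by move=> i; have [M _ hM] := test_fun_bounded (tx i); exists M.
    have -> : (fun x : V => (\sum_i x ord0 i * B i x a b) * phi x) =
        (fun x : V => \sum_i phi x * x ord0 i * B' (i, (a, b)) x).
      by apply/funext => x; rewrite mulr_suml; apply: eq_bigr => i _; rewrite BE; ring.
    apply: (relation _ (fun i => (i, (a, b))) (fun i x => phi x * x ord0 i) (\sum_i `|M i|)).
    - by move=> i; apply: smooth_mf; case: (tx i).
    - move=> i x; apply: (le_trans (hM i x)); apply: (le_trans (ler_norm _)).
      by rewrite (bigD1 i)//= lerDl; apply: sumr_ge0.
    move=> k x /=; have /matrixP/(_ a b) := rB k x; rewrite summxE [RHS]mxE => hr.
    apply: (@eq_trans _ _ (phi x * \sum_i (x ord0 i *: Bk k i x) a b)); last by rewrite hr mulr0.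
    by rewrite mulr_sumr; apply: eq_bigr => i _; rewrite mxE; ring.
- move=> phi tp i a b; rewrite (@half false 1 gk g (mulr1 1) mgk mg Gk Gg tgk _ phi tp i a b).
    by congr (- _); apply: eq_Rintegral => x _; rewrite mul1r mxE2.
  by move=> k j x x0 p q; rewrite mul1r -mxE2; exact: dB.
move=> phi tp i a b; rewrite (@half true (-1) hk h _ mhk mh Ghk Gh th _ phi tp i a b).
- by congr (- _); apply: eq_Rintegral => x _; rewrite mulN1r opprB mxE2.
- by rewrite mulrNN mulr1.
move=> k j x x0 p q; have := derive_inv hG Cp hC (Gk k) (dB k x x0 j) p q.
congr is_derive; rewrite mulN1r opprB -mxE2; congr (fun_of_matrix _ p q).
rewrite -/(hk k x) mulrBr mulrBl -!mulrA mulrV ?(group_unit hG)// mulr1.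
by rewrite mulrA mulVr ?(group_unit hG)// mul1r opprB.
Qed.

End radial_gauge.

(** * Curvature and change of gauge *)
Section leibniz.
Context {R : realType} {n : nat}.
Notation V := 'rV[R]_n.
Notation mu := (lebesgue_rV n).

(** Where |f| > m the mean of f is small, and elsewhere f is at most m. *)
Lemma bounded_to0 (f : V -> R) (d : nat -> V -> R) (K : R) : L1 mu f -> (forall k, mf (d k)) ->
  (forall k x, `|d k x| <= K) -> to0 (fun k => n1 mu (d k)) ->
  to0 (fun k => n1 mu (fun x => f x * d k x)%R).
Proof.
move=> Lf md dK td e e0; have e2 : 0 < e / 2 by rewrite divr_gt0.
have K0 : 0 <= K by exact: le_trans (normr_ge0 _) (dK 0%N 0).
have K1 : 0 < K + 1 by rewrite ltr_wpDl.
have mf_ := L1_mf Lf.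
pose S (m : nat) := [set x : V | m%:R < `|f x|].
have mS m : measurable (S m).
  have -> : S m = (fun x => `|f x|) @^-1` `]m%:R, +oo[.
    by apply/seteqP; split=> x /=; rewrite in_itv/= andbT.
  by rewrite -[X in measurable X]setTI; exact: (mf_norm mf_).
have m1 m : mf (\1_(S m) : V -> R) by exact: measurable_indic.
have ts : to0 (fun m => n1 mu (fun x => \1_(S m) x * f x)).
  apply: (@vanishing_to0 _ _ _ _ 1 Lf m1).
    by move=> m x; rewrite indicE; case: (_ \in _); rewrite ?normr1// normr0.
  apply: aeW => x; exists (Num.truncn `|f x|).+1 => m hm; rewrite indicE memNset ?mul0r// /S/=.
  apply/negP; rewrite -leNgt; apply: ltW; apply: lt_le_trans (truncnS_gt _) _.
  by rewrite ler_nat.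
have [m hm] := ts (e / 2 / (K + 1)) (divr_gt0 e2 K1).
have M1 : 0 < m%:R + 1 :> R by rewrite ltr_wpDl.
have [N hN] := td (e / 2 / (m%:R + 1)) (divr_gt0 e2 M1); exists N => k Nk.
have a1 : mf (fun x => K * (\1_(S m) x * f x)) by apply: mfZ; exact: mfM.
have a2 : mf (fun x => m%:R * d k x) by exact: mfZ.
apply: (@le_trans _ _ (n1 mu (fun x => `|K * (\1_(S m) x * f x)| + `|m%:R * d k x|)%R)).
  apply: le_n1; [exact: mfM|by apply: mfD; exact: mf_norm|move=> x].
  rewrite (ger0_norm (addr_ge0 _ _))// !normrM (ger0_norm K0) (@ger0_norm _ m%:R)// indicE.
  have [xS|xS] := boolP (x \in S m).
    by rewrite normr1 mul1r mulrC; apply: ler_wpDr; rewrite ?mulr_ge0// ler_wpM2r.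
  rewrite normr0 mul0r mulr0 add0r; apply: ler_wpM2r => //.
  by rewrite leNgt; apply/negP => h; move: xS; rewrite notin_setE; apply.
apply: (le_trans (n1D mu (mf_norm a1) (mf_norm a2))).
rewrite !n1_absE n1Z//; last exact: mfM.
rewrite n1Z// (ger0_norm K0) (@ger0_norm _ m%:R)// [in leRHS](splitr e) EFinD; apply: leeD.
  apply: (@le_trans _ _ (K%:E * (e / 2 / (K + 1))%:E)%E).
    by apply: lee_wpmul2l; [rewrite lee_fin|exact: hm].
  rewrite -EFinM lee_fin mulrA ler_pdivrMr// mulrC; apply: ler_wpM2l; [exact: ltW|by rewrite lerDl].
apply: (@le_trans _ _ (m%:R%:E * (e / 2 / (m%:R + 1))%:E)%E).
  by apply: lee_wpmul2l; [rewrite lee_fin|exact: hN].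
rewrite -EFinM lee_fin mulrA ler_pdivrMr// mulrC; apply: ler_wpM2l; [exact: ltW|by rewrite lerDl].
Qed.

Lemma leibniz_arith1 (p q r w f dj di wj wi : R) :
  p * (w * dj + f * wj) - q * (w * di + f * wi) - r * (w * f) =
  (p * dj - q * di - r * f) * w + (p * (wj * f) - q * (wi * f)).
Proof. ring. Qed.

Lemma leibniz_arith2 (P w w' p q f a a' b b' : R) :
  P * w + (p * (a * f) - q * (b * f)) - (P * w' + (p * (a' * f) - q * (b' * f))) =
  P * (w - w') + f * (p * (a - a') - q * (b - b')).
Proof. ring. Qed.

Lemma leibniz_arith3 (p q r v c f dj di a b : R) :
  p * v * dj - q * v * di - (r * v - p * a + q * b) * f =
  (p * dj - q * di - r * f) * (v - c) + (p * (a * f) - q * (b * f)) + c * (p * dj - q * di - r * f).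
Proof. ring. Qed.

Lemma L1_bounded_sqL (f : V -> R) (K : R) : mf f -> (forall x, `|f x| <= K) -> L1 mu f -> sqL mu f.
Proof.
move=> mf_ fK Lf; split=> //; have /L1P[_] := L1Ml mf_ fK Lf; apply: le_lt_trans.
apply: le_of_eq; apply: eq_integral => x _.
by rewrite -expr2 ger0_norm// sqr_ge0.
Qed.

Definition weak_gradient (v : V -> R) (D : 'I_n -> V -> R) := forall k phi, test_fun setT phi ->
  \int[mu]_x (v x * partial k phi x) = - \int[mu]_x (D k x * phi x).

Lemma Rint_partial k (f : V -> R) : test_fun setT f -> \int[mu]_x partial k f x = 0.
Proof.
move=> tf; have tk := test_fun_partial k tf.
have [s s0 hs] := test_fun_box tf; have [M1 M10 hM1] := test_fun_bounded tf.
have [M2 M20 hM2] := test_fun_bounded tk.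
apply: (@integral_partial_eq0 _ _ k f _ s (M1 + M2)) => //.
- exact: ltW.
- by apply: smooth_mf; case: tf.
- by apply: smooth_mf; case: tk.
- by move=> x; apply: smooth_is_derive; case: tf.
- by move=> x; apply: (le_trans (hM2 x)); rewrite lerDr.
- by move=> x; apply: (le_trans (hM1 x)); rewrite lerDl.
Qed.

Lemma weak_gradient_sub_cst (v : V -> R) (D : 'I_n -> V -> R) (c K : R) : mf v -> (forall x, `|v x| <= K) ->
  weak_gradient v D -> weak_gradient (fun x => v x - c) D.
Proof.
move=> mv vK hv k f tf; rewrite -(hv k f tf); have tk := test_fun_partial k tf.
have Lv := L1_bounded_test mv vK tk; have Lk := L1_test tk.
rewrite (_ : (fun x => _ * _) = fun x => v x * partial k f x - c * partial k f x); last first.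
  by apply/funext => x; rewrite mulrBl.
by rewrite RintB//; [rewrite RintZ// Rint_partial// mulr0 subr0|exact: L1Z].
Qed.

(** The form is tested against phi times a mollification of v - c, which has compact support;
    the limit exists as p, q and D are square integrable. *)
Lemma leibniz_curl (U : set V) i j (p q r v : V -> R) (D : 'I_n -> V -> R) (c K : R) :
  L1 mu p -> sqL mu p -> L1 mu q -> sqL mu q -> L1 mu r ->
  (forall phi, test_fun U phi ->
    \int[mu]_x (p x * partial j phi x - q x * partial i phi x) = \int[mu]_x (r x * phi x)) ->
  mf v -> (forall x, `|v x| <= K) -> (forall x, 1 <= sq x -> v x = c) ->
  (forall k, L1 mu (D k)) -> (forall k, sqL mu (D k)) -> weak_gradient v D ->
  forall phi, test_fun U phi ->
  [/\ L1 mu (fun x => p x * v x * partial j phi x - q x * v x * partial i phi x),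
      L1 mu (fun x => (r x * v x - p x * D j x + q x * D i x) * phi x) &
    \int[mu]_x (p x * v x * partial j phi x - q x * v x * partial i phi x) =
    \int[mu]_x ((r x * v x - p x * D j x + q x * D i x) * phi x)].
Proof.
move=> Lp Qp Lq Qq Lr H mv vK vc LD QD wD phi tpU.
have tp := test_funT tpU; have tj := test_fun_partial j tp; have ti := test_fun_partial i tp.
have sp : smooth phi by case: tp.
pose w x := v x - c; pose Di := D i; pose Dj := D j.
have [[LDi QDi] [LDj QDj]] := ((LD i, QD i), (LD j, QD j)).
have mw : mf w by apply: mfB => //; exact: mf_cst.
have wK x : `|w x| <= K + `|c| by apply: (le_trans (ler_normB _ _)); rewrite lerD2r.
have w0 x : 1 < `|x| -> w x = 0 by move=> /far h; rewrite /w vc// subrr.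
have Lw : L1 mu w := L1_supp_bounded ler01 mw wK w0.
have Qw : sqL mu w := L1_bounded_sqL mw wK Lw.
have weakw : weak_gradient w D := weak_gradient_sub_cst c mv vK wD.
pose e (k : nat) : R := 1 / k.+1%:R.
pose W k := moll (e k) w; pose Wi k := moll (e k) Di; pose Wj k := moll (e k) Dj.
have sW k : smooth (W k) by exact: moll_smooth.
have e0 k : 0 < e k by rewrite divr_gt0// ltr0n.
have dWi k x : partial i (W k) x = Wi k x.
  exact: (conv_weak x (test_eta n (e k)) Lw LDi (weakw i)).
have dWj k x : partial j (W k) x = Wj k x.
  exact: (conv_weak x (test_eta n (e k)) Lw LDj (weakw j)).
have WK k x : `|W k x| <= K + `|c| by exact: moll_bounded.
have mW k : mf (W k) by exact: smooth_mf.
have mWi k : mf (Wi k) by apply: smooth_mf; exact: moll_smooth.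
have mWj k : mf (Wj k) by apply: smooth_mf; exact: moll_smooth.
have [M M0 hM] := test_fun_bounded tp.
have mp : mf phi by exact: smooth_mf.
pose P x := p x * partial j phi x - q x * partial i phi x - r x * phi x.
have LP1 : L1 mu (fun x => p x * partial j phi x) by exact: L1_mul_test.
have LP2 : L1 mu (fun x => q x * partial i phi x) by exact: L1_mul_test.
have LP3 : L1 mu (fun x => r x * phi x) by exact: L1_mul_test.
have LP : L1 mu P by apply: L1B => //; exact: L1B.
have P0 : \int[mu]_x P x = 0 by rewrite RintB//; [rewrite H// subrr|exact: L1B].
have LPw (u : V -> R) (C : R) : mf u -> (forall x, `|u x| <= C) -> L1 mu (fun x => P x * u x).
  by move=> mu_ hu; under eq_fun do rewrite mulrC; exact: (L1Ml mu_ hu).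
have LpW (f u : V -> R) : L1 mu f -> smooth u -> L1 mu (fun x => f x * (u x * phi x)).
  move=> Lf su; apply: L1_mul_test => //; under eq_fun do rewrite mulrC; exact: test_mul.
pose f k x := P x * W k x + (p x * (Wj k x * phi x) - q x * (Wi k x * phi x)).
pose f0 x := P x * w x + (p x * (Dj x * phi x) - q x * (Di x * phi x)).
have Lf k : L1 mu (f k).
  apply: L1D; first exact: LPw (mW k) (WK k).
  by apply: L1B; apply: LpW => //; exact: moll_smooth.
have LpD (g u : V -> R) : sqL mu g -> sqL mu u -> L1 mu (fun x => g x * (u x * phi x)).
  move=> Qg Qu; have -> : (fun x => g x * (u x * phi x)) = fun x => g x * u x * phi x.
    by apply/funext => x; rewrite mulrA.
  by apply: L1_mul_test => //; exact: sqLM.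
have Lf0 : L1 mu f0.
  by apply: L1D; [exact: LPw mw wK|apply: L1B; exact: LpD].
have If k : \int[mu]_x f k x = 0.
  have tW : test_fun U (fun x => phi x * W k x) by exact: test_mul.
  have := H _ tW => HW.
  have E x : f k x = (p x * partial j (fun x => phi x * W k x) x - q x * partial i (fun x => phi x * W k x) x)
     - r x * (phi x * W k x).
    rewrite (partialM j x sp (sW k)) (partialM i x sp (sW k)) dWi dWj.
    rewrite (addrC (phi x * Wj k x)) (addrC (phi x * Wi k x)) (mulrC (phi x) (W k x)).
    by rewrite leibniz_arith1.
  under eq_Rintegral => x _ do rewrite E.
  have tWT := test_funT tW.
  have l1 : L1 mu (fun x => p x * partial j (fun x => phi x * W k x) x).
    by apply: L1_mul_test => //; exact: test_fun_partial.
  have l2 : L1 mu (fun x => q x * partial i (fun x => phi x * W k x) x).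
    by apply: L1_mul_test => //; exact: test_fun_partial.
  have l3 : L1 mu (fun x => r x * (phi x * W k x)) by exact: L1_mul_test.
  by rewrite RintB//; [rewrite HW subrr|exact: L1B].
have mp_ := L1_mf Lp; have mq_ := L1_mf Lq.
have t0 : to0 (fun k => n1 mu (fun x => f k x - f0 x)%R).
  have b1 := bounded_to0 LP (fun k => mfB (mW k) mw) _ (moll_to0_1 ltr01 Lw).
  have {}b1 := b1 ((K + `|c|) + (K + `|c|)) (fun k x => le_trans (ler_normB _ _) (lerD (WK k x) (wK x))).
  have bp (g u : V -> R) : sqL mu g -> L1 mu u -> sqL mu u ->
      to0 (fun k => n1 mu (fun x => g x * (moll (e k) u x - u x))%R).
    move=> Qg Lu Qu; have [mg _] := Qg.
    apply: (@to0_L2M _ _ _ mu (fine (n2 mu g)) (fun=> g) (fun k x => moll (e k) u x - u x)).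
    - by [].
    - by move=> k; apply: mfB; [apply: smooth_mf; exact: moll_smooth|case: Qu].
    - by move=> k; rewrite -n2_fine.
    exact: moll_to0_2.
  have b2 := to0Z M0 (to0D (bp p Dj Qp LDj QDj) (bp q Di Qq LDi QDi)).
  apply: to0_le (to0D b1 b2) => k.
  have E x : f k x - f0 x = P x * (W k x - w x) + phi x * (p x * (Wj k x - Dj x) - q x * (Wi k x - Di x)).
    exact: leibniz_arith2.
  rewrite (eq_n1 mu E).
  have mPW : mf (fun x => P x * (W k x - w x)) by apply: mfM; [exact: (L1_mf LP)|exact: mfB].
  have mpj : mf (fun x => p x * (Wj k x - Dj x)) by apply: mfM => //; apply: mfB => //; exact: (L1_mf LDj).
  have mqi : mf (fun x => q x * (Wi k x - Di x)) by apply: mfM => //; apply: mfB => //; exact: (L1_mf LDi).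
  have md := mfB mpj mqi.
  apply: (le_trans (n1D mu mPW (mfM mp md))); apply: leeD => //.
  apply: (@le_trans _ _ (M%:E * n1 mu (fun x => p x * (Wj k x - Dj x) - q x * (Wi k x - Di x))%R)%E).
    rewrite -{1}(ger0_norm M0) -n1Z//; apply: le_n1; [exact: mfM|exact: mfZ|move=> x].
    by rewrite normrM [leRHS]normrM (ger0_norm M0); apply: ler_wpM2r.
  by apply: lee_wpmul2l; [rewrite lee_fin|exact: n1B].
have I0 : \int[mu]_x f0 x = 0.
  have h1 := Rint_lim Lf Lf0 t0; rewrite (funext If) in h1.
  exact: (cvg_unique _ h1 (cvg_cst _)).
have La : L1 mu (fun x => p x * v x * partial j phi x - q x * v x * partial i phi x).
  have B (g u : V -> R) : L1 mu (fun x => g x * u x) -> L1 mu (fun x => g x * v x * u x).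
    move=> L; have -> : (fun x => g x * v x * u x) = fun x => v x * (g x * u x).
      by apply/funext => x; ring.
    exact: (L1Ml mv vK L).
  by apply: L1B; exact: B.
have Lb : L1 mu (fun x => (r x * v x - p x * Dj x + q x * Di x) * phi x).
  apply: L1_mul_test => //; apply: L1D; last exact: sqLM.
  by apply: L1B; [under eq_fun do rewrite mulrC; exact: (L1Ml mv vK Lr)|exact: sqLM].
split=> //; apply/eqP; rewrite -subr_eq0 -RintB//.
have E x : p x * v x * partial j phi x - q x * v x * partial i phi x -
   (r x * v x - p x * Dj x + q x * Di x) * phi x = f0 x + c * P x.
  exact: leibniz_arith3.
under eq_Rintegral => x _ do rewrite E.
by rewrite RintD//; [rewrite RintZ// I0 P0 mulr0 addr0|exact: L1Z].
Qed.

End leibniz.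

Section gauge_curvature.
Context {R : realType} {n N : nat}.
Notation V := 'rV[R]_n.
Notation mat := 'M[R]_N.+1.
Notation mu := (lebesgue_rV n).

Lemma sqL_mulmx (X Y : V -> mat) (C : R) a b : mfx X -> (forall x, nm (X x) <= C) ->
  (forall a b, sqL mu (fun x => Y x a b)) ->
  sqL mu (fun x => (X x * Y x) a b) /\ sqL mu (fun x => (Y x * X x) a b).
Proof.
move=> mX hX LY; split; under eq_fun do rewrite mulmx_entry; apply: sqL_sum => c.
  exact: (sqLMl (mX a c) (fun x => entry_bound a c (hX x))).
under eq_fun do rewrite mulrC; exact: (sqLMl (mX c b) (fun x => entry_bound c b (hX x))).
Qed.

Lemma leibniz_sum (I : finType) (U : set V) i j (p q r v : I -> V -> R) (D : I -> 'I_n -> V -> R)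
    (c : I -> R) (K : R) :
  (forall s, L1 mu (p s)) -> (forall s, sqL mu (p s)) -> (forall s, L1 mu (q s)) -> (forall s, sqL mu (q s)) ->
  (forall s, L1 mu (r s)) ->
  (forall s phi, test_fun U phi ->
    \int[mu]_x (p s x * partial j phi x - q s x * partial i phi x) = \int[mu]_x (r s x * phi x)) ->
  (forall s, mf (v s)) -> (forall s x, `|v s x| <= K) -> (forall s x, 1 <= sq x -> v s x = c s) ->
  (forall s k, L1 mu (D s k)) -> (forall s k, sqL mu (D s k)) -> (forall s, weak_gradient (v s) (D s)) ->
  forall phi, test_fun U phi ->
  \int[mu]_x ((\sum_s p s x * v s x) * partial j phi x - (\sum_s q s x * v s x) * partial i phi x) =
  \int[mu]_x ((\sum_s (r s x * v s x - p s x * D s j x + q s x * D s i x)) * phi x).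
Proof.
move=> Lp Qp Lq Qq Lr H mv vK vc LD QD wD phi tp.
have h s := leibniz_curl (Lp s) (Qp s) (Lq s) (Qq s) (Lr s) (H s) (mv s) (vK s) (vc s)
  (LD s) (QD s) (wD s) tp.
transitivity (\int[mu]_x \sum_s (p s x * v s x * partial j phi x - q s x * v s x * partial i phi x)).
  by apply: eq_Rintegral => x _; rewrite !mulr_suml -sumrB.
rewrite Rint_sum; last by move=> s; case: (h s).
transitivity (\int[mu]_x \sum_s ((r s x * v s x - p s x * D s j x + q s x * D s i x) * phi x)).
  rewrite Rint_sum; last by move=> s; case: (h s).
  by apply: eq_bigr => s _; case: (h s).
by apply: eq_Rintegral => x _; rewrite mulr_suml.
Qed.

Variables (A B : 'I_n -> V -> mat) (F : 'I_n -> 'I_n -> V -> mat) (g : V -> mat) (C : R).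
Hypothesis QA : forall i a b, sqL mu (fun x => A i x a b).
Hypothesis A0 : forall i x, 1 <= sq x -> A i x = 0.
Hypothesis QF : forall i j a b, sqL mu (fun x => F i j x a b).
Hypothesis F0 : forall i j x, 1 <= sq x -> F i j x = 0.
Hypothesis hF : forall i j phi a b, test_fun (eball 0 1) phi ->
  \int[mu]_x curl_density A i j phi a b x = \int[mu]_x (F i j x a b * phi x).
Hypothesis mg : mfx g.
Hypothesis ug : forall x, g x \is a GRing.unit.
Hypothesis gC : forall x, nm (g x) <= C /\ nm (g x)^-1 <= C.
Hypothesis g1 : forall x, 1 <= sq x -> g x = 1.
Hypothesis QB : forall i a b, sqL mu (fun x => B i x a b).
Hypothesis B0 : forall i x, 1 <= sq x -> B i x = 0.
Hypothesis wg : forall phi, test_fun setT phi -> forall i a b,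
  \int[mu]_x (g x a b * partial i phi x) =
  - \int[mu]_x ((g x * B i x - A i x * g x) a b * phi x).
Hypothesis wh : forall phi, test_fun setT phi -> forall i a b,
  \int[mu]_x ((g x)^-1 a b * partial i phi x) =
  - \int[mu]_x (((g x)^-1 * A i x - B i x * (g x)^-1) a b * phi x).

Let Q (X : V -> mat) := forall a b, sqL mu (fun x => X x a b).
Let Z (X : V -> mat) := forall x, 1 <= sq x -> X x = 0.

Let QL X a b : Q X -> Z X -> L1 mu (fun x => X x a b).
Proof. by move=> q z; apply: (sqL_L1 ler01 (q a b)) => x /far h; rewrite z// mxE. Qed.

Let Q_sub X Y : Q X -> Q Y -> Q (fun x => X x - Y x).
Proof. by move=> hX hY a b; under eq_fun do rewrite mxE2; exact: sqLB. Qed.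

Let Q_mull X Y : mfx X -> (forall x, nm (X x) <= C) -> Q Y -> Q (fun x => X x * Y x).
Proof. by move=> mX XC hY a b; have [] := sqL_mulmx a b mX XC hY. Qed.

Let Q_mulr X Y : mfx X -> (forall x, nm (X x) <= C) -> Q Y -> Q (fun x => Y x * X x).
Proof. by move=> mX XC hY a b; have [] := sqL_mulmx a b mX XC hY. Qed.

Let L_mul X Y a b : Q X -> Q Y -> L1 mu (fun x => (X x * Y x) a b).
Proof. by move=> hX hY; under eq_fun do rewrite mulmx_entry; apply: L1_sum => c; exact: sqLM. Qed.

Let L_sub (X Y : V -> mat) a b : L1 mu (fun x => X x a b) -> L1 mu (fun x => Y x a b) ->
  L1 mu (fun x => (X x - Y x) a b).
Proof. by move=> hX hY; under eq_fun do rewrite mxE2; exact: L1B. Qed.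

Let mh : mfx (fun x => (g x)^-1). Proof. by move=> a b; exact: mf_invmx. Qed.

Let Dg i x := g x * B i x - A i x * g x.
Let Dh i x := (g x)^-1 * A i x - B i x * (g x)^-1.

Let gC1 x := (gC x).1.
Let gC2 x := (gC x).2.

Let QDg i : Q (Dg i).
Proof. exact: Q_sub (Q_mull mg gC1 (QB i)) (Q_mulr mg gC1 (QA i)). Qed.

Let QDh i : Q (Dh i).
Proof. exact: Q_sub (Q_mull mh gC2 (QA i)) (Q_mulr mh gC2 (QB i)). Qed.

Let ZDg i : Z (Dg i).
Proof. by move=> x h; rewrite /Dg B0// A0// mulr0 mul0r subrr. Qed.

Let ZDh i : Z (Dh i).
Proof. by move=> x h; rewrite /Dh B0// A0// mulr0 mul0r subrr. Qed.

(** The partial derivatives of the test function commute. *)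
Let curl_grad i j phi a b : test_fun setT phi ->
  \int[mu]_x (Dg i x a b * partial j phi x) = \int[mu]_x (Dg j x a b * partial i phi x).
Proof.
move=> tp; have ti := test_fun_partial i tp; have tj := test_fun_partial j tp.
have e1 := wg tj i a b; have e2 := wg ti j a b.
apply: oppr_inj; apply: (etrans (esym e1)); apply: (etrans _ e2).
by apply: eq_Rintegral => x _; rewrite partialC//; case: tp.
Qed.

Let L2D X k phi a b : Q X -> Z X -> test_fun setT phi -> L1 mu (fun x => X x a b * partial k phi x).
Proof.
move=> q z tp; have tk := test_fun_partial k tp; exact: (L1_mul_test (QL a b q z) tk).
Qed.

Let QgB i : Q (fun x => g x * B i x).
Proof. exact: Q_mull mg gC1 (QB i). Qed.

Let ZgB i : Z (fun x => g x * B i x).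
Proof. by move=> x h; rewrite B0// mulr0. Qed.

Lemma algebra1 (Fij Ai Aj Bi Bj gg : mat) :
  (Fij - (Ai * Aj - Aj * Ai)) * gg - Ai * (gg * Bj - Aj * gg) + Aj * (gg * Bi - Ai * gg) =
  Fij * gg - Ai * gg * Bj + Aj * gg * Bi.
Proof.
rewrite !mulrBl !mulrBr !mulrA; move: (Fij * gg) (_ * _ * _) (_ * _ * _) (_ * _ * _) (_ * _ * _) => a b c d e.
by apply/matrixP => p q; rewrite !mxE; ring.
Qed.

Lemma algebra2 (Fij Ai Aj Bi Bj gg h : mat) : h * gg = 1 ->
  h * (Fij * gg - Ai * gg * Bj + Aj * gg * Bi) - (h * Aj - Bj * h) * (gg * Bi) + (h * Ai - Bi * h) * (gg * Bj)
  = h * Fij * gg - (Bi * Bj - Bj * Bi).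
Proof.
move=> hg; rewrite mulrDr mulrBr !mulrBl !mulrA.
have -> : Bj * h * gg * Bi = Bj * Bi by rewrite -(mulrA Bj) hg mulr1.
have -> : Bi * h * gg * Bj = Bi * Bj by rewrite -(mulrA Bi) hg mulr1.
move: (h * Fij * gg) (h * Ai * gg * Bj) (h * Aj * gg * Bi) (Bi * Bj) (Bj * Bi) => a b c d e.
by apply/matrixP => p q; rewrite !mxE; ring.
Qed.

Let r1 i j x := F i j x - (A i x * A j x - A j x * A i x).
Let r2 i j x := F i j x * g x - A i x * g x * B j x + A j x * g x * B i x.

Let LF' i j a b : L1 mu (fun x => F i j x a b).
Proof. by apply: QL => [? ?|? ?]; [exact: QF|exact: F0]. Qed.

Let Lr1 i j a b : L1 mu (fun x => r1 i j x a b).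
Proof. exact: L_sub (LF' i j a b) (L_sub (L_mul a b (QA i) (QA j)) (L_mul a b (QA j) (QA i))). Qed.

Let QAg i : Q (fun x => A i x * g x).
Proof. exact: Q_mulr mg gC1 (QA i). Qed.

Let ZAg i : Z (fun x => A i x * g x).
Proof. by move=> x h; rewrite A0// mul0r. Qed.

Let Lr2 i j a b : L1 mu (fun x => r2 i j x a b).
Proof.
under eq_fun do rewrite mxE3; apply: L1D; last exact: L_mul a b (QAg j) (QB i).
apply: L1B; last exact: L_mul a b (QAg i) (QB j).
by have [] := L1_mulmx a b mg gC1 (LF' i j).
Qed.

Let curl_A i j phi a b : test_fun (eball 0 1) phi ->
  \int[mu]_x (A i x a b * partial j phi x - A j x a b * partial i phi x) =
  \int[mu]_x (r1 i j x a b * phi x).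
Proof.
move=> tpU; have tp := test_funT tpU; have h := hF i j a b tpU.
have l1 := @L2D (A i) j phi a b (QA i) (@A0 i) tp.
have l2 := @L2D (A j) i phi a b (QA j) (@A0 j) tp.
have l3 : L1 mu (fun x => (A i x * A j x - A j x * A i x) a b * phi x).
  exact: L1_mul_test (L_sub (L_mul a b (QA i) (QA j)) (L_mul a b (QA j) (QA i))) tp.
have l4 : L1 mu (fun x => F i j x a b * phi x) by exact: L1_mul_test (LF' i j a b) tp.
move: h; rewrite /curl_density RintD//; last exact: L1B.
have -> : \int[mu]_x (r1 i j x a b * phi x) = \int[mu]_x (F i j x a b * phi x) -
    \int[mu]_x ((A i x * A j x - A j x * A i x) a b * phi x).
  by rewrite -RintB//; apply: eq_Rintegral => x _; rewrite /r1 mxE2 mulrBl.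
by move=> <-; rewrite addrK.
Qed.

Let curl_gB i j phi a b : test_fun (eball 0 1) phi ->
  \int[mu]_x ((g x * B i x) a b * partial j phi x - (g x * B j x) a b * partial i phi x) =
  \int[mu]_x (r2 i j x a b * phi x).
Proof.
move=> tpU; have tp := test_funT tpU.
have E := @leibniz_sum _ (eball 0 1) i j (fun s x => A i x a s) (fun s x => A j x a s)
  (fun s x => r1 i j x a s) (fun s x => g x s b) (fun s k x => Dg k x s b) (fun s => (1 : mat) s b) C.
have {}E := E (fun s => QL a s (QA i) (@A0 i)) (fun s => QA i a s) (fun s => QL a s (QA j) (@A0 j))
  (fun s => QA j a s) (fun s => Lr1 i j a s) (fun s phi => @curl_A i j phi a s) (fun s => mg s b)
  (fun s x => entry_bound s b (gC x).1).
have {}E := E (fun s x h => congr1 (fun X : mat => X s b) (g1 h)) (fun s k => QL s b (QDg k) (@ZDg k)) (fun s k => QDg k s b)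
  (fun s k phi tp => wg tp k s b) phi tpU.
have l1 := L2D j a b (QAg i) (@ZAg i) tp; have l2 := L2D i a b (QAg j) (@ZAg j) tp.
have l3 := L2D j a b (QDg i) (@ZDg i) tp; have l4 := L2D i a b (QDg j) (@ZDg j) tp.
transitivity (\int[mu]_x (((A i x * g x) a b * partial j phi x - (A j x * g x) a b * partial i phi x) +
   (Dg i x a b * partial j phi x - Dg j x a b * partial i phi x))).
  apply: eq_Rintegral => x _.
  have e k : (g x * B k x) a b = (A k x * g x) a b + Dg k x a b.
    by rewrite /Dg [in RHS]mxE2 addrC subrK.
  by rewrite !e; ring.
rewrite RintD; [|exact: L1B|exact: L1B].
rewrite (RintB l3 l4) (curl_grad i j a b tp) subrr addr0.
transitivity (\int[mu]_x ((\sum_s A i x a s * g x s b) * partial j phi x -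
    (\sum_s A j x a s * g x s b) * partial i phi x)).
  by apply: eq_Rintegral => x _; rewrite !mulmx_entry.
rewrite E; apply: eq_Rintegral => x _; congr (_ * _).
by rewrite /r2 -algebra1 big_split sumrB/= -!mulmx_entry -/(r1 i j x) -/(Dg i x) -/(Dg j x) mxE3.
Qed.

(** As g B = A g + dg, the curl of g B is that of A g; the Leibniz rule gives it, and then the
    curl of B = g^-1 (g B). *)
Theorem gauge_curvature i j phi a b : test_fun (eball 0 1) phi ->
  \int[mu]_x curl_density B i j phi a b x =
  \int[mu]_x (((g x)^-1 * F i j x * g x) a b * phi x).
Proof.
move=> tpU; have tp := test_funT tpU.
have h1 x : 1 <= sq x -> (g x)^-1 = 1 by move=> h; rewrite g1// invr1.
have E := @leibniz_sum _ (eball 0 1) i j (fun s x => (g x * B i x) s b) (fun s x => (g x * B j x) s b)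
  (fun s x => r2 i j x s b) (fun s x => (g x)^-1 a s) (fun s k x => Dh k x a s) (fun s => (1 : mat) a s) C.
have {}E := E (fun s => QL s b (QgB i) (@ZgB i)) (fun s => QgB i s b) (fun s => QL s b (QgB j) (@ZgB j))
  (fun s => QgB j s b) (fun s => Lr2 i j s b) (fun s phi => @curl_gB i j phi s b) (fun s => mh a s)
  (fun s x => @entry_bound R n N (fun x => (g x)^-1) C x a s (gC2 x)).
have {}E := E (fun s x h => congr1 (fun X : mat => X a s) (h1 x h)) (fun s k => QL a s (QDh k) (@ZDh k)) (fun s k => QDh k a s)
  (fun s k phi tp => wh tp k a s) phi tpU.
have e k x : \sum_s (g x * B k x) s b * (g x)^-1 a s = B k x a b.
  transitivity (((g x)^-1 * (g x * B k x)) a b).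
    by rewrite mulmx_entry; apply: eq_bigr => s _; rewrite mulrC.
  by rewrite mulrA mulVr// mul1r.
have e2 x : \sum_s (r2 i j x s b * (g x)^-1 a s - (g x * B i x) s b * Dh j x a s +
     (g x * B j x) s b * Dh i x a s) =
     ((g x)^-1 * F i j x * g x) a b - (B i x * B j x - B j x * B i x) a b.
  rewrite -mxE2 -(algebra2 (F i j x) (A i x) (A j x) (B i x) (B j x) (mulVr (ug x))) mxE3.
  rewrite -/(r2 i j x) -/(Dh i x) -/(Dh j x) !mulmx_entry big_split sumrB/=.
  by congr (_ - _ + _); apply: eq_bigr => s _; rewrite mulrC.
have LK : L1 mu (fun x => (B i x * B j x - B j x * B i x) a b * phi x).
  exact: L1_mul_test (L_sub (L_mul a b (QB i) (QB j)) (L_mul a b (QB j) (QB i))) tp.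
have LX : L1 mu (fun x => ((g x)^-1 * F i j x * g x) a b * phi x).
  apply: L1_mul_test => //.
  have L1' c d : L1 mu (fun x => ((g x)^-1 * F i j x) c d).
    by have [] := L1_mulmx c d mh gC2 (LF' i j).
  by have [] := L1_mulmx a b mg gC1 L1'.
have l1 := L2D j a b (QB i) (@B0 i) tp; have l2 := L2D i a b (QB j) (@B0 j) tp.
rewrite /curl_density RintD//; last exact: L1B.
have -> : \int[mu]_x (B i x a b * partial j phi x - B j x a b * partial i phi x) =
    \int[mu]_x (((g x)^-1 * F i j x * g x) a b * phi x -
      (B i x * B j x - B j x * B i x) a b * phi x).
  transitivity (\int[mu]_x ((\sum_s (g x * B i x) s b * (g x)^-1 a s) * partial j phi x -
    (\sum_s (g x * B j x) s b * (g x)^-1 a s) * partial i phi x)).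
    by apply: eq_Rintegral => x _; rewrite !e.
  by rewrite E; apply: eq_Rintegral => x _; rewrite e2 mulrBl.
by rewrite (RintB LX LK) subrK.
Qed.

End gauge_curvature.

(** * Smooth approximation with the exact boundary values *)
Section smooth_trace.
Context {R : realType} {n : nat}.
Notation V := 'rV[R]_n.
Notation mu := (lebesgue_rV n).

Lemma dilate_to0 (f : V -> R) : sqL mu f ->
  to0 (fun k => n2 mu (fun x => f (affine (1 + k.+1%:R^-1) 0 x) - f x)%R).
Proof.
move=> Qf e e0; have [d d0 hd] := mean_square_cont Qf e0.
have d2 : 0 < d / 2 by rewrite divr_gt0.
have [M hM] := @harmonic_small R 1 _ d2; exists M => k /hM hk; apply: hd; last by rewrite normr0.
rewrite [1 + _]addrC addrK ger0_norm// -[ltLHS]mul1r; apply: le_lt_trans hk _.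
by rewrite ltr_pdivrMr// ltr_pMr// ltr1n.
Qed.

Lemma weak_dilate (l : R) (w D : V -> R) i : 0 < l -> L1 mu w -> L1 mu D ->
  (forall phi, test_fun setT phi -> \int[mu]_x (w x * partial i phi x) = - \int[mu]_x (D x * phi x)) ->
  forall phi, test_fun setT phi ->
    \int[mu]_x (w (affine l 0 x) * partial i phi x) = - \int[mu]_x (l * D (affine l 0 x) * phi x).
Proof.
move=> l0 Lw LD H phi tp; have ln : l != 0 by rewrite gt_eqF.
have lVn : l^-1 != 0 by rewrite invr_eq0.
have sp : smooth phi by case: tp.
pose psi x := phi (affine l^-1 0 x).
have tpsi : test_fun setT psi by exact: test_affine.
have dpsi x : partial i psi x = l^-1 * partial i phi (affine l^-1 0 x).
  by apply: is_derive_partial; exact: partial_affine.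
have back x : affine l^-1 0 (affine l 0 x) = x.
  by rewrite /affine !addr0 scalerA mulVf// scale1r.
have h := H psi tpsi.
have L1a : L1 mu (fun x => w x * partial i psi x).
  by apply: L1_mul_test => //; exact: test_fun_partial.
have L1b : L1 mu (fun x => D x * psi x) by exact: L1_mul_test.
have e1 := Rint_affine 0 ln L1a; have e2 := Rint_affine 0 ln L1b.
have e3 : \int[mu]_x (w (affine l 0 x) * partial i phi x) =
    l * \int[mu]_x (w (affine l 0 x) * partial i psi (affine l 0 x)).
  rewrite -RintZ; last exact: (L1_affine 0 ln L1a).
  by apply: eq_Rintegral => x _; rewrite dpsi back; field.
rewrite e3 e1 h mulrN mulrN -e2; congr (- _).
rewrite -RintZ; last exact: (L1_affine 0 ln L1b).
by apply: eq_Rintegral => x _; rewrite /psi back mulrA.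
Qed.

Lemma sq_shift (x y : V) (e : R) : sq x = 1 -> `|y| <= e -> 1 - 2 * n%:R * e <= sq (x - y).
Proof.
move=> x1 ye; have E : 2 * n%:R * e = \sum_(i < n) 2 * e.
  by rewrite sumr_const card_ord -mulr_natl; ring.
rewrite E -[X in X - _]x1 /sq -sumrB; apply: ler_sum => i _; rewrite !mxE.
have h1 : `|x ord0 i| <= 1 by apply: entry_sq1; rewrite x1.
have h2 : `|y ord0 i| <= e by exact: le_trans (entry_le_mx_norm y i) ye.
move: h1 h2; move: (x ord0 i) (y ord0 i) => s t; rewrite !ler_norml => /andP[? ?] /andP[? ?].
by nra.
Qed.

(** Dilating w by 1 + d moves its support into a smaller ball, so that a mollification at a
    scale below d / (4 (n + 1)) still vanishes on the unit sphere. *)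
Lemma smooth_trace (w : V -> R) (D : 'I_n -> V -> R) :
  L1 mu w -> sqL mu w -> (forall x, 1 <= sq x -> w x = 0) ->
  (forall i, L1 mu (D i)) -> (forall i, sqL mu (D i)) -> weak_gradient w D ->
  forall e : R, 0 < e -> exists f : V -> R, [/\ smooth f, forall x, sq x = 1 -> f x = 0,
    (n2 mu (fun x => f x - w x)%R <= e%:E)%E &
    forall i, (n2 mu (fun x => partial i f x - D i x)%R <= e%:E)%E].
Proof.
move=> Lw Qw w0 LD QD wD e e0.
have e4 : 0 < e / 4 by rewrite divr_gt0.
have e64 : 0 < e / 64 by rewrite divr_gt0.
have [K1 hK1] := dilate_to0 Qw e4.
have [K2 hK2] := @eventually_all _ (fun i k => (n2 mu (fun x => D i (affine (1 + k.+1%:R^-1) 0 x) - D i x)%R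
   <= (e / 64)%:E)%E) (fun i => dilate_to0 (QD i) e64).
have [K3 hK3] := @eventually_all 'I_n (fun i k => 16 * fine (n2 mu (D i)) / k.+1%:R <= e)
  (fun i => harmonic_small _ e0).
pose k := maxn K1 (maxn K2 K3); pose d : R := k.+1%:R^-1; pose l := 1 + d.
have d0 : 0 < d by rewrite invr_gt0 ltr0n.
have d1 : d <= 1 by rewrite /d invf_le1 ?ltr0n// ler1n.
have l0 : 0 < l by rewrite ltr_wpDl.
have ln : l != 0 by rewrite gt_eqF.
have g1 := hK1 k (leq_maxl _ _).
have g2 := hK2 k (leq_trans (leq_maxl _ _) (leq_maxr _ _)).
have g3 := hK3 k (leq_trans (leq_maxr _ _) (leq_maxr _ _)).
pose wl x := w (affine l 0 x); pose Dl i x := l * D i (affine l 0 x).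
have mD i : mf (D i) by case: (QD i).
have mDa i : mf (fun x => D i (affine l 0 x)) by exact: mf_affine.
have Lwl : L1 mu wl by exact: L1_affine.
have LDl i : L1 mu (Dl i) by apply: L1Z; exact: L1_affine.
have Qa (f : V -> R) : sqL mu f -> sqL mu (fun x => f (affine l 0 x)).
  move=> [mf_ hf]; split; first exact: mf_affine.
  by rewrite n2_affine// lte_mul_pinfty// lee_fin invr_ge0 exprn_ge0.
have Qwl : sqL mu wl by exact: Qa.
have QDl i : sqL mu (Dl i) by apply: sqLZ; exact: Qa.
have wDl i : forall phi, test_fun setT phi ->
    \int[mu]_x (wl x * partial i phi x) = - \int[mu]_x (Dl i x * phi x).
  exact: (weak_dilate l0 Lw (LD i) (wD i)).
have two (f g h : V -> R) : mf f -> mf g -> mf h -> (n2 mu (fun x => f x - g x)%R <= (e / 4)%:E)%E ->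
    (n2 mu (fun x => g x - h x)%R <= (e / 4)%:E)%E -> (n2 mu (fun x => f x - h x)%R <= e%:E)%E.
  move=> mf_ mg mh h1 h2.
  rewrite (eq_n2 mu (_ : _ =1 fun x => (f x - g x) + (g x - h x))); last by move=> x; rewrite addrA subrK.
  apply: (le_trans (n2D mu (mfB mf_ mg) (mfB mg mh))).
  have p2 : (0 <= 2%:E :> \bar R)%E by rewrite lee_fin.
  apply: (le_trans (leeD (lee_wpmul2l p2 h1) (lee_wpmul2l p2 h2))).
  by rewrite -!EFinM -EFinD lee_fin; apply: le_of_eq; field.
have dDl i : (n2 mu (fun x => Dl i x - D i x)%R <= (e / 4)%:E)%E.
  have md : mf (fun x => D i (affine l 0 x) - D i x) by exact: mfB.
  rewrite (eq_n2 mu (_ : _ =1 fun x => l * (D i (affine l 0 x) - D i x) + d * D i x)); last first.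
    by move=> x; rewrite /Dl /l; ring.
  apply: (le_trans (n2D mu (mfZ l md) (mfZ d (mD i)))); rewrite !n2Z// (n2_fine (QD i)).
  have p2 : (0 <= 2%:E :> \bar R)%E by rewrite lee_fin.
  have pl : (0 <= (l ^+ 2)%:E :> \bar R)%E by rewrite lee_fin sqr_ge0.
  apply: (le_trans (leeD (lee_wpmul2l p2 (lee_wpmul2l pl (g2 i))) (lexx _))).
  rewrite -!EFinM -EFinD lee_fin.
  have n0 : 0 <= fine (n2 mu (D i)) by rewrite fine_ge0// n2_ge0.
  have := g3 i; rewrite -/d; move: n0; move: (fine _) => z z0 hz.
  have h1 : d ^+ 2 * z <= e / 16.
    apply: (@le_trans _ _ (d * z)); first by apply: ler_wpM2r => //; rewrite expr2 ler_piMl// ltW.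
    by rewrite mulrC; move: hz; lra.
  have h2 : l ^+ 2 * (e / 64) <= e / 16.
    have : l ^+ 2 <= 4 by rewrite /l; nra.
    by move: (l ^+ 2) => s hs; nra.
  by move: h1 h2; lra.
have [M1 hM1] := moll_to0_2 ltr01 Lwl Qwl e4.
have [M2 hM2] := @eventually_all _ (fun i m => (n2 mu (fun x => moll (1 / m.+1%:R) (Dl i) x - Dl i x)%R
   <= (e / 4)%:E)%E) (fun i => moll_to0_2 ltr01 (LDl i) (QDl i) e4).
have dn : 0 < d / (4 * n.+1%:R) by rewrite divr_gt0// mulr_gt0// ltr0n.
have [M3 hM3] := @harmonic_small R 1 _ dn.
pose m := maxn M1 (maxn M2 M3); pose s : R := 1 / m.+1%:R.
have s0 : 0 < s by rewrite divr_gt0// ltr0n.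
have j1 := hM1 m (leq_maxl _ _).
have j2 := hM2 m (leq_trans (leq_maxl _ _) (leq_maxr _ _)).
have j3 := hM3 m (leq_trans (leq_maxr _ _) (leq_maxr _ _)).
have ms (f : V -> R) : L1 mu f -> mf (moll s f) by move=> Lf; apply: smooth_mf; exact: moll_smooth.
exists (moll s wl); split.
- exact: moll_smooth.
- move=> x x1; rewrite mollE//.
  rewrite (_ : (fun y => _) = fun=> 0); first by rewrite /Rintegral integral0.
  apply/funext => y; have [ye|ye] := leP s `|y|; first by rewrite eta_out// mulr0.
  rewrite /wl w0 ?mul0r// /affine addr0 sqZ.
  have h1 := sq_shift x1 (ltW ye).
  have h2 : 4 * n.+1%:R * s <= d.
    by move: j3; rewrite -/s ler_pdivlMr ?mulr_gt0 ?ltr0n// mulrC.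
  have h3 : 2 * n%:R * s <= d / 2.
    have : (n%:R : R) <= n.+1%:R by rewrite ler_nat.
    by move: h2 s0; nra.
  apply: (@le_trans _ _ (l ^+ 2 * (1 - d / 2))).
    by rewrite /l; nra.
  by apply: ler_wpM2l; [exact: sqr_ge0|lra].
- by apply: (two _ wl) => //; [exact: ms|exact: (L1_mf Lwl)|exact: (L1_mf Lw)].
move=> i.
have dm x : partial i (moll s wl) x = moll s (Dl i) x.
  exact: (conv_weak x (test_eta n s) Lwl (LDl i) (wDl i)).
rewrite (eq_n2 mu (_ : _ =1 fun x => moll s (Dl i) x - D i x)); last by move=> x; rewrite dm.
by apply: (two _ (Dl i)) => //; [exact: ms|exact: (L1_mf (LDl i))].
Qed.

End smooth_trace.

(** * Matrix fields on the unit ball *)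
Section ball.
Context {R : realType} {n N : nat}.
Notation V := 'rV[R]_n.
Notation mat := 'M[R]_N.+1.
Notation mu := (lebesgue_rV n).
Notation B1 := (eball (0 : V) 1).

Lemma ballE (x : V) : B1 x <-> sq x < 1.
Proof. by rewrite /eball/= subr0 -[X in _ < X]sqrtr1 /enorm ltr_sqrt. Qed.

Lemma measurable_ball : measurable B1.
Proof.
have -> : B1 = ~` [set x : V | 1 <= sq x].
  apply/seteqP; split=> x; first by move=> /ballE h /=; apply/negP; rewrite -ltNge.
  by move=> /= /negP; rewrite -ltNge => h; apply/ballE.
by apply: measurableC; exact: mf_sq_set.
Qed.

Lemma notin_ball (x : V) : (x \notin B1) = (1 <= sq x).
Proof.
by apply/idP/idP; [rewrite notin_setE => h; rewrite leNgt; apply/negP => h'; apply: h; apply/ballE|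
  rewrite leNgt => /negP h; rewrite notin_setE => /ballE].
Qed.

Definition cut (X : V -> mat) x : mat := if x \in B1 then X x else 0.

Lemma cut0 X x : 1 <= sq x -> cut X x = 0.
Proof. by rewrite -notin_ball /cut => /negbTE ->. Qed.

Lemma cut_in X x : B1 x -> cut X x = X x.
Proof. by move=> h; rewrite /cut mem_set. Qed.

Lemma Rint_ball (f h : V -> R) : (forall x, B1 x -> f x = h x) -> (forall x, 1 <= sq x -> h x = 0) ->
  \int[mu]_(x in B1) f x = \int[mu]_x h x.
Proof.
move=> fh h0; rewrite Rintegral_mkcond; apply: eq_Rintegral => x _; rewrite patchE.
case: ifPn => [|h1]; first by rewrite inE => /fh.
by rewrite h0// -notin_ball.
Qed.

Lemma Rint_ae (f h : V -> R) : mf f -> mf h -> {ae mu, forall x, f x = h x} ->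
  \int[mu]_x f x = \int[mu]_x h x.
Proof.
move=> mf_ mh fh; rewrite /Rintegral; congr fine; apply: ae_eq_integral => //.
- exact: mfE.
- exact: mfE.
by apply: filterS fh => x -> _.
Qed.

Lemma test_out U i (phi : V -> R) x : test_fun U phi -> ~ U x -> phi x = 0 /\ partial i phi x = 0.
Proof.
move=> [_ [K [cK KU h]]] Ux; have xK : ~ K x by move=> /KU.
split; first exact: h.
have oK : open (~` K) by apply: closed_openC; apply: compact_closed => //; exact: norm_hausdorff.
exact: (partial_open i oK xK h).
Qed.

Variable nrm : mat -> R.
Hypothesis hn : is_norm nrm.

Lemma mf_nrm (X : V -> mat) : mfx X -> mf (fun x => nrm (X x)).
Proof.
move=> mX; have -> : (fun x => nrm (X x)) = (fun v : 'rV[R]_(N.+1 * N.+1) => nrm (vec_mx v)) \o (fun x => mxvec (X x)).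
  by apply/funext => x /=; rewrite mxvecK.
apply: measurableT_comp; first by apply: continuous_mf; exact: nrm_continuous.
apply: measurable_fun_rV => i; case/mxvec_indexP: i => a b.
by under eq_fun do rewrite mxvecE; exact: mX.
Qed.

Lemma mfx_cut (X : V -> mat) : (forall a b, measurable_fun B1 (fun x => X x a b)) -> mfx (cut X).
Proof.
move=> h a b; have := (measurable_restrictT _ measurable_ball).1 (h a b).
rewrite (_ : (fun x => cut X x a b) = (fun x => X x a b) \_ B1)//.
by apply/funext => x; rewrite patchE /cut; case: ifP => //; rewrite mxE.
Qed.

Lemma int_cut X : (\int[mu]_(x in B1) (nrm (X x) ^+ 2)%:E = n2 mu (fun x => nrm (cut X x)))%E.
Proof.
rewrite integral_mkcond; apply: eq_integral => x _; rewrite patchE /cut.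
by case: ifP => // _; rewrite (nrm0 hn) expr0n.
Qed.

Lemma n2_le_scale (f h : V -> R) (C : R) : mf f -> mf h -> (forall x, `|f x| <= `|C * h x|) ->
  (n2 mu f <= (C ^+ 2)%:E * n2 mu h)%E.
Proof. by move=> mf_ mh h1; rewrite -n2Z//; apply: le_n2 => //; exact: mfZ. Qed.

Lemma L2_sqL (X : V -> mat) : L2 nrm B1 X -> forall a b, sqL mu (fun x => cut X x a b).
Proof.
move=> [mX iX] a b; have [C Cp hC] := nrm_lower hn; have mc := mfx_cut mX; split; first exact: mc.
have h : (n2 mu (fun x => cut X x a b) <= (C ^+ 2)%:E * n2 mu (fun x => nrm (cut X x)))%E.
  apply: n2_le_scale => // [|x]; first exact: mf_nrm.
  apply: (le_trans (le_nm _ _ _)); apply: (le_trans (hC _)); exact: ler_norm.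
apply: (le_lt_trans h); rewrite -int_cut lte_mul_pinfty// lee_fin sqr_ge0//.
Qed.

Lemma sqL_L2 (X : V -> mat) : (forall a b, measurable_fun B1 (fun x => X x a b)) ->
  (forall a b, sqL mu (fun x => cut X x a b)) -> L2 nrm B1 X.
Proof.
move=> mX QX; split=> //; rewrite int_cut; have [C Cp hC] := nrm_upper hn.
have [mn fn] := sqL_nm QX.
apply: (@le_lt_trans _ _ ((C ^+ 2)%:E * n2 mu (fun x => nm (cut X x)))%E).
  apply: n2_le_scale => // [|x]; first by apply: mf_nrm; exact: mfx_cut.
  by rewrite ger0_norm ?nrm_ge0// (le_trans (hC _))// ler_norm.
by rewrite lte_mul_pinfty// lee_fin sqr_ge0.
Qed.

Lemma cvg_int_nrm (X : nat -> V -> mat) : (forall k, mfx (X k)) ->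
  (forall k a b, n2 mu (fun x => X k x a b) <= (k.+1%:R^-1)%:E)%E ->
  (fun k => \int[mu]_(x in B1) (nrm (X k x) ^+ 2)%:E)%E @ \oo --> 0%E.
Proof.
move=> mX hX; have [C Cp hC] := nrm_upper hn.
apply: to0_cvg => [k|]; first by apply: integral_ge0 => x _; rewrite lee_fin sqr_ge0.
pose s : R := 2 ^+ size (index_enum 'I_N.+1).
have s0 : 0 <= s by rewrite exprn_ge0.
pose c := C ^+ 2 * (s * (\sum_(a < N.+1) s * (\sum_(b < N.+1) 1))).
have c0 : 0 <= c by rewrite mulr_ge0 ?sqr_ge0// mulr_ge0// sumr_ge0// => a _; rewrite mulr_ge0// sumr_ge0.
apply: to0_le (to0Z c0 (@to0_harmonic R (fun k => (k.+1%:R^-1)%:E) (fun=> lexx _))) => k.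
apply: (@le_trans _ _ (n2 mu (fun x => nrm (X k x)))).
  apply: ge0_subset_integral => //; [exact: measurable_ball|by apply: mfE; apply: mfX; exact: mf_nrm|].
  by move=> x _; rewrite lee_fin sqr_ge0.
apply: (@le_trans _ _ ((C ^+ 2)%:E * n2 mu (fun x => nm (X k x)))%E).
  apply: n2_le_scale => // [||x]; [exact: mf_nrm|exact: mf_nm (mX k)|].
  by rewrite ger0_norm ?nrm_ge0// (le_trans (hC _))// ler_norm.
rewrite /c (EFinM (C ^+ 2)) -muleA; apply: lee_wpmul2l; first by rewrite lee_fin sqr_ge0.
apply: (le_trans (n2_nm (mX k) (hX k))); rewrite -EFinM lee_fin -/s -mulrA; apply: ler_wpM2l => //.
rewrite mulr_suml; apply: ler_sum => a _; rewrite -mulrA; apply: ler_wpM2l => //.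
by rewrite mulr_suml; apply: ler_sum => b _; rewrite mul1r.
Qed.

(** A quotient with a finite limit at 0 is bounded near 0. *)
Lemma shell_growth (A Ae : 'I_n -> V -> mat) :
  (forall i a b, measurable_fun B1 (fun x => A i x a b)) -> (forall i, mfx (Ae i)) ->
  (forall i x, Ae i x = 0 \/ Ae i x = cut (A i) x) ->
  (exists l : R, (fun r : R => (r^-1)%:E *
       \int[mu]_(x in B1 `\` eball 0 (1 - r)%R) (\sum_i nrm (A i x) ^+ 2)%:E)%E @ 0^'+ --> l%:E) ->
  exists (l d0 : R), 0 < d0 /\ (forall d, 0 < d -> d < d0 ->
    (n2 mu (fun x => \1_[set x | (1 - d) ^+ 2 <= sq x] x * \sum_i nm (Ae i x))%R <= (l * d)%:E)%E).
Proof.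
move=> mA mAe hAe [l hl]; have [C Cp hC] := nrm_lower hn.
pose I d := (\int[mu]_(x in B1 `\` eball 0 (1 - d)%R) (\sum_i nrm (A i x) ^+ 2)%:E)%E.
have [d1 d10 hd1] : exists2 d1 : R, 0 < d1 & forall d, 0 < d -> d < d1 ->
    ((d^-1)%:E * I d <= (`|l| + 1)%:E)%E.
  have nb : nbhs l%:E [set y : \bar R | (y < (`|l| + 1)%:E)%E].
    apply: open_nbhs_nbhs; split; first exact: open_ereal_lt_ereal.
    by rewrite /= lte_fin (le_lt_trans (ler_norm l))// ltrDl.
  have /nbhs_ballP[d1 /= d10 h] := hl _ nb.
  exists d1 => // d dp dd; apply: ltW; apply: (h d) => //.
  by rewrite -ball_normE /ball_/= sub0r normrN gtr0_norm.
pose s : R := 2 ^+ size (index_enum 'I_n).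
have s0 : 0 <= s by rewrite exprn_ge0.
exists (s * (n%:R * (C ^+ 2 * (`|l| + 1)))), (Num.min d1 1); split.
  by rewrite lt_min d10 ltr01.
move=> d dp; rewrite lt_min => /andP[dd1 dlt1].
have dd : 0 <= 1 - d by rewrite subr_ge0 ltW.
pose S := [set x : V | (1 - d) ^+ 2 <= sq x].
pose D := B1 `\` eball 0 (1 - d).
have mS : measurable S by exact: mf_sq_set.
have DS x : B1 x -> (x \in D) = (x \in S).
  move=> Bx; apply/idP/idP; rewrite !inE /D /S /eball/= subr0.
    by move=> [_ /negP]; rewrite -leNgt ge_enorm.
  by rewrite -ge_enorm// => h; split; [have := Bx; rewrite /eball/= subr0|apply/negP; rewrite -leNgt].
have m1 : mf (\1_S : V -> R) by exact: measurable_indic.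
have mc i : mfx (cut (A i)) by exact: mfx_cut.
pose h i x := \1_S x * nrm (cut (A i) x).
have mh i : mf (h i) by apply: mfM => //; exact: mf_nrm.
have Ih : I d = (\int[mu]_x (\sum_i h i x ^+ 2)%:E)%E.
  rewrite /I integral_mkcond; apply: eq_integral => x _; rewrite patchE -/D.
  case: (boolP (x \in B1)) => [xB|xB].
    have Bx : B1 x by rewrite inE in xB.
    rewrite DS//; case: ifPn => xS.
      by congr EFin; apply: eq_bigr => i _; rewrite /h indicE xS mul1r cut_in.
    by rewrite big1// => i _; rewrite /h indicE (negbTE xS) mul0r expr0n.
  have -> : (x \in D) = false.
    by apply/negbTE; move: xB; apply: contra; rewrite !inE => -[].
  rewrite big1// => i _; rewrite /h cut0 ?(nrm0 hn) ?mulr0 ?expr0n//.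
  by rewrite -notin_ball.
have hI i : (n2 mu (h i) <= I d)%E.
  rewrite Ih; apply: ge0_le_integral => //.
  - by move=> x _; rewrite lee_fin sqr_ge0.
  - by apply: mfE; exact: mfX.
  - by apply: mfE; apply: mf_sum => j; exact: mfX.
  move=> x _; rewrite lee_fin (bigD1 i)//= lerDl; apply: sumr_ge0 => j _; exact: sqr_ge0.
have Id : (I d <= ((`|l| + 1) * d)%:E)%E.
  have -> : I d = (d%:E * ((d^-1)%:E * I d))%E by rewrite muleA -EFinM divff ?gt_eqF// mul1e.
  rewrite mulrC EFinM; apply: lee_wpmul2l; [by rewrite lee_fin ltW|exact: hd1].
pose f i x := \1_S x * nm (Ae i x).
have mf_ i : mf (f i) by apply: mfM => //; exact: mf_nm (mAe i).
rewrite (eq_n2 mu (_ : _ =1 fun x => \sum_i f i x)); last by move=> x; rewrite mulr_sumr.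
apply: (le_trans (n2_sum_le _ mf_)); rewrite -/s -mulrA EFinM; apply: lee_wpmul2l; first by rewrite lee_fin.
have -> : n%:R * (C ^+ 2 * (`|l| + 1)) * d = \sum_(i < n) (C ^+ 2 * ((`|l| + 1) * d)).
  by rewrite sumr_const card_ord -(mulr_natl _ n); ring.
rewrite -sumEFin; apply: lee_sum => i _.
apply: (@le_trans _ _ ((C ^+ 2)%:E * n2 mu (h i))%E).
  apply: n2_le_scale => // x; rewrite /f /h mulrCA !normrM; apply: ler_wpM2l => //.
  rewrite -normrM (ger0_norm (nm_ge0 _)); apply: le_trans (ler_norm _).
  case: (hAe i x) => ->; last exact: hC.
  by rewrite nm0 mulr_ge0 ?nrm_ge0// ltW.
rewrite [leRHS]EFinM; apply: lee_wpmul2l; first by rewrite lee_fin sqr_ge0.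
exact: le_trans (hI i) Id.
Qed.

Lemma mf_curl_density (A : 'I_n -> V -> mat) (phi : V -> R) i j a b : smooth phi ->
  (forall i, mfx (A i)) -> mf (curl_density A i j phi a b).
Proof.
move=> sp mA; have mp : mf phi by exact: smooth_mf.
have md k : mf (partial k phi) by apply: smooth_mf; exact: smooth_partial.
apply: mfD; first exact: mfB (mfM (mA i a b) (md j)) (mfM (mA j a b) (md i)).
exact: mfM (mfx_sub (mf_mulmx (mA i) (mA j)) (mf_mulmx (mA j) (mA i)) a b) mp.
Qed.

Lemma is_weak_partial (X D : V -> mat) i : (forall phi, test_fun setT phi -> forall a b,
    \int[mu]_x (X x a b * partial i phi x) = - \int[mu]_x (D x a b * phi x)) ->
  weak_partial B1 i X D.
Proof.
move=> h phi tp a b.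
have out x : 1 <= sq x -> phi x = 0 /\ partial i phi x = 0.
  by move=> x1; apply: (test_out i tp); rewrite ballE ltNge x1.
rewrite (@Rint_ball _ (fun x => X x a b * partial i phi x))//; last first.
  by move=> x /out[_ ->]; rewrite mulr0.
rewrite (@Rint_ball _ (fun x => D x a b * phi x))//; last by move=> x /out[-> _]; rewrite mulr0.
exact: h (test_funT tp) a b.
Qed.

End ball.

Section sphere.
Context {R : realType} {N : nat}.
Notation mat := 'M[R]_N.+1.
Notation mu := (@lebesgue_rV R 5).

Lemma sq_stereo (b : bool) (y : 'rV[R]_4) : sq (stereo 0 1 b y) = 1.
Proof.
rewrite /stereo add0r scale1r enorm_sq; set s := sq y; have s0 : 0 <= s by exact: sq_ge0.
have s1 : 1 + s != 0 by rewrite gt_eqF// ltr_pwDl.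
rewrite /sq (@big_split_ord _ _ _ 4 1) /= big_ord1.
transitivity (\sum_(i < 4) (2 / (1 + s) * y ord0 i) ^+ 2 + ((-1) ^+ b * ((s - 1) / (1 + s))) ^+ 2).
  congr (_ + _ ^+ 2); last by apply: etrans (row_mxEr _ _ _ _) _; rewrite mxE.
  by apply: eq_bigr => i _; congr (_ ^+ 2); apply: etrans (row_mxEl _ _ _ _) _; rewrite mxE.
under eq_bigr do rewrite exprMn.
have -> : ((-1) ^+ b * ((s - 1) / (1 + s))) ^+ 2 = ((s - 1) / (1 + s)) ^+ 2.
  by rewrite exprMn sqrr_sign mul1r.
by rewrite -mulr_sumr -/(sq y) -/s; field.
Qed.

(** g - X vanishes outside the ball, so it is a limit of smooth functions that vanish on the
    sphere. *)
Lemma constant_trace (nrm : mat -> R) (g : 'rV[R]_5 -> mat) (D : form1 5) (X : mat) (K : R) :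
  is_norm nrm -> mfx g -> (forall x a b, `|g x a b| <= K) -> (forall x, 1 <= sq x -> g x = X) ->
  (forall i x, 1 <= sq x -> D i x = 0) ->
  (forall i a b, sqL mu (fun x => D i x a b)) ->
  (forall a b, weak_gradient (fun x => g x a b) (fun i x => D i x a b)) ->
  has_trace nrm g D (fun=> X).
Proof.
move=> hn mg gK gX D0 QD wD.
have LD i a b : L1 mu (fun x => D i x a b).
  by apply: (sqL_L1 ler01 (QD i a b)) => x /far h; rewrite D0// mxE.
pose w a b x := g x a b - X a b.
have mw a b : mf (w a b) by apply: mfB; [exact: mg|exact: mf_cst].
have wK a b x : `|w a b x| <= K + `|X a b| by apply: (le_trans (ler_normB _ _)); rewrite lerD2r.
have w0 a b x : 1 <= sq x -> w a b x = 0 by move=> h; rewrite /w gX// subrr.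
have Lw a b : L1 mu (w a b).
  by apply: (L1_supp_bounded ler01 (mw a b) (wK a b)) => x /far; exact: w0.
have Qw a b := L1_bounded_sqL (mw a b) (wK a b) (Lw a b).
have ww a b := weak_gradient_sub_cst (X a b) (mg a b) (fun x => gK x a b) (wD a b).
have k0 (k : nat) : 0 < k.+1%:R^-1 :> R by rewrite invr_gt0 ltr0n.
have /choice[f hf] : forall t : nat * ('I_N.+1 * 'I_N.+1), exists f : 'rV[R]_5 -> R,
   [/\ smooth f, forall x, sq x = 1 -> f x = 0,
    (n2 mu (fun x => f x - w t.2.1 t.2.2 x)%R <= (t.1.+1%:R^-1)%:E)%E &
    forall i, (n2 mu (fun x => partial i f x - D i x t.2.1 t.2.2)%R <= (t.1.+1%:R^-1)%:E)%E].
  move=> [k [a b]] /=.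
  exact: (smooth_trace (Lw a b) (Qw a b) (@w0 a b) (fun i => LD i a b) (fun i => QD i a b) (ww a b) (k0 k)).
pose u k x : mat := \matrix_(a, b) (X a b + f (k, (a, b)) x).
have uE k a b : (fun x => u k x a b) = (fun x => X a b + f (k, (a, b)) x).
  by apply/funext => x; rewrite mxE.
have sf k a b : smooth (f (k, (a, b))) by have [] := hf (k, (a, b)).
have su k a b : smooth (fun x => u k x a b).
  by rewrite uE; apply: SmP; apply: Sm_add; [exact: Sm_cst|exact: Sm_smooth].
have du k a b i x : partial i (fun z => u k z a b) x = partial i (f (k, (a, b))) x.
  apply: is_derive_partial; rewrite uE -[partial _ _ _]add0r.
  by apply: is_deriveD; exact: smooth_is_derive.
have mu_ k : mfx (u k) by move=> a b; exact: smooth_mf.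
exists u; split=> //.
- apply: (cvg_int_nrm hn) => [k|k a b]; first exact: mfx_sub.
  have [_ _ h _] := hf (k, (a, b)); apply: le_trans h; apply: le_of_eq.
  by apply: eq_n2 => x; rewrite mxE2 mxE /w/=; ring.
- move=> i; apply: (cvg_int_nrm hn) => [k|k a b].
    apply: mfx_sub => a b; last by case: (QD i a b).
    by under eq_fun do rewrite mxE; apply: smooth_mf; exact: smooth_partial.
  have [_ _ _ h] := hf (k, (a, b)); apply: le_trans (h i); apply: le_of_eq.
  by apply: eq_n2 => x; rewrite mxE2 mxE du.
apply: cvg_near_cst; apply: nearW => k; rewrite /sphere_int; apply: integral0_eq => y _.
have -> : u k (stereo 0 1 false y) = X.
  apply/matrixP => a b; rewrite mxE; have [_ h _ _] := hf (k, (a, b)).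
  by rewrite h ?addr0// sq_stereo.
by rewrite subrr (nrm0 hn) expr0n mul0r.
Qed.

End sphere.

(** * The theorem *)
Local Notation leb5 := (lebesgue_rV 5).

Theorem corollary1p13 (R : realType) (N : nat)
  (G : set 'M[R]_N.+1) (nrm : 'M[R]_N.+1 -> R)
  (hG : compact_matrix_group G) (hG1 : simply_connected G)
  (hGna : nonabelian G)
  (hnrm : is_norm nrm) (hAd : Ad_invariant G nrm)
  (c : set (form1 5)) (hc : calA G nrm c)
  (A : form1 5) (hA : c A)
  (F : form2 5) (hF : is_curvature (eball 0 1) A F)
  (hFL2 : forall i j, L2 nrm (eball 0 1) (F i j))
  (hlim : exists l : R,
    (fun r : R => (r^-1)%:E *
       \int[lebesgue_rV 5]_(x in eball 0 1 `\` eball 0 (1 - r)%R)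
         (\sum_i nrm (A i x) ^+ 2)%:E)%E @ 0^'+ --> l%:E)
  (t : R) (ht : 0 <= t < 1) :
  exists (g : 'rV[R]_5 -> 'M[R]_N.+1) (Dg : form1 5),
    [/\ W12_in nrm G (eball 0 1) g Dg,
        aeon (eball 0 1 `\` eball 0 (1 - t))
          (fun x => rho_comp Dg x = - rho_comp A x * g x) &
        has_trace nrm g Dg (fun=> 1)] /\
    [/\ L2_form1 G nrm (eball 0 1) (gauge g Dg A),
        aeon (eball 0 1 `\` eball 0 (1 - t))
          (fun x => rho_comp (gauge g Dg A) x = 0) &
        is_curvature (eball 0 1) (gauge g Dg A)
          (fun i j x => (g x)^-1 * F i j x * g x)].
Proof.
have [C Cp hC] := group_bounded hG.
have n4 : (4 <= 5)%N by [].
have LA : L2_form1 G nrm (eball 0 1) A.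
  by move: hc => [A' _ cA]; move: hA; rewrite -cA => -[[]].
have mA i a b : measurable_fun (eball 0 1) (fun x => A i x a b) by have [[h _] _] := LA i; exact: h.
have mF i j a b : measurable_fun (eball 0 1) (fun x => F i j x a b) by have [h _] := hFL2 i j; exact: h.
have Qcut i := L2_sqL hnrm (LA i).1.
have [Nn [mN N0 hN]] : {ae leb5, forall x, forall i, eball 0 1 x -> lie_algebra G (A i x)}.
  by apply: ae_all => i; have [_] := LA i.
(* A extended by 0 outside the ball and, for its values to lie in the Lie algebra
   everywhere, corrected on a null set *)
pose Ae i x := if x \in Nn then 0 else cut (A i) x.
pose Fe i j := cut (F i j).
have AeE i x a b : Ae i x a b = \1_(~` Nn) x * cut (A i) x a b.
  rewrite /Ae indicE in_setC; case: (x \in Nn) => /=; first by rewrite mxE mul0r.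
  by rewrite mul1r.
have m1 : mf (\1_(~` Nn) : 'rV[R]_5 -> R) by apply: measurable_indic; exact: measurableC.
have QA i a b : sqL leb5 (fun x => Ae i x a b).
  rewrite (_ : (fun x => _) = fun x => \1_(~` Nn) x * cut (A i) x a b); last by apply/funext => x; rewrite AeE.
  apply: (@sqLMl _ _ _ _ 1 _ _ m1 _ (Qcut i a b)) => x.
  by rewrite indicE; case: (_ \in _); rewrite ?normr1// normr0.
have A0 i x : 1 <= sq x -> Ae i x = 0 by move=> h; rewrite /Ae cut0//; case: ifP.
have lieA i x : lie_algebra G (Ae i x).
  rewrite /Ae; case: ifPn => xN; first exact: lie0.
  rewrite /cut; case: ifPn => xB; last exact: lie0.
  apply: contrapT => h; move: xN; rewrite notin_setE; apply; apply: hN => /= H; apply: h; apply: H.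
  by rewrite inE in xB.
have QF i j a b : sqL leb5 (fun x => Fe i j x a b) by exact: (L2_sqL hnrm (hFL2 i j)).
have F0 i j x : 1 <= sq x -> Fe i j x = 0 by exact: cut0.
have offN (P : 'rV[R]_5 -> Prop) : (forall x, x \notin Nn -> P x) -> {ae leb5, forall x, P x}.
  by move=> h; exists Nn; split=> // x /= nP; apply: contrapT => xN; apply: nP; apply: h; rewrite notin_setE.
have AeA i x : x \notin Nn -> Ae i x = cut (A i) x by rewrite /Ae => /negbTE ->.
have outB (phi : 'rV[R]_5 -> R) (k : 'I_5) x : test_fun (eball 0 1) phi -> 1 <= sq x -> phi x = 0 /\ partial k phi x = 0.
  by move=> tp x1; apply: (test_out k tp); rewrite ballE ltNge x1.
have mcA i : mfx (cut (A i)) by exact: mfx_cut.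
have mAe i : mfx (Ae i) by move=> a b; case: (QA i a b).
have out0 X i j phi a b x : test_fun (eball 0 1) phi -> 1 <= sq x ->
    curl_density (X : @form1 R N 5) i j phi a b x = 0.
  move=> tp x1; rewrite /curl_density; have [-> ->] := outB phi j x tp x1.
  by have [_ ->] := outB phi i x tp x1; rewrite !mulr0 subrr addr0.
have hFe i j phi a b : test_fun (eball 0 1) phi ->
    \int[leb5]_x curl_density Ae i j phi a b x = \int[leb5]_x (Fe i j x a b * phi x).
  move=> tp; have [sp _] := tp.
  transitivity (\int[leb5]_x curl_density (fun i => cut (A i)) i j phi a b x).
    apply: Rint_ae; [exact: mf_curl_density|exact: mf_curl_density|].
    by apply: offN => x xN; rewrite /curl_density !AeA.
  rewrite -(@Rint_ball _ _ (curl_density A i j phi a b)); last 2 first.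
  - by move=> x xB; rewrite /curl_density !cut_in.
  - by move=> x; exact: out0.
  apply: (etrans (hF i j phi tp a b)); apply: Rint_ball => x; first by move=> xB; rewrite /Fe cut_in.
  by move=> x1; have [-> _] := outB phi j x tp x1; rewrite mulr0.
have [|l [d0 [d00 hgrow]]] := shell_growth hnrm mA mAe _ hlim.
  by move=> i x; rewrite /Ae; case: ifP => _; [left|right].
have happ := approximation hG n4 QA lieA A0 QF F0 hFe d00 hgrow.
have [g [B [[mg Gg g1] [QB B0 lieB radB] wg wh]]] := radial_gauge hG n4 QA A0 happ.
have ug x : g x \is a GRing.unit by exact: (group_unit hG (Gg x)).
have gC x : nm (g x) <= C /\ nm (g x)^-1 <= C by split; apply: hC => //; exact: groupV.
have hcurv := gauge_curvature QA A0 QF F0 hFe mg ug gC g1 QB B0 wg wh.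
pose Dg i x := g x * B i x - Ae i x * g x.
have gC1 x := (gC x).1; have gC2 x := (gC x).2.
have mh : mfx (fun x => (g x)^-1) by move=> a b; exact: mf_invmx.
have mB i : mfx (B i) by move=> a b; case: (QB i a b).
have QDg i a b : sqL leb5 (fun x => Dg i x a b).
  under eq_fun do rewrite mxE2.
  by apply: sqLB; [have [] := sqL_mulmx a b mg gC1 (QB i)|have [] := sqL_mulmx a b mg gC1 (QA i)].
have Dg0 i x : 1 <= sq x -> Dg i x = 0 by move=> h; rewrite /Dg B0// A0// mulr0 mul0r subrr.
have mDg i : mfx (Dg i) by move=> a b; case: (QDg i a b).
have gE i x : x \notin Nn -> eball 0 1 x -> gauge g Dg A i x = B i x.
  move=> xN xB; rewrite /gauge /Dg AeA// cut_in// mulrBr !mulrA mulVr// mul1r subrK//.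
have aeN : {ae leb5, forall x, x \notin Nn} by exact: offN.
pose Gc i := cut (gauge g Dg A i).
have mGauge i a b : measurable_fun (eball 0 1) (fun x => gauge g Dg A i x a b).
  apply: (@eq_measurable_fun _ _ _ _ _ (fun x => gauge g Dg (fun i => cut (A i)) i x a b)).
    by move=> x xB; rewrite /gauge cut_in//; rewrite inE in xB.
  apply: measurable_funTS; rewrite /gauge.
  have m2 p e : mf (fun x => ((g x)^-1 * Dg i x) p e) by exact: (mf_mulmx mh (mDg i)).
  have m3 p e : mf (fun x => ((g x)^-1 * cut (A i) x * g x) p e).
    exact: (mf_mulmx (mf_mulmx mh (mcA i)) mg).
  by under eq_fun do rewrite mxE; exact: mfD.
have mGc i : mfx (Gc i) by exact: mfx_cut.
have GcE i x : x \notin Nn -> Gc i x = B i x.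
  move=> xN; have [x1|x1] := leP 1 (sq x); first by rewrite /Gc cut0// B0.
  have xB : eball 0 1 x by apply/ballE.
  by rewrite /Gc cut_in// gE.
have radial (V : @form1 R N 5) (x : 'rV[R]_5) : \sum_i x ord0 i *: V i x = 0 -> rho_comp V x = 0.
  move=> h; rewrite /rho_comp (eq_bigr (fun i => (enorm x)^-1 *: (x ord0 i *: V i x))); last first.
    by move=> i _; rewrite scalerA mulrC.
  by rewrite -scaler_sumr h scaler0 oppr0.
exists g, Dg; split; split.
- split; last by apply: aeW => x _; exact: Gg.
  split.
    apply: (sqL_L2 hnrm) => a b; first exact: measurable_funTS (mg a b).
    have mc : mf (fun x => cut g x a b) by apply: mfx_cut => ? ?; apply: measurable_funTS; exact: mg.
    have cK x : `|cut g x a b| <= C.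
      rewrite /cut; case: ifP => _; first by apply: entry_bound.
      by rewrite mxE normr0 ltW.
    apply: (L1_bounded_sqL mc cK); apply: (L1_supp_bounded ler01 mc cK) => x /far h.
    by rewrite cut0// mxE.
  move=> i; split; last by apply: is_weak_partial => phi tp a b; exact: wg.
  apply: (sqL_L2 hnrm) => a b; first exact: measurable_funTS (mDg i a b).
  rewrite (_ : (fun x => _) = fun x => Dg i x a b)//; apply/funext => x.
  by rewrite /cut; case: ifPn => //; rewrite notin_ball => /Dg0 ->.
- apply: filterS2 radB aeN => x hx xN [xB _].
  have e (k : 'I_5) : (x ord0 k / enorm x) *: Dg k x = g x * ((x ord0 k / enorm x) *: B k x)
      - (x ord0 k / enorm x) *: A k x * g x.
    by rewrite /Dg AeA// cut_in// scalerBr scalerAr scalerAl.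
  rewrite /rho_comp opprK (eq_bigr _ (fun k _ => e k)) sumrB -mulr_sumr -mulr_suml.
  have /eqP := radial B x hx; rewrite /rho_comp oppr_eq0 => /eqP ->.
  by rewrite mulr0 sub0r opprK.
- apply: (@constant_trace _ _ _ _ _ 1 C) => //.
  + by move=> x a b; apply: entry_bound.
  + by move=> a b i phi tp; exact: wg.
- move=> i; split.
    apply: (sqL_L2 hnrm); [exact: mGauge|move=> a b].
    have E x : cut (gauge g Dg A i) x = B i x + (g x)^-1 * (cut (A i) x - Ae i x) * g x.
      have [x1|x1] := leP 1 (sq x).
        by rewrite !cut0// B0// A0// subrr mulr0 mul0r addr0.
      have xB : eball 0 1 x by apply/ballE.
      rewrite !cut_in// /gauge /Dg mulrBr !mulrA mulVr// mul1r mulrBr mulrBl.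
      by rewrite -addrA [- _ + _]addrC.
    rewrite (_ : (fun x => _) = fun x => B i x a b + ((g x)^-1 * (cut (A i) x - Ae i x) * g x) a b); last first.
      by apply/funext => x; rewrite E mxE.
    apply: sqLD; first exact: QB.
    have q1 p e : sqL leb5 (fun x => (cut (A i) x - Ae i x) p e).
      by under eq_fun do rewrite mxE2; apply: sqLB; [exact: Qcut|exact: QA].
    have q2 p e : sqL leb5 (fun x => ((g x)^-1 * (cut (A i) x - Ae i x)) p e).
      by have [] := sqL_mulmx p e mh gC2 q1.
    by have [] := sqL_mulmx a b mg gC1 q2.
  by apply: filterS2 (lieB i) aeN => x hx xN xB; rewrite gE.
- apply: filterS2 radB aeN => x hx xN [xB _]; apply: radial.
  by rewrite -[RHS]hx; apply: eq_bigr => i _; rewrite gE.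
move=> i j phi tp a b; have [sp _] := tp.
rewrite (@Rint_ball _ _ _ (curl_density Gc i j phi a b)); last 2 first.
- by move=> x xB; rewrite /curl_density /Gc !cut_in.
- by move=> x; exact: out0.
rewrite (@Rint_ball _ _ _ (fun x => ((g x)^-1 * Fe i j x * g x) a b * phi x)); last 2 first.
- by move=> x xB; rewrite /Fe cut_in.
- by move=> x x1; have [-> _] := outB phi j x tp x1; rewrite mulr0.
rewrite -(hcurv i j phi a b tp); apply: Rint_ae; [exact: mf_curl_density|exact: mf_curl_density|].
by apply: offN => x xN; rewrite /curl_density !GcE.
Qed.
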